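(* Let $(X,d,\mu)$ be a space of homogeneous type satisfying: there are $\epsilon_0>0$ and a constant $C(c,K)$ with $c^{j\epsilon_0}\mu(B(x,t))\le\mu(B(x,c^jt))\le C(c,K)^j\mu(B(x,t))$ for all $t>0$, $x\in X$, $j\in\mathbb N$. Let $T_{j,1},T_{j,2}$ $(j=1,\dots,m)$ be Calderón–Zygmund operators on $X$ bounded on $L^2(X)$, and let $\mathcal T_1=\sum_{j=1}^mT_{j,1}T_{j,2}$. Let $p,q>1$ with $1/p+1/q=1$. If $f\in L^p(X)$ satisfies $\mathcal T_1(f)=0$, then the linear operator $$B_f(g)=\sum_{j=1}^m T_{j,1}^*(g)\,\overline{T_{j,2}(f)}$$ is bounded from $L^q(X)$ to $H^1(X)$.
   Context: Space of homogeneous type: a locally compact Hausdorff space $X$ with a positive regular Borel measure $\mu$ and a family of basic open sets $\{B(x,r):x\in X,r>0\}$ such that for some constants $c>1,K>1$: (1) $x\in B(x,r)$; (2) $B(x,r_1)\subset B(x,r_2)$ if $0<r_1\le r_2$; (3) $0<\mu(B(x,r))<\infty$; (4) $X=\bigcup_{r>0}B(x,r)$; (5) $\mu(B(x,cr))\le K\mu(B(x,r))$; (6) if $B(x_1,r_1)\cap B(x_2,r_2)\neq\emptyset$ and $r_1\ge r_2$ then $B(x_2,r_2)\subset B(x_1,cr_1)$. Also $\mu(\{x\})=0$ for all $x$. Writing $(X,d,\mu)$ means the structure is given by a quasi-metric $d$, $B(x,r)=\{y:d(x,y)<r\}$. Let $\lambda(x,y)=\mu(B(x,d(x,y)))$.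 A standard kernel is $K:X\times X\setminus\{x=y\}\to\mathbb C$ such that for some $\epsilon>0$, $0<C<\infty$: $|K(x,y)|\le C/\lambda(x,y)$ for $x\ne y$, and $|K(x,y)-K(x',y)|+|K(y,x)-K(y,x')|\le (d(x,x')/d(x,y))^\epsilon C/\lambda(x,y)$ whenever $d(x,y)\ge c\,d(x,x')$. $\Lambda_\delta$ is the space of Hölder continuous functions of order $\delta$ on $X$ with bounded support, $\Lambda_\delta'$ its dual. A Calderón–Zygmund (singular integral) operator is a continuous linear $T:\Lambda_\delta\to\Lambda_\delta'$, for some $\delta>0$, associated to a standard kernel $K$: $K$ is locally integrable off the diagonal and $\langle Tf,g\rangle=\iint K(x,y)f(y)g(x)\,d\mu(y)\,d\mu(x)$ for $f,g\in\Lambda_\delta$ with supports separated by a positive distance; the identity operator is allowed among the $T_{j,i}$. Such operators bounded on $L^2$ are bounded on $L^p$, $1<p<\infty$. $T^*$ is the adjoint with respect to $\langle u,v\rangle=\int u\bar v\,d\mu$. An atom is $a\in L^\infty(X)$ for which there is a ball $B$ with $\operatorname{supp}a\subset B$, $|a|\le1/\mu(B)$, $\int_Ba\,d\mu=0$. $H^1(X)=\{u=\sum_{j\ge1}\lambda_ja_j:\ a_j\text{ atoms},\ \lambda_j\ge0,\ \{\lambda_j\}\in\ell^1\}$ with norm $\|u\|_{H^1}=\inf\sum_j\lambda_j$. *)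

(* Defs.v *)
From HB Require Import structures.
From mathcomp Require Import all_boot all_order all_algebra.
From mathcomp Require Import complex.
From mathcomp Require Import all_classical all_reals all_analysis.

Set Implicit Arguments.
Unset Strict Implicit.
Unset Printing Implicit Defensive.

Import Order.TTheory GRing.Theory Num.Theory.
Import numFieldNormedType.Exports ComplexField.Normc.

Local Open Scope classical_set_scope.
Local Open Scope ring_scope.
Local Open Scope complex_scope.

Notation borel X := (g_sigma_algebraType (@open X)).

Section homogeneous_type.
Context (R : realType) (X : ptopologicalType).
Variable mu : {measure set (borel X) -> \bar R}.

Definition regular_measure : Prop :=
  forall A : set (borel X), measurable A ->
    mu A = ereal_inf [set mu U | U in [set U : set X | open U /\ A `<=` U]] /\
    mu A = ereal_sup [set mu Q | Q in [set Q : set X | compact Q /\ Q `<=` A]].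

Record homogeneous_type (B : X -> R -> set X) (c K : R) : Prop := {
  ht_hausdorff : hausdorff_space X ;
  ht_locally_compact : locally_compact [set: X] ;
  ht_regular : regular_measure ;
  ht_c_gt1 : 1 < c ;
  ht_K_gt1 : 1 < K ;
  ht_open : forall x (r : R), 0 < r -> open (B x r) ;
  ht_nbhs : forall x (U : set X),
    nbhs x U -> exists2 r : R, 0 < r & B x r `<=` U ;
  ht_center : forall x (r : R), 0 < r -> B x r x ;
  ht_mono : forall x (r1 r2 : R), 0 < r1 -> r1 <= r2 -> B x r1 `<=` B x r2 ;
  ht_measure : forall x (r : R), 0 < r -> (0 < mu (B x r) < +oo)%E ;
  ht_cover : forall x, \bigcup_(r in [set r : R | 0 < r]) B x r = [set: X] ;
  ht_doubling : forall x (r : R), 0 < r ->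
    (mu (B x (c * r)%R) <= K%:E * mu (B x r))%E ;
  ht_engulfing : forall x1 x2 (r1 r2 : R), 0 < r2 -> r2 <= r1 ->
    B x1 r1 `&` B x2 r2 !=set0 -> B x2 r2 `<=` B x1 (c * r1) ;
  ht_no_atom : forall x, mu [set x] = 0%E }.

End homogeneous_type.

Section quasi_metric.
Context (R : realType) (X : Type).
Variable d : X -> X -> R.

Record quasi_metric : Prop := {
  qm_ge0 : forall x y, 0 <= d x y ;
  qm_eq0 : forall x y, d x y = 0 <-> x = y ;
  qm_sym : forall x y, d x y = d y x ;
  qm_triangle : exists kappa : R,
    forall x y z, d x z <= kappa * (d x y + d y z) }.

Definition qball (x : X) (r : R) : set X := [set y | d x y < r].

End quasi_metric.

Section function_spaces.
Context (R : realType) (X : ptopologicalType).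
Variable mu : {measure set (borel X) -> \bar R}.
Implicit Types f g u v : X -> R[i].

Definition cmeasurable f : Prop :=
  measurable_fun [set: borel X] (fun x => complex.Re (f x)) /\
  measurable_fun [set: borel X] (fun x => complex.Im (f x)).

Definition cintegral (D : set X) f : R[i] :=
  (\int[mu]_(x in D) complex.Re (f x)) +i*
  (\int[mu]_(x in D) complex.Im (f x)).

Definition cLnorm (p : \bar R) f : \bar R :=
  ('N[mu]_p [(fun x => (normc (f x))%:E)])%E.

Definition Lp (p : \bar R) : set (X -> R[i]) :=
  [set f | cmeasurable f /\ (cLnorm p f < +oo)%E].

(* Operators act on functions; linearity is understood modulo equality almost
   everywhere, as for operators on Lebesgue spaces. *)
Definition bounded_linear (U : set (X -> R[i])) (normU : (X -> R[i]) -> \bar R)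
    (V : set (X -> R[i])) (normV : (X -> R[i]) -> \bar R)
    (S : (X -> R[i]) -> (X -> R[i])) : Prop :=
  (forall (a : R[i]) f g, U f -> U g ->
     {ae mu, forall x, S (fun y => a * f y + g y) x = a * S f x + S g x}) /\
  (exists C : R, forall f, U f ->
     V (S f) /\ (normV (S f) <= C%:E * normU f)%E).

Definition Lp_bounded (p : \bar R) (S : (X -> R[i]) -> (X -> R[i])) : Prop :=
  bounded_linear (Lp p) (cLnorm p) (Lp p) (cLnorm p) S.

Definition pairing u v : R[i] := cintegral [set: X] (fun x => u x * (v x)^*).

Definition is_adjoint (p q : \bar R) (S S' : (X -> R[i]) -> (X -> R[i])) :
    Prop :=
  forall g, Lp q g -> Lp q (S' g) /\
    forall f, Lp p f -> pairing (S f) g = pairing f (S' g).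

(* The adjoint on [Lp q] of an operator [S] on [Lp p] (for conjugate
   exponents [is_adjoint] determines it up to equality almost everywhere). *)
Definition adjoint (p q : \bar R) (S : (X -> R[i]) -> (X -> R[i])) :
    (X -> R[i]) -> (X -> R[i]) :=
  xget (fun _ _ => 0) [set S' | is_adjoint p q S S'].

Definition supp f : set X := closure [set x | f x != 0].

End function_spaces.

Section hardy.
Context (R : realType) (X : ptopologicalType).
Variables (mu : {measure set (borel X) -> \bar R}) (d : X -> X -> R).

Definition atom (a : X -> R[i]) : Prop :=
  Lp mu +oo%E a /\
  exists x (r : R), [/\ 0 < r, supp a `<=` qball d x r,
    {ae mu, forall y, normc (a y) <= (fine (mu (qball d x r)))^-1} &
    cintegral mu (qball d x r) a = 0].

Record atomic_decomposition (u : X -> R[i]) (lam : nat -> R)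
    (a : nat -> X -> R[i]) : Prop := {
  ad_measurable : cmeasurable u ;
  ad_atom : forall j, atom (a j) ;
  ad_ge0 : forall j, 0 <= lam j ;
  ad_summable : (\sum_(0 <= j <oo) (lam j)%:E < +oo)%E ;
  ad_cvg : cLnorm mu 1%:E (fun x => u x - \sum_(j < n) (lam j)%:C * a j x)
             @[n --> \oo] --> 0%E }.

Definition H1 : set (X -> R[i]) :=
  [set u | exists lam a, atomic_decomposition u lam a].

Definition H1norm (u : X -> R[i]) : \bar R :=
  ereal_inf [set s | exists lam a, atomic_decomposition u lam a /\
                       s = (\sum_(0 <= j <oo) (lam j)%:E)%E].

End hardy.

Section holder.
Context (R : realType) (X : ptopologicalType).
Variables (d : X -> X -> R) (delta : R).

Definition Holder : set (X -> R[i]) :=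
  [set f | (exists A : R, forall x y,
              normc (f x - f y) <= A * d x y `^ delta) /\
           (exists x (r : R), 0 < r /\ supp f `<=` qball d x r)].

(* The diagonal contributes 0 to the second supremum, as [0 / 0 = 0]. *)
Definition Holder_norm (f : X -> R[i]) : \bar R :=
  (ereal_sup [set (normc (f x))%:E | x in [set: X]] +
   ereal_sup [set (normc (f z.1 - f z.2) / d z.1 z.2 `^ delta)%:E
             | z in [set: X * X]])%E.

(* Linear functionals continuous for the inductive limit topology of the
   Banach spaces of functions of [Holder] supported in a fixed ball. *)
Definition Holder_dual (F : (X -> R[i]) -> R[i]) : Prop :=
  (forall (a : R[i]) f g, Holder f -> Holder g ->
     F (fun x => a * f x + g x) = a * F f + F g) /\
  (forall x (r : R), 0 < r -> exists M : R,
     forall f, Holder f -> supp f `<=` qball d x r ->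
       ((normc (F f))%:E <= M%:E * Holder_norm f)%E).

Definition positively_separated (f g : X -> R[i]) : Prop :=
  exists2 eta : R, 0 < eta &
    forall x y, supp f x -> supp g y -> eta <= d x y.

End holder.

Section calderon_zygmund.
Context (R : realType) (X : ptopologicalType).
Variables (mu : {measure set (borel X) -> \bar R}) (d : X -> X -> R) (c : R).

Definition lambda (x y : X) : R := fine (mu (qball d x (d x y))).

(* A kernel is only meaningful off the diagonal; its values [k x x] are
   unconstrained. In the smoothness condition [1 < c] forces [x' != y]. *)
Definition standard_kernel (k : X -> X -> R[i]) : Prop :=
  exists eps C : R, [/\ 0 < eps, 0 < C,
    forall x y, x != y -> normc (k x y) <= C / lambda x y &
    forall x x' y, x != y -> c * d x x' <= d x y ->
      normc (k x y - k x' y) + normc (k y x - k y x') <=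
        (d x x' / d x y) `^ eps * (C / lambda x y)].

Definition off_diagonal : set (X * X) := [set z | z.1 != z.2].

Definition locally_integrable_off_diagonal (k : X -> X -> R[i]) : Prop :=
  [/\ measurable_fun (off_diagonal : set (borel X * borel X))
        (fun z : borel X * borel X => complex.Re (k z.1 z.2)),
      measurable_fun (off_diagonal : set (borel X * borel X))
        (fun z : borel X * borel X => complex.Im (k z.1 z.2)) &
      forall Q : set (X * X), compact Q -> Q `<=` off_diagonal ->
        (\int[mu \x mu]_(z in (Q : set (borel X * borel X)))
           (normc (k z.1 z.2))%:E < +oo)%E].

Definition associated (delta : R) (T : (X -> R[i]) -> (X -> R[i]) -> R[i])
    (k : X -> X -> R[i]) : Prop :=
  locally_integrable_off_diagonal k /\
  forall f g, Holder d delta f -> Holder d delta g ->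
    positively_separated d f g ->
    T f g = cintegral mu [set: X] (fun x =>
              cintegral mu [set: X] (fun y => k x y * f y * g x)).

(* [cz_form T f g] is the bilinear bracket of [T f] with [g]. The continuity
   of [T] is for the weak-star topology of the dual. The order must be such
   that [Holder] is dense in [L^2]: for large orders [Holder] may be reduced
   to 0 (order > 1 on the real line), and then neither boundedness on [L^2]
   nor the extension of [T] to Lebesgue spaces has any content. *)
Record cz_operator := CZOperator {
  cz_order : R ;
  cz_form :> (X -> R[i]) -> (X -> R[i]) -> R[i] ;
  cz_order_gt0 : 0 < cz_order ;
  cz_dense : forall f, Lp mu 2%:E f -> forall e : R, 0 < e ->
    exists2 g, Holder d cz_order g &
      (cLnorm mu 2%:E (fun x => (f x - g x)%R) < e%:E)%E ;
  cz_dual : forall f, Holder d cz_order f ->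
    Holder_dual d cz_order (cz_form f) ;
  cz_continuous : forall g, Holder d cz_order g ->
    Holder_dual d cz_order (fun f => cz_form f g) ;
  cz_kernel : exists k,
    standard_kernel k /\ associated cz_order cz_form k }.

Definition Lp_extends (p : \bar R) (T : cz_operator)
    (S : (X -> R[i]) -> (X -> R[i])) : Prop :=
  Lp_bounded mu p S /\
  forall f g, Holder d (cz_order T) f -> Holder d (cz_order T) g ->
    T f g = cintegral mu [set: X] (fun x => S f x * g x).

Definition bounded_on (p : \bar R) (T : cz_operator) : Prop :=
  exists S, Lp_extends p T S.

(* The operator on [Lp p] defined by [T], for [1 < p < +oo]: by density,
   [Lp_extends] determines it up to equality almost everywhere. *)
Definition Lp_op (p : \bar R) (T : cz_operator) :
    (X -> R[i]) -> (X -> R[i]) :=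
  xget (fun _ _ => 0) [set S | Lp_extends p T S].

End calderon_zygmund.

(* Main.v *)
(** Write [F_j] for [T_{j,2} f] in [L^p]. Since [sum_j T_{j,1} F_j = 0], the value
    [B_f(g)] is the sum over [j] of the commutator-like forms
    [T_{j,1}^* g . conj F_j - g . conj (T_{j,1} F_j)], each of which has integral zero;
    it suffices to bound one such form from [L^q x L^p] to [H^1]. Splitting into real and
    imaginary parts reduces this to real operators [S], [S'] in duality and to the real form
    [bil S S' g F = S' g . F - g . S F].

    For bounded [g], [F] with supports of finite measure, a Calderon-Zygmund decomposition of
    the indicator of the support of [g] replaces [g] by its averages: on each piece [b] of mean
    zero, the local part of [bil b F] is an [L^2]-atom, and the remaining part is a sum of atoms
    because [S' b] decays away from [b] and [S F] oscillates little there. Averaging [g] and [F] alternately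
    spreads their supports, so the remaining [L^1]-norm tends to zero. This gives a restricted
    estimate with cost [C |g|_oo |F|_oo min(a,t) (max(a,t)/min(a,t))^e] for supports of
    measures [a], [t] and any small [e > 0]. Decomposing [g], [F] into dyadic levels of [|g|^q],
    [|F|^p] and summing a geometric series in the difference of the levels yields the strong
    bound, which extends to [L^q x L^p] by completeness of the atomic space.

    The hypotheses on [T_{j,1}] enter only through the size of [S], [S'] on [L^2] and the
    off-diagonal decay. The adjoint comes from the Radon-Nikodym theorem. As Holder functions
    need not contain cutoffs of balls, the kernel representation is obtained on the sets
    [F >= 1/2] and [F <= -1/2] for a Holder [F] close in [L^2] to a difference of two
    indicators: these sets are at a positive distance, and the kernel is continuous
    there. *)

From HB Require Import structures.
Require Import Defs.
From mathcomp Require Import all_boot all_order all_algebra.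
From mathcomp Require Import complex.
From mathcomp Require Import all_classical all_reals all_analysis.
From mathcomp Require Import measurable_realfun ess_sup_inf.
From mathcomp Require Import zify ring lra.

Set Implicit Arguments.
Unset Strict Implicit.
Unset Printing Implicit Defensive.

Import Order.TTheory GRing.Theory Num.Theory.
Import numFieldNormedType.Exports.

Local Open Scope classical_set_scope.
Local Open Scope ring_scope.

(** * Integrals of real functions *)

(** A restricted cost of the form [a^(1-r) t^r] is used on pairs of dyadic levels [n], [j], where it
    carries a factor [2^((n-j)(r-1/p))]. It is summable only if [r] can be put on either side of
    [1/p] according to the sign of [n-j]; hence the loss [(max/min)^e] is wanted for arbitrarily
    small [e], while Cauchy-Schwarz gives [r = 1/2] alone. The free parameter is the spreading
    factor [L]: one spreading enlarges a support by [3 K L] at the price of a factor [4 K^2] that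
    does not involve [L], so the loss is a power that tends to 0 as [L] grows. Supports may be
    spread without limit because the lower growth of balls makes the total measure infinite.

    The cost of a mean-zero piece contains the local mean of [S F], for which no uniform bound
    exists when [F] is merely bounded. It is therefore kept as the integral of [|S F|] over the
    piece; the pieces are disjoint, and the sum of these integrals is bounded by a separate estimate
    whose proof uses the same spreading. *)

Lemma indicP (T : Type) (R : pzRingType) (A : set T) x :
  (A x /\ \1_A x = 1 :> R) \/ (~ A x /\ \1_A x = 0 :> R).
Proof.
rewrite indicE; have [Ax|nAx] := pselect (A x).
  by left; rewrite (mem_set Ax).
by right; rewrite memNset.
Qed.

Lemma norm_indic (T : Type) (R : realType) (A : set T) x : `|\1_A x : R| <= 1.
Proof. by have [[_ ->]|[_ ->]] := @indicP _ R A x; rewrite ?normr1 ?normr0. Qed.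

Section real_integrals.
Context d (T : measurableType d) (R : realType).
Variable mu : {measure set T -> \bar R}.
Implicit Types (f g h : T -> R) (A : set T).

Lemma ae_imp (P Q : T -> Prop) : {ae mu, forall x, P x} -> (forall x, P x -> Q x) ->
  {ae mu, forall x, Q x}.
Proof. by move=> h PQ; apply: filterS h. Qed.

Lemma ae_imp2 (P Q S : T -> Prop) : {ae mu, forall x, P x} -> {ae mu, forall x, Q x} ->
  (forall x, P x -> Q x -> S x) -> {ae mu, forall x, S x}.
Proof. by move=> h1 h2 PQ; apply: filterS2 h1 h2. Qed.

Definition intg f : Prop := mu.-integrable [set: T] (EFin \o f).
(** [Rintegral] takes the value 0 when the extended integral is infinite, so [I] is informative only
    together with [intg]. *)
Definition I f : R := \int[mu]_x f x.

Lemma intg_meas f : intg f -> measurable_fun [set: T] f.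
Proof. by move=> /measurable_int /measurable_EFinP. Qed.

Lemma intg0 : intg (fun=> 0).
Proof. exact: integrable0. Qed.

Lemma intgD f g : intg f -> intg g -> intg (fun x => f x + g x).
Proof. by move=> hf hg; apply: eq_integrable (integrableD measurableT hf hg). Qed.

Lemma intgB f g : intg f -> intg g -> intg (fun x => f x - g x).
Proof. by move=> hf hg; apply: eq_integrable (integrableB measurableT hf hg). Qed.

Lemma intgN f : intg f -> intg (fun x => - f x).
Proof. by move=> hf; apply: eq_integrable (integrableN hf). Qed.

Lemma intgZ k f : intg f -> intg (fun x => k * f x).
Proof. by move=> hf; apply: eq_integrable (integrableZl measurableT k hf). Qed.

Lemma intg_norm f : intg f -> intg (fun x => `|f x|).
Proof. exact: integrable_norm. Qed.

Lemma intg_sum J (s : seq J) (P : pred J) (h : J -> T -> R) :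
  (forall i, P i -> intg (h i)) -> intg (fun x => \sum_(i <- s | P i) h i x).
Proof.
move=> hh; elim: s => [|i s IH].
  by apply: eq_integrable intg0 => // x _ /=; rewrite big_nil.
have [Pi|nPi] := boolP (P i).
  by apply: eq_integrable (intgD (hh i Pi) IH) => // x _ /=; rewrite big_cons Pi.
by apply: eq_integrable IH => // x _ /=; rewrite big_cons (negbTE nPi).
Qed.

Lemma intg_le f g : measurable_fun [set: T] f -> (forall x, `|f x| <= g x) ->
  intg g -> intg f.
Proof.
move=> mf fg; apply: le_integrable => //; first exact/measurable_EFinP.
by move=> x _ /=; rewrite lee_fin (le_trans (fg x))// ler_norm.
Qed.

Lemma eq_intg f g : f =1 g -> intg f -> intg g.
Proof. by move=> /funext ->. Qed.

Lemma eq_I f g : f =1 g -> I f = I g.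
Proof. by move=> /funext ->. Qed.

Lemma ID f g : intg f -> intg g -> I (fun x => f x + g x) = I f + I g.
Proof. by move=> hf hg; apply: RintegralD. Qed.

Lemma IB f g : intg f -> intg g -> I (fun x => f x - g x) = I f - I g.
Proof. by move=> hf hg; apply: RintegralB. Qed.

Lemma IZ k f : intg f -> I (fun x => k * f x) = k * I f.
Proof. by move=> hf; apply: RintegralZl. Qed.

Lemma IN f : intg f -> I (fun x => - f x) = - I f.
Proof.
move=> hf; rewrite -mulN1r -IZ//; apply: eq_I => x; by rewrite mulN1r.
Qed.

Lemma I0 : I (fun=> 0) = 0.
Proof. by rewrite /I /Rintegral integral0. Qed.

Lemma I_sum J (s : seq J) (P : pred J) (h : J -> T -> R) :
  (forall i, P i -> intg (h i)) ->
  I (fun x => \sum_(i <- s | P i) h i x) = \sum_(i <- s | P i) I (h i).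
Proof.
move=> hh; elim: s => [|i s IH].
  by rewrite big_nil -[RHS]I0; apply: eq_I => x; rewrite big_nil.
rewrite big_cons; case: ifPn => [Pi|nPi].
  rewrite -IH -ID//; [|exact: hh|exact: intg_sum].
  by apply: eq_I => x; rewrite big_cons Pi.
by rewrite -IH; apply: eq_I => x; rewrite big_cons (negbTE nPi).
Qed.

Lemma I_le f g : intg f -> intg g -> (forall x, f x <= g x) -> I f <= I g.
Proof. by move=> hf hg fg; apply: le_Rintegral. Qed.

Lemma I_ge0 f : (forall x, 0 <= f x) -> 0 <= I f.
Proof. by move=> f0; apply: Rintegral_ge0 => x _. Qed.

Lemma I_abs f : intg f -> `|I f| <= I (fun x => `|f x|).
Proof. by move=> hf; apply: le_normr_Rintegral. Qed.

Lemma intgM_bd f h M : intg f -> measurable_fun [set: T] h ->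
  (forall x, `|h x| <= M) -> intg (fun x => f x * h x).
Proof.
move=> hf mh hM; apply: (@intg_le _ (fun x => M * `|f x|)).
- by apply: measurable_funM => //; exact: intg_meas.
- by move=> x; rewrite normrM mulrC ler_wpM2r.
- by apply: intgZ; exact: intg_norm.
Qed.

Lemma meas_indic A : measurable A -> measurable_fun [set: T] (\1_A : T -> R).
Proof. by move=> mA; exact: measurable_indic. Qed.

Lemma intgM_indic f A : intg f -> measurable A -> intg (fun x => f x * \1_A x).
Proof.
move=> hf mA; apply: (intgM_bd hf (meas_indic mA)) => x; exact: norm_indic.
Qed.

Lemma intg_indic A : measurable A -> (mu A < +oo)%E -> intg (\1_A).
Proof.
move=> mA fA; apply/integrableP; split; first exact/measurable_EFinP/meas_indic.
rewrite (eq_integral (fun x => (\1_A x)%:E)); last first.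
  by move=> x _; rewrite gee0_abs// lee_fin.
by rewrite integral_indic// setIT.
Qed.

Lemma I_indic A : measurable A -> I (\1_A) = fine (mu A).
Proof. by move=> mA; rewrite /I /Rintegral integral_indic// setIT. Qed.

(** Measurability of [g] is assumed because [mu] need not be complete: it does not pass along
    equality almost everywhere. *)
Lemma I_eq_ae f g : intg f -> measurable_fun [set: T] g ->
  {ae mu, forall x, f x = g x} -> intg g /\ I g = I f.
Proof.
move=> hf mg fg.
have E : ae_eq mu [set: T] (EFin \o f) (EFin \o g).
  by apply: filterS fg => x /= -> _.
have mf := intg_meas hf.
split; last first.
  rewrite /I /Rintegral; congr fine; apply: ae_eq_integral => //.
  - exact/measurable_EFinP.
  - exact/measurable_EFinP.
  - exact: ae_eq_sym.
apply/integrableP; split; first exact/measurable_EFinP.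
move/integrableP : hf => [_].
rewrite (@ae_eq_integral _ _ _ mu setT (abse \o (EFin \o g)) (abse \o (EFin \o f)))//=.
- by apply: measurableT_comp => //; exact/measurable_EFinP.
- by apply: measurableT_comp => //; exact/measurable_EFinP.
- by apply: filterS fg => x /= -> _.
Qed.

(** The pointwise maximum of [f] and [g] is above [f] everywhere and equals [g] almost everywhere,
    which reduces the claim to a comparison that holds everywhere. *)
Lemma I_le_ae f g : intg f -> intg g -> {ae mu, forall x, f x <= g x} ->
  I f <= I g.
Proof.
move=> hf hg fg.
have mf := intg_meas hf; have mg := intg_meas hg.
have hM : measurable_fun [set: T] (fun x => Num.max (f x) (g x)).
  exact: measurable_maxr.
have [iM <-] : intg (fun x => Num.max (f x) (g x)) /\
    I (fun x => Num.max (f x) (g x)) = I g.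
  apply: I_eq_ae => //.
  by apply: filterS fg => x fgx; rewrite max_r.
by apply: I_le => // x; rewrite le_max lexx.
Qed.

Lemma I_eq0_ae f : intg f -> I (fun x => `|f x|) = 0 ->
  {ae mu, forall x, f x = 0}.
Proof.
move=> hf H.
have /integrableP [mf _] := hf.
have : (\int[mu]_x `|(EFin \o f) x| = 0)%E.
  have := intg_norm hf => /(integrable_fin_num measurableT) /fineK <-.
  by move: H; rewrite /I /Rintegral /= => ->.
move/(ae_eq_integral_abs mu measurableT mf).
by apply: filterS => x /(_ Logic.I) /= [].
Qed.

Lemma I_dct (f_ : nat -> T -> R) f g : (forall n, measurable_fun [set: T] (f_ n)) ->
  measurable_fun [set: T] f ->
  {ae mu, forall x, f_ n x @[n --> \oo] --> f x} ->
  {ae mu, forall x, forall n, `|f_ n x| <= g x} -> intg g ->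
  [/\ intg f, (I (fun x => `|f_ n x - f x|) @[n --> \oo] --> 0) &
    I (f_ n) @[n --> \oo] --> I f].
Proof.
move=> mf_ mf cf fg ig.
have [|||||hi h1 h2] := @dominated_convergence _ T R mu setT measurableT
  (fun n => EFin \o f_ n) (EFin \o f) (EFin \o g).
- by move=> n; exact/measurable_EFinP.
- exact/measurable_EFinP.
- by apply: filterS cf => x cx _; apply: cvg_EFin => //; exact: nearW.
- exact: ig.
- by apply: filterS fg => x fgx n _; rewrite lee_fin.
split => //.
- exact: (fine_cvg h1).
- rewrite /I /Rintegral; apply: fine_cvg; rewrite fineK//.
  exact: integrable_fin_num.
Qed.

Definition sqi f : Prop := measurable_fun [set: T] f /\ intg (fun x => f x ^+ 2).

Lemma sqi0 : sqi (fun=> 0).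
Proof.
by split => //; apply: eq_intg intg0 => x; rewrite expr0n.
Qed.

Lemma sqiZ k f : sqi f -> sqi (fun x => k * f x).
Proof.
move=> [mf hf]; split; first exact: measurable_funM.
by apply: eq_intg (intgZ (k ^+ 2) hf) => x; rewrite exprMn.
Qed.

Lemma sqiD f g : sqi f -> sqi g -> sqi (fun x => f x + g x).
Proof.
move=> [mf hf] [mg hg]; split; first exact: measurable_funD.
apply: (intg_le _ _ (intgD (intgZ 2 hf) (intgZ 2 hg))).
  by apply: measurable_funX; exact: measurable_funD.
by move=> x; rewrite ger0_norm ?sqr_ge0//; have := sqr_ge0 (f x - g x); nra.
Qed.

Lemma sqi_le f g : measurable_fun [set: T] f -> (forall x, `|f x| <= `|g x|) ->
  sqi g -> sqi f.
Proof.
move=> mf fg [mg hg]; split => //; apply: (intg_le _ _ hg).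
  exact: measurable_funX.
by move=> x; rewrite ger0_norm ?sqr_ge0// -(real_normK (num_real (f x))) -(real_normK (num_real (g x))) lerXn2r// ?nnegrE.
Qed.

Lemma sqi_mul f g : sqi f -> sqi g -> intg (fun x => f x * g x).
Proof.
move=> [mf hf] [mg hg].
apply: (intg_le _ _ (intgD hf hg)); first exact: measurable_funM.
move=> x; rewrite normrM -(real_normK (num_real (f x))) -(real_normK (num_real (g x))).
have := sqr_ge0 (`|f x| - `|g x|).
by have := normr_ge0 (f x); have := normr_ge0 (g x); nra.
Qed.

(** The discriminant of a quadratic polynomial that stays nonnegative; the vertex [x / a] is the
    test point when [a] is not 0. *)
Lemma quad_disc (a b x : R) : 0 <= a -> 0 <= b ->
  (forall t, 0 <= a * t ^+ 2 - 2 * t * x + b) -> x ^+ 2 <= a * b.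
Proof.
move=> a0 b0 H; have [a00|a1] := eqVneq a 0.
  have [->|x0] := eqVneq x 0; first by rewrite expr0n /= mulr_ge0.
  (* At this [t] the degenerate polynomial takes the value -1. *)
  have := H ((b + 1) / (2 * x)); rewrite a00 !mul0r add0r.
  have -> : 2 * ((b + 1) / (2 * x)) * x = b + 1 by field.
  by rewrite opprD; lra.
have ap : 0 < a by rewrite lt_neqAle eq_sym a1.
have := H (x / a).
have -> : a * (x / a) ^+ 2 - 2 * (x / a) * x + b = (a * b - x ^+ 2) / a by field.
by rewrite pmulr_lge0 ?invr_gt0// subr_ge0.
Qed.

(** The discriminant inequality for the integral of [(t |f| - |g|)^2] as a polynomial in [t]. *)
Lemma I_CS f g : sqi f -> sqi g ->
  I (fun x => `|f x * g x|) <=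
  Num.sqrt (I (fun x => f x ^+ 2)) * Num.sqrt (I (fun x => g x ^+ 2)).
Proof.
move=> hf hg; have ifg := intg_norm (sqi_mul hf hg).
case: hf => mf hf; case: hg => mg hg.
have A0 : 0 <= I (fun x => f x ^+ 2) by apply: I_ge0 => x; exact: sqr_ge0.
have B0 : 0 <= I (fun x => g x ^+ 2) by apply: I_ge0 => x; exact: sqr_ge0.
have X0 : 0 <= I (fun x => `|f x * g x|) by apply: I_ge0.
rewrite -sqrtrM// -(ger0_norm X0) -sqrtr_sqr ler_wsqrtr//.
apply: quad_disc => // t.
have -> : I (fun x => f x ^+ 2) * t ^+ 2 - 2 * t * I (fun x => `|f x * g x|) +
  I (fun x => g x ^+ 2) = I (fun x => (t ^+ 2 * f x ^+ 2 - 2 * t * `|f x * g x|)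
     + g x ^+ 2).
  rewrite ID//; last by apply: intgB; apply: intgZ.
  by rewrite IB ?IZ//; [rewrite mulrC|exact: intgZ|exact: intgZ].
apply: I_ge0 => x.
have -> : t ^+ 2 * f x ^+ 2 - 2 * t * `|f x * g x| + g x ^+ 2 =
  (t * `|f x| - `|g x|) ^+ 2.
  rewrite normrM sqrrB exprMn !real_normK ?num_real//; ring.
exact: sqr_ge0.
Qed.

End real_integrals.

Arguments intg {d T R} mu f.
Arguments I {d T R} mu f.
Arguments sqi {d T R} mu f.

(** * Series of atoms *)

Lemma cvgn0_scale (R : realType) (u : nat -> R) k :
  u n @[n --> \oo] --> 0 -> k * u n @[n --> \oo] --> 0.
Proof. by move=> h; rewrite -(mulr0 k); exact: cvgMl_tmp. Qed.

Section uniq_sums.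
Context (R : realType) (J : eqType).
Implicit Types (s t : seq J).

Lemma big_uniq_split (V : zmodType) s t (g : J -> V) : uniq s -> uniq t ->
  {subset s <= t} ->
  \sum_(x <- t) g x = \sum_(x <- s) g x + \sum_(x <- t | x \notin s) g x.
Proof.
move=> us ut st; rewrite (bigID (mem s))/=; congr (_ + _).
rewrite -big_filter; apply: perm_big; apply: uniq_perm => //.
  exact: filter_uniq.
by move=> x; rewrite mem_filter/=; case: (boolP (x \in s)) => //= /st.
Qed.

Lemma ler_sum_uniq s t (g : J -> R) : uniq s -> uniq t -> {subset s <= t} ->
  (forall x, 0 <= g x) -> \sum_(x <- s) g x <= \sum_(x <- t) g x.
Proof.
by move=> us ut st g0; rewrite (big_uniq_split g us ut st) lerDl sumr_ge0.
Qed.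

End uniq_sums.

Section atomic_cost.
Context d (T : measurableType d) (R : realType).
Variable mu : {measure set T -> \bar R}.
Implicit Types (C : R) (u v : T -> R) (P Q : (T -> R) -> Prop).

Local Notation intg := (intg mu).
Local Notation I := (I mu).

(** The atom 0 lets a finite sum be padded to a series, and stability under scalars of modulus at
    most 1 lets signs be absorbed by the atoms, so that coefficients can stay nonnegative. *)
Definition atomic_family P : Prop :=
  [/\ P (fun=> 0), forall (k : R) a, `|k| <= 1 -> P a -> P (fun x => k * a x) &
    forall a, P a -> intg a /\ I (fun x => `|a x|) <= 1].

(* [C] bounds the atomic norm of [u] with respect to the atoms [P]. *)
Definition acost P u (C : R) : Prop :=
  intg u /\ exists (lam : nat -> R) (a : nat -> T -> R),
    [/\ forall j, P (a j), forall j, 0 <= lam j,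
      forall n, \sum_(j < n) lam j <= C &
      I (fun x => `|u x - \sum_(j < n) lam j * a j x|) @[n --> \oo] --> 0].

Lemma acost_intg P u C : acost P u C -> intg u.
Proof. by case. Qed.

Lemma acost_ge0 P u C : acost P u C -> 0 <= C.
Proof. by move=> [_ [lam [a [_ _ /(_ 0%N)]]]]; rewrite big_ord0. Qed.

Lemma acost_le P u C C' : acost P u C -> C <= C' -> acost P u C'.
Proof.
move=> [iu [lam [a [h1 h2 h3 h4]]]] CC; split => //.
by exists lam, a; split => // n; exact: le_trans (h3 n) CC.
Qed.

Lemma acost_atom P a C : atomic_family P -> P a -> 0 <= C ->
  acost P (fun x => C * a x) C.
Proof.
move=> [hP0 _ hP] Pa C0; have [ia _] := hP _ Pa.
split; first exact: intgZ.
exists (fun j => if j is 0%N then C else 0), (fun j => if j is 0%N then a else fun=> 0).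
split.
- by case.
- by case.
- case=> [|n]; first by rewrite big_ord0.
  by rewrite big_ord_recl/= big1 ?addr0.
- apply/cvgrPdist_lt => e e0; near=> n.
  have n0 : (0 < n)%N by near: n; exists 1%N.
  rewrite (_ : I _ = 0) ?subrr ?normr0//.
  rewrite -[RHS](I0 mu); apply: eq_I => x; rewrite -(prednK n0).
  rewrite big_ord_recl/= big1 ?addr0 ?subrr ?normr0// => i _; rewrite mul0r.
Unshelve. all: by end_near. Qed.

Lemma acost_eq_ae P u v C : acost P u C -> measurable_fun [set: T] v ->
  {ae mu, forall x, u x = v x} -> atomic_family P -> acost P v C.
Proof.
move=> [iu [lam [a [h1 h2 h3 h4]]]] mv uv [_ _ hP].
have [iv _] := I_eq_ae iu mv uv.
split => //; exists lam, a; split => //.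
rewrite (_ : (fun n => _) = (fun n => I (fun x => `|u x - \sum_(j < n) lam j * a j x|)))//.
apply/funext => n.
have is_ : intg (fun x => \sum_(j < n) lam j * a j x).
  by apply: intg_sum => i _; apply: intgZ; have [] := hP _ (h1 i).
have i1 := intg_norm (intgB iu is_); have i2 := intg_norm (intgB iv is_).
apply: (I_eq_ae i1 (intg_meas i2) _).2.
by apply: filterS uv => x ->.
Qed.

Lemma acost0 P C : atomic_family P -> 0 <= C -> acost P (fun=> 0) C.
Proof.
move=> hP C0; apply: acost_le C0.
by apply: acost_eq_ae (acost_atom hP (let: And3 h _ _ := hP in h) (lexx 0)) _ _ hP => //; apply: aeW => x; rewrite mul0r.
Qed.

(** The modulus of [k] goes to the coefficients, its sign to the atoms. *)
Lemma acostZ P u C (k : R) : atomic_family P ->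
  acost P u C -> acost P (fun x => k * u x) (`|k| * C).
Proof.
move=> [_ hN hP] [iu [lam [a [h1 h2 h3 h4]]]]; split; first exact: intgZ.
exists (fun j => `|k| * lam j), (fun j x => Num.sg k * a j x); split.
- move=> j; apply: hN => //; rewrite normr_sg lern1; exact: leq_b1.
- by move=> j; rewrite mulr_ge0.
- by move=> n; rewrite -mulr_sumr ler_wpM2l.
- rewrite (_ : (fun n => _) = (fun n => `|k| * I (fun x => `|u x - \sum_(j < n) lam j * a j x|))).
    exact: cvgn0_scale.
  apply/funext => n; rewrite -IZ; last first.
    apply: intg_norm; apply: intgB => //.
    by apply: intg_sum => i _; apply: intgZ; have [] := hP _ (h1 i).
  apply: eq_I => x; rewrite -normrM mulrBr mulr_sumr; congr (`| _ - _ |).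
  by apply: eq_bigr => i _; rewrite [in RHS](numEsg k); ring.
Qed.

(** A series of series is rearranged into one series along the coding of pairs by [pickle]; a code
    without preimage contributes the term 0. The initial segments [s_ M] and the rectangles
    [rect N J] are cofinal in each other. *)
Let s_ (M : nat) : seq (nat * nat) := pmap (@pickle_inv (nat * nat)%type) (iota 0 M).
Let rect (N J : nat) : seq (nat * nat) := [seq (n, j) | n <- iota 0 N, j <- iota 0 J].

Let s_uniq M : uniq (s_ M).
Proof. by apply: (pmap_uniq (@pickle_invK _)); exact: iota_uniq. Qed.

Let mem_s M x : (pickle x < M)%N -> x \in s_ M.
Proof.
move=> xM; rewrite mem_pmap; apply/mapP; exists (pickle x).
  by rewrite mem_iota.
by rewrite pickleK_inv.
Qed.

Let s_mono M N : (M <= N)%N -> {subset s_ M <= s_ N}.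
Proof.
move=> MN x; rewrite !mem_pmap => /mapP[k]; rewrite mem_iota/= add0n => kM ->.
by apply: map_f; rewrite mem_iota/= add0n (leq_trans kM).
Qed.

Let rect_uniq N J : uniq (rect N J).
Proof.
by apply: allpairs_uniq; rewrite ?iota_uniq// => -[a b] [a' b'] _ _ /= ->.
Qed.

Let mem_rect N J (x : nat * nat) : (x \in rect N J) = (x.1 < N)%N && (x.2 < J)%N.
Proof.
apply/allpairsP/andP => [[[n j]] /= [+ + ->]|[h1 h2]].
  by rewrite !mem_iota.
by exists x; rewrite !mem_iota/= -surjective_pairing.
Qed.

Let sub_rect M : exists B, forall N J, (B <= N)%N -> (B <= J)%N ->
  {subset s_ M <= rect N J}.
Proof.
exists (\max_(x <- s_ M) (maxn x.1 x.2)).+1 => N J BN BJ x xs.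
have : (maxn x.1 x.2 <= \max_(x <- s_ M) (maxn x.1 x.2))%N by exact: leq_bigmax_seq.
rewrite geq_max => /andP[h1 h2]; rewrite mem_rect.
by rewrite (leq_trans _ BN)//= (leq_trans _ BJ).
Qed.

Let sub_s N J : exists M0, forall M, (M0 <= M)%N -> {subset rect N J <= s_ M}.
Proof.
exists (\max_(x <- rect N J) pickle x).+1 => M MM x xs; apply: mem_s.
by rewrite (leq_trans _ MM)// ltnS leq_bigmax_seq.
Qed.

Let sum_s (V : zmodType) (g : nat * nat -> V) M :
  \sum_(k < M) oapp g 0 (pickle_inv k) = \sum_(x <- s_ M) g x.
Proof.
by rewrite -(big_mkord xpredT (fun k => oapp g 0 (pickle_inv k))) big_pmap/= /index_iota subn0.
Qed.

Let sum_rect (V : zmodType) (g : nat * nat -> V) N J :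
  \sum_(x <- rect N J) g x = \sum_(n < N) \sum_(j < J) g (n : nat, j : nat).
Proof.
rewrite big_allpairs/= -(big_mkord xpredT (fun n => \sum_(j < J) g (n, j : nat))).
rewrite /index_iota subn0; apply: eq_bigr => n _.
by rewrite -(big_mkord xpredT (fun j => g (n, j))) /index_iota subn0.
Qed.

Let I_triang f g : intg f -> intg g ->
  I (fun x => `|f x + g x|) <= I (fun x => `|f x|) + I (fun x => `|g x|).
Proof.
move=> hf hg; rewrite -ID; [|exact: intg_norm|exact: intg_norm].
apply: I_le => [||x]; last exact: ler_normD.
  by apply: intg_norm; exact: intgD.
by apply: intgD; exact: intg_norm.
Qed.

Let I_sum_norm J (s : seq J) (p : pred J) (f : J -> T -> R) : (forall i, p i -> intg (f i)) ->
  I (fun x => `|\sum_(i <- s | p i) f i x|) <= \sum_(i <- s | p i) I (fun x => `|f i x|).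
Proof.
move=> hf; rewrite -I_sum; last by move=> i pi; apply: intg_norm; exact: hf.
apply: I_le => [||x]; last exact: ler_norm_sum.
  by apply: intg_norm; exact: intg_sum.
by apply: intg_sum => i pi; apply: intg_norm; exact: hf.
Qed.

(** Completeness of the atomic space. The rearranged double series converges in [L^1] to the
    iterated sum because its coefficients are summable and atoms have [L^1] norm at most 1. *)
Theorem acost_series P (u_ : nat -> T -> R) (C_ : nat -> R) u C :
  atomic_family P -> intg u ->
  (forall n, acost P (u_ n) (C_ n)) -> (forall n, \sum_(k < n) C_ k <= C) ->
  I (fun x => `|u x - \sum_(k < n) u_ k x|) @[n --> \oo] --> 0 ->
  acost P u C.
Proof.
move=> hP iu hu hC cu.
have [P0 _ hPi] := hP.
have iu_ n := acost_intg (hu n).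
have /choice[lam hlam] : forall n, exists lam : nat -> R, exists a : nat -> T -> R,
    [/\ forall j, P (a j), forall j, 0 <= lam j,
      forall m, \sum_(j < m) lam j <= C_ n &
      I (fun x => `|u_ n x - \sum_(j < m) lam j * a j x|) @[m --> \oo] --> 0].
  by move=> n; case: (hu n).
have {hlam}/choice[a ha] := hlam.
pose L (x : nat * nat) := lam x.1 x.2.
pose A (x : nat * nat) := a x.1 x.2.
have L0 x : 0 <= L x by have [_ h _ _] := ha x.1; exact: h.
have PA x : P (A x) by have [h _ _ _] := ha x.1; exact: h.
pose lam' k := oapp L 0 (pickle_inv k).
pose a' k := oapp A (fun=> 0) (pickle_inv k).
have lam'0 k : 0 <= lam' k by rewrite /lam'; case: pickle_inv => //= x; exact: L0.
have Pa' k : P (a' k) by rewrite /a'; case: pickle_inv.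
have iLA x : intg (fun t => L x * A x t) by apply: intgZ; case: (hPi _ (PA x)).
have nLA x : I (fun t => `|L x * A x t|) <= L x.
  have [ia Ia] := hPi _ (PA x).
  rewrite (_ : I _ = L x * I (fun t => `|A x t|)); last first.
    rewrite -IZ; last exact: intg_norm.
    by apply: eq_I => t; rewrite normrM (ger0_norm (L0 x)).
  by rewrite ler_piMr.
have bnd M : \sum_(k < M) lam' k <= C.
  rewrite /lam' sum_s; have [B hB] := sub_rect M.
  apply: le_trans (ler_sum_uniq _ (rect_uniq B B) (hB B B _ _) L0) _ => //.
  rewrite sum_rect; apply: le_trans (hC B); apply: ler_sum => n _.
  by case: (ha n).
split => //; exists lam', a'; split => //.
have cl : cvgn (fun M => \sum_(k < M) lam' k).
  apply: nondecreasing_is_cvgn; last by exists C => _ [M _ <-].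
  apply/nondecreasing_seqP => n; by rewrite big_ord_recr/= lerDl.
apply/cvgrPdist_le => e e0.
have e3 : 0 < e / 3 by rewrite divr_gt0.
move/cvgrPdist_le : (cl) => /(_ _ e3) [M0 _ hM0].
set ell := limn _ in hM0.
have ltell M : \sum_(k < M) lam' k <= ell.
  apply: nondecreasing_cvgn_le => //; apply/nondecreasing_seqP => n.
  by rewrite big_ord_recr/= lerDl.
have [B hB] := sub_rect M0.
move/cvgrPdist_le : (cu) => /(_ _ e3) [N0 _ hN0].
(* From [B] on the rectangle contains the first [M0] codes, after which the coefficients add up to
   at most [e / 3]. *)
pose N := maxn N0 B.
have eN : 0 < e / 3 / N.+1%:R by rewrite divr_gt0.
have /choice[J_ hJ_] : forall n, exists J, forall j, (J <= j)%N ->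
    I (fun x => `|u_ n x - \sum_(i < j) lam n i * a n i x|) <= e / 3 / N.+1%:R.
  move=> n; have [_ _ _ cn] := ha n.
  move/cvgrPdist_le : (cn) => /(_ _ eN) [J _ hJ].
  exists J => j Jj; have := hJ _ Jj; rewrite sub0r normrN ger0_norm//.
  exact: I_ge0.
pose J := maxn (\max_(n < N) J_ n) B.
have [M1 hM1] := sub_s N J.
exists (maxn M0 M1) => // M /=; rewrite geq_max => /andP[M0M M1M].
rewrite sub0r normrN ger0_norm; last exact: I_ge0.
(* Three errors of size [e / 3]: the outer tail, the inner tails of the first [N] series, and the
   enumerated terms outside the rectangle. *)
pose r1 x := u x - \sum_(n < N) u_ n x.
pose r2 x := \sum_(n < N) (u_ n x - \sum_(j < J) lam n j * a n j x).
pose r3 x := - \sum_(y <- s_ M | y \notin rect N J) L y * A y x.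
have E x : u x - \sum_(j < M) lam' j * a' j x = r1 x + (r2 x + r3 x).
  have -> : \sum_(j < M) lam' j * a' j x = \sum_(y <- s_ M) L y * A y x.
    rewrite -sum_s; apply: eq_bigr => k _; rewrite /lam' /a'.
    by case: pickle_inv => //=; rewrite mul0r.
  rewrite (big_uniq_split _ (rect_uniq N J) (s_uniq M) (hM1 M M1M)).
  by rewrite sum_rect /r1 /r2 /r3 sumrB /L /A/=; ring.
have iun n : intg (fun x => \sum_(j < J) lam n j * a n j x).
  by apply: intg_sum => j _; exact: (iLA (n, j : nat)).
have i1 : intg r1 by apply: intgB => //; apply: intg_sum.
have i2 : intg r2 by apply: intg_sum => n _; exact: intgB.
have i3 : intg r3 by apply: intgN; apply: intg_sum => y _; exact: iLA.
rewrite (eq_I mu (g := fun x => `|r1 x + (r2 x + r3 x)|)); last by move=> x; rewrite E.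
apply: le_trans (I_triang i1 (intgD i2 i3)) _.
have -> : e = e / 3 + (e / 3 + e / 3) by field.
apply: lerD.
  have := hN0 N (leq_maxl _ _); rewrite sub0r normrN ger0_norm//.
  exact: I_ge0.
apply: le_trans (I_triang i2 i3) _; apply: lerD.
  apply: le_trans (I_sum_norm _ _) _ => [n _|]; first exact: intgB.
  apply: (@le_trans _ _ (\sum_(n < N) (e / 3 / N.+1%:R))).
    apply: ler_sum => n _; apply: hJ_; rewrite /J leq_max; apply/orP; left.
    exact: (@leq_bigmax _ (fun n : 'I_N => J_ n)).
  rewrite sumr_const card_ord -(mulr_natr (e / 3 / N.+1%:R) N) -(mulrA (e / 3)); apply: ler_piMr; first exact: ltW.
  by rewrite mulrC ler_pdivrMr// mul1r ler_nat.
rewrite /r3 (eq_I mu (g := fun x => `|\sum_(y <- s_ M | y \notin rect N J) L y * A y x|));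
  last by move=> x; rewrite normrN.
apply: le_trans (I_sum_norm _ _) _ => [y _|]; first exact: iLA.
apply: (@le_trans _ _ (\sum_(y <- s_ M | y \notin rect N J) L y)).
  by apply: ler_sum => y _; exact: nLA.
apply: (@le_trans _ _ (\sum_(y <- s_ M | y \notin s_ M0) L y)).
  rewrite big_mkcond [leRHS]big_mkcond/=; apply: ler_sum => y _.
  case: ifPn => [h|_]; last by case: ifP.
  case: ifPn => // /negPn /hB h'; move: h; rewrite h'//; exact: leq_maxr.
have := big_uniq_split L (s_uniq M0) (s_uniq M) (s_mono M0M).
rewrite -!sum_s -/lam' => h.
have := ltell M; rewrite h => h'.
have := hM0 M0 (leqnn _); rewrite ger0_norm ?subr_ge0// => h2.
lra.
Qed.

End atomic_cost.

(** * Balls, doubling and coverings *)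

(** Follows from Bernoulli's inequality [1 + k (e - 1) <= e^k]. *)
Lemma expr_unbounded (R : realType) (e A : R) : 1 < e -> exists n, A < e ^+ n.
Proof.
move=> he; have e1 : 0 < e - 1 by rewrite subr_gt0.
pose n := Num.Def.truncn (`|A| / (e - 1)).
exists n.+1; apply: (le_lt_trans (ler_norm A)).
have h : `|A| / (e - 1) < n.+1%:R by exact: truncnS_gt.
rewrite ltr_pdivrMr// in h; apply: lt_le_trans h _.
have : forall k, k%:R * (e - 1) <= (1 + (e - 1)) ^+ k.
  move=> k; suff : 1 + k%:R * (e - 1) <= (1 + (e - 1)) ^+ k by lra.
  elim: k => [|k IH]; first by rewrite mul0r addr0 expr0.
  rewrite exprS -natr1; have : 0 <= k%:R :> R by [].
  have : 0 <= (e - 1) by exact: ltW.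
  move: IH; set f := (e - 1); set p := (1 + f) ^+ k => IH e0 k0.
  have : (1 + f) * (1 + k%:R * f) <= (1 + f) * p by rewrite ler_pM2l// ltr_pwDl.
  nra.
by move=> /(_ n.+1); rewrite (addrC 1) subrK.
Qed.

Lemma geometric_sum_le (R : realType) (t : R) n : 0 <= t -> t < 1 ->
  \sum_(j < n) t ^+ j <= (1 - t)^-1.
Proof.
move=> t0 t1; have t1' : 0 < 1 - t by rewrite subr_gt0.
rewrite -[leRHS]mul1r ler_pdivlMr//.
have -> : (\sum_(j < n) t ^+ j) * (1 - t) = 1 - t ^+ n.
  elim: (n) => [|j IH]; first by rewrite big_ord0 mul0r expr0 subrr.
  by rewrite big_ord_recr/= mulrDl IH exprS; ring.
by rewrite gerBl exprn_ge0.
Qed.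

Lemma half_lt1 (R : realType) : 2^-1 < 1 :> R.
Proof. by rewrite invf_lt1// ltr1n. Qed.

Lemma geometric_half_le (R : realType) n : \sum_(j < n) 2^-1 ^+ j <= 2 :> R.
Proof.
have h := @geometric_sum_le R 2^-1 n (ltW (_ : 0 < 2^-1 :> R)) (half_lt1 R).
by apply: le_trans (h _) _ => //; rewrite (_ : 1 - 2^-1 = 2^-1 :> R) ?invrK//; field.
Qed.

Lemma half_cvg0 (R : realType) : (2^-1 : R) ^+ n @[n --> \oo] --> 0.
Proof. by apply: cvg_expr; rewrite ger0_norm// half_lt1. Qed.

Section real_measure.
Context d (T : measurableType d) (R : realType).
Variable mu : {measure set T -> \bar R}.
Implicit Types A B : set T.

Lemma mu_le A B : measurable A -> measurable B -> A `<=` B -> (mu A <= mu B)%E.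
Proof. by move=> mA mB; apply: le_measure; rewrite inE. Qed.

Lemma mu_fine A : (mu A < +oo)%E -> mu A = (fine (mu A))%:E.
Proof. by move=> h; rewrite fineK// ge0_fin_numE. Qed.

Lemma le_mr A B : measurable A -> measurable B -> A `<=` B ->
  (mu B < +oo)%E -> fine (mu A) <= fine (mu B).
Proof.
move=> mA mB AB fB; have le := le_measure mu (mem_set mA) (mem_set mB) AB.
have fA := le_lt_trans le fB.
by rewrite -lee_fin -!mu_fine.
Qed.

Lemma mr_ge0 A : 0 <= fine (mu A).
Proof. exact: fine_ge0. Qed.

End real_measure.

(* [hs_eta] is [c `^ eps0] for the lower growth exponent [eps0]. *)
Record growing_space (R : realType) (X : ptopologicalType)
    (mu : {measure set (borel X) -> \bar R}) (d : X -> X -> R)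
    (c K eta : R) : Prop := GrowingSpace {
  hs_space : homogeneous_type mu (qball d) c K ;
  hs_eta : 1 < eta ;
  hs_growth : forall (t : R) (x : X) (j : nat), 0 < t ->
    ((eta ^+ j)%:E * mu (qball d x t) <= mu (qball d x (c ^+ j * t)))%E }.

Section geometry.
Context (R : realType) (X : ptopologicalType).
Variables (mu : {measure set (borel X) -> \bar R}) (d : X -> X -> R).
Variables (c K eta : R).
Hypothesis hs : growing_space mu d c K eta.

Local Notation B := (qball d).
Let hX := hs_space hs.
Implicit Types (x y : X) (r : R) (n : nat).

Local Notation mr A := (fine (mu A)).
Local Notation m x r := (mr (B x r)).

Lemma c_gt1 : 1 < c. Proof. exact: (ht_c_gt1 hX). Qed.
Lemma c_gt0 : 0 < c. Proof. exact: lt_trans c_gt1. Qed.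
Lemma K_gt1 : 1 < K. Proof. exact: (ht_K_gt1 hX). Qed.
Lemma K_gt0 : 0 < K. Proof. exact: lt_trans K_gt1. Qed.
Lemma cr_gt0 n r : 0 < r -> 0 < c ^+ n * r.
Proof. by move=> r0; rewrite mulr_gt0// exprn_gt0// c_gt0. Qed.

Lemma cr_ge n r : 0 < r -> r <= c ^+ n * r.
Proof. by move=> r0; rewrite ler_pMl// exprn_ege1// ltW// c_gt1. Qed.

Lemma meas_open (U : set X) : open U -> measurable (U : set (borel X)).
Proof. exact: sub_sigma_algebra. Qed.

Lemma open_ball x r : 0 < r -> open (B x r).
Proof. exact: (ht_open hX). Qed.

Lemma meas_ball x r : 0 < r -> measurable (B x r : set (borel X)).
Proof. by move=> r0; apply: meas_open; exact: open_ball. Qed.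

Lemma fin_ball x r : 0 < r -> (mu (B x r) < +oo)%E.
Proof. by move=> r0; case/andP: (ht_measure hX x r0). Qed.

Lemma mballE x r : 0 < r -> mu (B x r) = (m x r)%:E.
Proof. by move=> r0; apply: mu_fine; exact: fin_ball. Qed.

Lemma m_gt0 x r : 0 < r -> 0 < m x r.
Proof.
by move=> r0; case/andP: (ht_measure hX x r0); rewrite mballE// lte_fin.
Qed.

Lemma fin_sub A x r : measurable (A : set (borel X)) -> 0 < r -> A `<=` B x r ->
  (mu A < +oo)%E.
Proof.
move=> mA r0 AB; apply: le_lt_trans (fin_ball x r0).
by apply: mu_le => //; exact: meas_ball.
Qed.

Lemma mr_sub A x r : measurable (A : set (borel X)) -> 0 < r -> A `<=` B x r ->
  mr A <= m x r.
Proof.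
by move=> mA r0 AB; apply: le_mr => //; [exact: meas_ball|exact: fin_ball].
Qed.

Lemma ball_mono x r1 r2 : r1 <= r2 -> B x r1 `<=` B x r2.
Proof. by move=> r12 y /= h; exact: lt_le_trans h r12. Qed.

Lemma ball_center x r : 0 < r -> B x r x.
Proof. exact: (ht_center hX). Qed.

Lemma m_dbl n x r : 0 < r -> m x (c ^+ n * r) <= K ^+ n * m x r.
Proof.
move=> r0; elim: n => [|n IH]; first by rewrite !expr0 !mul1r.
have := ht_doubling hX x (cr_gt0 n r0).
rewrite mulrA -exprS (mballE x (cr_gt0 n.+1 r0)) (mballE x (cr_gt0 n r0)).
rewrite -EFinM lee_fin => /le_trans; apply.
by rewrite exprS -mulrA ler_pM2l// K_gt0.
Qed.

Lemma m_grow n x r : 0 < r -> eta ^+ n * m x r <= m x (c ^+ n * r).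
Proof.
move=> r0; have := hs_growth hs x n r0.
by rewrite (mballE x (cr_gt0 n r0)) (mballE x r0) -EFinM lee_fin.
Qed.

Lemma engulf x1 x2 r1 r2 y : 0 < r2 -> r2 <= r1 -> B x1 r1 y -> B x2 r2 y ->
  B x2 r2 `<=` B x1 (c * r1).
Proof.
by move=> r20 r21 h1 h2; apply: (ht_engulfing hX) => //; exists y.
Qed.

(** A ball of radius [r] about a point of the closure meets [B x r], hence is engulfed by the
    dilate. *)
Lemma closure_ball x r : 0 < r -> closure (B x r) `<=` B x (c * r).
Proof.
move=> r0 y /(_ (B y r)) /= h.
have [|z [h1 h2]] := h; first by apply: open_nbhs_nbhs; split; [exact: open_ball|exact: ball_center].
by apply: (engulf r0 (lexx r) h1 h2); exact: ball_center.
Qed.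

(** The lower growth of balls makes the total measure infinite; this is what allows supports to be
    spread without limit. *)
Lemma m_unbounded x r A : 0 < r -> exists n, A < m x (c ^+ n * r).
Proof.
move=> r0; have [n hn] := expr_unbounded (A / m x r) (hs_eta hs).
exists n; apply: lt_le_trans (m_grow n x r0).
by rewrite ltr_pdivrMr ?m_gt0// in hn.
Qed.

Section vitali.
Variables (V : set X) (R0 : R) (j : X -> nat).
Hypothesis R00 : 0 < R0.
Let rho x := R0 / c ^+ j x.

Let rho0 x : 0 < rho x.
Proof. by rewrite divr_gt0// exprn_gt0// c_gt0. Qed.

Let rho_le x y : (j x <= j y)%N -> rho y <= rho x.
Proof.
move=> h; rewrite ler_pM2l// lef_pV2 ?posrE ?exprn_gt0 ?c_gt0//.
by rewrite ler_weXn2l// ltW// c_gt1.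
Qed.

Let meets x y := exists z, B x (rho x) z /\ B y (rho y) z.

(** Vitali's selection by Zorn's lemma. The radii take the discrete values [R0 / c^j], so any
    nonempty set of candidates contains one of largest radius. *)
Lemma vitali_family : exists J : set X, [/\ J `<=` V,
  trivIset J (fun x => B x (rho x)) &
  forall y, V y -> exists2 x, J x & B y (rho y) `<=` B x (c * rho x)].
Proof.
(* The last clause keeps the selection greedy: a candidate that meets the family meets a member at
   least as large, which then engulfs it. *)
pose P (G : set X) := [/\ G `<=` V, trivIset G (fun x => B x (rho x)) &
  forall y, V y -> (exists2 x, G x & meets x y) ->
    exists2 x, G x & meets x y /\ (j x <= j y)%N].
have [J [[JV tJ PJ] maxJ]] : exists A, P A /\ forall A', A `<` A' -> ~ P A'.
  apply: Zorn_bigcup => F FP totF; split.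
  - by move=> x [G FG Gx]; have [h _ _] := FP _ FG; exact: h.
  - move=> x y [G FG Gx] [H FH Hy].
    have [GH|HG] := totF _ _ FG FH.
      by have [_ h _] := FP _ FH; apply: h => //; exact: GH.
    by have [_ h _] := FP _ FG; apply: h => //; exact: HG.
  - move=> y Vy [x [G FG Gx] xy]; have [_ _ h] := FP _ FG.
    have [|z Gz zy] := h y Vy; first by exists x.
    by exists z => //; exists G.
exists J; split => // y Vy.
have [[x Jx xy]|nJ] := pselect (exists2 x, J x & meets x y).
  have [|z Jz [[t [h1 h2]] jz]] := PJ y Vy; first by exists x.
  by exists z => //; apply: (engulf (rho0 y) (rho_le jz) h1 h2).
exfalso.
(* If some candidate met no member, the largest such candidate could be added to the family, against
   maximality. *)
pose Q n := `[< exists y, [/\ V y, ~ (exists2 x, J x & meets x y) & j y = n] >].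
have exQ : exists n, Q n by exists (j y); apply/asboolP; exists y.
case: (ex_minnP exQ) => n /asboolP [y0 [Vy0 ny0 jy0]] minn.
apply: (maxJ (J `|` [set y0])).
  split; first by move=> x Jx; left.
  move=> /(_ y0 (or_intror erefl)) Jy0; apply: ny0; exists y0 => //.
  by exists y0; split; exact: ball_center.
split.
- by move=> x [/JV//|->].
- move=> a b [Ja|->] [Jb|->] [z [h1 h2]] => //.
  + by apply: tJ => //; exists z.
  + by exfalso; apply: ny0; exists a => //; exists z.
  + by exfalso; apply: ny0; exists b => //; exists z.
- move=> z Vz [x [Jx|->] xz].
    have [|x' Jx' h] := PJ z Vz; first by exists x.
    by exists x' => //; left.
  have [[x' Jx' xz']|nz] := pselect (exists2 x, J x & meets x z).
    have [|x'' Jx'' h] := PJ z Vz; first by exists x'.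
    by exists x'' => //; left.
  exists y0; first by right.
  by split => //; rewrite jy0; apply: minn; apply/asboolP; exists z.
Qed.

End vitali.

End geometry.

From mathcomp Require Import finmap.


Section disjoint_families.
Context d (T : measurableType d) (R : realType).
Variable mu : {measure set T -> \bar R}.

(** By additivity inside a set of finite measure, only finitely many members have measure above
    [1/(k+1)]. *)
Lemma countable_disjoint (J : choiceType) (D : set J) (F : J -> set T) (A : set T) :
  trivIset D F -> (forall i, D i -> measurable (F i)) ->
  (forall i, D i -> (0 < mu (F i))%E) -> (forall i, D i -> F i `<=` A) ->
  measurable A -> (mu A < +oo)%E -> countable D.
Proof.
move=> tF mF F0 FA mA fA.
have fF i : D i -> (mu (F i) < +oo)%E.
  move=> Di; apply: le_lt_trans fA; apply: mu_le => //; [exact: mF|exact: FA].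
pose Dk k := [set i | D i /\ k.+1%:R^-1 < fine (mu (F i))].
have -> : D = \bigcup_k Dk k.
  apply/seteqP; split => [i Di|i [k _ []]//].
  have f0 : 0 < fine (mu (F i)) by rewrite -lte_fin -mu_fine ?F0//; exact: fF.
  exists (Num.Def.truncn (fine (mu (F i)))^-1) => //; split => //.
  rewrite -[ltRHS]invrK ltf_pV2 ?posrE ?invr_gt0//; exact: truncnS_gt.
apply: bigcup_countable => // k _; apply: finite_set_countable.
apply: contrapT => inf.
pose n := (Num.Def.truncn (k.+1%:R * fine (mu A))).+1.
have [S SD Sn] := infinite_set_fset n inf.
have mS i : i \in S -> measurable (F i) by move=> /SD [Di _]; exact: mF.
have tS : trivIset [set` S] F by apply: sub_trivIset tF => i /SD[].
have h := measure_fbigsetU mu mS tS.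
have le : (mu (\big[setU/set0]_(i <- S) F i) <= mu A)%E.
  apply: mu_le => //.
    by rewrite -bigcup_fset; apply: fin_bigcup_measurable => // i /mS.
  by rewrite -bigcup_fset => x [i /SD[/FA Fi _] /Fi].
move: le; rewrite h mu_fine// => le.
have : (\sum_(i <- S) (k.+1%:R^-1)%:E <= \sum_(i <- S) mu (F i))%E.
  rewrite big_seq [leRHS]big_seq; apply: lee_sum => i /SD[Di ki].
  by rewrite mu_fine ?fF// lee_fin ltW.
move=> /le_trans /(_ le); rewrite sumEFin lee_fin big_const_seq count_predT iter_addr_0.
rewrite -[_ *+ size _]mulr_natl ler_pdivrMr// leNgt => /negP; apply.
rewrite mulrC; apply: lt_le_trans (truncnS_gt _) _.
by rewrite ler_nat.
Qed.

End disjoint_families.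

(** * The Calderon-Zygmund covering at a given height *)

Section cz.
Context (R : realType) (X : ptopologicalType).
Variables (mu : {measure set (borel X) -> \bar R}) (d : X -> X -> R).
Variables (c K eta : R).
Hypothesis hs : growing_space mu d c K eta.

Local Notation B := (qball d).
Local Notation mr A := (fine (mu A)).
Local Notation m x r := (mr (B x r)).
Local Notation intg := (intg mu).
Local Notation I := (I mu).
Let hX := hs_space hs.

(** The pieces are indexed by all of [nat], whatever the number of selected balls; the alternative
    [E i = set0] fills the indices to which no ball corresponds. *)
Record cz_cover (x0 : X) (R0 : R) (w : X -> R) (alpha W : R)
    (x_ : nat -> X) (r_ : nat -> R) (E : nat -> set X) : Prop := {
  cz_meas : forall i, measurable (E i : set (borel X)) ;
  cz_triv : trivIset [set: nat] E ;
  cz_rad : forall i, 0 < r_ i ;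
  cz_sub : forall i, E i `<=` B (x_ i) (r_ i) ;
  cz_fat : forall i, E i = set0 \/ m (x_ i) (r_ i) <= K * mr (E i) ;
  cz_bnd : forall i, E i `<=` B x0 (c ^+ 3 * R0) ;
  cz_avg : forall i, I (fun x => w x * \1_(E i) x) <= alpha * K * mr (E i) ;
  cz_sum : forall n, \sum_(i < n) mr (E i) <= 3 * K * W / alpha ;
  cz_out : forall x, (forall i, ~ E i x) -> w x <= alpha }.

(** A stopping-time argument over the scales [c^2 R0 / c^j]. That small balls are eventually charged
    enough comes from an open neighborhood of the level set and outer regularity, not from
    differentiation of integrals. *)
Lemma cz_decomposition (x0 : X) (R0 : R) (w : X -> R) (alpha W : R) :
  0 < R0 -> 0 < alpha -> 0 < W -> intg w -> (forall x, 0 <= w x) ->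
  (forall x, ~ B x0 R0 x -> w x = 0) -> I w <= W ->
  3 * W <= alpha * m x0 R0 ->
  exists x_ r_ E, cz_cover x0 R0 w alpha W x_ r_ E.
Proof.
move=> R00 a0 W0 iw w0 wB IW hW.
have c0 := c_gt0 hs; have c1 := c_gt1 hs; have K0 := K_gt0 hs.
have mw := intg_meas iw.
pose D : set (borel X) := [set x | alpha < w x].
have mD : measurable D.
  rewrite -[D]setTI (_ : D = w @^-1` `]alpha, +oo[%classic); first exact: mw.
  by apply/seteqP; split => x /=; rewrite in_itv/= andbT.
have DB : D `<=` B x0 R0.
  by move=> x /= Dx; apply: contrapT => /wB wx; move: Dx; rewrite /D/= wx ltNge (ltW a0).
have fD := fin_sub hs mD R00 DB.
have aD : alpha * mr D <= W.
  apply: le_trans IW; rewrite -(I_indic mu mD) -IZ; last exact: intg_indic.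
  apply: I_le => [||x]; [by apply: intgZ; exact: intg_indic|by []|].
  have [[Dx ->]|[_ ->]] := @indicP _ R D x; rewrite ?mulr1 ?mulr0//.
  exact: ltW.
(* Outer regularity with slack [W / alpha]; since [alpha mu(D) <= W], this gives
   [alpha mu(U) <= 2 W]. *)
have [U [oU DU mUD]] : exists U : set X, [/\ open U, D `<=` U & (mu U <= (mr D + W / alpha)%:E)%E].
  have [h _] := ht_regular hX mD.
  have Wa : 0 < W / alpha by rewrite divr_gt0.
  have finf : ereal_inf [set mu U | U in [set U : set X | open U /\ D `<=` U]] \is a fin_num.
    by rewrite -h ge0_fin_numE.
  have [_ [U [oU DU] <-]] := lb_ereal_inf_adherent Wa finf.
  rewrite -h => hU; exists U; split => //; apply: ltW.
  by rewrite EFinD -mu_fine.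
pose V : set X := U `&` B x0 R0.
have oV : open V by apply: openI => //; exact: (open_ball hs).
have mV : measurable (V : set (borel X)) by exact: meas_open.
have VB : V `<=` B x0 R0 by move=> x [].
have DV : D `<=` V by move=> x Dx; split; [exact: DU|exact: DB].
have fV := fin_sub hs mV R00 VB.
have aV : alpha * mr V <= 2 * W.
  have : mr V <= mr D + W / alpha.
    rewrite -lee_fin -mu_fine//; apply: le_trans mUD.
    by apply: mu_le => //; [exact: meas_open|move=> x []].
  rewrite -(ler_pM2l a0) => /le_trans; apply.
  have -> : alpha * (mr D + W / alpha) = alpha * mr D + W by field; rewrite gt_eqF.
  by lra.
(* The added term gives every ball inside [V] average at least [alpha], so each point of [V] has a
   stopping scale. The total mass becomes at most [3 W]. *)
pose nw x := w x + alpha * \1_V x.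
have inw : intg nw by apply: intgD => //; apply: intgZ; exact: intg_indic.
have Inw : I nw <= 3 * W.
  rewrite ID//; last by apply: intgZ; exact: intg_indic.
  rewrite IZ; last exact: intg_indic.
  by rewrite I_indic//; move: aV; lra.
have nw0 x : 0 <= nw x by rewrite addr_ge0// mulr_ge0// ltW.
pose nu (A : set X) := I (fun x => nw x * \1_A x).
have nule A A' : measurable (A : set (borel X)) -> measurable (A' : set (borel X)) ->
    A `<=` A' -> nu A <= nu A'.
  move=> mA mA' AA'; apply: I_le => [||x]; [exact: intgM_indic|exact: intgM_indic|].
  rewrite ler_wpM2l//; have [[/AA' Ax ->]|[_ ->]] := @indicP _ R A x => //.
  by rewrite indicE mem_set.
have nuW A : measurable (A : set (borel X)) -> nu A <= 3 * W.
  move=> mA; apply: le_trans Inw; apply: I_le => [|//|x]; first exact: intgM_indic.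
  by rewrite ler_piMr//; apply: le_trans (ler_norm _) _; exact: norm_indic.
pose R1 := c ^+ 2 * R0.
have R10 : 0 < R1 by exact: (cr_gt0 hs).
(* From scale [R1] on the averages are below [alpha]; the strict inequality is due to [eta > 1]. *)
have bigbad x r : V x -> R1 <= r -> nu (B x r) < alpha * m x r.
  move=> Vx Rr; have r0 : 0 < r by exact: lt_le_trans Rr.
  apply: le_lt_trans (nuW _ (meas_ball hs _ r0)) _; apply: le_lt_trans hW _.
  rewrite ltr_pM2l//.
  have cR : 0 < c * R0 by rewrite mulr_gt0.
  have h1 : m x0 R0 <= m x (c * R0).
    apply: (mr_sub hs) => //; first exact: (meas_ball hs).
    by apply: (engulf hs (y := x)) => //; [exact: (ball_center hs)|exact: VB].
  have h2 : m x (c * R0) < m x (c ^+ 1 * (c * R0)).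
    apply: lt_le_trans (m_grow hs 1 x cR).
    by rewrite expr1 ltr_pMl ?(m_gt0 hs)//; exact: hs_eta hs.
  have h3 : m x (c ^+ 1 * (c * R0)) <= m x r.
    apply: (mr_sub hs) => //; first by apply: (meas_ball hs); rewrite expr1 mulr_gt0.
    by apply: ball_mono; rewrite expr1 mulrA -expr2.
  lra.
pose good x j := alpha * m x (R1 / c ^+ j) <= nu (B x (R1 / c ^+ j)).
have rho0 j : 0 < R1 / c ^+ j by rewrite divr_gt0// exprn_gt0.
have exgood x : V x -> exists j, good x j.
  move=> Vx; have [r r0 rV] := ht_nbhs hX (open_nbhs_nbhs (conj oV Vx)).
  have [n hn] := expr_unbounded (R1 / r) c1.
  exists n; rewrite /good.
  have BV : B x (R1 / c ^+ n) `<=` V.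
    apply: subset_trans rV; apply: ball_mono.
    by rewrite ler_pdivrMr ?exprn_gt0// mulrC -ler_pdivrMr// ltW.
  rewrite /nu -I_indic; last exact: (meas_ball hs).
  have iB : intg (\1_(B x (R1 / c ^+ n))).
    by apply: intg_indic; [exact: (meas_ball hs)|exact: (fin_ball hs)].
  rewrite -IZ//.
  apply: I_le => [||y]; [exact: intgZ|by apply: intgM_indic => //; exact: (meas_ball hs)|].
  have [[By ->]|[_ ->]] := @indicP _ R (B x (R1 / c ^+ n)) y; rewrite ?mulr0 ?mulr1//.
  by rewrite /nw indicE (mem_set (BV _ By))/= mulr1 lerDr.
(* The first scale of average at least [alpha] is not the top one. The ball one factor [c] larger
   therefore still has average below [alpha], and it is this larger ball that is used. *)
have exj x : exists j, V x -> good x j /\ nu (B x (c * (R1 / c ^+ j))) < alpha * m x (c * (R1 / c ^+ j))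
    /\ c * (R1 / c ^+ j) <= R1.
  have [Vx|nV] := pselect (V x); last by exists 0%N.
  case: (ex_minnP (exgood x Vx)) => j gj minj; exists j => _; split => //.
  case: j gj minj => [g0 _|j gj minj].
    by move: g0; rewrite /good expr0 divr1 leNgt (bigbad _ _ Vx (lexx _)).
  have -> : c * (R1 / c ^+ j.+1) = R1 / c ^+ j.
    by rewrite exprS; field; rewrite expf_neq0 ?gt_eqF.
  split; last by rewrite ler_pdivrMr ?exprn_gt0// ler_peMr ?(ltW R10)// exprn_ege1 ?ltW.
  by rewrite ltNge; apply/negP => /minj; rewrite ltnn.
have {exj}/choice[j hj] := exj.
pose rho x := R1 / c ^+ j x.
have rho_gt0 x : 0 < rho x by exact: rho0.
have crho x : 0 < c * rho x by rewrite mulr_gt0.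
have [J [JV tJ coverJ]] := vitali_family hs V j R10.
have PB x : V x -> B x (c * rho x) `<=` B x0 (c ^+ 3 * R0).
  move=> Vx; have [_ [_ h]] := hj x Vx.
  have -> : c ^+ 3 * R0 = c * R1 by rewrite mulrA -exprS.
  apply: (engulf hs (y := x)) => //; last exact: (ball_center hs).
  by apply: (ball_mono _ (VB _ Vx)); exact: (cr_ge hs).
have rP x : B x (rho x) `<=` B x (c * rho x).
  by apply: ball_mono; rewrite ler_peMl ?ltW.
have R30 : 0 < c ^+ 3 * R0 by exact: (cr_gt0 hs).
have /countable_injP[f finj] : countable J.
  apply: (@countable_disjoint _ (borel X) R mu X J (fun x => B x (rho x)) (B x0 (c ^+ 3 * R0))) => //.
  - by move=> x _; exact: (meas_ball hs).
  - by move=> x _; case/andP: (ht_measure hX x (rho_gt0 x)).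
  - by move=> x Jx; apply: subset_trans (rP x) (PB x (JV _ Jx)).
  - exact: (meas_ball hs).
  - exact: (fin_ball hs).
(* Indices outside the image of [f] get the default center [point]; [act i] marks the genuine
   ones. *)
pose x_ i := xget point [set x | J x /\ f x = i].
pose act i := J (x_ i) /\ f (x_ i) = i.
have actx x : J x -> x_ (f x) = x.
  move=> Jx; have [h1 h2] : J (x_ (f x)) /\ f (x_ (f x)) = f x.
    by rewrite /x_; case: xgetP => [y _ []//|/(_ x)] /=; case.
  by apply: finj => //; exact: mem_set.
have actf x : J x -> act (f x) by move=> Jx; split; rewrite actx.
pose cb i : set X := [set y | act i /\ B (x_ i) (rho (x_ i)) y].
pose pb i : set X := [set y | act i /\ B (x_ i) (c * rho (x_ i)) y].
have cbE i : act i -> cb i = B (x_ i) (rho (x_ i)).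
  by move=> ai; apply/seteqP; split => [y []//|y ?]; split.
have pbE i : act i -> pb i = B (x_ i) (c * rho (x_ i)).
  by move=> ai; apply/seteqP; split => [y []//|y ?]; split.
have cb0 i : ~ act i -> cb i = set0 by move=> ai; apply/seteqP; split => // y [].
have pb0 i : ~ act i -> pb i = set0 by move=> ai; apply/seteqP; split => // y [].
have mcb i : measurable (cb i : set (borel X)).
  have [ai|ai] := pselect (act i); last by rewrite cb0.
  by rewrite cbE//; exact: (meas_ball hs).
have mpb i : measurable (pb i : set (borel X)).
  have [ai|ai] := pselect (act i); last by rewrite pb0.
  by rewrite pbE//; exact: (meas_ball hs).
have cpb i : cb i `<=` pb i by move=> y [ai /rP h]; split.
have tcb : trivIset [set: nat] cb.
  move=> i k _ _ [y [[[Ji fi] h1] [[Jk fk] h2]]].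
  have e : x_ i = x_ k by apply: tJ => //; exists y.
  by rewrite -fi -fk e.
(* Every core ball is kept whole, and the rest of a dilate goes to the first index that reaches it.
   The sets are disjoint, cover [V], and [E i] lies between [cb i] and [pb i]. *)
pose E i : set X := cb i `|` (pb i `\` (\bigcup_l cb l `|` \bigcup_(l < i) pb l)).
have mE i : measurable (E i : set (borel X)).
  apply: (@measurableU _ (borel X)) => //; apply: (@measurableD _ (borel X)) => //.
  apply: (@measurableU _ (borel X)); first exact: (@bigcup_measurable _ (borel X)).
  exact: (@bigcup_measurable _ (borel X)).
have Epb i : E i `<=` pb i by move=> y [/cpb//|[]].
have tE : trivIset [set: nat] E.
  have key i k y : (i < k)%N -> E i y -> E k y -> False.
    move=> ik [ci|[pi ni]] [ck|[pk nk]].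
    - have e : i = k by apply: tcb => //; exists y.
      by move: ik; rewrite e ltnn.
    - by apply: nk; left; exists i.
    - by apply: ni; left; exists k.
    - by apply: nk; right; exists i.
  move=> i k _ _ [y [Ei Ek]].
  by case: (ltngtP i k) => // ik; [case: (key _ _ _ ik Ei Ek)|case: (key _ _ _ ik Ek Ei)].
have cover x : V x -> exists i, E i x.
  move=> Vx; have [z Jz hz] := coverJ x Vx.
  have pfz : pb (f z) x.
    split; first exact: actf.
    by rewrite actx//; apply: hz; exact: (ball_center hs).
  have [[l _ cl]|nc] := pselect ((\bigcup_l cb l) x); first by exists l; left.
  have ex : exists i, `[< pb i x >] by exists (f z); apply/asboolP.
  case: (ex_minnP ex) => i /asboolP pi mini; exists i; right; split => // -[//|[l /= li pl]].
  have := mini l (asboolT pl); rewrite leqNgt => /negP; exact.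
have Epb3 i : pb i `<=` B x0 (c ^+ 3 * R0) by move=> y [[Ji _] h]; apply: (PB _ (JV _ Ji)).
have fat i : act i -> m (x_ i) (c * rho (x_ i)) <= K * mr (cb i).
  by move=> ai; rewrite cbE//; have := m_dbl hs 1 (x_ i) (rho_gt0 (x_ i)); rewrite !expr1.
have cE i : mr (cb i) <= mr (E i).
  apply: le_mr => //; first by move=> y ?; left.
  apply: (fin_sub hs (mE i) R30); exact: subset_trans (Epb i) (@Epb3 i).
exists x_, (fun i => c * rho (x_ i)), E; split => //.
- by move=> i y /Epb[].
- move=> i; have [ai|ai] := pselect (act i); last first.
    by left; rewrite -subset0 -(pb0 _ ai); exact: Epb.
  right; apply: le_trans (fat i ai) _; rewrite ler_pM2l//; exact: cE.
- by move=> i; exact: subset_trans (Epb i) (@Epb3 i).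
- move=> i; have [ai|ai] := pselect (act i); last first.
    have -> : E i = set0 by rewrite -subset0 -(pb0 _ ai); exact: Epb.
    rewrite measure0/= mulr0 -(I0 mu) le_eqVlt; apply/orP; left; apply/eqP.
    by apply: eq_I => x; rewrite indic0 mulr0.
  have [Ji _] := ai; have [_ [h _]] := hj _ (JV _ Ji).
  have le1 : I (fun x => w x * \1_(E i) x) <= nu (B (x_ i) (c * rho (x_ i))).
    apply: I_le => [||x]; first exact: intgM_indic.
      by apply: intgM_indic => //; exact: (meas_ball hs).
    apply: ler_pM => //; first by rewrite /nw lerDl mulr_ge0// ltW.
    have [[/Epb [_ Bx] ->]|[_ ->]] := @indicP _ R (E i) x => //.
    by rewrite indicE mem_set.
  apply: (le_trans le1); apply: (le_trans (ltW h)); rewrite -mulrA ler_pM2l//.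
  by apply: le_trans (fat i ai) _; rewrite ler_pM2l.
- move=> n.
  have s1 : \sum_(i < n) nu (cb i) <= 3 * W.
    rewrite -I_sum; last by move=> i _; exact: intgM_indic.
    apply: le_trans Inw; apply: I_le => [||x] //.
      by apply: intg_sum => i _; exact: intgM_indic.
    rewrite -mulr_sumr ler_piMr//.
    rewrite (eq_bigr (fun i : 'I_n => \1_(cb i) x : R))//.
    have [[i ci]|nci] := pselect (exists i : 'I_n, cb i x).
      rewrite (bigD1 i)//= big1 ?addr0.
        by apply: le_trans (ler_norm _) _; exact: norm_indic.
      move=> k ki; have [[ck _]|[_ //]] := @indicP _ R (cb k) x.
      by move/eqP: ki; case; apply/val_inj/tcb => //; exists x.
    rewrite big1// => i _; have [[ci _]|[_ //]] := @indicP _ R (cb i) x.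
    by case: nci; exists i.
  have s2 (i : 'I_n) : mr (E i) <= K / alpha * nu (cb i).
    have [ai|ai] := pselect (act i); last first.
      have -> : E i = set0 by rewrite -subset0 -(pb0 _ ai); exact: Epb.
      rewrite measure0/= mulr_ge0//; first by rewrite divr_ge0// ltW.
      by apply: I_ge0 => x; rewrite mulr_ge0.
    have [Ji _] := ai; have [h _] := hj _ (JV _ Ji).
    have : mr (E i) <= K * mr (cb i).
      apply: le_trans (fat i ai); rewrite -pbE//.
      apply: le_mr => //; exact: (fin_sub hs (mpb i) R30 (@Epb3 i)).
    move=> /le_trans; apply; rewrite -mulrA ler_pM2l// mulrC ler_pdivlMr// mulrC.
    by rewrite cbE.
  apply: le_trans (ler_sum _ (fun i _ => s2 i)) _; rewrite -mulr_sumr.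
  have -> : 3 * K * W / alpha = K / alpha * (3 * W) by field; rewrite gt_eqF.
  by rewrite ler_pM2l// divr_gt0.
- move=> x hx; rewrite leNgt; apply/negP => Dx.
  by have [i Ei] := cover x (DV _ Dx); exact: (hx i).
Qed.

End cz.

(** * Convergent series in [L^1] *)

Section L1_series.
Context d (T : measurableType d) (R : realType).
Variable mu : {measure set T -> \bar R}.
Local Notation intg := (intg mu).
Local Notation I := (I mu).

Lemma acost_norm P u C : atomic_family mu P -> acost mu P u C ->
  I (fun x => `|u x|) <= C.
Proof.
move=> [_ _ hP] [iu [lam [a [Pa lam0 hC cu]]]].
apply/ler_addgt0Pr => e e0.
move/cvgrPdist_le : cu => /(_ _ e0) [N _ /(_ N (leqnn _))].
have ila j : intg (fun x => lam j * a j x) by apply: intgZ; case: (hP _ (Pa j)).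
have iS : intg (fun x => \sum_(j < N) lam j * a j x) by apply: intg_sum.
rewrite sub0r normrN ger0_norm; last exact: I_ge0.
move=> le; have : I (fun x => `|u x|) <= I (fun x => `|u x - \sum_(j < N) lam j * a j x|
    + \sum_(j < N) lam j * `|a j x|).
  have iR : intg (fun x => \sum_(j < N) lam j * `|a j x|).
    by apply: intg_sum => j _; apply: intgZ; apply: intg_norm; case: (hP _ (Pa j)).
  apply: I_le => [||x]; first exact: intg_norm.
    by apply: intgD => //; apply: intg_norm; exact: intgB.
  rewrite -{1}(subrK (\sum_(j < N) lam j * a j x) (u x)).
  apply: le_trans (ler_normD _ _) _; rewrite lerD2l.
  apply: le_trans (ler_norm_sum _ _ _) _; apply: ler_sum => j _.
  by rewrite normrM (ger0_norm (lam0 j)).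
move=> /le_trans; apply; rewrite ID; last 2 first.
- by apply: intg_norm; exact: intgB.
- by apply: intg_sum => j _; apply: intgZ; apply: intg_norm; case: (hP _ (Pa j)).
rewrite addrC lerD//; apply: le_trans (hC N).
rewrite I_sum; last by move=> j _; apply: intgZ; apply: intg_norm; case: (hP _ (Pa j)).
apply: ler_sum => j _; have [ia Ia] := hP _ (Pa j).
by rewrite IZ ?ler_piMr//; exact: intg_norm.
Qed.

(** By monotone convergence the extended sum is integrable, hence finite almost everywhere; [fine]
    of it is a real representative. *)
Let pos_series (v : nat -> T -> R) C : (forall j, intg (v j)) ->
  (forall j x, 0 <= v j x) -> (forall n, \sum_(j < n) I (v j) <= C) ->
  exists g, intg g /\ {ae mu, forall x, \sum_(j < n) v j x @[n --> \oo] --> g x}.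
Proof.
move=> iv v0 hC.
have mv j : measurable_fun [set: T] (EFin \o v j) by apply/measurable_EFinP/intg_meas.
pose S x := (\sum_(j <oo) (v j x)%:E)%E.
have mS : measurable_fun [set: T] S.
  apply: (ge0_emeasurable_sum (P := xpredT)) => [j x _ _|j _]; last exact: mv.
  by rewrite /= lee_fin.
have S0 x : (0 <= S x)%E by apply: nneseries_ge0 => j _ _; rewrite lee_fin.
have iS : (\int[mu]_x S x <= C%:E)%E.
  rewrite integral_nneseries//; last by move=> j x _; rewrite /= lee_fin.
  apply: lime_le.
    by apply: is_cvg_nneseries => j _ _; apply: integral_ge0 => x _; rewrite /= lee_fin.
  apply: nearW => n; rewrite big_mkord.
  rewrite (eq_bigr (fun j : 'I_n => (I (v j))%:E)); last first.
    move=> j _; rewrite /I /Rintegral fineK//; exact: (integrable_fin_num measurableT (iv j)).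
  by rewrite sumEFin lee_fin; exact: hC.
have intS : mu.-integrable setT S.
  apply/integrableP; split => //.
  rewrite (eq_integral S); first by apply: le_lt_trans iS _; exact: ltry.
  by move=> x _; rewrite gee0_abs.
exists (fine \o S).
have aeS := integrable_ae measurableT intS.
split.
  apply: le_integrable intS => //; first by apply/measurable_EFinP; exact: measurableT_comp.
  move=> x _ /=; have := S0 x; case: (S x) => //= _.
  by rewrite normr0 leey.
apply: filterS aeS => x /(_ Logic.I) fSx.
have : (fun n => (\sum_(0 <= j < n) (v j x)%:E)%E) @ \oo --> S x.
  by apply: is_cvg_nneseries => j _ _; rewrite lee_fin.
rewrite -{1}(fineK fSx) => /fine_cvg; apply: cvg_trans; apply: near_eq_cvg.
by apply: nearW => n; rewrite /= big_mkord sumEFin.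
Qed.

(** Completeness of [L^1], with the sum of the absolute values as dominating function. *)
Lemma L1_series (v : nat -> T -> R) C : (forall j, intg (v j)) ->
  (forall n, \sum_(j < n) I (fun x => `|v j x|) <= C) ->
  exists g, intg g /\ I (fun x => `|g x - \sum_(j < n) v j x|) @[n --> \oo] --> 0.
Proof.
move=> iv hC.
have [G [iG cG]] := pos_series (fun j => intg_norm (iv j)) (fun j x => normr_ge0 (v j x)) hC.
(* Positive parts: as [v = 2 vp - |v|], two nonnegative series suffice. *)
pose vp j x := (`|v j x| + v j x) / 2.
have ivp j : intg (vp j).
  by apply: eq_intg (intgZ 2^-1 (intgD (intg_norm (iv j)) (iv j))) => x; rewrite /vp mulrC.
have [g1 [ig1 cg1]] : exists g, intg g /\ {ae mu, forall x, \sum_(j < n) vp j x @[n --> \oo] --> g x}.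
  apply: (@pos_series _ C) => //.
    move=> j x; rewrite /vp divr_ge0//; have := ler_norm (- v j x).
    by rewrite normrN; lra.
  move=> n; apply: le_trans (hC n); apply: ler_sum => j _.
  apply: I_le => [||x] //; first exact: intg_norm.
  by rewrite /vp; have := ler_norm (v j x); lra.
exists (fun x => 2 * g1 x - G x).
have ig : intg (fun x => 2 * g1 x - G x) by apply: intgB => //; exact: intgZ.
split => //.
have is_ n : intg (fun x => \sum_(j < n) v j x) by apply: intg_sum.
have cg : {ae mu, forall x, \sum_(j < n) v j x @[n --> \oo] --> 2 * g1 x - G x}.
  apply: filterS2 cg1 cG => x h1 h2.
  rewrite (_ : (fun n => _) = (fun n => 2 * (\sum_(j < n) vp j x) - \sum_(j < n) `|v j x|)).
    by apply: cvgB => //; exact: cvgMl_tmp.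
  apply/funext => n; rewrite mulr_sumr -sumrB; apply: eq_bigr => j _.
  by rewrite /vp; field.
have dom : {ae mu, forall x n, `|\sum_(j < n) v j x| <= G x}.
  apply: filterS cG => x h n; apply: le_trans (ler_norm_sum _ _ _) _.
  rewrite -(cvg_lim (@Rhausdorff R) h); apply: nondecreasing_cvgn_le.
    by apply/nondecreasing_seqP => k; rewrite big_ord_recr/= lerDl.
  by apply/cvg_ex; exists (G x).
have [_ h _] := I_dct (fun n => intg_meas (is_ n)) (intg_meas ig) cg dom iG.
by move: h; under eq_fun do under eq_I do rewrite distrC.
Qed.

End L1_series.

(** * Good and bad parts of a function along a disjoint family *)

Section cz_pieces.
Context d (T : measurableType d) (R : realType).
Variable mu : {measure set T -> \bar R}.
Local Notation intg := (intg mu).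
Local Notation I := (I mu).
Local Notation mr A := (fine (mu A)).
Variables (E : nat -> set T) (g : T -> R).
Hypothesis mE : forall i, measurable (E i).
Hypothesis tE : trivIset [set: nat] E.
Hypothesis fE : forall i, (mu (E i) < +oo)%E.
Hypothesis ig : intg g.

Definition czmean i : R := I (fun x => g x * \1_(E i) x) / mr (E i).
Definition czbad i x : R := (g x - czmean i) * \1_(E i) x.
(** [xget] returns some index of a piece containing [x]; disjointness makes it the only one, which
    is the content of [czgoodE]. *)
Definition czgood x : R :=
  if `[< exists i, E i x >] then czmean (xget 0%N [set i | E i x]) else g x.

Lemma czgoodE i x : E i x -> czgood x = czmean i.
Proof.
move=> Ei; rewrite /czgood asboolT; last by exists i.
congr czmean; case: xgetP => [k _ Ek|/(_ i)//].
by apply: tE => //; exists x.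
Qed.

Lemma czgood_out x : (forall i, ~ E i x) -> czgood x = g x.
Proof. by move=> h; rewrite /czgood asboolF// => -[i /h]. Qed.

(** At a point at most one bad piece is nonzero, so a partial sum is either complete or 0. Pointwise
    convergence and domination by [g - czgood] both follow. *)
Lemma sum_czbad n x :
  (\sum_(i < n) czbad i x = g x - czgood x /\ exists2 i : 'I_n, E i x & True) \/
  (\sum_(i < n) czbad i x = 0 /\ forall i : 'I_n, ~ E i x).
Proof.
have [[i Ei]|nE] := pselect (exists i : 'I_n, E i x).
  left; split; last by exists i.
  rewrite (bigD1 i)//= big1 ?addr0.
    by rewrite /czbad indicE (mem_set Ei)/= mulr1 (czgoodE Ei).
  move=> k ki; rewrite /czbad; have [[Ek _]|[_ ->]] := @indicP _ R (E k) x; last by rewrite mulr0.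
  by move/eqP: ki; case; apply/val_inj/tE => //; exists x.
right; split; last by move=> i Ei; apply: nE; exists i.
apply: big1 => i _; rewrite /czbad; have [[Ei _]|[_ ->]] := @indicP _ R (E i) x; last by rewrite mulr0.
by case: nE; exists i.
Qed.

Lemma norm_sum_czbad n x : `|\sum_(i < n) czbad i x| <= `|g x - czgood x|.
Proof.
by have [[-> _]//|[-> _]] := sum_czbad n x; rewrite normr0.
Qed.

Lemma sum_czbad_cvg x : \sum_(i < n) czbad i x @[n --> \oo] --> g x - czgood x.
Proof.
have [[k Ek]|nE] := pselect (exists i, E i x).
  apply/cvgrPdist_le => e e0; exists k.+1 => // n /= kn.
  have [[-> _]|[_ /(_ (Ordinal kn))//]] := sum_czbad n x.
  by rewrite subrr normr0 ltW.
rewrite czgood_out ?subrr; last by move=> i Ei; apply: nE; exists i.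
rewrite (_ : (fun n => _) = fun=> 0); first exact: cvg_cst.
apply/funext => n; have [[_ [i Ei _]]|[-> //]] := sum_czbad n x.
by case: nE; exists i.
Qed.

Lemma meas_czbad i : measurable_fun [set: T] (czbad i).
Proof.
apply: measurable_funM; last exact: meas_indic.
by apply: measurable_funB => //; exact: intg_meas ig.
Qed.

Lemma meas_sum_czbad n : measurable_fun [set: T] (fun x => \sum_(i < n) czbad i x).
Proof. by apply: measurable_sum => i; exact: meas_czbad. Qed.

Lemma meas_czgood : measurable_fun [set: T] czgood.
Proof.
rewrite (_ : czgood = fun x => g x - (g x - czgood x)); last first.
  by apply/funext => x; rewrite opprB addrC subrK.
apply: measurable_funB; first exact: intg_meas ig.
apply: (measurable_fun_cvg (h := fun n x => \sum_(i < n) czbad i x)) => [n|x _].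
  exact: meas_sum_czbad.
exact: sum_czbad_cvg.
Qed.

Lemma intg_czbad i : intg (czbad i).
Proof.
apply: eq_intg (intgB (intgM_indic ig (mE i)) (intgZ (czmean i) (intg_indic (mE i) (fE i)))).
by move=> x; rewrite /czbad mulrBl.
Qed.

(** Null pieces are included: division by 0 makes their mean 0, and the integral over them is 0 as
    well. *)
Lemma czmeanE i : I (fun x => g x * \1_(E i) x) = czmean i * mr (E i).
Proof.
rewrite /czmean; have [m0|m0] := eqVneq (mr (E i)) 0; last by rewrite divfK.
rewrite m0 mulr0; apply/eqP; rewrite -normr_le0.
apply: le_trans (I_abs (intgM_indic ig (mE i))) _.
have muE0 : mu (E i) = 0%E by rewrite (mu_fine (fE i)) m0.
have [_ ->] : intg (fun x => `|g x * \1_(E i) x|) /\ I (fun x => `|g x * \1_(E i) x|) = I (fun=> 0).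
  apply: I_eq_ae; first exact: intg0.
    by apply: (intg_meas (mu := mu)); apply: intg_norm; exact: intgM_indic.
  exists (E i); split => // x /= h.
  have [[//]|[_ e]] := @indicP _ R (E i) x.
  by exfalso; apply: h; rewrite e mulr0 normr0.
by rewrite I0.
Qed.

Lemma I_czbad i : I (czbad i) = 0.
Proof.
rewrite (eq_I mu (g := fun x => g x * \1_(E i) x - czmean i * \1_(E i) x)); last first.
  by move=> x; rewrite /czbad mulrBl.
rewrite IB; [|exact: intgM_indic|by apply: intgZ; exact: intg_indic].
by rewrite IZ ?I_indic ?czmeanE ?subrr//; exact: intg_indic.
Qed.

Lemma I_czbad_cvg : intg (fun x => g x - czgood x) ->
  I (fun x => `|g x - czgood x - \sum_(i < n) czbad i x|) @[n --> \oo] --> 0 /\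
  I (fun x => g x - czgood x) = 0.
Proof.
move=> ib.
have [_ h1 h2] := I_dct meas_sum_czbad (intg_meas ib) (aeW mu sum_czbad_cvg)
  (aeW mu (fun x n => norm_sum_czbad n x)) (intg_norm ib).
split.
  by move: h1; under eq_fun do under eq_I do rewrite distrC.
have : I (fun x => \sum_(i < n) czbad i x) @[n --> \oo] --> 0.
  rewrite (_ : (fun n => _) = fun=> 0); first exact: cvg_cst.
  apply/funext => n; rewrite I_sum; last by move=> i _; exact: intg_czbad.
  by apply: big1 => i _; exact: I_czbad.
by move=> h3; apply: (cvg_unique _ h2 h3).
Qed.

(** Jensen's inequality, obtained by expanding the integral of [(g - czmean i)^2] over the piece. *)
Lemma sqi_czmean i : sqi mu g ->
  czmean i ^+ 2 * mr (E i) <= I (fun x => g x ^+ 2 * \1_(E i) x).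
Proof.
move=> [mg sg].
have i2 : intg (fun x => g x ^+ 2 * \1_(E i) x) by exact: intgM_indic.
have i1 := intgM_indic ig (mE i).
have : 0 <= I (fun x => (g x - czmean i) ^+ 2 * \1_(E i) x).
  by apply: I_ge0 => x; rewrite mulr_ge0// sqr_ge0.
rewrite (eq_I mu (g := fun x => g x ^+ 2 * \1_(E i) x - (2 * czmean i * (g x * \1_(E i) x)
    - czmean i ^+ 2 * \1_(E i) x))); last first.
  by move=> x; ring.
have iI := intg_indic (mE i) (fE i).
rewrite IB//; last by apply: intgB; exact: intgZ.
rewrite IB; [|exact: intgZ|exact: intgZ].
rewrite !IZ// I_indic// czmeanE; nra.
Qed.

(** The same expansion: a variance is at most the second moment. *)
Lemma sqi_czbad i : sqi mu g -> sqi mu (czbad i) /\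
  I (fun x => czbad i x ^+ 2) <= I (fun x => g x ^+ 2 * \1_(E i) x).
Proof.
move=> sgi; have [mg sg] := sgi.
have i2 : intg (fun x => g x ^+ 2 * \1_(E i) x) by exact: intgM_indic.
have i1 := intgM_indic ig (mE i).
have iI := intg_indic (mE i) (fE i).
have iB : intg (fun x => 2 * czmean i * (g x * \1_(E i) x) - czmean i ^+ 2 * \1_(E i) x).
  by apply: intgB; exact: intgZ.
have E2 x : g x ^+ 2 * \1_(E i) x - (2 * czmean i * (g x * \1_(E i) x)
    - czmean i ^+ 2 * \1_(E i) x) = czbad i x ^+ 2.
  by rewrite /czbad; have [[_ ->]|[_ ->]] := @indicP _ R (E i) x; ring.
split.
  split; first exact: meas_czbad.
  by apply: eq_intg E2 _; exact: intgB.
rewrite -(eq_I mu E2) IB// lerBlDr lerDl IB; [|exact: intgZ|exact: intgZ].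
rewrite !IZ// I_indic// czmeanE; have := mr_ge0 mu (E i).
by have := sqr_ge0 (czmean i); nra.
Qed.

End cz_pieces.

(** * Atoms of the space *)

Section atoms.
Context (R : realType) (X : ptopologicalType).
Variables (mu : {measure set (borel X) -> \bar R}) (d : X -> X -> R).
Variables (c K eta : R).
Hypothesis hs : growing_space mu d c K eta.
Local Notation B := (qball d).
Local Notation mr A := (fine (mu A)).
Local Notation m x r := (mr (B x r)).
Local Notation intg := (intg mu).
Local Notation sqi := (sqi mu).
Local Notation I := (I mu).
Implicit Types (f a : X -> R) (x : X).

Definition ball_fun f x (r : R) : Prop :=
  [/\ measurable_fun [set: borel X] f, 0 < r & forall y, ~ B x r y -> f y = 0].

(** Real atoms, with the bound everywhere and with vanishing off the ball in place of a condition on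
    the closed support; [complex_atom] turns them into [atom]. *)
Definition latom a : Prop := exists x r, [/\ ball_fun a x r,
  forall y, `|a y| <= (m x r)^-1 & I a = 0].

(** Atoms normalized in mean square, needed because the local part of the form is only known to be
    square integrable. By [acost_l2] they cost at most a constant more than bounded atoms. *)
Definition l2atom a : Prop := exists x r, [/\ ball_fun a x r, sqi a,
  I (fun y => a y ^+ 2) <= (m x r)^-1 & I a = 0].

Lemma ball_fun_indic f x r : ball_fun f x r -> forall y, f y = f y * \1_(B x r) y.
Proof.
move=> [_ _ f0] y; have [[_ ->]|[h ->]] := @indicP _ R (B x r) y.
  by rewrite mulr1.
by rewrite mulr0 f0.
Qed.

Lemma intg_ball x r : 0 < r -> intg (\1_(B x r)).
Proof. by move=> r0; apply: intg_indic; [exact: (meas_ball hs)|exact: (fin_ball hs)]. Qed.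

Lemma I_ball x r : 0 < r -> I (\1_(B x r)) = m x r.
Proof. by move=> r0; apply: I_indic; exact: (meas_ball hs). Qed.

Lemma ball_fun_intg f x r H : ball_fun f x r -> (forall y, `|f y| <= H) ->
  intg f /\ I (fun y => `|f y|) <= H * m x r.
Proof.
move=> bf hH; have [mf r0 f0] := bf.
have le y : `|f y| <= H * \1_(B x r) y.
  rewrite {1}(ball_fun_indic bf) normrM; have [[_ ->]|[_ ->]] := @indicP _ R (B x r) y.
    by rewrite normr1 !mulr1.
  by rewrite normr0 !mulr0.
have iH : intg (fun y => H * \1_(B x r) y) by apply: intgZ; exact: intg_ball.
have iff := intg_le mf le iH.
split => //; rewrite -I_ball// -IZ; last exact: intg_ball.
by apply: I_le => //; exact: intg_norm.
Qed.

Lemma sqi_ball x r : 0 < r -> sqi (\1_(B x r)).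
Proof.
move=> r0; split; first by apply: meas_indic; exact: (meas_ball hs).
apply: eq_intg (intg_ball x r0) => y.
by have [[_ ->]|[_ ->]] := @indicP _ R (B x r) y; rewrite ?expr1n ?expr0n.
Qed.

Lemma ball_fun_sqi f x r : ball_fun f x r -> sqi f ->
  intg f /\ I (fun y => `|f y|) <= Num.sqrt (I (fun y => f y ^+ 2) * m x r).
Proof.
move=> bf sf; have [mf r0 f0] := bf; have sB := sqi_ball x r0.
split; first by apply: eq_intg (sqi_mul sf sB) => y; rewrite -ball_fun_indic.
rewrite sqrtrM; last by apply: I_ge0 => y; exact: sqr_ge0.
have := I_CS sf sB.
rewrite (eq_I mu (g := fun y => `|f y|)); last by move=> y; rewrite -ball_fun_indic.
rewrite (eq_I mu (f := fun y => \1_(B x r) y ^+ 2) (g := \1_(B x r))) ?I_ball//.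
by move=> y; have [[_ ->]|[_ ->]] := @indicP _ R (B x r) y; rewrite ?expr1n ?expr0n.
Qed.

Lemma ball_funZ k f x r : ball_fun f x r -> ball_fun (fun y => k * f y) x r.
Proof.
move=> [mf r0 f0]; split => //; first exact: measurable_funM.
by move=> y /f0 ->; rewrite mulr0.
Qed.

Lemma latom_family : atomic_family mu latom.
Proof.
split.
- exists point, 1; split => //.
  + by move=> y; rewrite normr0 invr_ge0; exact: mr_ge0.
  + by rewrite I0.
- move=> k a k1 [x [r [bf ha Ia]]]; exists x, r; split.
  + exact: ball_funZ.
  + by move=> y; rewrite normrM; apply: le_trans (ha y); rewrite ler_piMl.
  + by rewrite IZ ?Ia ?mulr0//; have [] := ball_fun_intg bf ha.
- move=> a [x [r [bf ha Ia]]]; have [ia le] := ball_fun_intg bf ha; split => //.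
  have [_ r0 _] := bf.
  by move: le; rewrite mulVf// gt_eqF// (m_gt0 hs).
Qed.

Lemma l2atom_family : atomic_family mu l2atom.
Proof.
split.
- exists point, 1; split => //.
  + exact: sqi0.
  + rewrite (eq_I mu (g := fun=> 0)); last by move=> y; rewrite expr0n.
    by rewrite I0 invr_ge0; exact: mr_ge0.
  + by rewrite I0.
- move=> k a k1 [x [r [bf sa ha Ia]]]; exists x, r; split.
  + exact: ball_funZ.
  + exact: sqiZ.
  + apply: le_trans ha; rewrite (eq_I mu (g := fun y => k ^+ 2 * a y ^+ 2)); last by move=> y; rewrite exprMn.
    rewrite IZ; last by case: sa.
    rewrite ler_piMl//; first by apply: I_ge0 => y; exact: sqr_ge0.
    by rewrite -real_normK ?num_real// exprn_ile1.
  + by rewrite IZ ?Ia ?mulr0//; have [] := ball_fun_sqi bf sa.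
- move=> a [x [r [bf sa ha Ia]]]; have [ia le] := ball_fun_sqi bf sa; split => //.
  have [_ r0 _] := bf; apply: (le_trans le); rewrite -[leRHS]sqrtr1 ler_wsqrtr//.
  by rewrite -ler_pdivlMr ?(m_gt0 hs)// mul1r.
Qed.

Lemma acost_latom f x r H L : ball_fun f x r -> (forall y, `|f y| <= H) ->
  I f = 0 -> H * m x r <= L -> acost mu latom f L.
Proof.
move=> bf hH If hL; have [_ r0 _] := bf.
have H0 : 0 <= H by exact: le_trans (normr_ge0 _) (hH point).
have m0 := m_gt0 hs x r0.
apply: acost_le hL; have Hm0 : 0 <= H * m x r by rewrite mulr_ge0// ltW.
have [H00|Hn0] := eqVneq H 0.
  rewrite (_ : f = fun=> 0); first exact: (acost0 latom_family).
  by apply/funext => y; apply/eqP; rewrite -normr_le0 -H00.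
rewrite (_ : f = fun y => (H * m x r) * ((H * m x r)^-1 * f y)); last first.
  by apply/funext => y; rewrite mulrA divff ?mul1r// mulf_neq0// gt_eqF.
apply: acost_atom => //; first exact: latom_family.
exists x, r; split; first exact: ball_funZ.
- move=> y; rewrite normrM normfV (ger0_norm Hm0) mulrC ler_pdivrMr; last first.
    by rewrite mulr_gt0// lt_neqAle eq_sym Hn0.
  by rewrite mulrC -mulrA divff ?mulr1// gt_eqF.
- by rewrite IZ ?If ?mulr0//; have [] := ball_fun_intg bf hH.
Qed.

Lemma acost_l2atom f x r L : ball_fun f x r -> sqi f -> I f = 0 ->
  0 <= L -> I (fun y => f y ^+ 2) * m x r <= L ^+ 2 -> acost mu l2atom f L.
Proof.
move=> bf sf If L0 hL; have [mf r0 _] := bf; have m0 := m_gt0 hs x r0.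
have [i1 le1] := ball_fun_sqi bf sf.
have [L00|Ln0] := eqVneq L 0.
  apply: (acost_eq_ae (acost0 l2atom_family L0)) => //; last exact: l2atom_family.
  suff : {ae mu, forall y, f y = 0} by move=> h; apply: (ae_imp h) => y ->.
  apply: I_eq0_ae => //; apply/eqP; rewrite eq_le I_ge0// andbT.
  apply: le_trans le1 _; rewrite -(sqrtr0 R) ler_wsqrtr//.
  by move: hL; rewrite L00 expr0n.
rewrite (_ : f = fun y => L * (L^-1 * f y)); last first.
  by apply/funext => y; rewrite mulrA divff ?mul1r.
apply: acost_atom => //; first exact: l2atom_family.
exists x, r; split; first exact: ball_funZ.
- exact: sqiZ.
- rewrite (eq_I mu (g := fun y => (L^-1) ^+ 2 * f y ^+ 2)); last by move=> y; rewrite exprMn.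
  rewrite IZ; last by case: sf.
  have L20 : 0 < L ^+ 2 by rewrite exprn_even_gt0.
  rewrite exprVn mulrC ler_pdivrMr// mulrC ler_pdivlMr//.
- by rewrite IZ ?If ?mulr0.
Qed.

(** The covering for [b^2] is used: the good part is bounded, hence a multiple of one bounded atom
    on a dilated ball, and the bad pieces are again multiples of [l2atom], with total cost [1/2]. *)
Lemma l2atom_half b : l2atom b -> exists v,
  acost mu latom v (6 * K ^+ 6) /\ acost mu l2atom (fun x => b x - v x) 2^-1.
Proof.
move=> [x [r [bf sb hb Ib]]]; have [mb r0 b0] := bf.
have m0 := m_gt0 hs x r0; set M := m x r in hb m0.
have K1 := K_gt1 hs; have K0 := K_gt0 hs.
have [ib _] := ball_fun_sqi bf sb.
(* With this height the good part is at most [6 K^3 / M]. The bad pieces have total measure at most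
   [3 K / (M al) = M / (12 K^4)], which times the cost [6 K^4 / M] per unit of measure is [1/2]. *)
pose al := 36 * K ^+ 5 / M ^+ 2.
have al0 : 0 < al by rewrite divr_gt0 ?exprn_gt0// mulr_gt0// exprn_gt0.
have W0 : 0 < M^-1 by rewrite invr_gt0.
have K51 : 1 <= K ^+ 5 by apply: exprn_ege1; exact: ltW.
have [|||||x_ [r_ [E cz]]] := @cz_decomposition R X mu d c K eta hs x r
  (fun y => b y ^+ 2) al (M^-1) r0 al0 W0.
- by case: sb.
- by move=> y; exact: sqr_ge0.
- by move=> y /b0 ->; rewrite expr0n.
- exact: hb.
- rewrite -/M (_ : al * M = 36 * K ^+ 5 / M); last by rewrite /al; field; rewrite gt_eqF.
  by rewrite ler_pM2r//; nra.
case: cz => mE tE rad sub fat bnd avg sm out.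
have R30 : 0 < c ^+ 3 * r by exact: (cr_gt0 hs).
have fE i : (mu (E i) < +oo)%E by exact: (fin_sub hs (mE i) R30 (@bnd i)).
have bd2 : al * K <= (6 * K ^+ 3 / M) ^+ 2.
  rewrite (_ : _ ^+ 2 = 36 * K ^+ 6 / M ^+ 2); last by field; rewrite gt_eqF.
  rewrite (_ : al * K = 36 * K ^+ 6 / M ^+ 2)//; by rewrite /al; field; rewrite gt_eqF.
have h0 : 0 <= 6 * K ^+ 3 / M by rewrite divr_ge0 ?mulr_ge0 ?exprn_ge0 ?ltW.
have gb y : `|czgood mu E b y| <= 6 * K ^+ 3 / M.
  rewrite -ler_sqr ?nnegrE// real_normK ?num_real//.
  have [[i Ei]|nE] := pselect (exists i, E i y).
    rewrite (czgoodE mu b tE Ei); apply: le_trans bd2.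
    have me0 : 0 < mr (E i).
      case: (fat i) => [e|/lt_le_trans-/(_ _ (m_gt0 hs (x_ i) (rad i)))].
        by move: Ei; rewrite e.
      by rewrite pmulr_rgt0.
    have := le_trans (sqi_czmean mE fE ib i sb) (avg i).
    by rewrite ler_pM2r.
  rewrite czgood_out; last by move=> i Ei; apply: nE; exists i.
  apply: le_trans bd2; apply: le_trans (out y _) _.
    by move=> i Ei; apply: nE; exists i.
  by rewrite ler_peMr ?ltW.
have bgood : ball_fun (czgood mu E b) x (c ^+ 3 * r).
  split => //; first exact: meas_czgood mE tE ib.
  move=> y yB; rewrite czgood_out; last by move=> i /bnd.
  by apply: b0 => /(ball_mono (cr_ge hs 3 r0)).
have [igood _] := ball_fun_intg bgood gb.
have ibg := intgB ib igood.
have [cv I0'] := I_czbad_cvg mE tE fE ib ibg.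
exists (czgood mu E b); split.
  apply: (acost_latom bgood gb); first by move: I0'; rewrite IB// Ib sub0r => /eqP; rewrite oppr_eq0 => /eqP.
  have := m_dbl hs 3 x r0; rewrite -/M => le.
  apply: le_trans (ler_wpM2l h0 le) _.
  by rewrite le_eqVlt; apply/orP; left; apply/eqP; field; rewrite gt_eqF.
apply: (acost_series (C_ := fun i => 6 * K ^+ 4 / M * mr (E i)) l2atom_family ibg _ _ cv).
  move=> i; have [sbad lebad] := sqi_czbad mE fE ib i sb.
  have l0 : 0 <= 6 * K ^+ 4 / M * mr (E i).
    by rewrite mulr_ge0 ?mr_ge0// divr_ge0 ?mulr_ge0 ?exprn_ge0 ?ltW.
  apply: (@acost_l2atom _ (x_ i) (r_ i)) => //.
  - split => //; first exact: meas_czbad mE ib i.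
    move=> y yB; rewrite /czbad; have [[/sub//]|[_ ->]] := @indicP _ R (E i) y.
    by rewrite mulr0.
  - exact: I_czbad.
  - case: (fat i) => [e|fati].
      rewrite (eq_I mu (g := fun=> 0)) ?I0 ?mul0r ?sqr_ge0// => y.
      by rewrite /czbad e indic0 mulr0 expr0n.
    have e0 := mr_ge0 mu (E i).
    apply: le_trans (_ : (al * K * mr (E i)) * (K * mr (E i)) <= _).
      apply: ler_pM => //; first by apply: I_ge0 => y; exact: sqr_ge0.
      - exact: le_trans lebad (avg i).
    rewrite (_ : _ * (_ * _) = 36 * K ^+ 7 / M ^+ 2 * mr (E i) ^+ 2); last first.
      by rewrite /al; field; rewrite gt_eqF.
    rewrite [leRHS](_ : _ = 36 * K ^+ 8 / M ^+ 2 * mr (E i) ^+ 2); last first.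
      by field; rewrite gt_eqF.
    rewrite ler_wpM2r ?sqr_ge0// ler_pM2r ?invr_gt0 ?exprn_gt0// ler_pM2l//.
    by apply: ler_weXn2l => //; exact: ltW.
move=> n; rewrite -mulr_sumr.
apply: le_trans (ler_wpM2l _ (sm n)) _; first by rewrite divr_ge0 ?mulr_ge0 ?exprn_ge0 ?ltW.
rewrite le_eqVlt; apply/orP; left; apply/eqP; rewrite /al; field.
by rewrite !gt_eqF.
Qed.

(** The splitting is applied to each atom of a decomposition of [u]; the bounded parts are then
    summed in [L^1]. *)
Lemma acost_l2_half u M : acost mu l2atom u M -> exists v,
  acost mu latom v (6 * K ^+ 6 * M) /\ acost mu l2atom (fun x => u x - v x) (M / 2).
Proof.
move=> [iu [lam [a [Pa lam0 hM cu]]]].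
have /choice[v hv] : forall j, exists v, acost mu latom v (6 * K ^+ 6) /\
    acost mu l2atom (fun x => a j x - v x) 2^-1.
  by move=> j; exact: l2atom_half.
have C0 : 0 <= 6 * K ^+ 6 by rewrite mulr_ge0// exprn_ge0// ltW// (K_gt0 hs).
have ia j : intg (a j) by case: l2atom_family => _ _ /(_ _ (Pa j))[].
have iv j : intg (v j) by exact: acost_intg (hv j).1.
have cl j : acost mu latom (fun x => lam j * v j x) (lam j * (6 * K ^+ 6)).
  by rewrite -{2}(ger0_norm (lam0 j)); apply: (acostZ _ latom_family); exact: (hv j).1.
have c2 j : acost mu l2atom (fun x => lam j * (a j x - v j x)) (lam j * 2^-1).
  by rewrite -{2}(ger0_norm (lam0 j)); apply: (acostZ _ l2atom_family); exact: (hv j).2.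
have [g [ig cg]] : exists g, intg g /\
    I (fun x => `|g x - \sum_(j < n) lam j * v j x|) @[n --> \oo] --> 0.
  apply: (@L1_series _ (borel X) R mu (fun j x => lam j * v j x) (M * (6 * K ^+ 6))).
    by move=> j; exact: intgZ.
  move=> n; apply: le_trans (ler_wpM2r C0 (hM n)); rewrite mulr_suml.
  by apply: ler_sum => j _; exact: (acost_norm latom_family (cl j)).
exists g; split.
  apply: (acost_series latom_family ig cl _ cg) => n.
  by rewrite -mulr_suml mulrC ler_wpM2l.
apply: (acost_series l2atom_family (intgB iu ig) c2).
  by move=> n; rewrite -mulr_suml ler_wpM2r.
have iS n : intg (fun x => \sum_(j < n) lam j * a j x) by apply: intg_sum => j _; exact: intgZ.
have iS' n : intg (fun x => \sum_(j < n) lam j * v j x) by apply: intg_sum => j _; exact: intgZ.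
apply: (@squeeze_cvgr _ _ _ _ (fun=> 0) (fun n =>
    I (fun x => `|u x - \sum_(j < n) lam j * a j x|) +
    I (fun x => `|g x - \sum_(j < n) lam j * v j x|))).
- apply: nearW => n; rewrite I_ge0//=.
  have iuS := intg_norm (intgB iu (iS n)); have igS := intg_norm (intgB ig (iS' n)).
  rewrite -ID//; apply: I_le => [||x].
  + apply: intg_norm; apply: intgB; first exact: intgB.
    by apply: intg_sum => j _; apply: intgZ; exact: intgB.
  + exact: intgD.
  + rewrite (_ : _ - _ = (u x - \sum_(j < n) lam j * a j x) - (g x - \sum_(j < n) lam j * v j x)).
      exact: ler_normB.
    rewrite (eq_bigr (fun j : 'I_n => lam j * a j x - lam j * v j x)); last by move=> j _; ring.
    by rewrite sumrB; ring.
- exact: cvg_cst.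
- by have := cvgD cu cg; rewrite addr0; apply.
Qed.

(** Iterated halving: the costs [6 K^6 M / 2^n] add up to [12 K^6 M], and the remainder has [L^1]
    norm at most [M / 2^n]. *)
Theorem acost_l2 u M : acost mu l2atom u M -> acost mu latom u (12 * K ^+ 6 * M).
Proof.
move=> cu.
have M0 := acost_ge0 cu.
pose st (u : X -> R) M := acost mu l2atom u M.
have /choice[v hv] : forall w : (X -> R) * R, exists v, acost mu l2atom w.1 w.2 ->
    acost mu latom v (6 * K ^+ 6 * w.2) /\ acost mu l2atom (fun x => w.1 x - v x) (w.2 / 2).
  move=> [w N] /=; have [h|h] := pselect (acost mu l2atom w N).
    by have [v hv] := acost_l2_half h; exists v.
  by exists (fun=> 0) => /h.
pose s n := iter n (fun w => ((fun x => w.1 x - v w x), w.2 / 2)) (u, M).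
have hs2 n : acost mu l2atom (s n).1 (s n).2.
  by elim: n => [//|n IH] /=; exact: (hv (s n) IH).2.
have s2 n : (s n).2 = M / 2 ^+ n.
  by elim: n => [|n IH] /=; rewrite ?expr0 ?divr1// IH exprS; field; rewrite expf_neq0.
have s1 n : (s n).1 = fun x => u x - \sum_(k < n) v (s k) x.
  elim: n => [|n IH] /=; first by apply/funext => x; rewrite big_ord0 subr0.
  apply/funext => x; rewrite big_ord_recr/= opprD addrA; congr (_ - _).
  by rewrite -[LHS]/((s n).1 x) IH.
have iu := acost_intg cu.
apply: (acost_series (u_ := fun n => v (s n)) (C_ := fun n => 6 * K ^+ 6 * (s n).2) latom_family iu).
- by move=> n; exact: (hv (s n) (hs2 n)).1.
- move=> n; rewrite -mulr_sumr.
  have -> : 12 * K ^+ 6 * M = 6 * K ^+ 6 * (2 * M) by ring.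
  apply: ler_wpM2l; first by rewrite mulr_ge0// exprn_ge0// ltW// (K_gt0 hs).
  suff : \sum_(k < n) (s k).2 <= 2 * M - M / 2 ^+ n * 2.
    by move/le_trans; apply; rewrite gerBl mulr_ge0// divr_ge0// exprn_ge0.
  elim: n => [|n IH]; first by rewrite big_ord0 expr0 divr1; lra.
  rewrite big_ord_recr/= s2; apply: le_trans (lerD IH (lexx _)) _.
  by rewrite le_eqVlt; apply/orP; left; apply/eqP; rewrite exprS; field; rewrite expf_neq0.
- apply: (@squeeze_cvgr _ _ _ _ (fun=> 0) (fun n => M / 2 ^+ n)).
  + apply: nearW => n; rewrite I_ge0//=.
    have := acost_norm l2atom_family (hs2 n); rewrite s2 => /(le_trans _); apply.
    by rewrite s1.
  + exact: cvg_cst.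
  + have := @cvg_geometric R M 2^-1; rewrite ger0_norm// invf_lt1 ?ltr1n// => /(_ isT).
    by rewrite /geometric/=; under eq_fun do rewrite exprVn.
Qed.

End atoms.

(** * Operators with off-diagonal decay *)

Lemma meas_sg (R : realType) : measurable_fun [set: R] (Num.sg : R -> R).
Proof.
rewrite (_ : Num.sg = fun y : R => \1_`]0, +oo[%classic y - \1_`]-oo, 0[%classic y).
  by apply: measurable_funB; apply: meas_indic; exact: measurable_itv.
apply/funext => y; rewrite !indicE !mem_setE !in_itv/= andbT.
by case: sgrP => /= _; rewrite ?subr0 ?sub0r ?subrr.
Qed.

Section operators.
Context (R : realType) (X : ptopologicalType).
Variables (mu : {measure set (borel X) -> \bar R}) (d : X -> X -> R).
Variables (c K eta : R).
Hypothesis hs : growing_space mu d c K eta.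
Local Notation B := (qball d).
Local Notation mr A := (fine (mu A)).
Local Notation m x r := (mr (B x r)).
Local Notation intg := (intg mu).
Local Notation sqi := (sqi mu).
Local Notation I := (I mu).
Local Notation meas := (measurable_fun [set: borel X]).
Implicit Types (f g u v b F : X -> R) (x y : X) (r k t : R).

(** Test functions that lie in every [L^p] at once. The class is stable under truncation and under
    passage to good and bad parts, and all estimates of the form are first proved on it. *)
Definition bbf u : Prop := exists x r k, ball_fun d u x r /\ forall y, `|u y| <= k.

(** Balls about [x'] exhaust the space, so one of them contains [x]; engulfing does the rest. *)
Lemma ball_in x x' r : 0 < r -> exists2 r', 0 < r' & B x r `<=` B x' r'.
Proof.
move=> r0; have : [set: X] x by [].
rewrite -(ht_cover (hs_space hs) x') => -[r1 /= r10 h].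
have r2 : 0 < Num.max r r1 by rewrite lt_max r0.
exists (c * Num.max r r1); first by rewrite mulr_gt0// (c_gt0 hs).
apply: (engulf hs (y := x)) => //; first by rewrite le_max lexx.
  by apply: (ball_mono _ h); rewrite le_max lexx orbT.
exact: (ball_center hs).
Qed.

Lemma ball_fun_sub f x r x' r' : ball_fun d f x r -> 0 < r' -> B x r `<=` B x' r' ->
  ball_fun d f x' r'.
Proof. by move=> [mf r0 f0] r'0 h; split => // y hy; apply: f0 => /h. Qed.

Lemma bbf_at u x : bbf u -> exists r k, [/\ ball_fun d u x r, 0 <= k & forall y, `|u y| <= k].
Proof.
move=> [x' [r [k [bu hk]]]]; have [_ r0 _] := bu.
have [r' r'0 sub] := ball_in x' x r0.
exists r', k; split => //; first exact: ball_fun_sub bu r'0 sub.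
exact: le_trans (normr_ge0 _) (hk point).
Qed.

Lemma bbf_meas u : bbf u -> meas u.
Proof. by move=> [x [r [k [[]]]]]. Qed.

Lemma bbf_le u v k : bbf u -> meas v -> (forall y, `|v y| <= k * `|u y|) -> bbf v.
Proof.
move=> [x [r [H [[mu_ r0 u0] hH]]]] mv hv; exists x, r, (`|k| * H); split; last first.
  move=> y; apply: le_trans (hv y) _; apply: le_trans (_ : `|k| * `|u y| <= _).
    by rewrite ler_wpM2r// ler_norm.
  by rewrite ler_wpM2l.
split => // y /u0 uy; apply/eqP; rewrite -normr_le0; apply: le_trans (hv y) _.
by rewrite uy normr0 mulr0.
Qed.

Lemma bbfD u v : bbf u -> bbf v -> bbf (fun y => u y + v y).
Proof.
move=> bu bv; have [r [k [[mu_ r0 u0] k0 hu]]] := bbf_at point bu.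
have [r' [k' [[mv r'0 v0] k'0 hv]]] := bbf_at point bv.
exists point, (Num.max r r'), (k + k'); split.
  split; [exact: measurable_funD|by rewrite lt_max r0|move=> y hy].
  by rewrite u0 ?v0 ?addr0// => h; apply: hy; apply: (ball_mono _ h); rewrite le_max lexx// orbT.
by move=> y; apply: le_trans (ler_normD _ _) _; exact: lerD.
Qed.

Lemma bbfZ a u : bbf u -> bbf (fun y => a * u y).
Proof.
move=> bu; apply: (bbf_le (k := `|a|) bu); last by move=> y; rewrite normrM.
by apply: measurable_funM => //; exact: bbf_meas.
Qed.

Lemma bbfB u v : bbf u -> bbf v -> bbf (fun y => u y - v y).
Proof.
move=> bu bv; rewrite (_ : (fun y => _) = fun y => u y + (-1) * v y).
  by apply: bbfD => //; exact: bbfZ.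
by apply/funext => y; rewrite mulN1r.
Qed.

Lemma bbf0 : bbf (fun=> 0).
Proof.
by exists point, 1, 0; split; [split|move=> y; rewrite normr0].
Qed.

Lemma bbf_sum J (s : seq J) (u : J -> X -> R) : (forall i, bbf (u i)) ->
  bbf (fun y => \sum_(i <- s) u i y).
Proof.
move=> hu; elim: s => [|i s IH].
  by rewrite (_ : (fun y => _) = fun=> 0); [exact: bbf0|apply/funext => y; rewrite big_nil].
rewrite (_ : (fun y => _) = fun y => u i y + \sum_(j <- s) u j y); first exact: bbfD.
by apply/funext => y; rewrite big_cons.
Qed.

Lemma bbfM_bd u v k : bbf u -> meas v -> (forall y, `|v y| <= k) -> bbf (fun y => u y * v y).
Proof.
move=> bu mv hv; apply: (bbf_le (k := k) bu).
  by apply: measurable_funM => //; exact: bbf_meas.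
by move=> y; rewrite normrM mulrC ler_wpM2r.
Qed.

Lemma bbfM_indic u (A : set (borel X)) : bbf u -> measurable A -> bbf (fun y => u y * \1_A y).
Proof.
move=> bu mA; apply: (bbfM_bd (k := 1) bu); first exact: meas_indic.
by move=> y; exact: norm_indic.
Qed.

Lemma bbf_intg u : bbf u -> intg u.
Proof. by move=> [x [r [k [bu hu]]]]; have [] := ball_fun_intg hs bu hu. Qed.

Lemma bbf_sqi u : bbf u -> sqi u.
Proof.
move=> bu; split; first exact: bbf_meas.
have [x [r [k [_ hk]]]] := bu.
by apply: bbf_intg; apply: (bbfM_bd bu _ hk); exact: bbf_meas.
Qed.

Lemma bbf_norm u : bbf u -> bbf (fun y => `|u y|).
Proof.
move=> bu; apply: (bbf_le (k := 1) bu).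
  by apply: measurableT_comp => //; exact: bbf_meas.
by move=> y; rewrite normr_id mul1r.
Qed.

Lemma bbf_ball x r : 0 < r -> bbf (\1_(B x r)).
Proof.
move=> r0; exists x, r, 1; split; last by move=> y; exact: norm_indic.
split => //; first by apply: meas_indic; exact: (meas_ball hs).
by move=> y hy; rewrite indicE memNset.
Qed.

Lemma bbf_bounded u x r k : ball_fun d u x r -> (forall y, `|u y| <= k) -> bbf u.
Proof. by move=> h1 h2; exists x, r, k. Qed.

Lemma sqiB u v : sqi u -> sqi v -> sqi (fun y => u y - v y).
Proof.
move=> su sv; rewrite (_ : (fun y => _) = fun y => u y + (-1) * v y).
  by apply: sqiD => //; exact: sqiZ.
by apply/funext => y; rewrite mulN1r.
Qed.

Lemma sqi_bbf f u : sqi f -> bbf u -> intg (fun y => f y * u y).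
Proof. by move=> sf bu; apply: sqi_mul => //; exact: bbf_sqi. Qed.

(** The test function is the sign of [f] on the set where the bound fails, cut by a ball. Then
    [f v - t |v|] is nonnegative with integral at most 0, hence null. *)
Lemma ae_bound f (G : set (borel X)) t : sqi f -> measurable G -> 0 <= t ->
  (forall v, bbf v -> (forall y, ~ G y -> v y = 0) -> (forall y, `|v y| <= 1) ->
     I (fun y => f y * v y) <= t * I (fun y => `|v y|)) ->
  {ae mu, forall y, G y -> `|f y| <= t}.
Proof.
move=> sf mG t0 H; have [mf _] := sf.
pose D : set (borel X) := G `&` [set y | t < `|f y|].
have mD : measurable D.
  apply: (@measurableI _ (borel X)) => //.
  rewrite -[X in measurable X]setTI (_ : [set y | _] = (fun y => `|f y|) @^-1` `]t, +oo[%classic).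
    have mnf : meas (fun y => `|f y|) by apply: measurableT_comp.
    by apply: (mnf measurableT); exact: measurable_itv.
  by apply/seteqP; split => y /=; rewrite in_itv/= andbT.
suff h n : {ae mu, forall y, B point (c ^+ n) y -> ~ D y}.
  have := ae_foralln h; move=> /ae_imp; apply => y hy Gy.
  rewrite leNgt; apply/negP => ty.
  have [r r0 hr] := ball_in y point (ltr01 : 0 < 1 :> R).
  have [n hn] := expr_unbounded r (c_gt1 hs).
  apply: (hy n _ (conj Gy ty)); apply: (ball_mono (ltW hn)); apply: hr.
  exact: (ball_center hs).
have cn0 : 0 < c ^+ n by rewrite exprn_gt0// (c_gt0 hs).
pose v y := Num.sg (f y) * (\1_(B point (c ^+ n)) y * \1_D y).
have msg : meas (fun y => Num.sg (f y)).
  by apply: measurableT_comp mf; exact: meas_sg.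
have bv : bbf v.
  rewrite (_ : v = fun y => (\1_(B point (c ^+ n)) y * \1_D y) * Num.sg (f y)).
    apply: (bbfM_bd (k := 1)) => //; first by apply: bbfM_indic => //; exact: bbf_ball.
    by move=> y; rewrite normr_sg; case: (_ == _); rewrite ?normr0 ?normr1.
  by apply/funext => y; rewrite mulrC.
have hv : I (fun y => f y * v y) <= t * I (fun y => `|v y|).
  apply: H => // y.
    by move=> nG; rewrite /v (_ : \1_D y = 0) ?mulr0// indicE memNset// => -[].
  rewrite /v !normrM -[leRHS]mulr1 ler_pM//.
    by rewrite normr_sg; case: (_ == _).
  by rewrite -[leRHS]mulr1 ler_pM// norm_indic.
pose w y := f y * v y - t * `|v y|.
have iw : intg w.
  by apply: intgB; [exact: sqi_bbf|apply: intgZ; apply: bbf_intg; exact: bbf_norm].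
have w0 y : 0 <= w y /\ (B point (c ^+ n) y -> D y -> 0 < w y).
  rewrite /w /v; have [[By ->]|[nBy ->]] := @indicP _ R (B point (c ^+ n)) y; last first.
    by rewrite !(mul0r, mulr0) normr0 mulr0 subrr.
  have [[Dy ->]|[nDy ->]] := @indicP _ R D y; last by rewrite !mulr0 normr0 mulr0 subrr.
  have [_ /= ty] := Dy; rewrite !mulr1 mulrC -normrEsg.
  have fy0 : f y != 0.
    by apply/eqP => fy; move: ty; rewrite fy normr0 ltNge t0.
  rewrite normr_sg fy0 mulr1 subr_ge0; split; first exact: ltW.
  by rewrite subr_gt0.
have Iw : I (fun y => `|w y|) = 0.
  rewrite (eq_I mu (g := w)); last by move=> y; rewrite ger0_norm//; case: (w0 y).
  apply/eqP; rewrite eq_le; apply/andP; split; last by apply: I_ge0 => y; case: (w0 y).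
  rewrite IB; [|exact: sqi_bbf|by apply: intgZ; apply: bbf_intg; exact: bbf_norm].
  by rewrite IZ ?subr_le0//; apply: bbf_intg; exact: bbf_norm.
apply: (ae_imp (I_eq0_ae iw Iw)) => y wy By Dy.
by have [_ /(_ By Dy)] := w0 y; rewrite wy ltxx.
Qed.

(* [op_cz] is all that is kept of the kernel: it follows from the smoothness of the kernel with
   [theta = c `^ (- eps)], and it is a statement about [S] modulo equality almost everywhere. *)
Record czhalf (S : (X -> R) -> X -> R) (A theta : R) (l0 : nat) : Prop := {
  op_lin : forall a u v, bbf u -> bbf v ->
    {ae mu, forall y, S (fun z => a * u z + v z) y = a * S u y + S v y} ;
  op_sqi : forall u, bbf u -> sqi (S u) ;
  op_l2 : forall u, bbf u -> I (fun y => S u y ^+ 2) <= A ^+ 2 * I (fun y => u y ^+ 2) ;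
  op_cz : forall x r l b v, ball_fun d b x r -> bbf b -> I b = 0 -> (l0 <= l)%N ->
    bbf v -> (forall y, B x (c ^+ l * r) y -> v y = 0) ->
    I (fun y => S v y * b y) <=
      A * theta ^+ l * I (fun y => `|v y|) * I (fun y => `|b y|) / m x (c ^+ l * r) }.

(** The conditions are symmetric in [S] and [S'], so that every estimate can be used with the roles
    exchanged. *)
Record czpair (S S' : (X -> R) -> X -> R) (A theta : R) (l0 : nat) : Prop := {
  pair_A : 0 < A ;
  pair_theta : 0 <= theta < 1 ;
  pair_half : czhalf S A theta l0 ;
  pair_half' : czhalf S' A theta l0 ;
  pair_adj : forall u v, bbf u -> bbf v ->
    I (fun y => S u y * v y) = I (fun y => u y * S' v y) }.

Lemma czpair_sym S S' A theta l0 : czpair S S' A theta l0 -> czpair S' S A theta l0.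
Proof.
move=> [a t h h' adj]; split => // u v bu bv.
rewrite (eq_I mu (g := fun y => v y * S' u y)); last by move=> y; rewrite mulrC.
by rewrite -adj//; apply: eq_I => y; rewrite mulrC.
Qed.

Section pair.
Variables (S S' : (X -> R) -> X -> R) (A theta : R) (l0 : nat).
Hypothesis hp : czpair S S' A theta l0.
Let A0 := pair_A hp.
Let hS := pair_half hp.
Let hS' := pair_half' hp.
Let adj := pair_adj hp.
Let th0 : 0 <= theta. Proof. by case/andP: (pair_theta hp). Qed.
Let th1 : theta < 1. Proof. by case/andP: (pair_theta hp). Qed.

(** [K] compares consecutive dilates and [1 / (1 - theta)] sums the decay over the annuli. *)
Let C1 := A * K / (1 - theta).

Lemma tail_const_ge0 : 0 <= C1.
Proof. by rewrite divr_ge0 ?mulr_ge0 ?subr_ge0 ?ltW// (K_gt0 hs). Qed.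

(** Duality turns the decay of [S] tested on [b] into a pointwise bound for [S' b] away from the
    ball of [b]. *)
Lemma pair_tail_ae x r l b : ball_fun d b x r -> bbf b -> I b = 0 -> (l0 <= l)%N ->
  {ae mu, forall y, ~ B x (c ^+ l * r) y ->
    `|S' b y| <= A * theta ^+ l * I (fun y => `|b y|) / m x (c ^+ l * r)}.
Proof.
move=> bb bbb Ib ll; have [_ r0 _] := bb; have cr0 := cr_gt0 hs l r0.
apply: (ae_bound (op_sqi hS' bbb) (G := ~` B x (c ^+ l * r))).
- by apply: measurableC; exact: (meas_ball hs).
- rewrite divr_ge0 ?mr_ge0// mulr_ge0//; first by rewrite mulr_ge0 ?exprn_ge0// ltW.
  by apply: I_ge0.
- move=> v bv v0 v1.
  rewrite (eq_I mu (g := fun y => v y * S' b y)); last by move=> y; rewrite mulrC.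
  rewrite -adj//.
  have := op_cz hS bb bbb Ib ll bv; move=> /(_ (fun y By => v0 y (fun nB => nB By))).
  move/le_trans; apply; rewrite le_eqVlt; apply/orP; left; apply/eqP.
  by field; rewrite gt_eqF// (m_gt0 hs).
Qed.

(** The pointwise bound is integrated over the annuli between the balls of radius [c^(l+n) r]; the
    bounded support of [v] leaves finitely many of them. *)
Lemma pair_tail x r l b v k : ball_fun d b x r -> bbf b -> I b = 0 -> (l0 <= l)%N ->
  bbf v -> (forall y, `|v y| <= k) -> (forall y, B x (c ^+ l * r) y -> v y = 0) ->
  I (fun y => `|v y * S' b y|) <= C1 * k * theta ^+ l * I (fun y => `|b y|).
Proof.
move=> bb bbb Ib ll bv hk v0; have [_ r0 _] := bb.
have k0 : 0 <= k by exact: le_trans (normr_ge0 _) (hk point).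
have sSb := op_sqi hS' bbb.
set N := I (fun y => `|b y|); have N0 : 0 <= N by exact: I_ge0.
have [r' [k' [bv' _ _]]] := bbf_at x bv.
have [_ r'0 v'0] := bv'.
pose Bn n := B x (c ^+ (l + n) * r).
have mBn n : measurable (Bn n : set (borel X)) by apply: (meas_ball hs); exact: (cr_gt0 hs).
pose w y := `|v y * S' b y|.
have iw : intg w by apply: intg_norm; apply: eq_intg (sqi_bbf sSb bv) => y; rewrite mulrC.
have key n : I (fun y => w y * \1_(Bn n) y) <= A * K * k * N * (theta ^+ l * \sum_(j < n) theta ^+ j).
  elim: n => [|n IH].
    rewrite big_ord0 !mulr0 (eq_I mu (g := fun=> 0)) ?I0// => y.
    rewrite /Bn addn0; have [[/v0 vy ->]|[_ ->]] := @indicP _ R (B x (c ^+ l * r)) y; last by rewrite mulr0.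
    by rewrite /w vy mul0r normr0 mul0r.
  rewrite big_ord_recr/= mulrDr mulrDr.
  pose g y := k * (A * theta ^+ (l + n) * N / m x (c ^+ (l + n) * r)) * \1_(Bn n.+1) y.
  have ig : intg g by apply: intgZ; apply: intg_ball hs _ _ _; exact: (cr_gt0 hs).
  have ae := pair_tail_ae bb bbb Ib (leq_trans ll (leq_addr n l)).
  have : I (fun y => w y * \1_(Bn n.+1) y) <= I (fun y => w y * \1_(Bn n) y + g y).
    apply: I_le_ae; [exact: intgM_indic|by apply: intgD => //; exact: intgM_indic|].
    apply: (ae_imp ae) => y hy.
    have w0 : 0 <= w y by rewrite /w.
    have H0 : 0 <= A * theta ^+ (l + n) * N / m x (c ^+ (l + n) * r).
      by rewrite divr_ge0 ?mr_ge0// !mulr_ge0 ?exprn_ge0// ltW.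
    rewrite /g; have [[By ->]|[nBy ->]] := @indicP _ R (Bn n.+1) y; last first.
      by rewrite !mulr0 addr0 mulr_ge0.
    rewrite !mulr1; have [[_ ->]|[nBn ->]] := @indicP _ R (Bn n) y.
      by rewrite mulr1 lerDl mulr_ge0.
    rewrite mulr0 add0r /w normrM ler_pM//; exact: hy.
  move/le_trans; apply; rewrite ID//; last exact: intgM_indic.
  apply: lerD => //; rewrite IZ; last by apply: intg_ball hs _ _ _; exact: (cr_gt0 hs).
  rewrite (I_ball hs); last exact: (cr_gt0 hs).
  have cl0 := cr_gt0 hs (l + n) r0.
  have M0 := m_gt0 hs x cl0.
  have := m_dbl hs 1 x cl0; rewrite expr1 expr1 mulrA -exprS => dbl.
  rewrite /Bn addnS.
  apply: le_trans (_ : k * (A * theta ^+ (l + n) * N / m x (c ^+ (l + n) * r)) * (K * m x (c ^+ (l + n) * r)) <= _).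
    apply: ler_wpM2l => //; rewrite mulr_ge0// divr_ge0 ?mr_ge0// !mulr_ge0 ?exprn_ge0// ltW//.
  by rewrite le_eqVlt; apply/orP; left; apply/eqP; rewrite exprD; field; rewrite gt_eqF.
have [n hn] := expr_unbounded (r' / r) (c_gt1 hs).
have le_r' : r' <= c ^+ (l + n) * r.
  rewrite -ler_pdivrMr//; apply: le_trans (ltW hn) _.
  by apply: ler_weXn2l; [exact: ltW (c_gt1 hs)|exact: leq_addl].
have -> : I w = I (fun y => w y * \1_(Bn n) y).
  apply: eq_I => y; have [[_ ->]|[nB ->]] := @indicP _ R (Bn n) y; first by rewrite mulr1.
  by rewrite mulr0 /w v'0 ?mul0r ?normr0// => h; apply: nB; exact: (ball_mono le_r' h).
apply: (le_trans (key n)).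
have geo := geometric_sum_le n th0 th1.
rewrite (_ : C1 * k * theta ^+ l * N = A * K * k * N * (theta ^+ l * (1 - theta)^-1)); last first.
  by rewrite /C1; field; rewrite subr_eq0 gt_eqF.
by rewrite ler_wpM2l// ?ler_wpM2l ?exprn_ge0// !mulr_ge0 ?(ltW A0)// ltW// (K_gt0 hs).
Qed.

End pair.

End operators.

(** * Near and far estimates for a pair of operators *)

Section pair_estimates.
Context (R : realType) (X : ptopologicalType).
Variables (mu : {measure set (borel X) -> \bar R}) (d : X -> X -> R).
Variables (c K eta : R).
Hypothesis hs : growing_space mu d c K eta.
Local Notation B := (qball d).
Local Notation mr A := (fine (mu A)).
Local Notation m x r := (mr (B x r)).
Local Notation intg := (intg mu).
Local Notation sqi := (sqi mu).
Local Notation I := (I mu).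
Local Notation bbf := (bbf d).
Local Notation meas := (measurable_fun [set: borel X]).
Implicit Types (f g u v b F : X -> R) (x y : X) (r k h a t : R).

Lemma ball_fun_sq_le b x r H : ball_fun d b x r -> (forall y, `|b y| <= H) ->
  I (fun y => b y ^+ 2) <= H ^+ 2 * m x r.
Proof.
move=> bb hb; have [mb r0 b0] := bb.
have bb2 : ball_fun d (fun y => b y ^+ 2) x r.
  by split => // [|y /b0 ->]; [exact: measurable_funX|rewrite expr0n].
have h2 y : `|b y ^+ 2| <= H ^+ 2.
  by rewrite normrX lerXn2r// nnegrE (le_trans _ (hb y)).
have [i2 le2] := ball_fun_intg hs bb2 h2.
apply: le_trans le2; apply: I_le => [||y]; [exact: i2|exact: intg_norm|exact: ler_norm].
Qed.

Definition nz u : set (borel X) := [set y | u y != 0].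

Lemma supp_meas u : bbf u -> measurable (nz u) /\ (mu (nz u) < +oo)%E.
Proof.
move=> bu; have mS : measurable (nz u).
  rewrite (_ : nz u = [set: borel X] `&` u @^-1` (~` [set 0])).
    by apply: (bbf_meas bu) => //; exact: measurableC.
  by apply/seteqP; split => y /=; [move=> /eqP h; split|move=> [_ /eqP]].
split => //; have [x [r [k [[_ r0 u0] _]]]] := bu.
apply: (fin_sub hs mS r0) => y /= /eqP uy; apply: contrapT => /u0; exact: uy.
Qed.

(** Height and measure of the support are recorded separately because spreading trades one for the
    other. *)
Definition small u h a : Prop :=
  [/\ bbf u, forall y, `|u y| <= h & mr (nz u) <= a].

Lemma small_norms u h a : small u h a ->
  I (fun y => u y ^+ 2) <= h ^+ 2 * a /\ I (fun y => `|u y|) <= h * a.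
Proof.
move=> [bu hu ha]; have [mS fS] := supp_meas bu.
have h0 : 0 <= h by exact: le_trans (normr_ge0 _) (hu point).
have iS := intg_indic mS fS.
have le (p : nat) : (0 < p)%N -> I (fun y => `|u y| ^+ p) <= h ^+ p * a.
  move=> p0; apply: le_trans (ler_wpM2l (exprn_ge0 p h0) ha).
  rewrite -(I_indic mu mS) -IZ//.
  have le1 y : `|u y| ^+ p <= h ^+ p * \1_(nz u) y.
    have [[_ ->]|[/= /negP + ->]] := @indicP _ R (nz u) y.
      by rewrite mulr1 lerXn2r// nnegrE.
    by rewrite negbK => /eqP ->; rewrite normr0 expr0n eqn0Ngt p0 mulr0.
  apply: I_le => //; last exact: intgZ.
  apply: (intg_le _ _ (intgZ (h ^+ p) iS)) => [|y].
    by apply: measurable_funX; apply: measurableT_comp => //; exact: (bbf_meas bu).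
  by rewrite ger0_norm// exprn_ge0.
split; last by have := le 1%N isT; rewrite expr1.
apply: le_trans (le 2%N isT); rewrite le_eqVlt; apply/orP; left; apply/eqP.
by apply: eq_I => y; rewrite real_normK// num_real.
Qed.

Section pair.
Variables (S S' : (X -> R) -> X -> R) (A theta : R) (l0 : nat).
Hypothesis hp : czpair mu d c S S' A theta l0.
Let A0 := pair_A hp.
Let hS := pair_half hp.
Let hS' := pair_half' hp.
Let adj := pair_adj hp.
Let th0 : 0 <= theta. Proof. by case/andP: (pair_theta hp). Qed.
Let th1 : theta < 1. Proof. by case/andP: (pair_theta hp). Qed.
Let C1 := A * K / (1 - theta).
Let C10 : 0 <= C1. Proof. exact: (tail_const_ge0 hs hp). Qed.
Let K0 := K_gt0 hs.
Let K1 := K_gt1 hs.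

(** Testing [S F - ga] on [v] amounts to testing [S F] on [v] minus its mean over the ball. This
    function has mean zero, so after passing to [S'] the tail estimate applies. *)
Lemma pair_osc F x r k : 0 < r -> bbf F -> (forall y, `|F y| <= k) ->
  (forall y, B x (c ^+ l0 * r) y -> F y = 0) ->
  {ae mu, forall y, B x r y ->
     `|S F y - I (fun y => S F y * \1_(B x r) y) / m x r| <= 2 * C1 * k}.
Proof.
move=> r0 bF hk F0; set ga := _ / _.
have k0 : 0 <= k by exact: le_trans (normr_ge0 _) (hk point).
have m0 := m_gt0 hs x r0; have mB := meas_ball hs x r0.
have sSF := op_sqi hS bF; have [mSF _] := sSF.
have bP := bbf_ball hs x r0.
have sf : sqi (fun y => (S F y - ga) * \1_(B x r) y).
  rewrite (_ : (fun y => _) = fun y => S F y * \1_(B x r) y - ga * \1_(B x r) y).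
    apply: sqiB; last by apply: bbf_sqi hs _ _; exact: bbfZ.
    apply: (sqi_le _ _ sSF); first by apply: measurable_funM => //; exact: meas_indic.
    by move=> y; rewrite normrM ler_piMr// norm_indic.
  by apply/funext => y; rewrite mulrBl.
have := @ae_bound R X mu d c K eta hs _ (B x r) (2 * C1 * k) sf mB.
move=> h; apply: (ae_imp (h _ _)).
- by apply: mulr_ge0 => //; exact: mulr_ge0.
- move=> v bv v0 v1.
  pose b y := v y - I v / m x r * \1_(B x r) y.
  have iv := bbf_intg hs bv; have iP := bbf_intg hs bP.
  have bb : ball_fun d b x r.
    split => //; first by apply: measurable_funB; [exact: bbf_meas bv|apply: measurable_funM => //; exact: meas_indic].
    by move=> y nB; rewrite /b v0// indicE memNset// mulr0 subrr.
  have bbb : bbf b := bbfB hs bv (bbfZ (I v / m x r) bP).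
  have Ib : I b = 0.
    by rewrite IB ?IZ ?(I_ball hs)// ?divfK ?subrr ?gt_eqF//; exact: intgZ.
  (* Removing the mean at most doubles the [L^1] norm, hence the factor 2 of the statement. *)
  have Nb : I (fun y => `|b y|) <= 2 * I (fun y => `|v y|).
    apply: (@le_trans _ _ (I (fun y => `|v y| + `|I v / m x r| * \1_(B x r) y))).
      apply: I_le => [||y].
      - by apply: intg_norm; exact: (bbf_intg hs).
      - by apply: intgD; [exact: intg_norm|exact: intgZ].
      - apply: le_trans (ler_normB _ _) _; rewrite normrM lerD2l ler_wpM2l//.
        by have [[_ ->]|[_ ->]] := @indicP _ R (B x r) y; rewrite ?normr1 ?normr0.
    rewrite ID; [|exact: intg_norm|exact: intgZ].
    rewrite IZ// (I_ball hs)// normrM normfV (gtr0_norm m0) divfK ?gt_eqF//.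
    by have := I_abs iv; lra.
  have E1 : I (fun y => (S F y - ga) * \1_(B x r) y * v y) = I (fun y => S F y * b y).
    have iSv := sqi_bbf hs sSF bv; have iSP := sqi_bbf hs sSF bP.
    rewrite (eq_I mu (g := fun y => S F y * v y - ga * v y)); last first.
      move=> y; have [[_ ->]|[nB ->]] := @indicP _ R (B x r) y; first by ring.
      by rewrite v0//; ring.
    rewrite IB ?IZ//; last exact: intgZ.
    rewrite [RHS](eq_I mu (g := fun y => S F y * v y - I v / m x r * (S F y * \1_(B x r) y))); last first.
      by move=> y; rewrite /b; ring.
    rewrite IB ?IZ//; last exact: intgZ.
    by rewrite /ga; field; rewrite gt_eqF.
  rewrite E1 adj//.
  have iFb : intg (fun y => F y * S' b y).
    by apply: eq_intg (sqi_bbf hs (op_sqi hS' bbb) bF) => y; rewrite mulrC.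
  apply: le_trans (ler_norm _) _; apply: le_trans (I_abs iFb) _.
  apply: le_trans (pair_tail hs hp bb bbb Ib (leqnn _) bF hk F0) _.
  rewrite -/C1; apply: le_trans (_ : C1 * k * 1 * (2 * I (fun y => `|v y|)) <= _); last first.
    by rewrite le_eqVlt; apply/orP; left; apply/eqP; ring.
  apply: ler_pM => //; first by apply: mulr_ge0; [exact: mulr_ge0|exact: exprn_ge0].
    exact: I_ge0.
  by apply: ler_wpM2l; [exact: mulr_ge0|rewrite exprn_ile1// ltW].
- move=> y + By; move=> /(_ By); rewrite indicE mem_set// mulr1.
  by [].
Qed.

Definition piece_const : R := A * K ^+ l0 + C1.

Lemma piece_const_ge0 : 0 <= piece_const.
Proof. by apply: addr_ge0 => //; rewrite mulr_ge0 ?exprn_ge0 ?ltW. Qed.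

Lemma pair_near b x r H : ball_fun d b x r -> (forall y, `|b y| <= H) ->
  I (fun y => `|S' b y * \1_(B x (c ^+ l0 * r)) y|) <= A * K ^+ l0 * H * m x r.
Proof.
move=> bb hb; have [mb r0 b0] := bb.
have H0 : 0 <= H by exact: le_trans (normr_ge0 _) (hb point).
have bbb : bbf b by exact: bbf_bounded bb hb.
have cr0 := cr_gt0 hs l0 r0.
apply: le_trans (I_CS (op_sqi hS' bbb) (sqi_ball hs x cr0)) _.
rewrite (eq_I mu (f := fun y => \1_(B x (c ^+ l0 * r)) y ^+ 2) (g := \1_(B x (c ^+ l0 * r)))); last first.
  by move=> y; have [[_ ->]|[_ ->]] := @indicP _ R (B x (c ^+ l0 * r)) y; rewrite ?expr1n ?expr0n.
rewrite (I_ball hs)// -sqrtrM; last by apply: I_ge0 => y; exact: sqr_ge0.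
have m0 := m_gt0 hs x r0.
have K10 : 1 <= K ^+ l0 by apply: exprn_ege1; exact: ltW.
rewrite -[leRHS]ger0_norm -?sqrtr_sqr; last by rewrite !mulr_ge0 ?exprn_ge0// ltW.
apply: ler_wsqrtr.
apply: le_trans (_ : (A ^+ 2 * (H ^+ 2 * m x r)) * (K ^+ l0 * m x r) <= _).
  apply: ler_pM; [by apply: I_ge0 => y; exact: sqr_ge0|exact: mr_ge0| |exact: (m_dbl hs l0 x r0)].
  apply: le_trans (op_l2 hS' bbb) _; rewrite ler_wpM2l ?sqr_ge0//.
  exact: ball_fun_sq_le.
rewrite [leLHS](_ : _ = (A * H * m x r) ^+ 2 * K ^+ l0); last by ring.
rewrite [leRHS](_ : _ = (A * H * m x r) ^+ 2 * (K ^+ l0 * K ^+ l0)); last by ring.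
by rewrite ler_wpM2l ?sqr_ge0// ler_peMr// (le_trans _ K10).
Qed.

(** Splits at radius [c^l0 r]: Cauchy-Schwarz and the [L^2] bound inside, the tail outside. The set
    [D] supplies a test function of bounded support, and the constant does not depend on it. *)
Lemma pair_L1 b x r H (D : set (borel X)) : ball_fun d b x r ->
  (forall y, `|b y| <= H) -> I b = 0 -> measurable D -> bbf (\1_D) ->
  I (fun y => `|S' b y| * \1_D y) <= piece_const * H * m x r.
Proof.
move=> bb hb Ib mD bD; have [mb r0 b0] := bb.
have H0 : 0 <= H by exact: le_trans (normr_ge0 _) (hb point).
have bbb : bbf b by exact: bbf_bounded bb hb.
have cr0 := cr_gt0 hs l0 r0.
have mB := meas_ball hs x cr0.
have sS := op_sqi hS' bbb; have [mS _] := sS.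
pose Bl := B x (c ^+ l0 * r).
have mBc : measurable (~` Bl : set (borel X)) by exact: (@measurableC _ (borel X)).
pose v y : R := \1_D y * \1_(~` Bl) y.
have bv : bbf v by exact: bbfM_indic.
have v1 y : `|v y| <= 1.
  rewrite /v normrM -[leRHS]mulr1; apply: ler_pM => //; exact: norm_indic.
have v0 y : Bl y -> v y = 0.
  by move=> By; rewrite /v [\1_(~` Bl) y]indicE memNset ?mulr0//; apply.
have far := pair_tail hs hp bb bbb Ib (leqnn _) bv v1 v0.
have near := pair_near bb hb.
have i1 : intg (fun y => `|S' b y * \1_Bl y|).
  by apply: intg_norm; apply: (sqi_bbf hs sS); exact: (bbf_ball hs).
have i2 : intg (fun y => `|v y * S' b y|).
  by apply: intg_norm; apply: eq_intg (sqi_bbf hs sS bv) => y; rewrite mulrC.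
have i3 : intg (fun y => `|S' b y| * \1_D y).
  apply: eq_intg (intg_norm (sqi_bbf hs sS bD)) => y.
  by rewrite normrM; have [[_ ->]|[_ ->]] := @indicP _ R D y; rewrite ?normr1 ?normr0.
apply: (@le_trans _ _ (I (fun y => `|S' b y * \1_Bl y| + `|v y * S' b y|))).
  apply: I_le => //; first exact: intgD.
  move=> y; rewrite /v !normrM.
  have [[By ->]|[nB ->]] := @indicP _ R Bl y.
    rewrite normr1 mulr1; apply: le_trans (_ : `|S' b y| <= _); last by rewrite lerDl !mulr_ge0.
    by rewrite ler_piMr//; apply: le_trans (ler_norm _) _; exact: norm_indic.
  rewrite [\1_(~` Bl) y]indicE mem_set// normr0 mulr0 add0r normr1 mulr1 mulrC.
  by rewrite ler_wpM2r// ler_norm.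
rewrite ID// /piece_const !mulrDl; apply: lerD; first exact: near.
apply: le_trans far _; rewrite -/C1 mulr1 -[leRHS]mulrA.
have [_ leb] := ball_fun_intg hs bb hb.
apply: ler_pM => //; [by rewrite mulr_ge0// exprn_ge0|exact: I_ge0|].
by rewrite ler_piMr// exprn_ile1// ltW.
Qed.

End pair.

End pair_estimates.

Lemma cvgn0_sqrt (R : realType) (e : nat -> R) :
  e n @[n --> \oo] --> 0 -> Num.sqrt (e n) @[n --> \oo] --> 0.
Proof.
by move=> ce; rewrite -(sqrtr0 R); exact: (cvg_comp _ _ ce (@sqrt_continuous R 0)).
Qed.

Lemma le_sqrt_cvg0 (R : realType) (z L k : R) (e : nat -> R) :
  (forall n, z <= L + k * Num.sqrt (e n)) -> e n @[n --> \oo] --> 0 -> z <= L.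
Proof.
move=> hz ce.
have cs := cvgn0_sqrt ce.
have ck : k * Num.sqrt (e n) @[n --> \oo] --> 0 by exact: cvgn0_scale.
have cL : L + k * Num.sqrt (e n) @[n --> \oo] --> L.
  rewrite -[X in _ --> X]addr0; apply: cvgD ck; exact: cvg_cst.
apply: (cvgr_to_ge cL); exact: nearW.
Qed.

(** * Spreading a function over a larger support *)

Section spread.
Context (R : realType) (X : ptopologicalType).
Variables (mu : {measure set (borel X) -> \bar R}) (d : X -> X -> R).
Variables (c K eta : R).
Hypothesis hs : growing_space mu d c K eta.
Local Notation B := (qball d).
Local Notation mr A := (fine (mu A)).
Local Notation m x r := (mr (B x r)).
Local Notation intg := (intg mu).
Local Notation sqi := (sqi mu).
Local Notation I := (I mu).
Local Notation bbf := (bbf d).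
Local Notation small := (small mu d).
Local Notation meas := (measurable_fun [set: borel X]).
Implicit Types (f g u v b F : X -> R) (x y : X) (r k h a t : R).
Let K0 := K_gt0 hs.
Let K1 := K_gt1 hs.

Lemma mr_bigcup_le (E : nat -> set (borel X)) (C : R) : (forall i, measurable (E i)) ->
  (forall i, (mu (E i) < +oo)%E) -> trivIset [set: nat] E ->
  (forall n, \sum_(i < n) mr (E i) <= C) -> (mu (\bigcup_i E i) <= C%:E)%E.
Proof.
move=> mE fE tE hC.
have mU : measurable (\bigcup_i E i : set (borel X)) by exact: bigcup_measurable.
rewrite measure_semi_bigcup//.
apply: lime_le; first by apply: is_cvg_nneseries.
apply: nearW => n; rewrite big_mkord.
rewrite (eq_bigr (fun i : 'I_n => (mr (E i))%:E)); last by move=> i _; exact: mu_fine.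
by rewrite sumEFin lee_fin; exact: hC.
Qed.

Record spread_data (L : R) g h a (x_ : nat -> X) (r_ : nat -> R) (E : nat -> set (borel X)) : Prop := {
  sp_meas : forall i, measurable (E i) ;
  sp_triv : trivIset [set: nat] E ;
  sp_fin : forall i, (mu (E i) < +oo)%E ;
  sp_good : small (czgood mu E g) (h * K / L) (3 * K * L * a) ;
  sp_ball : forall i, ball_fun d (czbad mu E g i) (x_ i) (r_ i) ;
  sp_bound : forall i y, `|czbad mu E g i y| <= 2 * h ;
  sp_mean : forall i, I (czbad mu E g i) = 0 ;
  sp_sub : forall i, E i `<=` B (x_ i) (r_ i) ;
  sp_fat : forall i, E i = set0 \/ m (x_ i) (r_ i) <= K * mr (E i) ;
  sp_sum : forall n, \sum_(i < n) mr (E i) <= 3 * K * L * a ;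
  sp_bbf : bbf (\1_(\bigcup_i E i)) ;
  sp_cvg : I (fun y => (g y - czgood mu E g y - \sum_(i < n) czbad mu E g i y) ^+ 2)
             @[n --> \oo] --> 0 }.

(** The covering for the indicator of the support at height [1/L], started from a ball of measure
    above [3 a L]. Off the pieces the indicator is at most [1/L < 1], so [g] vanishes there and the
    good part lives on the pieces alone. *)
Lemma spread (L : R) g h a : K <= L -> 0 < a -> small g h a ->
  exists (x_ : nat -> X) (r_ : nat -> R) (E : nat -> set (borel X)),
    spread_data L g h a x_ r_ E.
Proof.
move=> KL a0 sg; have [bg hg hga] := sg.
have L1 : 1 < L by exact: lt_le_trans KL.
have L0 : 0 < L by exact: lt_trans L1.
have h0 : 0 <= h by exact: le_trans (normr_ge0 _) (hg point).
have [mS fS] := supp_meas hs bg.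
have [r [k [[mg r0 g0] _ _]]] := bbf_at hs point bg.
have [n hn] := m_unbounded hs point (3 * a * L) r0.
set r1 := c ^+ n * r in hn.
have r10 : 0 < r1 by exact: (cr_gt0 hs).
have iL : 0 < L^-1 by rewrite invr_gt0.
have w0 y : 0 <= \1_(nz g) y :> R by have [[_ ->]|[_ ->]] := @indicP _ R (nz g) y.
have [|||||x_ [r_ [E cz]]] := @cz_decomposition R X mu d c K eta hs point r1
  (\1_(nz g)) (L^-1) a r10 iL a0.
- exact: intg_indic.
- exact: w0.
- move=> y nB; rewrite indicE memNset// => /= /eqP; apply; apply: g0 => By; apply: nB.
  by apply: (ball_mono _ By); exact: (cr_ge hs).
- by rewrite I_indic.
- by rewrite ler_pdivlMl// mulrC ltW.
case: cz => mE tE rad sub fat bnd avg sm out.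
have R30 : 0 < c ^+ 3 * r1 by exact: (cr_gt0 hs).
have fE i : (mu (E i) < +oo)%E by exact: (fin_sub hs (mE i) R30 (@bnd i)).
have ig := bbf_intg hs bg.
have sm' N : \sum_(i < N) mr (E i) <= 3 * K * L * a.
  by apply: le_trans (sm N) _; rewrite invrK le_eqVlt; apply/orP; left; apply/eqP; ring.
have out0 y : (forall i, ~ E i y) -> g y = 0.
  move=> nE; have := out y nE; have [[_ ->] le|[/= /negP + _] _] := @indicP _ R (nz g) y.
    have : L^-1 < 1 by rewrite invf_lt1.
    by rewrite ltNge le.
  by rewrite negbK => /eqP.
have mean_le i : `|czmean mu E g i| <= h * K / L.
  have [Im|Im] := eqVneq (mr (E i)) 0.
    rewrite /czmean Im invr0 mulr0 normr0 divr_ge0 ?mulr_ge0//; exact: ltW.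
  have m0 : 0 < mr (E i) by rewrite lt_neqAle eq_sym Im mr_ge0.
  rewrite /czmean normrM normfV (gtr0_norm m0) ler_pdivrMr//.
  apply: le_trans (I_abs (intgM_indic ig (mE i))) _.
  have iw := intgM_indic (intg_indic mS fS) (mE i).
  apply: (@le_trans _ _ (I (fun y => h * (\1_(nz g) y * \1_(E i) y)))).
    apply: I_le => [||y]; [by apply: intg_norm; exact: intgM_indic|exact: intgZ|].
    rewrite normrM mulrA; apply: ler_pM => //.
      have [[_ ->]|[/= /negP + ->]] := @indicP _ R (nz g) y; first by rewrite mulr1.
      by rewrite negbK => /eqP ->; rewrite normr0 mulr0.
    by have [[_ ->]|[_ ->]] := @indicP _ R (E i) y; rewrite ?normr1 ?normr0.
  rewrite IZ//; apply: le_trans (ler_wpM2l h0 (avg i)) _.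
  by rewrite le_eqVlt; apply/orP; left; apply/eqP; field; rewrite gt_eqF.
have KL1 : K / L <= 1 by rewrite ler_pdivrMr// mul1r.
have hKL : h * K / L <= h by rewrite -mulrA ler_piMr.
have hKL0 : 0 <= h * K / L by rewrite divr_ge0 ?mulr_ge0//; exact: ltW.
have mU : measurable (\bigcup_i E i : set (borel X)) by exact: bigcup_measurable.
have bU : bbf (\1_(\bigcup_i E i)).
  exists point, (c ^+ 3 * r1), 1; split; last by move=> y; exact: norm_indic.
  split => // y nB; rewrite indicE memNset// => -[i _ /bnd]; exact: nB.
have ggood y : `|czgood mu E g y| <= (h * K / L) * \1_(\bigcup_i E i) y.
  have [[i Ei]|nE] := pselect (exists i, E i y).
    rewrite indicE mem_set; last by exists i.
    by rewrite mulr1 (czgoodE mu g tE Ei).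
  have nE' i : ~ E i y by move=> Ei; apply: nE; exists i.
  by rewrite czgood_out// out0// normr0 mulr_ge0// indicE ler0n.
have mgood := meas_czgood mE tE ig.
have bgood : bbf (czgood mu E g).
  apply: (bbf_le (k := h * K / L) bU mgood) => y.
  by apply: le_trans (ggood y) _; rewrite ler_wpM2l// ler_norm.
exists x_, r_, E; split => //.
- split => //.
    by move=> y; apply: le_trans (ggood y) _; rewrite ler_piMr//.
  have [mS' fS'] := supp_meas hs bgood.
  have le : (mu (nz (czgood mu E g)) <= (3 * K * L * a)%:E)%E.
    apply: le_trans (mr_bigcup_le mE fE tE sm'); apply: mu_le => // y /= /eqP ny.
    apply: contrapT => nU; apply: ny; apply/eqP; rewrite -normr_le0.
    by apply: le_trans (ggood y) _; rewrite indicE memNset// mulr0.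
  by rewrite -lee_fin -mu_fine.
- move=> i; split => //; first exact: (meas_czbad mE ig).
  move=> y nB; rewrite /czbad; have [[/sub//]|[_ ->]] := @indicP _ R (E i) y.
  by rewrite mulr0.
- move=> i y; rewrite /czbad; have [[_ ->]|[_ ->]] := @indicP _ R (E i) y.
    rewrite mulr1; apply: le_trans (ler_normB _ _) _.
    have := hg y; have := le_trans (mean_le i) hKL; lra.
  by rewrite mulr0 normr0 mulr_ge0.
- move=> i; exact: (I_czbad mE fE ig).
- have sb := bbf_sqi hs (bbfB hs bg bgood).
  have ib : intg (fun y => 4 * (g y - czgood mu E g y) ^+ 2) by apply: intgZ; case: sb.
  have mb := (bbf_meas (bbfB hs bg bgood)).
  have mdn N : meas (fun y => (g y - czgood mu E g y - \sum_(i < N) czbad mu E g i y) ^+ 2).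
    by apply: measurable_funX; apply: measurable_funB => //; exact: (meas_sum_czbad mE ig).
  have [|||_ _] := I_dct mdn (f := fun=> 0) _ _ _ ib.
  + exact: measurable_cst.
  + apply: aeW => y.
    have h1 : g y - czgood mu E g y - \sum_(i < N) czbad mu E g i y @[N --> \oo] --> 0.
      rewrite -[X in _ --> X](subrr (g y - czgood mu E g y)).
      by apply: cvgB; [exact: cvg_cst|exact: (@sum_czbad_cvg _ (borel X) R mu E g tE y)].
    by rewrite -[X in _ --> X](mulr0 0); under eq_fun do rewrite expr2; exact: cvgM.
  + apply: aeW => y N; rewrite ger0_norm ?sqr_ge0//.
    have [[-> _]|[-> _]] := sum_czbad mu g tE N y.
      by rewrite subrr expr0n mulr_ge0// sqr_ge0.
    by rewrite subr0; have := sqr_ge0 (g y - czgood mu E g y); lra.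
  + by rewrite I0.
Qed.

End spread.

(** * Integrals of [|S' g|] over sets much larger than the support of [g] *)

Section level_estimates.
Context (R : realType) (X : ptopologicalType).
Variables (mu : {measure set (borel X) -> \bar R}) (d : X -> X -> R).
Variables (c K eta : R).
Hypothesis hs : growing_space mu d c K eta.
Local Notation B := (qball d).
Local Notation mr A := (fine (mu A)).
Local Notation m x r := (mr (B x r)).
Local Notation intg := (intg mu).
Local Notation sqi := (sqi mu).
Local Notation I := (I mu).
Local Notation bbf := (bbf d).
Local Notation small := (small mu d).
Local Notation meas := (measurable_fun [set: borel X]).
Implicit Types (f g u v b F : X -> R) (x y : X) (r k h a t : R).
Let K0 := K_gt0 hs.
Let K1 := K_gt1 hs.

Section half.
Variables (S : (X -> R) -> X -> R) (A theta : R) (l0 : nat).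
Hypothesis A0 : 0 < A.
Hypothesis hS : czhalf mu d c S A theta l0.

Lemma op_add u v : bbf u -> bbf v ->
  {ae mu, forall y, S (fun z => u z + v z) y = S u y + S v y}.
Proof.
move=> bu bv; apply: (ae_imp (op_lin hS 1 bu bv)) => y.
rewrite mul1r => <-; congr (S _ y); by apply/funext => z; rewrite mul1r.
Qed.

(** Linearity at [u = v = 0] gives [S 0 = 2 S 0] almost everywhere. *)
Lemma op_zero : {ae mu, forall y, S (fun=> 0) y = 0}.
Proof.
apply: (ae_imp (op_lin hS 1 (bbf0 d) (bbf0 d))) => y.
rewrite (_ : (fun z => _) = fun=> 0); last by apply/funext => z; rewrite mul1r addr0.
lra.
Qed.

Lemma op_scale k u : bbf u -> {ae mu, forall y, S (fun z => k * u z) y = k * S u y}.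
Proof.
move=> bu; apply: (ae_imp2 (op_lin hS k bu (bbf0 d)) op_zero) => y h h0.
move: h; rewrite h0 addr0 => <-; congr (S _ y).
by apply/funext => z; rewrite addr0.
Qed.

Lemma op_sum n (u : nat -> X -> R) : (forall i, bbf (u i)) ->
  {ae mu, forall y, S (fun z => \sum_(i < n) u i z) y = \sum_(i < n) S (u i) y}.
Proof.
move=> hu; elim: n => [|n IH].
  apply: (ae_imp op_zero) => y h0; rewrite big_ord0 -[RHS]h0; congr (S _ y).
  by apply/funext => z; rewrite big_ord0.
have bs : bbf (fun z => \sum_(i < n) u i z) by apply: (bbf_sum hs) => i; exact: hu.
apply: (ae_imp2 IH (op_add bs (hu n))) => y h1 h2.
rewrite big_ord_recr/= -h1 -h2; congr (S _ y).
by apply/funext => z; rewrite big_ord_recr.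
Qed.

Lemma op_meas u : bbf u -> meas (S u).
Proof. by move=> /(op_sqi hS) []. Qed.

Lemma op_CS u v : bbf u -> sqi v -> I (fun y => `|S u y * v y|) <=
  A * Num.sqrt (I (fun y => u y ^+ 2)) * Num.sqrt (I (fun y => v y ^+ 2)).
Proof.
move=> bu sv; apply: le_trans (I_CS (op_sqi hS bu) sv) _.
apply: ler_wpM2r; first exact: sqrtr_ge0.
rewrite -[X in X * _](ger0_norm (ltW A0)) -sqrtr_sqr -sqrtrM ?sqr_ge0//.
by apply: ler_wsqrtr; exact: (op_l2 hS bu).
Qed.

End half.

Lemma bbf_nz u : bbf u -> bbf (\1_(nz u)).
Proof.
move=> bu; have [mS _] := supp_meas hs bu.
have [x [r [k [[_ r0 u0] _]]]] := bu.
exists x, r, 1; split; last by move=> y; exact: norm_indic.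
split => // y nB; rewrite indicE memNset// => /= /eqP; apply; exact: u0.
Qed.

Lemma I_indic_sq (D : set (borel X)) : measurable D ->
  I (fun y => \1_D y ^+ 2) = mr D.
Proof.
move=> mD; rewrite -(I_indic mu mD); apply: eq_I => y.
by have [[_ ->]|[_ ->]] := @indicP _ R D y; rewrite ?expr1n ?expr0n.
Qed.

Lemma indic_norm_mul f (D : set (borel X)) y : `|f y * \1_D y| = `|f y| * \1_D y.
Proof.
by rewrite normrM; have [[_ ->]|[_ ->]] := @indicP _ R D y; rewrite ?normr1 ?normr0.
Qed.

Section pair.
Variables (S S' : (X -> R) -> X -> R) (A theta : R) (l0 : nat).
Hypothesis hp : czpair mu d c S S' A theta l0.
Let A0 := pair_A hp.
Let hS := pair_half hp.
Let hS' := pair_half' hp.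
Let adj := pair_adj hp.
Local Notation C3 := (piece_const K A theta l0).

(** Cauchy-Schwarz alone gives [h sqrt(a t)], and serves only as the base case. Spreading [g] once
    multiplies [h a] by [3 K^2] while the support grows by [3 K L], and the mean-zero pieces cost a
    multiple of [h a] whatever the size of [D]. The loss is thus [4 K^2] per factor [3 K L] in
    [t / a]. *)
Lemma level_estimate (L : R) : K <= L -> exists2 C : R, 0 < C &
  forall n g (D : set (borel X)) h a t, 0 < a -> small g h a -> measurable D ->
    bbf (\1_D) -> mr D <= t -> t <= (3 * K * L) ^+ n * a ->
    I (fun y => `|S' g y| * \1_D y) <= C * (4 * K ^+ 2) ^+ n * h * a.
Proof.
move=> KL; have C30 : 0 <= C3 by exact: (piece_const_ge0 hs hp).
have L0 : 0 < L by exact: lt_le_trans KL.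
pose C' := 6 * C3 * K ^+ 2 * L.
have C'0 : 0 <= C' by rewrite /C' !mulr_ge0 ?exprn_ge0 ?C30 ?(ltW K0) ?(ltW L0).
exists (A + C'); first by rewrite ltr_wpDr.
elim=> [|n IH] g D h a t a0 sg mD bD Db ba.
  have [bg hg ha] := sg; have [sq _] := small_norms hs sg.
  have h0 : 0 <= h by exact: le_trans (normr_ge0 _) (hg point).
  rewrite (eq_I mu (g := fun y => `|S' g y * \1_D y|)); last by move=> y; rewrite indic_norm_mul.
  apply: le_trans (op_CS A0 hS' bg (bbf_sqi hs bD)) _.
  rewrite I_indic_sq// expr0 mulr1.
  have Da : mr D <= a by move: ba; rewrite expr0 mul1r; exact: le_trans.
  apply: (@le_trans _ _ (A * (h * a))).
    rewrite -mulrA ler_pM2l// -sqrtrM; last by apply: I_ge0 => y; exact: sqr_ge0.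
    rewrite -[leRHS]ger0_norm ?mulr_ge0 ?(ltW a0)// -sqrtr_sqr ler_wsqrtr//.
    rewrite (_ : (h * a) ^+ 2 = h ^+ 2 * a * a); last by ring.
    by apply: ler_pM => //; apply: I_ge0 => y; exact: sqr_ge0.
  by rewrite -mulrA ler_wpM2r ?mulr_ge0 ?(ltW a0)// lerDl.
have [x_ [r_ [E sp]]] := spread hs KL a0 sg.
case: sp => mE tE fE sgood bball bbd bI sub fat sm bU cv.
set gt := czgood mu E g in sgood cv; pose be := czbad mu E g.
have [bg hg ha] := sg; have [bgt _ _] := sgood.
have h0 : 0 <= h by exact: le_trans (normr_ge0 _) (hg point).
have a'0 : 0 < 3 * K * L * a by rewrite !mulr_gt0.
have := IH gt D _ _ t a'0 sgood mD bD Db.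
rewrite mulrA -exprSr => /(_ ba) IHgt.
pose de y := g y - gt y.
have bde : bbf de by exact: (bbfB hs bg bgt).
have bbe i : bbf (be i) by exact: bbf_bounded (bball i) (bbd i).
have bsum n' : bbf (fun y => \sum_(i < n') be i y) by apply: (bbf_sum hs) => i; exact: bbe.
have intSD u : bbf u -> intg (fun y => `|S' u y| * \1_D y).
  move=> bu; apply: eq_intg (intg_norm (sqi_bbf hs (op_sqi hS' bu) bD)) => y.
  by rewrite indic_norm_mul.
have D1 y : 0 <= \1_D y :> R by have [[_ ->]|[_ ->]] := @indicP _ R D y.
have triang u v w : bbf u -> bbf v -> bbf w -> (forall y, u y = v y + w y) ->
    I (fun y => `|S' u y| * \1_D y) <= I (fun y => `|S' v y| * \1_D y) + I (fun y => `|S' w y| * \1_D y).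
  move=> bu bv bw /funext ->; rewrite -ID; [|exact: intSD|exact: intSD].
  apply: I_le_ae; [by apply: intSD; exact: (bbfD hs bv bw)|by apply: intgD; exact: intSD|].
  apply: (ae_imp (op_add hS' bv bw)) => y ->.
  by rewrite -mulrDl ler_wpM2r// ler_normD.
have piece i : I (fun y => `|S' (be i) y| * \1_D y) <= C3 * (2 * h) * K * mr (E i).
  have [Ei|fati] := fat i.
    rewrite (_ : be i = fun=> 0); last first.
      by apply/funext => y; rewrite /be /czbad Ei indic0 mulr0.
    rewrite Ei measure0 mulr0 -[leRHS](I0 mu); apply: I_le_ae.
    - exact: (intSD _ (bbf0 d)).
    - exact: intg0.
    - by apply: (ae_imp (op_zero hS')) => y ->; rewrite normr0 mul0r.
  apply: le_trans (pair_L1 hs hp (bball i) (bbd i) (bI i) mD bD) _.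
  by rewrite -[leRHS]mulrA ler_wpM2l// mulr_ge0// mulr_ge0.
have sumpiece n' : I (fun y => `|S' (fun z => \sum_(i < n') be i z) y| * \1_D y) <= C' * h * a.
  apply: (@le_trans _ _ (I (fun y => \sum_(i < n') `|S' (be i) y| * \1_D y))).
    apply: I_le_ae; [exact: intSD|by apply: intg_sum => i _; exact: intSD|].
    apply: (ae_imp (op_sum hS' n' bbe)) => y ->.
    by rewrite -mulr_suml ler_wpM2r// ler_norm_sum.
  rewrite I_sum; last by move=> i _; exact: intSD.
  apply: (@le_trans _ _ (\sum_(i < n') C3 * (2 * h) * K * mr (E i))); first by apply: ler_sum => i _; exact: piece.
  rewrite -mulr_sumr.
  apply: le_trans (ler_wpM2l _ (sm n')) _; first by rewrite !mulr_ge0// ltW.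
  by rewrite le_eqVlt; apply/orP; left; apply/eqP; rewrite /C'; ring.
have delta : I (fun y => `|S' de y| * \1_D y) <= C' * h * a.
  apply: (le_sqrt_cvg0 (k := A * Num.sqrt (mr D)) _ cv) => n'.
  have bw : bbf (fun y => g y - gt y - \sum_(i < n') be i y) by exact: (bbfB hs bde (bsum n')).
  apply: le_trans (triang de _ _ bde (bsum n') bw _) _.
    by move=> y; rewrite addrC subrK.
  apply: lerD => //.
  rewrite (eq_I mu (g := fun y => `|S' (fun y => g y - gt y - \sum_(i < n') be i y) y * \1_D y|)); last first.
    by move=> y; rewrite indic_norm_mul.
  apply: le_trans (op_CS A0 hS' bw (bbf_sqi hs bD)) _.
  by rewrite I_indic_sq// mulrAC.
apply: le_trans (triang g gt de bg bgt bde _) _; first by move=> y; rewrite /de addrC subrK.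
apply: le_trans (lerD IHgt delta) _.
(* Of the four copies of [K^2 P], three pay for the spread function and one for the mean-zero
   pieces. *)
set P := (4 * K ^+ 2) ^+ n.
have K21 : 1 <= K ^+ 2 by apply: exprn_ege1; exact: ltW.
have P1 : 1 <= P by apply: exprn_ege1; lra.
rewrite exprS -/P.
have -> : (A + C') * P * (h * K / L) * (3 * K * L * a) = (A + C') * P * 3 * K ^+ 2 * (h * a).
  by field; rewrite gt_eqF.
rewrite -!(mulrA _ h a) -mulrDl; apply: ler_wpM2r; first by rewrite mulr_ge0// ltW.
have AC0 : 0 <= A + C' by rewrite addr_ge0// ltW.
have PK : 1 <= P * K ^+ 2 by rewrite -[X in X <= _]mulr1 ler_pM.
have : (A + C') * 1 <= (A + C') * (P * K ^+ 2) by rewrite ler_wpM2l.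
by have := ltW A0; nra.
Qed.

(** [S F] is tested on its own sign over [U]. This sign function has support of measure at most [a],
    so the preceding estimate applies to it, with the support of [F] as the large set. *)
Lemma level_estimate_dual (L : R) : K <= L -> exists2 C : R, 0 < C &
  forall n F (U : set (borel X)) k a t, 0 < a -> small F k t -> measurable U ->
    bbf (\1_U) -> mr U <= a -> t <= (3 * K * L) ^+ n * a ->
    I (fun y => `|S F y| * \1_U y) <= C * (4 * K ^+ 2) ^+ n * k * a.
Proof.
move=> KL; have [C C0 hC] := level_estimate KL.
exists C => // n F U k a t a0 sF mU bU Ua ba.
have [bF hF Fb] := sF; have [mF fF] := supp_meas hs bF.
have k0 : 0 <= k by exact: le_trans (normr_ge0 _) (hF point).
have mSF := op_meas hS bF.
pose v y := \1_U y * Num.sg (S F y).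
have sg1 y : `|Num.sg (S F y)| <= 1 by rewrite normr_sg; case: (_ == _).
have bv : bbf v.
  apply: (bbfM_bd (k := 1) bU _ sg1).
  by apply: measurableT_comp mSF; exact: meas_sg.
have v1 y : `|v y| <= 1 by rewrite normrM -[leRHS]mulr1 ler_pM// norm_indic.
have sv : small v 1 a.
  split => //; apply: le_trans Ua; apply: le_mr => //.
  - by have [] := supp_meas hs bv.
  - move=> y /= vy; apply: contrapT => nU; move/eqP: vy; apply.
    by rewrite /v indicE memNset// mul0r.
  - have [Ur [rr [kk [[_ rr0 U0] _]]]] := bU.
    apply: (fin_sub hs mU rr0) => y Uy; apply: contrapT => /U0.
    by rewrite indicE mem_set// => /eqP; rewrite oner_eq0.
have E : I (fun y => `|S F y| * \1_U y) = I (fun y => S F y * v y).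
  by apply: eq_I => y; rewrite /v normrEsg; ring.
rewrite E adj//.
have := hC n v (nz F) 1 a t a0 sv mF (bbf_nz bF) Fb ba.
rewrite mulr1 => le.
have iFv : intg (fun y => F y * S' v y).
  by apply: eq_intg (sqi_bbf hs (op_sqi hS' bv) bF) => y; rewrite mulrC.
apply: le_trans (ler_norm _) _; apply: le_trans (I_abs iFv) _.
have iSv : intg (fun y => `|S' v y| * \1_(nz F) y).
  apply: eq_intg (intg_norm (sqi_bbf hs (op_sqi hS' bv) (bbf_nz bF))) => y.
  by rewrite indic_norm_mul.
apply: (@le_trans _ _ (k * I (fun y => `|S' v y| * \1_(nz F) y))).
  rewrite -IZ//; apply: I_le; [exact: intg_norm|exact: intgZ|].
  move=> y; rewrite normrM; have [[_ ->]|[/= /negP + ->]] := @indicP _ R (nz F) y.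
    by rewrite mulr1 ler_wpM2r.
  by rewrite negbK => /eqP ->; rewrite normr0 mul0r !mulr0.
apply: le_trans (ler_wpM2l k0 le) _.
by rewrite le_eqVlt; apply/orP; left; apply/eqP; ring.
Qed.

End pair.

End level_estimates.

(** * The bilinear form *)

Section acost_sums.
Context d (T : measurableType d) (R : realType).
Variable mu : {measure set T -> \bar R}.
Local Notation intg := (intg mu).
Local Notation I := (I mu).
Variable P : (T -> R) -> Prop.
Hypothesis hP : atomic_family mu P.

Lemma acostD u v C C' : acost mu P u C -> acost mu P v C' ->
  acost mu P (fun x => u x + v x) (C + C').
Proof.
move=> cu cv; have iu := acost_intg cu; have iv := acost_intg cv.
pose w n := if n is 0%N then u else if n is 1%N then v else fun=> 0.
pose D n := if n is 0%N then C else if n is 1%N then C' else 0.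
have C0 := acost_ge0 cu; have C0' := acost_ge0 cv.
apply: (acost_series (u_ := w) (C_ := D) hP (intgD iu iv)).
- by case=> [|[|n]] //; exact: (acost0 hP).
- case=> [|[|n]]; rewrite ?big_ord0 ?addr_ge0// !big_ord_recl ?big_ord0 /=.
    by rewrite addr0 lerDl.
  by rewrite big1 ?addr0.
- apply/cvgrPdist_lt => e e0; near=> n.
  have n2 : (1 < n)%N by near: n; exists 2%N.
  rewrite (_ : I _ = 0) ?subrr ?normr0//.
  rewrite -[RHS](I0 mu); apply: eq_I => x.
  rewrite -(prednK (ltnW n2)) big_ord_recl/=.
  have n1 : (0 < n.-1)%N by rewrite -ltnS prednK// ltnW.
  by rewrite -(prednK n1) big_ord_recl/= big1 ?addr0 ?subrr ?normr0.
Unshelve. all: by end_near. Qed.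

Lemma acost_bigsum n (u : nat -> T -> R) (C : nat -> R) :
  (forall i, (i < n)%N -> acost mu P (u i) (C i)) ->
  acost mu P (fun x => \sum_(i < n) u i x) (\sum_(i < n) C i).
Proof.
elim: n => [_|n IH hu].
  rewrite big_ord0 (_ : (fun x => _) = fun=> 0); first exact: (acost0 hP).
  by apply/funext => x; rewrite big_ord0.
rewrite big_ord_recr/= (_ : (fun x => _) = fun x => \sum_(i < n) u i x + u n x).
  apply: acostD; last exact: hu.
  by apply: IH => i lin; apply: hu; exact: ltnW.
by apply/funext => x; rewrite big_ord_recr.
Qed.

End acost_sums.

(** * Atoms in the form on one mean-zero piece *)

Section pieces.
Context (R : realType) (X : ptopologicalType).
Variables (mu : {measure set (borel X) -> \bar R}) (d : X -> X -> R).
Variables (c K eta : R).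
Hypothesis hs : growing_space mu d c K eta.
Local Notation B := (qball d).
Local Notation mr A := (fine (mu A)).
Local Notation m x r := (mr (B x r)).
Local Notation intg := (intg mu).
Local Notation sqi := (sqi mu).
Local Notation I := (I mu).
Local Notation bbf := (bbf d).
Local Notation small := (small mu d).
Local Notation latom := (latom mu d).
Local Notation meas := (measurable_fun [set: borel X]).
Implicit Types (f g u v b F : X -> R) (x y : X) (r k h a t H : R).
Let K0 := K_gt0 hs.
Let K1 := K_gt1 hs.

(** Clamping [f] at [H] makes the bound hold everywhere and changes [f] only on a null set. *)
Lemma acost_latom_ae f x r H L : ball_fun d f x r -> 0 <= H -> intg f ->
  {ae mu, forall y, `|f y| <= H} -> I f = 0 -> H * m x r <= L ->
  acost mu latom f L.
Proof.
move=> [mf r0 f0] H0 iff hH If hL.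
pose g y := Num.max (- H) (Num.min H (f y)).
have mg : meas g by apply: measurable_maxr => //; exact: measurable_minr.
have fg : {ae mu, forall y, f y = g y}.
  apply: (ae_imp hH) => y; rewrite ler_norml => /andP[h1 h2].
  by rewrite /g (min_r h2) (max_r h1).
have gf : {ae mu, forall y, g y = f y} by apply: (ae_imp fg) => y ->.
have [ig Ig] := I_eq_ae iff mg fg.
have bg : ball_fun d g x r.
  split => // y /f0 fy; rewrite /g fy min_r// max_r// oppr_le0//.
have gH y : `|g y| <= H.
  rewrite ler_norml /g le_max lexx/= ge_max ge_min lexx/= andbT.
  by rewrite -subr_ge0 opprK addr_ge0.
apply: (acost_eq_ae (acost_latom hs bg gH _ hL) mf gf); last exact: (latom_family hs).
by rewrite Ig.
Qed.

Definition bil (S S' : (X -> R) -> X -> R) g F : X -> R :=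
  fun y => S' g y * F y - g y * S F y.

Section pair.
Variables (S S' : (X -> R) -> X -> R) (A theta : R) (l0 : nat).
Hypothesis hp : czpair mu d c S S' A theta l0.
Let A0 := pair_A hp.
Let hS := pair_half hp.
Let hS' := pair_half' hp.
Let adj := pair_adj hp.
Let th0 : 0 <= theta. Proof. by case/andP: (pair_theta hp). Qed.
Let th1 : theta < 1. Proof. by case/andP: (pair_theta hp). Qed.
Local Notation C1 := (A * K / (1 - theta)).
Let C10 : 0 <= C1. Proof. exact: (tail_const_ge0 hs hp). Qed.

Section piece.
Variables (x : X) (r : R) (b : X -> R) (H : R) (F : X -> R) (k : R).
Hypothesis bb : ball_fun d b x r.
Hypothesis hb : forall y, `|b y| <= H.
Hypothesis Ib : I b = 0.
Hypothesis bF : bbf F.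
Hypothesis hF : forall y, `|F y| <= k.
Let r0 : 0 < r. Proof. by case: bb. Qed.
Let Bl l := B x (c ^+ l * r).
(** [F] is split at radius [c^l0 r]. The near part yields a multiple of an [l2atom]. For the far
    part [S Fi] stays close to its mean [ga] on the ball of [b] and [S' b] decays, which yields a
    multiple of [b], a bounded core and one atom per annulus. *)
Let F0 y := F y * \1_(Bl l0) y.
Let Fi y := F y * \1_(~` Bl l0) y.
Let ga := I (fun y => S Fi y * \1_(B x r) y) / m x r.
Let M := m x r.

Let M0 : 0 < M. Proof. exact: (m_gt0 hs). Qed.
Let H0 : 0 <= H. Proof. exact: le_trans (normr_ge0 _) (hb point). Qed.
Let k0 : 0 <= k. Proof. exact: le_trans (normr_ge0 _) (hF point). Qed.
Let Bl0 l : 0 < c ^+ l * r. Proof. exact: (cr_gt0 hs). Qed.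
Let mBl l : measurable (Bl l : set (borel X)). Proof. exact: (meas_ball hs). Qed.
Let mBlc l : measurable (~` Bl l : set (borel X)).
Proof. exact: (@measurableC _ (borel X)). Qed.
Let bbb : bbf b. Proof. exact: bbf_bounded bb hb. Qed.
Let bF0 : bbf F0. Proof. exact: bbfM_indic. Qed.
Let bFi : bbf Fi. Proof. exact: bbfM_indic. Qed.
Let indic_split l y : \1_(Bl l) y + \1_(~` Bl l) y = 1 :> R.
Proof.
have [[h ->]|[h ->]] := @indicP _ R (Bl l) y; rewrite indicE.
  by rewrite memNset ?addr0//; apply.
by rewrite mem_set// add0r.
Qed.
Let FE y : F y = F0 y + Fi y.
Proof. by rewrite -mulrDr indic_split mulr1. Qed.
Let hF0 y : `|F0 y| <= k.
Proof. by rewrite normrM -[leRHS]mulr1; apply: ler_pM => //; exact: norm_indic. Qed.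
Let hFi y : `|Fi y| <= k.
Proof. by rewrite normrM -[leRHS]mulr1; apply: ler_pM => //; exact: norm_indic. Qed.
Let Fi0 y : Bl l0 y -> Fi y = 0.
Proof. by move=> h; rewrite /Fi indicE memNset ?mulr0//; apply. Qed.
Let Nb := I (fun y => `|b y|).
Let Nb0 : 0 <= Nb. Proof. exact: I_ge0. Qed.
Let NbH : Nb <= H * M. Proof. by have [] := ball_fun_intg hs bb hb. Qed.
Let sSb : sqi (S' b). Proof. exact: (op_sqi hS' bbb). Qed.
Let sSF0 : sqi (S F0). Proof. exact: (op_sqi hS bF0). Qed.
Let sSFi : sqi (S Fi). Proof. exact: (op_sqi hS bFi). Qed.
Let mball_le l : M <= m x (c ^+ l * r).
Proof.
apply: (mr_sub hs) => //; first exact: (meas_ball hs).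
by apply: ball_mono; exact: (cr_ge hs).
Qed.

(** The integral vanishes by duality and the square is controlled by the [L^2] bounds of both
    operators, so this is a multiple of an [l2atom]; the factor [12 K^6] is that of [acost_l2]. *)
Lemma piece_near :
  acost mu latom (fun y => S' b y * F0 y - b y * S F0 y)
    (12 * K ^+ 6 * (2 * A * H * k * K ^+ l0 * M)).
Proof.
have s1 : sqi (fun y => S' b y * F0 y).
  apply: (sqi_le _ _ (sqiZ k sSb)).
    by apply: measurable_funM; [case: sSb|exact: bbf_meas bF0].
  by move=> y; rewrite (normrM (S' b y)) (normrM k) (ger0_norm k0) mulrC ler_wpM2r.
have s2 : sqi (fun y => b y * S F0 y).
  apply: (sqi_le _ _ (sqiZ H sSF0)).
    by apply: measurable_funM; [exact: bbf_meas bbb|case: sSF0].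
  by move=> y; rewrite !normrM (ger0_norm H0) ler_wpM2r.
have K10 : 1 <= K ^+ l0 by apply: exprn_ege1; exact: ltW.
apply: (acost_l2 hs); apply: (acost_l2atom hs (x := x) (r := c ^+ l0 * r)).
- split => //; first by apply: measurable_funB; [case: s1|case: s2].
  move=> y nB; rewrite /F0 indicE memNset// !mulr0 sub0r.
  have [_ _ ->] := bb; first by rewrite mul0r oppr0.
  by move=> h; apply: nB; apply: (ball_mono _ h); exact: (cr_ge hs).
- exact: sqiB.
- rewrite IB; last 2 first.
  + exact: (sqi_bbf hs sSb bF0).
  + by apply: eq_intg (sqi_bbf hs sSF0 bbb) => y; rewrite mulrC.
  rewrite (eq_I mu (g := fun y => F0 y * S' b y)); last by move=> y; rewrite mulrC.
  rewrite -adj//; apply/eqP; rewrite subr_eq0; apply/eqP.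
  by apply: eq_I => y; rewrite mulrC.
- by rewrite !mulr_ge0 ?exprn_ge0 ?(ltW A0) ?(ltW K0) ?(ltW M0).
- have le1 : I (fun y => (S' b y * F0 y - b y * S F0 y) ^+ 2) <=
      2 * k ^+ 2 * (A ^+ 2 * (H ^+ 2 * M)) + 2 * H ^+ 2 * (A ^+ 2 * (k ^+ 2 * m x (c ^+ l0 * r))).
    apply: (@le_trans _ _ (I (fun y => 2 * k ^+ 2 * S' b y ^+ 2 + 2 * H ^+ 2 * S F0 y ^+ 2))).
      apply: I_le => [||y].
      - by case: (sqiB s1 s2).
      - by apply: intgD; apply: intgZ; [case: sSb|case: sSF0].
      - have h1 : (S' b y * F0 y) ^+ 2 <= k ^+ 2 * S' b y ^+ 2.
          rewrite exprMn mulrC ler_wpM2r ?sqr_ge0// -(real_normK (num_real (F0 y))).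
          by rewrite lerXn2r// nnegrE.
        have h2 : (b y * S F0 y) ^+ 2 <= H ^+ 2 * S F0 y ^+ 2.
          rewrite exprMn ler_wpM2r ?sqr_ge0// -(real_normK (num_real (b y))).
          by rewrite lerXn2r// nnegrE.
        have := sqr_ge0 (S' b y * F0 y + b y * S F0 y); nra.
    rewrite ID; [|by apply: intgZ; case: sSb|by apply: intgZ; case: sSF0].
    rewrite !IZ; [|by case: sSF0|by case: sSb].
    apply: lerD; (apply: ler_wpM2l; first by rewrite mulr_ge0// sqr_ge0).
      apply: le_trans (op_l2 hS' bbb) _; rewrite ler_wpM2l ?sqr_ge0//.
      exact: (ball_fun_sq_le hs bb hb).
    apply: le_trans (op_l2 hS bF0) _; rewrite ler_wpM2l ?sqr_ge0//.
    apply: (ball_fun_sq_le hs _ hF0); split => //; first exact: bbf_meas bF0.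
    by move=> y nB; rewrite /F0 indicE memNset// mulr0.
  have le2 := m_dbl hs l0 x r0; rewrite -/M in le2.
  have m'0 := m_gt0 hs x (Bl0 l0).
  set m' := m x (c ^+ l0 * r) in le1 le2 m'0 *.
  set P := K ^+ l0 in K10 le2 *.
  have MPM : M <= P * M by rewrite ler_peMl// ltW.
  apply: (@le_trans _ _ ((4 * A ^+ 2 * H ^+ 2 * k ^+ 2 * (P * M)) * (P * M))).
    apply: ler_pM => //; [by apply: I_ge0 => y; exact: sqr_ge0|exact: ltW|].
    apply: (le_trans le1).
    rewrite (_ : _ + _ = 2 * A ^+ 2 * H ^+ 2 * k ^+ 2 * (M + m')); last by ring.
    rewrite (_ : 4 * _ * _ * _ * _ = 2 * A ^+ 2 * H ^+ 2 * k ^+ 2 * (P * M + P * M)); last by ring.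
    apply: ler_wpM2l; last exact: lerD.
    by rewrite !mulr_ge0 ?sqr_ge0 ?(ltW A0).
  by rewrite le_eqVlt; apply/orP; left; apply/eqP; ring.
Qed.

Let osc : {ae mu, forall y, B x r y -> `|S Fi y - ga| <= 2 * C1 * k}.
Proof. exact: (pair_osc hs hp r0 bFi hFi Fi0). Qed.

(** The mean [ga] is estimated by averaging over [E], which fills a fixed proportion of the ball:
    there [ga] equals [S F] up to [S F0], controlled in [L^2], and the oscillation of [S Fi]. *)
Lemma piece_mean (E : set (borel X)) : measurable E -> E `<=` B x r ->
  M <= K * mr E ->
  acost mu latom (fun y => - ga * b y)
    (K * H * (I (fun y => `|S F y| * \1_E y) + (A * K ^+ l0 * K + 2 * C1) * k * mr E)).
Proof.
move=> mE EB fat.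
have fE := fin_sub hs mE r0 EB.
have iE := intg_indic mE fE.
have bE : bbf (\1_E).
  exists x, r, 1; split; last by move=> y; exact: norm_indic.
  by split => // y nB; rewrite indicE memNset// => /EB.
have iabs u : bbf u -> intg (fun y => `|S u y| * \1_E y).
  move=> bu; apply: eq_intg (intg_norm (sqi_bbf hs (op_sqi hS bu) bE)) => y.
  by rewrite indic_norm_mul.
apply: (acost_latom hs (x := x) (r := r) (H := `|ga| * H)).
- exact: ball_funZ.
- by move=> y; rewrite normrM normrN ler_wpM2l.
- by rewrite IZ ?Ib ?mulr0//; exact: (bbf_intg hs).
rewrite -/M; set J := I _.
have near0 : I (fun y => `|S F0 y| * \1_E y) <= A * K ^+ l0 * K * k * mr E.
  apply: (@le_trans _ _ (I (fun y => `|S F0 y * \1_(B x r) y|))).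
    apply: I_le => [||y]; first exact: iabs.
      by apply: intg_norm; apply: (sqi_bbf hs sSF0); exact: (bbf_ball hs).
    rewrite indic_norm_mul ler_wpM2l//; have [[/EB Ey ->]|[_ ->]] := @indicP _ R E y.
      by rewrite indicE mem_set.
    by rewrite indicE ler0n.
  apply: le_trans (op_CS A0 hS bF0 (sqi_ball hs x r0)) _.
  have K10 : 1 <= K ^+ l0 by apply: exprn_ege1; exact: ltW.
  rewrite (I_indic_sq mu (meas_ball hs x r0)) -/M.
  apply: (@le_trans _ _ (A * (k * (K ^+ l0 * M)))).
    rewrite -mulrA ler_pM2l// -sqrtrM; last by apply: I_ge0 => y; exact: sqr_ge0.
    rewrite -[leRHS]ger0_norm -?sqrtr_sqr; last by rewrite !mulr_ge0 ?exprn_ge0 ?(ltW K0) ?(ltW M0).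
    rewrite ler_wsqrtr//.
    apply: (@le_trans _ _ (k ^+ 2 * (K ^+ l0 * M) * (K ^+ l0 * M))); last first.
      by rewrite le_eqVlt; apply/orP; left; apply/eqP; ring.
    apply: ler_pM; [by apply: I_ge0 => y; exact: sqr_ge0|exact: ltW| |by rewrite ler_peMl// ltW].
    apply: le_trans (ball_fun_sq_le hs (x := x) (r := c ^+ l0 * r) _ hF0) _.
      split => //; first exact: bbf_meas bF0.
      by move=> y nB; rewrite /F0 indicE memNset// mulr0.
    by rewrite ler_wpM2l ?sqr_ge0//; exact: (m_dbl hs).
  rewrite (_ : A * (k * (K ^+ l0 * M)) = A * K ^+ l0 * k * M); last by ring.
  rewrite (_ : _ * _ * K * k * _ = A * K ^+ l0 * k * (K * mr E)); last by ring.
  by rewrite ler_wpM2l// !mulr_ge0 ?exprn_ge0 ?(ltW A0) ?(ltW K0).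
have le1 : `|ga| * mr E <= J + (A * K ^+ l0 * K + 2 * C1) * k * mr E.
  rewrite -{1}(I_indic mu mE) -IZ//.
  apply: (@le_trans _ _ (I (fun y => (`|S F y| * \1_E y + `|S F0 y| * \1_E y) + 2 * C1 * k * \1_E y))).
    apply: I_le_ae; [exact: intgZ|by apply: intgD; [apply: intgD; exact: iabs|exact: intgZ]|].
    apply: (ae_imp2 osc (op_add hS bF0 bFi)) => y ho hadd.
    have [[Ey ->]|[_ ->]] := @indicP _ R E y; last by rewrite !mulr0 !addr0.
    rewrite !mulr1; have {}ho := ho (EB _ Ey).
    have hF' : S F y = S F0 y + S Fi y.
      by rewrite -hadd; congr (S _ y); apply/funext => z; rewrite FE.
    have -> : ga = (S F y - S F0 y) - (S Fi y - ga) by rewrite hF'; ring.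
    by apply: le_trans (ler_normB _ _) _; apply: lerD => //; exact: ler_normB.
  rewrite ID; [|by apply: intgD; exact: iabs|exact: intgZ].
  rewrite ID; [|exact: iabs|exact: iabs].
  rewrite IZ// I_indic// -/J.
  rewrite (_ : J + _ * k * _ = J + A * K ^+ l0 * K * k * mr E + 2 * C1 * k * mr E); last by ring.
  by rewrite lerD2r lerD2l.
have g0 : 0 <= `|ga| by [].
rewrite (_ : `|ga| * H * M = H * (`|ga| * M)); last by ring.
rewrite (_ : K * H * _ = H * (K * (J + (A * K ^+ l0 * K + 2 * C1) * k * mr E))); last by ring.
apply: ler_wpM2l => //; apply: (@le_trans _ _ (`|ga| * (K * mr E))); first exact: ler_wpM2l.
by rewrite mulrCA ler_wpM2l// ltW.
Qed.

Let q y := S' b y * Fi y.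
Let iq : intg q. Proof. exact: (sqi_bbf hs sSb bFi). Qed.
(** The mass of [q] outside the ball of index [l], which the atoms inside have to compensate. *)
Let s l := I (fun y => q y * \1_(~` Bl l) y).
Let iql l : intg (fun y => q y * \1_(~` Bl l) y). Proof. exact: intgM_indic. Qed.

Let s_le l : (l0 <= l)%N -> `|s l| <= C1 * k * theta ^+ l * Nb.
Proof.
move=> ll; apply: le_trans (I_abs (iql l)) _.
have bv : bbf (fun y => Fi y * \1_(~` Bl l) y) by exact: bbfM_indic.
have v0 y : Bl l y -> Fi y * \1_(~` Bl l) y = 0.
  by move=> h; rewrite indicE memNset ?mulr0//; apply.
have v1 y : `|Fi y * \1_(~` Bl l) y| <= k.
  by rewrite normrM -[leRHS]mulr1; apply: ler_pM => //; exact: norm_indic.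
apply: le_trans (pair_tail hs hp bb bbb Ib ll bv v1 v0).
rewrite le_eqVlt; apply/orP; left; apply/eqP; apply: eq_I => y.
by congr (`| _ |); rewrite /q; ring.
Qed.

(** The annular part of [q], corrected by the outer masses [s] spread evenly over the two balls.
    With [l = l0 + j] the integral is [(s l - s (l+1)) - s l + s (l+1) = 0], and the corrections
    telescope over [j]. *)
Let ann j y := q y * (\1_(~` Bl (l0 + j)) y - \1_(~` Bl (l0 + j).+1) y)
  - s (l0 + j) / m x (c ^+ (l0 + j) * r) * \1_(Bl (l0 + j)) y
  + s (l0 + j).+1 / m x (c ^+ (l0 + j).+1 * r) * \1_(Bl (l0 + j).+1) y.

Let ibl l : intg (\1_(Bl l)). Proof. exact: (intg_ball hs). Qed.

(** The height is of order [theta^l / m] on the inner ball and the support is the outer ball, whose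
    measure is at most [K] times larger; the decay in [j] remains. *)
Lemma piece_annulus j :
  acost mu latom (ann j) (K * (A + 2 * C1) * k * Nb * theta ^+ j).
Proof.
rewrite /ann; set l := (l0 + j)%N.
have ll : (l0 <= l)%N by exact: leq_addr.
set m1 := m x (c ^+ l * r); set m2 := m x (c ^+ l.+1 * r).
have m10 : 0 < m1 by exact: (m_gt0 hs).
have m20 : 0 < m2 by exact: (m_gt0 hs).
have m12 : m1 <= m2.
  apply: (mr_sub hs) => //; first exact: mBl.
  by apply: ball_mono; rewrite exprS -mulrA; have := cr_ge hs 1 (Bl0 l); rewrite expr1.
have m21 : m2 <= K * m1 by have := m_dbl hs 1 x (Bl0 l); rewrite !expr1 mulrA -exprS.
have BlS y : Bl l y -> Bl l.+1 y.
  by apply: ball_mono; rewrite exprS -mulrA; have := cr_ge hs 1 (Bl0 l); rewrite expr1.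
have thl : theta ^+ l.+1 <= theta ^+ l by rewrite exprS ler_piMl ?exprn_ge0// ltW.
have thj : theta ^+ l <= theta ^+ j.
  by rewrite /l exprD ler_piMl ?exprn_ge0// exprn_ile1// ltW.
have i1 : intg (fun y => q y * (\1_(~` Bl l) y - \1_(~` Bl l.+1) y)).
  by apply: eq_intg (intgB (iql l) (iql l.+1)) => y; rewrite mulrBr.
have i2 := intgZ (s l / m1) (ibl l); have i3 := intgZ (s l.+1 / m2) (ibl l.+1).
pose H' := (A + 2 * C1) * k * Nb * theta ^+ l / m1.
have AC0 : 0 <= A + 2 * C1 by rewrite addr_ge0 ?(ltW A0)// mulr_ge0.
have H'0 : 0 <= H'.
  by apply: divr_ge0; [rewrite !(mulr_ge0 _ (exprn_ge0 _ _))// !mulr_ge0|exact: ltW].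
have ia := intgD (intgB i1 i2) i3.
apply: (acost_latom_ae (x := x) (r := c ^+ l.+1 * r) (H := H')) => //.
- split => //; first exact: intg_meas ia.
  move=> y nB; have nB1 : ~ Bl l y by move=> /BlS.
  rewrite [\1_(Bl l) y]indicE [\1_(Bl l.+1) y]indicE !memNset// !mulr0.
  by rewrite !indicE !mem_set// subrr mulr0 subr0 addr0.
- have ae := pair_tail_ae hs hp bb bbb Ib ll.
  apply: (ae_imp ae) => y hy.
  have e1 : `|s l / m1 * \1_(Bl l) y| <= C1 * k * theta ^+ l * Nb / m1.
    rewrite normrM -[leRHS]mulr1; apply: ler_pM => //; last exact: norm_indic.
    by rewrite normrM normfV (gtr0_norm m10) ler_wpM2r ?invr_ge0 ?(ltW m10)// s_le.
  have e2 : `|s l.+1 / m2 * \1_(Bl l.+1) y| <= C1 * k * theta ^+ l * Nb / m1.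
    rewrite normrM -[leRHS]mulr1; apply: ler_pM => //; last exact: norm_indic.
    rewrite normrM normfV (gtr0_norm m20); apply: ler_pM => //; rewrite ?invr_ge0 ?(ltW m20)//.
      apply: le_trans (s_le (leq_trans ll (leqnSn _))) _.
      by rewrite ler_wpM2r// ler_wpM2l// mulr_ge0.
    by rewrite lef_pV2.
  have e0 : `|q y * (\1_(~` Bl l) y - \1_(~` Bl l.+1) y)| <= A * theta ^+ l * Nb / m1 * k.
    have ub0 : 0 <= A * theta ^+ l * Nb / m1 * k.
      by rewrite !mulr_ge0 ?exprn_ge0 ?(ltW A0) ?invr_ge0 ?(ltW m10).
    have c1 := indic_split l y; have c2 := indic_split l.+1 y.
    have [[By e]|[nB e]] := @indicP _ R (Bl l) y; rewrite e in c1.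
      have e2' : \1_(Bl l.+1) y = 1 :> R by rewrite indicE mem_set//; exact: BlS.
      rewrite e2' in c2.
      rewrite (_ : \1_(~` Bl l) y - _ = 0) ?mulr0 ?normr0//; lra.
    rewrite normrM -[leRHS]mulr1; apply: ler_pM => //.
      by rewrite normrM; apply: ler_pM => //; exact: hy.
    rewrite (_ : _ - _ = \1_(Bl l.+1) y); last by lra.
    exact: norm_indic.
  apply: le_trans (ler_normD _ _) _; apply: le_trans (lerD (ler_normB _ _) (lexx _)) _.
  apply: le_trans (lerD (lerD e0 e1) e2) _.
  rewrite /H' le_eqVlt; apply/orP; left; apply/eqP; field.
  by rewrite gt_eqF//= subr_eq0 gt_eqF.
- rewrite ID//; last exact: intgB.
  rewrite IB// !IZ// !(I_ball hs)// !divfK ?gt_eqF//.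
  rewrite (eq_I mu (g := fun y => q y * \1_(~` Bl l) y - q y * \1_(~` Bl l.+1) y)); last first.
    by move=> y; rewrite mulrBr.
  by rewrite IB// /s; ring.
- rewrite /H' -/m2; apply: (@le_trans _ _ ((A + 2 * C1) * k * Nb * theta ^+ l / m1 * (K * m1))).
    by rewrite ler_wpM2l.
  rewrite [leLHS](_ : _ = K * (A + 2 * C1) * k * Nb * theta ^+ l); last by field; rewrite ?(gt_eqF m10)//= ?subr_eq0 ?gt_eqF.
  by rewrite ler_wpM2l// !mulr_ge0// ltW.
Qed.

(** The correction left over by the telescoping annuli restores mean zero: [s l0] is the integral of
    [S' b . Fi], hence by duality that of [b . S Fi]. *)
Let core y := - (b y * (S Fi y - ga)) + s l0 / m x (c ^+ l0 * r) * \1_(Bl l0) y.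

Lemma piece_core : acost mu latom core (3 * C1 * H * k * (K ^+ l0 * M)).
Proof.
have ib := bbf_intg hs bbb.
have i1 : intg (fun y => b y * (S Fi y - ga)).
  apply: eq_intg (intgB (sqi_bbf hs sSFi bbb) (intgZ ga ib)) => y; ring.
have m0 := m_gt0 hs x (Bl0 l0).
have Is : s l0 = I (fun y => S' b y * Fi y).
  apply: eq_I => y; rewrite /q; have := indic_split l0 y.
  have [[h ->]|[h ->]] := @indicP _ R (Bl l0) y.
    by rewrite (Fi0 h) !mulr0 mul0r.
  by rewrite add0r => ->; rewrite mulr1.
have ic : intg core by apply: intgD; [exact: intgN|apply: intgZ; exact: ibl].
apply: (acost_latom_ae (x := x) (r := c ^+ l0 * r) (H := 3 * C1 * H * k)) => //.
- split => //; first exact: intg_meas ic.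
  move=> y nB; rewrite /core [\1_(Bl l0) y]indicE memNset// mulr0 addr0.
  have [_ _ ->] := bb; first by rewrite mul0r oppr0.
  by move=> h; apply: nB; apply: (ball_mono _ h); exact: (cr_ge hs).
- by rewrite mulr_ge0// mulr_ge0// mulr_ge0.
- apply: (ae_imp osc) => y ho.
  have e1 : `|b y * (S Fi y - ga)| <= H * (2 * C1 * k).
    rewrite normrM; have [[h _]|[h _]] := @indicP _ R (B x r) y.
      by apply: ler_pM => //; exact: ho.
    have [_ _ ->] := bb => //; rewrite normr0 mul0r.
    by rewrite mulr_ge0// mulr_ge0// mulr_ge0.
  have e2 : `|s l0 / m x (c ^+ l0 * r) * \1_(Bl l0) y| <= C1 * k * H.
    rewrite normrM -[leRHS]mulr1; apply: ler_pM => //; last exact: norm_indic.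
    rewrite normrM normfV (gtr0_norm m0) ler_pdivrMr//.
    apply: le_trans (s_le (leqnn _)) _.
    rewrite -[leRHS]mulrA -(mulrA (C1 * k)); apply: ler_wpM2l; first exact: mulr_ge0.
    apply: le_trans (_ : 1 * Nb <= _); first by rewrite ler_wpM2r// exprn_ile1// ltW.
    by rewrite mul1r; apply: le_trans NbH _; rewrite ler_wpM2l.
  apply: le_trans (ler_normD _ _) _; rewrite normrN; apply: le_trans (lerD e1 e2) _.
  by rewrite le_eqVlt; apply/orP; left; apply/eqP; ring.
- rewrite ID; [|exact: intgN|by apply: intgZ; exact: ibl].
  rewrite IN// IZ ?(I_ball hs)// ?divfK ?gt_eqF//.
  rewrite (eq_I mu (g := fun y => S Fi y * b y - ga * b y)); last by move=> y; ring.
  rewrite IB; [|exact: (sqi_bbf hs sSFi bbb)|exact: intgZ].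
  rewrite IZ// Ib mulr0 subr0 Is adj//.
  by apply/eqP; rewrite addrC subr_eq0; apply/eqP; apply: eq_I => y; rewrite mulrC.
- apply: ler_wpM2l; first by rewrite mulr_ge0// mulr_ge0// mulr_ge0.
  exact: (m_dbl hs).
Qed.

Let ann_sum N y : \sum_(j < N) ann j y = q y * (\1_(~` Bl l0) y - \1_(~` Bl (l0 + N)) y)
  - s l0 / m x (c ^+ l0 * r) * \1_(Bl l0) y
  + s (l0 + N) / m x (c ^+ (l0 + N) * r) * \1_(Bl (l0 + N)) y.
Proof.
elim: N => [|N IH]; first by rewrite big_ord0 addn0; ring.
by rewrite big_ord_recr/= IH /ann addnS; ring.
Qed.

(** Constants of the near, mean, core and annular parts. The factor [K] passes from the measure of
    the ball to that of [E]; the last summand [K] pays for the integral of [|S F|]. *)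
Definition bil_const : R :=
  (24 * K ^+ 6 * A * K ^+ l0 + (A * K ^+ l0 * K + 2 * C1)
    + 3 * C1 * K ^+ l0 + K * (A + 2 * C1) / (1 - theta)) * K + K.

Lemma bil_piece (E : set (borel X)) : measurable E -> E `<=` B x r ->
  M <= K * mr E ->
  acost mu latom (bil S S' b F)
    (bil_const * H * (k * mr E + I (fun y => `|S F y| * \1_E y))).
Proof.
move=> mE EB fat; set J := I _; set e := mr E.
have [rF [kF [[mF rF0 F0F] _ _]]] := bbf_at hs x bF.
have [N hN] := expr_unbounded (rF / r) (c_gt1 hs).
have rN : rF <= c ^+ (l0 + N) * r.
  rewrite -ler_pdivrMr//; apply: le_trans (ltW hN) _.
  by apply: ler_weXn2l; [exact: ltW (c_gt1 hs)|exact: leq_addl].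
have Fi_out y : ~ Bl (l0 + N) y -> Fi y = 0.
  move=> nB; rewrite /Fi F0F ?mul0r// => h; apply: nB; exact: (ball_mono rN h).
(* The bounded support of [F] makes the telescoping end exactly after finitely many annuli. *)
have sN : s (l0 + N) = 0.
  rewrite /s -[RHS](I0 mu); apply: eq_I => y.
  have [[_ e0]|[nB _]] := @indicP _ R (Bl (l0 + N)) y.
    have := indic_split (l0 + N) y; rewrite e0 => h.
    by rewrite (_ : \1_(~` _) y = 0) ?mulr0//; lra.
  by rewrite /q Fi_out// mulr0 mul0r.
have cS := acost_bigsum (latom_family hs) (n := N) (fun j _ => piece_annulus j).
have cT := acostD (latom_family hs) piece_near
  (acostD (latom_family hs) (piece_mean mE EB fat)
    (acostD (latom_family hs) piece_core cS)).
have tot : {ae mu, forall y, (S' b y * F0 y - b y * S F0 y) +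
    (- ga * b y + (core y + \sum_(j < N) ann j y)) = bil S S' b F y}.
  apply: (ae_imp (op_add hS bF0 bFi)) => y hadd.
  have hF' : S F y = S F0 y + S Fi y.
    by rewrite -hadd; congr (S _ y); apply/funext => z; rewrite FE.
  have z1 : q y * (\1_(~` Bl l0) y - \1_(~` Bl (l0 + N)) y) = q y.
    have h1 := indic_split l0 y; have h2 := indic_split (l0 + N) y.
    have [[B0 _]|[_ e0]] := @indicP _ R (Bl l0) y; first by rewrite /q Fi0// mulr0 mul0r.
    have [[_ e1]|[nB _]] := @indicP _ R (Bl (l0 + N)) y; last by rewrite /q Fi_out// mulr0 mul0r.
    rewrite e0 in h1; rewrite e1 in h2; rewrite (_ : _ - _ = 1) ?mulr1//; lra.
  rewrite ann_sum sN z1 /core /bil hF' /q (FE y); ring.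
have mbil : meas (bil S S' b F).
  apply: measurable_funB; apply: measurable_funM.
  - by case: sSb.
  - exact: bbf_meas bF.
  - exact: bbf_meas bbb.
  - exact: (op_meas hS bF).
apply: acost_le (acost_eq_ae cT mbil tot (latom_family hs)) _.
have e0 : 0 <= e by exact: mr_ge0.
have J0 : 0 <= J by apply: I_ge0 => y; rewrite mulr_ge0// indicE ler0n.
have geo := geometric_sum_le N th0 th1.
rewrite -mulr_sumr.
have P0 : 0 <= K ^+ l0 by rewrite exprn_ge0// ltW.
have A0' := ltW A0; have K0' := ltW K0.
have Hk : 0 <= H * k by rewrite mulr_ge0.
have HkM : H * k * M <= H * k * (K * e) by rewrite ler_wpM2l.
have t1 : 0 <= (1 - theta)^-1 by rewrite invr_ge0 subr_ge0 ltW.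
have T1 : 12 * K ^+ 6 * (2 * A * H * k * K ^+ l0 * M) <= 24 * K ^+ 6 * A * K ^+ l0 * (H * k * (K * e)).
  rewrite (_ : 12 * _ * _ = 24 * K ^+ 6 * A * K ^+ l0 * (H * k * M)); last by ring.
  by rewrite ler_wpM2l// !mulr_ge0 ?exprn_ge0.
have T3 : 3 * C1 * H * k * (K ^+ l0 * M) <= 3 * C1 * K ^+ l0 * (H * k * (K * e)).
  rewrite (_ : 3 * C1 * H * k * _ = 3 * C1 * K ^+ l0 * (H * k * M)); last by ring.
  by rewrite ler_wpM2l// mulr_ge0// mulr_ge0.
have T4 : K * (A + 2 * C1) * k * Nb * \sum_(j < N) theta ^+ j <=
    K * (A + 2 * C1) / (1 - theta) * (H * k * (K * e)).
  have AC : 0 <= K * (A + 2 * C1) by rewrite mulr_ge0// addr_ge0// mulr_ge0.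
  apply: (@le_trans _ _ (K * (A + 2 * C1) * k * (H * M) * (1 - theta)^-1)).
    apply: ler_pM => //; [by apply: mulr_ge0 => //; exact: mulr_ge0|by rewrite sumr_ge0// => j _; rewrite exprn_ge0|].
    by rewrite ler_wpM2l// mulr_ge0.
  rewrite (_ : K * (A + 2 * C1) * k * _ * _ = K * (A + 2 * C1) / (1 - theta) * (H * k * M)); last by ring.
  by rewrite ler_wpM2l// mulr_ge0.
apply: le_trans (lerD T1 (lerD (lexx _) (lerD T3 T4))) _.
have pos : 0 <= ((24 * K ^+ 6 * A * K ^+ l0 + (A * K ^+ l0 * K + 2 * C1)
    + 3 * C1 * K ^+ l0 + K * (A + 2 * C1) / (1 - theta)) * K) * H * J.
  apply: mulr_ge0 => //; apply: mulr_ge0 => //; apply: mulr_ge0 => //.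
  have h2C : 0 <= 2 * C1 by rewrite mulr_ge0.
  apply: addr_ge0; last by rewrite mulr_ge0// mulr_ge0// addr_ge0.
  apply: addr_ge0; last by rewrite mulr_ge0// mulr_ge0.
  apply: addr_ge0; first by rewrite !mulr_ge0 ?exprn_ge0.
  by apply: addr_ge0 => //; rewrite !mulr_ge0.
have pos2 : 0 <= K * H * (k * e) by rewrite !mulr_ge0.
rewrite -subr_ge0; apply: le_trans (addr_ge0 pos pos2) _.
rewrite le_eqVlt; apply/orP; left; apply/eqP; rewrite /bil_const -/e -/J.
ring.
Qed.

Lemma bil_const_ge0 : 0 <= bil_const.
Proof.
have A0' := ltW A0; have K0' := ltW K0.
have P0 : 0 <= K ^+ l0 by rewrite exprn_ge0.
have h2C : 0 <= 2 * C1 by rewrite mulr_ge0.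
have t1 : 0 <= (1 - theta)^-1 by rewrite invr_ge0 subr_ge0 ltW.
apply: addr_ge0 => //; apply: mulr_ge0 => //.
apply: addr_ge0; last by rewrite mulr_ge0// mulr_ge0// addr_ge0.
apply: addr_ge0; last by rewrite mulr_ge0// mulr_ge0.
apply: addr_ge0; first by rewrite !mulr_ge0 ?exprn_ge0.
by apply: addr_ge0 => //; rewrite !mulr_ge0.
Qed.

End piece.

End pair.

End pieces.

(** * One spreading step for the form *)

Section restricted.
Context (R : realType) (X : ptopologicalType).
Variables (mu : {measure set (borel X) -> \bar R}) (d : X -> X -> R).
Variables (c K eta : R).
Hypothesis hs : growing_space mu d c K eta.
Local Notation B := (qball d).
Local Notation mr A := (fine (mu A)).
Local Notation m x r := (mr (B x r)).
Local Notation intg := (intg mu).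
Local Notation sqi := (sqi mu).
Local Notation I := (I mu).
Local Notation bbf := (bbf d).
Local Notation small := (small mu d).
Local Notation latom := (latom mu d).
Local Notation meas := (measurable_fun [set: borel X]).
Implicit Types (f g u v b F w : X -> R) (x y : X) (r k h a t H : R).
Let K0 := K_gt0 hs.
Let K1 := K_gt1 hs.

Lemma small_h0 g h a : small g h a -> 0 <= h.
Proof. by move=> [_ hg _]; exact: le_trans (normr_ge0 _) (hg point). Qed.

Section basic.
Variables (S S' : (X -> R) -> X -> R) (A theta : R) (l0 : nat).
Hypothesis hp : czpair mu d c S S' A theta l0.
Let A0 := pair_A hp.
Let hS := pair_half hp.
Let hS' := pair_half' hp.

Lemma intg_bil g F : bbf g -> bbf F -> intg (bil S S' g F).
Proof.
move=> bg bF; apply: intgB; first exact: (sqi_bbf hs (op_sqi hS' bg) bF).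
by apply: eq_intg (sqi_bbf hs (op_sqi hS bF) bg) => y; rewrite mulrC.
Qed.

Lemma bil_norm g F : bbf g -> bbf F -> I (fun y => `|bil S S' g F y|) <=
  2 * A * Num.sqrt (I (fun y => g y ^+ 2)) * Num.sqrt (I (fun y => F y ^+ 2)).
Proof.
move=> bg bF; have i1 := sqi_bbf hs (op_sqi hS' bg) bF.
have i2 := sqi_bbf hs (op_sqi hS bF) bg.
apply: (@le_trans _ _ (I (fun y => `|S' g y * F y| + `|S F y * g y|))).
  apply: I_le => [||y].
  - by apply: intg_norm; exact: intg_bil.
  - by apply: intgD; exact: intg_norm.
  - by apply: le_trans (ler_normB _ _) _; rewrite (mulrC (g y)).
rewrite ID; [|exact: intg_norm|exact: intg_norm].
have := op_CS A0 hS' bg (bbf_sqi hs bF); have := op_CS A0 hS bF (bbf_sqi hs bg).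
lra.
Qed.

Lemma bil_norm_small g F h k a t : small g h a -> small F k t -> 0 <= a -> 0 <= t ->
  I (fun y => `|bil S S' g F y|) <= 2 * A * h * k * Num.sqrt (a * t).
Proof.
move=> sg sF a0 t0; have [bg _ _] := sg; have [bF _ _] := sF.
have [hg _] := small_norms hs sg; have [hF _] := small_norms hs sF.
have h0 := small_h0 sg; have k0 := small_h0 sF.
apply: le_trans (bil_norm bg bF) _; rewrite sqrtrM//.
have e1 : Num.sqrt (I (fun y => g y ^+ 2)) <= h * Num.sqrt a.
  rewrite -(ger0_norm h0) -sqrtr_sqr -sqrtrM ?sqr_ge0//; exact: ler_wsqrtr.
have e2 : Num.sqrt (I (fun y => F y ^+ 2)) <= k * Num.sqrt t.
  rewrite -(ger0_norm k0) -sqrtr_sqr -sqrtrM ?sqr_ge0//; exact: ler_wsqrtr.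
rewrite -!mulrA; apply: ler_wpM2l => //; apply: ler_wpM2l; first exact: ltW.
apply: (@le_trans _ _ ((h * Num.sqrt a) * (k * Num.sqrt t))); first exact: ler_pM.
by rewrite le_eqVlt; apply/orP; left; apply/eqP; ring.
Qed.

Lemma bilDl u v F : bbf u -> bbf v ->
  {ae mu, forall y, bil S S' (fun z => u z + v z) F y = bil S S' u F y + bil S S' v F y}.
Proof.
move=> bu bv; apply: (ae_imp (op_add hS' bu bv)) => y h.
by rewrite /bil h; ring.
Qed.

Lemma bil_suml n (u : nat -> X -> R) F : (forall i, bbf (u i)) ->
  {ae mu, forall y, bil S S' (fun z => \sum_(i < n) u i z) F y = \sum_(i < n) bil S S' (u i) F y}.
Proof.
move=> hu; apply: (ae_imp (op_sum hs hS' n hu)) => y h.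
by rewrite /bil h sumrB !mulr_suml.
Qed.

(** The form of [g - gt] is summed piece by piece. The integrals of [|S F|] over the disjoint pieces
    combine into one over their union, a set of measure at most [3 K L a], which
    [level_estimate_dual] bounds. *)
Lemma bil_step (L : R) : K <= L -> exists2 C : R, 0 < C &
  forall n g F h k a t, 0 < a -> small g h a -> small F k t ->
    t <= (3 * K * L) ^+ n * a ->
    exists gt w, [/\ small gt (h * K / L) (3 * K * L * a),
      acost mu latom w (C * (4 * K ^+ 2) ^+ n * h * k * a) &
      {ae mu, forall y, bil S S' g F y = w y + bil S S' gt F y}].
Proof.
move=> KL; have [Cd Cd0 hCd] := level_estimate_dual hs hp KL.
have L0 : 0 < L by exact: lt_le_trans KL.
set M := 3 * K * L; have M0 : 0 < M by rewrite !mulr_gt0.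
have M1 : 1 <= M.
  have L1 : 1 <= L by apply: le_trans KL; exact: ltW.
  have : 1 <= K * L by rewrite -[X in X <= _]mulr1; apply: ler_pM => //; exact: ltW.
  by rewrite /M; lra.
have Cb0 := bil_const_ge0 hs hp; set Cb := bil_const _ _ _ _ in Cb0.
exists (Cb * 2 * M * (1 + Cd) + 1).
  apply: ltr_pwDr => //; apply: mulr_ge0; last by rewrite addr_ge0// ltW.
  by apply: mulr_ge0; [exact: mulr_ge0|exact: ltW].
move=> n g F h k a t a0 sg sF ta.
have [x_ [r_ [E sp]]] := spread hs KL a0 sg.
case: sp => mE tE fE sgood bball bbd bI sub fat sm bU cv.
have [bg hg _] := sg; have [bF hF _] := sF; have [bgt _ _] := sgood.
have h0 := small_h0 sg; have k0 := small_h0 sF.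
set gt := czgood mu E g in sgood bgt cv *; pose be := czbad mu E g.
pose de y := g y - gt y.
have bde : bbf de by exact: (bbfB hs bg bgt).
have bbe i : bbf (be i) by exact: bbf_bounded (bball i) (bbd i).
have bsum n' : bbf (fun y => \sum_(i < n') be i y) by apply: (bbf_sum hs) => i; exact: bbe.
exists gt, (bil S S' de F); split => //; last first.
  apply: (ae_imp (bilDl F bde bgt)) => y <-; congr (bil _ _ _ F y).
  by apply/funext => z; rewrite /de subrK.
have iSE (U : set (borel X)) : measurable U -> bbf (\1_U) -> intg (fun y => `|S F y| * \1_U y).
  move=> mU bU'; apply: eq_intg (intg_norm (sqi_bbf hs (op_sqi hS bF) bU')) => y.
  by rewrite indic_norm_mul.
have bE i : bbf (\1_(E i)).
  rewrite (_ : \1_(E i) = fun y => \1_(\bigcup_j E j) y * \1_(E i) y); first exact: bbfM_indic.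
  apply/funext => y; have [[Ey ->]|[_ ->]] := @indicP _ R (E i) y; last by rewrite mulr0.
  by rewrite mulr1 indicE mem_set//; exists i.
pose J i := I (fun y => `|S F y| * \1_(E i) y).
have J0 i : 0 <= J i by apply: I_ge0 => y; rewrite mulr_ge0// indicE ler0n.
have mU : measurable (\bigcup_i E i : set (borel X)) by exact: bigcup_measurable.
have JU n' : \sum_(i < n') J i <= Cd * (4 * K ^+ 2) ^+ n * k * (M * a).
  apply: (@le_trans _ _ (I (fun y => `|S F y| * \1_(\bigcup_i E i) y))).
    rewrite -I_sum; last by move=> i _; exact: iSE.
    apply: I_le => [||y]; [by apply: intg_sum => i _; exact: iSE|exact: iSE|].
    rewrite -mulr_sumr ler_wpM2l//.
    have [[i Ei]|nE] := pselect (exists i : 'I_n', E i y).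
      rewrite (bigD1 i)//= big1 ?addr0.
        by rewrite !indicE !mem_set//; exists i.
      move=> j ji; have [[Ej _]|[_ //]] := @indicP _ R (E j) y.
      by move/eqP: ji; case; apply/val_inj/tE => //; exists y.
    rewrite big1; first by rewrite indicE ler0n.
    move=> i _; have [[Ei _]|[_ //]] := @indicP _ R (E i) y.
    by case: nE; exists i.
  have Ma0 : 0 < M * a by rewrite mulr_gt0.
  apply: (hCd n F _ k (M * a) t Ma0 sF mU bU).
    have := mr_bigcup_le mE fE tE sm; rewrite -/M.
    rewrite (mu_fine (A := \bigcup_i E i)) ?lee_fin//.
    by apply: le_lt_trans (mr_bigcup_le mE fE tE sm) _; exact: ltry.
  apply: le_trans ta _; apply: ler_wpM2l; first by rewrite exprn_ge0// ltW.
  by rewrite ler_peMl// ltW.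
have cost i : acost mu latom (bil S S' (be i) F) (Cb * (2 * h) * (k * mr (E i) + J i)).
  have [Ei|fati] := fat i.
    have bi0 : be i = fun=> 0 by apply/funext => y; rewrite /be /czbad Ei indic0 mulr0.
    apply: (acost_eq_ae (acost0 (latom_family hs) _)).
    - apply: mulr_ge0; first by apply: mulr_ge0 => //; exact: mulr_ge0.
      by apply: addr_ge0 => //; apply: mulr_ge0.
    - by apply: intg_meas (intg_bil (bbe i) bF).
    - by rewrite bi0; apply: (ae_imp (op_zero hS')) => y hy; rewrite /bil hy !mul0r subrr.
    - exact: (latom_family hs).
  exact: (bil_piece hs hp (bball i) (bbd i) (bI i) bF hF (mE i) (sub i) fati).
apply: (@acost_series _ (borel X) R mu latom (fun i => bil S S' (be i) F)
  (fun i => Cb * (2 * h) * (k * mr (E i) + J i)) (bil S S' de F) _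
  (latom_family hs) (intg_bil bde bF) cost).
  move=> n'; rewrite -mulr_sumr big_split/= -mulr_sumr.
  apply: (@le_trans _ _ (Cb * (2 * h) * (k * (M * a) + Cd * (4 * K ^+ 2) ^+ n * k * (M * a)))).
    apply: ler_wpM2l; first by apply: mulr_ge0 => //; exact: mulr_ge0.
    by apply: lerD; [apply: ler_wpM2l => //; exact: sm|exact: JU].
  set P := (4 * K ^+ 2) ^+ n.
  have P1 : 1 <= P.
    apply: exprn_ege1; have : 1 <= K ^+ 2 by apply: exprn_ege1; exact: ltW.
    lra.
  have hka : 0 <= h * k * a by rewrite !mulr_ge0// ltW.
  rewrite (_ : Cb * _ * _ = Cb * 2 * M * (1 + Cd * P) * (h * k * a)); last by ring.
  rewrite (_ : _ * P * h * k * a = (Cb * 2 * M * (1 + Cd) * P + P) * (h * k * a)); last by ring.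
  apply: ler_wpM2r => //.
  have X0 : 0 <= Cb * 2 * M by apply: mulr_ge0; [exact: mulr_ge0|exact: ltW].
  rewrite -[leLHS]addr0; apply: lerD; last by lra.
  rewrite -[leRHS]mulrA; apply: ler_wpM2l => //.
  by rewrite mulrDl mul1r lerD2r.
have key n' : I (fun y => `|bil S S' de F y - \sum_(i < n') bil S S' (be i) F y|) <=
    2 * A * Num.sqrt (I (fun y => F y ^+ 2)) *
      Num.sqrt (I (fun y => (g y - gt y - \sum_(i < n') be i y) ^+ 2)).
  have bw : bbf (fun y => g y - gt y - \sum_(i < n') be i y) by exact: (bbfB hs bde (bsum n')).
  rewrite mulrAC; apply: le_trans (bil_norm bw bF).
  apply: I_le_ae.
  - apply: intg_norm; apply: intgB; first exact: intg_bil.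
    by apply: intg_sum => i _; exact: intg_bil.
  - by apply: intg_norm; exact: intg_bil.
  - apply: (ae_imp2 (bilDl F (bsum n') bw) (bil_suml n' F bbe)) => y h1 h2.
    rewrite -h2 (_ : de = fun z => \sum_(i < n') be i z + (g z - gt z - \sum_(i < n') be i z)).
      by rewrite h1 addrAC subrr add0r.
    by apply/funext => z; rewrite /de; ring.
apply: (@squeeze_cvgr _ _ _ _ (fun=> 0) (fun n' => 2 * A * Num.sqrt (I (fun y => F y ^+ 2)) *
      Num.sqrt (I (fun y => (g y - gt y - \sum_(i < n') be i y) ^+ 2)))).
- by apply: nearW => n'; rewrite I_ge0//=; exact: key.
- exact: cvg_cst.
- by apply: cvgn0_scale; exact: cvgn0_sqrt.
Qed.

End basic.

End restricted.

(** * The restricted estimate by alternate spreading *)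

Section restricted_estimate.
Context (R : realType) (X : ptopologicalType).
Variables (mu : {measure set (borel X) -> \bar R}) (d : X -> X -> R).
Variables (c K eta : R).
Hypothesis hs : growing_space mu d c K eta.
Local Notation intg := (intg mu).
Local Notation I := (I mu).
Local Notation bbf := (bbf d).
Local Notation small := (small mu d).
Local Notation latom := (latom mu d).
Implicit Types (f g u v b F w : X -> R) (x y : X) (r k h a t H : R).
Let K0 := K_gt0 hs.
Let K1 := K_gt1 hs.

Section pair.
Variables (S S' : (X -> R) -> X -> R) (A theta : R) (l0 : nat).
Hypothesis hp : czpair mu d c S S' A theta l0.
Let A0 := pair_A hp.

Lemma bil_sym g F y : bil S' S F g y = - bil S S' g F y.
Proof. by rewrite /bil; ring. Qed.

(** Spreading [g] and then [F] by the same factor brings both supports to measure at most [3 K L a]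
    and multiplies [h k a] by [(K/L)^2 (3 K L) = 3 K^3 / L]. *)
Lemma bil_halve : exists2 C : R, 0 < C & forall g F h k a,
  0 < a -> small g h a -> small F k a ->
  exists g' F' w h' k' a', [/\ [/\ 0 < a', small g' h' a' & small F' k' a'],
    acost mu latom w (C * (h * k * a)),
    {ae mu, forall y, bil S S' g F y = w y + bil S S' g' F' y} &
    h' * k' * a' <= h * k * a / 2].
Proof.
have KK : 1 <= K ^+ 2 by apply: exprn_ege1; exact: ltW.
have KL : K <= 6 * K ^+ 3.
  rewrite exprS mulrCA ler_peMr ?(ltW K0)//; lra.
(* This [L] makes [3 K^3 / L] equal to [1/2]. *)
set L := 6 * K ^+ 3 in KL.
have L0 : 0 < L by exact: lt_le_trans KL.
have [C1 C10 h1] := bil_step hs hp KL.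
have [C2 C20 h2] := bil_step hs (czpair_sym hp) KL.
exists (C1 + C2 * (4 * K ^+ 2)) => [|g F h k a a0 sg sF].
  by rewrite addr_gt0// !mulr_gt0// exprn_gt0.
have [|gt [w1 [sgt cw1 e1]]] := h1 0%N g F h k a a a0 sg sF.
  by rewrite expr0 mul1r.
(* The support of [gt] is already larger by one factor [3 K L], hence the index 1. *)
have [|Ft [w2 [sFt cw2 e2]]] := h2 1%N F gt k _ a _ a0 sF sgt.
  by rewrite expr1.
have a'0 : 0 < 3 * K * L * a by rewrite !mulr_gt0.
exists gt, Ft, (fun y => w1 y + -1 * w2 y), (h * K / L), (k * K / L), (3 * K * L * a).
have h0 := small_h0 sg; have k0 := small_h0 sF.
split => //.
- have := acostD (latom_family hs) cw1 (acostZ (-1) (latom_family hs) cw2).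
  move/acost_le; apply; rewrite normrN1 mul1r expr0 expr1 mulr1.
  have KL1 : K / L <= 1 by rewrite ler_pdivrMr// mul1r.
  have hka : 0 <= h * k * a by rewrite !mulr_ge0// ltW.
  rewrite (mulrDl C1); apply: lerD; first by rewrite !mulrA.
  rewrite (_ : _ * k * _ * a = C2 * (4 * K ^+ 2) * (h * k * a) * (K / L)); last by ring.
  by rewrite ler_piMr// !mulr_ge0 ?sqr_ge0// ltW.
- apply: (ae_imp2 e1 e2) => y; rewrite !bil_sym => -> h3.
  by rewrite -(opprK (bil S S' gt F y)) h3; ring.
- rewrite le_eqVlt; apply/orP; left; apply/eqP; rewrite /L; field.
  by rewrite gt_eqF.
Qed.

(** Iterated halving. With supports of equal measure the remaining form has [L^1] norm at most
    [2 A h k a], which tends to 0 along the iteration. *)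
Lemma bil_base : exists2 C : R, 0 < C & forall g F h k a,
  0 < a -> small g h a -> small F k a -> acost mu latom (bil S S' g F) (C * (h * k * a)).
Proof.
have [C C0 hC] := bil_halve.
exists (2 * C); first by rewrite mulr_gt0.
pose st := (((X -> R) * (X -> R)) * (R * R * R))%type.
pose sg (s : st) := s.1.1; pose sF (s : st) := s.1.2.
pose sh (s : st) := s.2.1.1; pose sk (s : st) := s.2.1.2; pose sa (s : st) := s.2.2.
pose sc s := sh s * sk s * sa s.
pose good s := [/\ 0 < sa s, small (sg s) (sh s) (sa s) & small (sF s) (sk s) (sa s)].
have /choice[nx hnx] : forall s : st, exists p : st * (X -> R), good s ->
    [/\ good p.1, acost mu latom p.2 (C * sc s),
      {ae mu, forall y, bil S S' (sg s) (sF s) y = p.2 y + bil S S' (sg p.1) (sF p.1) y} &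
      sc p.1 <= sc s / 2].
  move=> s; have [[a0 h1 h2]|ng] := pselect (good s); last by exists (s, fun=> 0).
  have [g' [F' [w [h' [k' [a' [p1 p2 p3 p4]]]]]]] := hC _ _ _ _ _ a0 h1 h2.
  by exists (((g', F'), ((h', k'), a')), w).
move=> g F h k a a0 smg smF.
pose s n := iter n (fun s => (nx s).1) ((g, F), ((h, k), a)).
have gs n : good (s n) by elim: n => [//|n IH]; have [] := hnx _ IH.
have c0 n : 0 <= sc (s n).
  have [h1 h2 h3] := gs n; have := small_h0 h2; have := small_h0 h3 => x1 x2.
  by rewrite /sc !mulr_ge0// ltW.
have scn n : sc (s n) <= h * k * a / 2 ^+ n.
  elim: n => [|n IH]; first by rewrite expr0 divr1.
  have [_ _ _ le] := hnx _ (gs n); apply: le_trans le _.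
  apply: le_trans (ler_wpM2r _ IH) _; first by rewrite invr_ge0.
  by rewrite exprS invfM mulrAC mulrA mulrAC.
have bb n : bbf (sg (s n)) /\ bbf (sF (s n)).
  by have [_ [h1 _ _] [h2 _ _]] := gs n.
have ibil n : intg (bil S S' (sg (s n)) (sF (s n))).
  by have [h1 h2] := bb n; exact: (intg_bil hs hp).
pose w n := (nx (s n)).2.
have cw n : acost mu latom (w n) (C * sc (s n)) by have [] := hnx _ (gs n).
have iw n := acost_intg (cw n).
have tele n : {ae mu, forall y, bil S S' g F y = \sum_(i < n) w i y +
    bil S S' (sg (s n)) (sF (s n)) y}.
  elim: n => [|n IH]; first by apply: aeW => y; rewrite big_ord0 add0r.
  have [_ _ e _] := hnx _ (gs n).
  by apply: (ae_imp2 IH e) => y -> ->; rewrite big_ord_recr/= addrA.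
apply: (@acost_series _ (borel X) R mu latom w (fun n => C * sc (s n)) (bil S S' g F) _
  (latom_family hs) (ibil 0%N) cw).
  move=> n; rewrite -mulr_sumr.
  rewrite (_ : 2 * C * _ = C * (2 * (h * k * a))); last by ring.
  rewrite ler_pM2l//.
  suff : \sum_(i < n) sc (s i) <= 2 * (h * k * a) - h * k * a / 2 ^+ n * 2.
    have : 0 <= h * k * a / 2 ^+ n * 2.
      by rewrite mulr_ge0// divr_ge0// ?exprn_ge0//; exact: (c0 0%N).
    by lra.
  elim: n => [|n IH]; first by rewrite big_ord0 expr0 divr1; lra.
  rewrite big_ord_recr/=; apply: le_trans (lerD IH (scn n)) _.
  by rewrite le_eqVlt; apply/orP; left; apply/eqP; rewrite exprS; field; rewrite expf_neq0.
apply: (@squeeze_cvgr _ _ _ _ (fun=> 0) (fun n => 2 * A * (h * k * a) * (1 / 2 ^+ n))).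
- apply: nearW => n; rewrite I_ge0//=.
  have [a1 h1 h2] := gs n.
  apply: (@le_trans _ _ (I (fun y => `|bil S S' (sg (s n)) (sF (s n)) y|))).
    apply: I_le_ae.
    + by apply: intg_norm; apply: intgB; [exact: (ibil 0%N)|apply: intg_sum => i _; exact: iw].
    + by apply: intg_norm; exact: ibil.
    + by apply: (ae_imp (tele n)) => y ->; rewrite addrAC subrr add0r.
  apply: le_trans (bil_norm_small hs hp h1 h2 (ltW a1) (ltW a1)) _.
  rewrite -expr2 sqrtr_sqr (gtr0_norm a1) (_ : _ * _ * _ * _ = 2 * A * sc (s n)); last first.
    by rewrite /sc; ring.
  rewrite -[leRHS]mulrA; apply: ler_wpM2l; first by rewrite mulr_ge0// ltW.
  by rewrite mul1r; exact: scn.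
- exact: cvg_cst.
- apply: cvgn0_scale.
  have := @cvg_geometric R 1 2^-1; rewrite ger0_norm// invf_lt1 ?ltr1n// => /(_ isT).
  by rewrite /geometric/=; under eq_fun do rewrite exprVn.
Qed.

(** As long as the support of [F] is the larger one only [g] is spread, one factor [3 K L] per
    induction step; [bil_base] takes over once the supports are comparable. *)
Lemma bil_unbalanced (L : R) : K <= L -> exists2 C : R, 0 < C &
  forall n g F h k a t, 0 < a -> small g h a -> small F k t ->
    t <= (3 * K * L) ^+ n * a ->
    acost mu latom (bil S S' g F) (C * (4 * K ^+ 2) ^+ n * (h * k * a)).
Proof.
move=> KL; have [Cb Cb0 hb] := bil_base.
have [Cs Cs0 hst] := bil_step hs hp KL.
have L0 : 0 < L by exact: lt_le_trans KL.
(* The induction step needs [4 Cs + 3 (Cb + 4 Cs) <= 4 (Cb + 4 Cs)]. *)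
exists (Cb + 4 * Cs); first by rewrite addr_gt0// mulr_gt0.
elim=> [|n IH] g F h k a t a0 sg sF ta; have h0 := small_h0 sg; have k0 := small_h0 sF.
  have hka : 0 <= h * k * a by rewrite !mulr_ge0// ltW.
  have sF' : small F k a.
    by have [b1 b2 b3] := sF; split => //; apply: le_trans b3 _; rewrite expr0 mul1r in ta.
  apply: acost_le (hb g F h k a a0 sg sF') _.
  by rewrite expr0 mulr1 ler_wpM2r// lerDl mulr_ge0// ltW.
have [gt [w [sgt cw e]]] := hst _ _ _ _ _ _ _ a0 sg sF ta.
have a'0 : 0 < 3 * K * L * a by rewrite !mulr_gt0.
have := IH gt F _ k _ t a'0 sgt sF.
rewrite mulrA -exprSr => /(_ ta) cgt.
have [bg _ _] := sg; have [bF _ _] := sF.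
have := acostD (latom_family hs) cw cgt.
have mb := intg_meas (intg_bil hs hp bg bF).
have e' : {ae mu, forall y, w y + bil S S' gt F y = bil S S' g F y}.
  by apply: (ae_imp e) => y ->.
move/acost_eq_ae => /(_ _ mb e' (latom_family hs)) /acost_le; apply.
set P := (4 * K ^+ 2) ^+ n.
have hka : 0 <= h * k * a by rewrite !mulr_ge0// ltW.
have P0 : 0 <= P by rewrite exprn_ge0// mulr_ge0// sqr_ge0.
rewrite exprS -/P.
rewrite (_ : Cs * _ * h * k * a = 4 * Cs * (P * K ^+ 2) * (h * k * a)); last by ring.
rewrite (_ : (Cb + 4 * Cs) * P * _ = 3 * (Cb + 4 * Cs) * (P * K ^+ 2) * (h * k * a)); last first.
  by field; rewrite gt_eqF.
rewrite (_ : _ * (4 * _ * P) * _ = 4 * (Cb + 4 * Cs) * (P * K ^+ 2) * (h * k * a)); last by ring.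
rewrite -!mulrDl ler_wpM2r// ler_wpM2r//; first by rewrite mulr_ge0// sqr_ge0.
lra.
Qed.

End pair.

End restricted_estimate.

(** * Lebesgue spaces of real functions *)

Section real_lp.
Context d (T : measurableType d) (R : realType).
Variable mu : {measure set T -> \bar R}.
Local Notation intg := (intg mu).
Local Notation I := (I mu).
Implicit Types (f g : T -> R) (p q H G : R).

Definition lp p f : Prop :=
  measurable_fun [set: T] f /\ intg (fun x => `|f x| `^ p).

Definition Ip p f : R := I (fun x => `|f x| `^ p).

Lemma meas_norm_powR p f : measurable_fun [set: T] f ->
  measurable_fun [set: T] (fun x => `|f x| `^ p).
Proof.
move=> mf; apply: (measurableT_comp (f := fun y : R => y `^ p)).
  exact: measurable_powR.
exact: measurableT_comp.
Qed.

Lemma Ip_ge0 p f : 0 <= Ip p f.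
Proof. by apply: I_ge0 => x; exact: powR_ge0. Qed.

Lemma lp_le p f g : 0 <= p -> measurable_fun [set: T] f ->
  (forall x, `|f x| <= `|g x|) -> lp p g -> lp p f /\ Ip p f <= Ip p g.
Proof.
move=> p0 mf fg [mg ig].
have le x : `|f x| `^ p <= `|g x| `^ p by rewrite ge0_ler_powR ?nnegrE.
have iff : intg (fun x => `|f x| `^ p).
  apply: (intg_le _ _ ig); first exact: meas_norm_powR.
  by move=> x; rewrite ger0_norm// powR_ge0.
by split => //; exact: I_le.
Qed.

Lemma lpZ p f k : 0 <= p -> lp p f -> lp p (fun x => k * f x) /\
  Ip p (fun x => k * f x) = `|k| `^ p * Ip p f.
Proof.
move=> p0 [mf iff].
have E x : `|k| `^ p * `|f x| `^ p = `|k * f x| `^ p by rewrite normrM powRM.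
split; last by rewrite /Ip -IZ//; apply: eq_I => x; rewrite E.
by split; [exact: measurable_funM|exact: eq_intg E (intgZ _ iff)].
Qed.

(** From [a + b <= 2 max(a, b)]; unlike convexity this also covers exponents below 1. *)
Lemma powR_add_le p (a b : R) : 0 <= p -> 0 <= a -> 0 <= b ->
  (a + b) `^ p <= 2 `^ p * (a `^ p + b `^ p).
Proof.
move=> p0 a0 b0; wlog ab : a b a0 b0 / a <= b.
  move=> h; have [ab|ba] := leP a b; first exact: h.
  by rewrite (addrC a) (addrC (a `^ p)); apply: h => //; exact: ltW.
apply: (@le_trans _ _ ((2 * b) `^ p)).
  by rewrite ge0_ler_powR ?nnegrE ?addr_ge0 ?mulr_ge0//; lra.
by rewrite powRM// ler_wpM2l ?powR_ge0// lerDr powR_ge0.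
Qed.

Lemma lpD p f g : 0 <= p -> lp p f -> lp p g -> lp p (fun x => f x + g x).
Proof.
move=> p0 [mf iff] [mg ig]; split; first exact: measurable_funD.
apply: (intg_le _ _ (intgZ (2 `^ p) (intgD iff ig))).
  by apply: meas_norm_powR; exact: measurable_funD.
move=> x; rewrite ger0_norm ?powR_ge0//.
apply: (@le_trans _ _ ((`|f x| + `|g x|) `^ p)).
  by rewrite ge0_ler_powR ?nnegrE ?addr_ge0// ler_normD.
exact: powR_add_le.
Qed.

Lemma lpB p f g : 0 <= p -> lp p f -> lp p g -> lp p (fun x => f x - g x).
Proof.
move=> p0 lf lg; have := lpD p0 lf (lpZ (-1) p0 lg).1.
by congr (lp p _); apply/funext => x; rewrite mulN1r.
Qed.

Lemma lp0 p : 0 < p -> lp p (fun=> 0).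
Proof.
move=> p0; split => //; apply: eq_intg (intg0 mu) => x.
by rewrite normr0 powR0// gt_eqF.
Qed.

Section conjugate.
Variables p q : R.
Hypothesis p0 : 0 < p.
Hypothesis q0 : 0 < q.
Hypothesis pq : p^-1 + q^-1 = 1.

Lemma lp_mul f g : lp p f -> lp q g -> intg (fun x => f x * g x).
Proof.
move=> [mf iff] [mg ig].
apply: (intg_le _ _ (intgD (intgZ p^-1 iff) (intgZ q^-1 ig))).
  exact: measurable_funM.
move=> x; rewrite normrM (mulrC p^-1) (mulrC q^-1).
exact: conjugate_powR.
Qed.

(** Young's inequality for [f / H] and [g / G]. Positive majorants take the place of the norms, so
    the case of norm 0 needs no separate treatment. *)
Lemma hoelderR f g H G : lp p f -> lp q g -> 0 < H -> 0 < G ->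
  Ip p f <= H `^ p -> Ip q g <= G `^ q -> I (fun x => `|f x * g x|) <= H * G.
Proof.
move=> lf lg H0 G0 hH hG.
have [lf' e1] := lpZ H^-1 (ltW p0) lf; have [lg' e2] := lpZ G^-1 (ltW q0) lg.
have i1 := intg_norm (lp_mul lf lg).
have n1 : Ip p (fun x => H^-1 * f x) <= 1.
  rewrite e1 gtr0_norm ?invr_gt0// -powR_inv1 ?(ltW H0)// -powRrM mulN1r powRN.
  by rewrite mulrC ler_pdivrMr ?mul1r// powR_gt0.
have n2 : Ip q (fun x => G^-1 * g x) <= 1.
  rewrite e2 gtr0_norm ?invr_gt0// -powR_inv1 ?(ltW G0)// -powRrM mulN1r powRN.
  by rewrite mulrC ler_pdivrMr ?mul1r// powR_gt0.
have [_ iF] := lf'; have [_ iG] := lg'.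
have ip0 : 0 <= p^-1 by rewrite invr_ge0 ltW.
have iq0 : 0 <= q^-1 by rewrite invr_ge0 ltW.
apply: (@le_trans _ _ (I (fun x => H * G * (p^-1 * `|H^-1 * f x| `^ p + q^-1 * `|G^-1 * g x| `^ q)))).
  apply: I_le => // [|x]; first by apply: intgZ; apply: intgD; exact: intgZ.
  have -> : f x * g x = (H * G) * ((H^-1 * f x) * (G^-1 * g x)) by field; rewrite !gt_eqF.
  rewrite normrM gtr0_norm ?mulr_gt0// ler_pM2l ?mulr_gt0// normrM.
  by rewrite (mulrC p^-1) (mulrC q^-1); exact: conjugate_powR.
rewrite IZ; last by apply: intgD; exact: intgZ.
rewrite ID ?IZ//; [|exact: intgZ|exact: intgZ].
apply: ler_piMr; first by rewrite mulr_ge0// ltW.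
rewrite -[leRHS]pq; apply: lerD; [exact: ler_piMr ip0 n1|exact: ler_piMr iq0 n2].
Qed.

End conjugate.

End real_lp.

Section bbf_lp.
Context (R : realType) (X : ptopologicalType).
Variables (mu : {measure set (borel X) -> \bar R}) (d : X -> X -> R).
Variables (c K eta : R).
Hypothesis hs : growing_space mu d c K eta.

Lemma bbf_lp (p : R) u : 0 < p -> bbf d u -> lp mu p u.
Proof.
move=> p0 bu; have mu_ := bbf_meas bu; split => //.
have [x [r [k [[_ r0 u0] hk]]]] := bu.
apply: (bbf_intg hs); exists x, r, (k `^ p); split.
  split => //; first exact: meas_norm_powR.
  by move=> y /u0 ->; rewrite normr0 powR0// gt_eqF.
move=> y; rewrite ger0_norm ?powR_ge0//.
by rewrite ge0_ler_powR ?nnegrE ?(ltW p0)// (le_trans _ (hk y)).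
Qed.

End bbf_lp.

(** The bound is stated for every positive majorant [H] of the norm, which spares roots of [Ip]. *)
Record lpop (R : realType) (X : ptopologicalType)
    (mu : {measure set (borel X) -> \bar R}) (p : R)
    (S : (X -> R) -> X -> R) (A : R) : Prop := {
  lpop_gt0 : 0 < A ;
  lpop_lp : forall f, lp mu p f -> lp mu p (S f) ;
  lpop_bound : forall f (H : R), 0 < H -> lp mu p f -> Ip mu p f <= H `^ p ->
    Ip mu p (S f) <= (A * H) `^ p ;
  lpop_add : forall f g, lp mu p f -> lp mu p g ->
    {ae mu, forall y, S (fun z => f z + g z) y = S f y + S g y} }.

(** * From functions with finitely many dyadic levels to [L^q] *)

Section extension.
Context (R : realType) (X : ptopologicalType).
Variables (mu : {measure set (borel X) -> \bar R}) (d : X -> X -> R).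
Variables (c K eta : R).
Hypothesis hs : growing_space mu d c K eta.
Local Notation B := (qball d).
Local Notation intg := (intg mu).
Local Notation I := (I mu).
Local Notation bbf := (bbf d).
Local Notation lp := (lp mu).
Local Notation Ip := (Ip mu).
Local Notation latom := (latom mu d).
Implicit Types (f g u v b F w : X -> R) (x y : X) (G H : R).

(** The nonzero values of [|g|^q] meet finitely many dyadic intervals, and [g] has bounded
    support. *)
Definition lvl (q : R) g : Prop := exists (s : R) (N : nat) (r : R),
  [/\ 0 < s, ball_fun d g point r &
    forall y, g y != 0 -> s < `|g y| `^ q <= s * 2 ^+ N].

Lemma lvl_bbf q g : 0 < q -> lvl q g -> bbf g.
Proof.
move=> q0 [s [N [r [s0 bg hg]]]].
have sN : 0 <= s * 2 ^+ N by rewrite mulr_ge0 ?exprn_ge0// ltW.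
exists point, r, ((s * 2 ^+ N) `^ q^-1); split => // y.
have [->|/hg/andP[_ h]] := eqVneq (g y) 0; first by rewrite normr0 powR_ge0.
have -> : `|g y| = (`|g y| `^ q) `^ q^-1 by rewrite -powRrM divff ?gt_eqF// powRr1.
by rewrite ge0_ler_powR ?nnegrE ?powR_ge0// invr_ge0 ltW.
Qed.

Section truncation.
Variables (q : R) (g : X -> R).
Hypothesis q0 : 0 < q.
Hypothesis lg : lp q g.

(* Bounding [|g| `^ q] from below as well makes the truncation a finite union of dyadic levels. *)
Definition trunc_set (N : nat) : set (borel X) :=
  [set y | B point (c ^+ N) y /\ 2^-1 ^+ N < `|g y| `^ q <= 2 ^+ N].

Lemma meas_trunc_set N : measurable (trunc_set N).
Proof.
have [mg _] := lg.
have -> : trunc_set N = B point (c ^+ N) `&`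
    ((fun y => `|g y| `^ q) @^-1` `](2^-1 ^+ N), (2 ^+ N)]%classic).
  by apply/seteqP; split => y /=; rewrite in_itv.
apply: (@measurableI _ (borel X)).
  by apply: (meas_ball hs); rewrite exprn_gt0// (c_gt0 hs).
rewrite -[X in measurable X]setTI.
by apply: (meas_norm_powR q mg) => //; exact: measurable_itv.
Qed.

Lemma trunc_set_mono M N : (M <= N)%N -> trunc_set M `<=` trunc_set N.
Proof.
move=> MN y [h1 /andP[h2 h3]]; split.
  by apply: (ball_mono _ h1); rewrite ler_weXn2l// ltW// (c_gt1 hs).
apply/andP; split.
  by apply: le_lt_trans h2; apply: ler_wiXn2l => //; lra.
by apply: le_trans h3 _; apply: ler_weXn2l => //; lra.
Qed.

Lemma trunc_set_ex y : g y != 0 -> exists N, trunc_set N y.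
Proof.
move=> gy; have [r r0 hr] := ball_in hs y point (ltr01 : 0 < 1 :> R).
have g0 : 0 < `|g y| `^ q by rewrite powR_gt0// normr_gt0.
have [n1 h1] := expr_unbounded r (c_gt1 hs).
have two : 1 < 2 :> R by lra.
have [n2 h2] := expr_unbounded (`|g y| `^ q) two.
have [n3 h3] := expr_unbounded (`|g y| `^ q)^-1 two.
exists (n1 + (n2 + n3))%N; split.
  apply: (ball_mono _ (hr y (ball_center hs y ltr01))); apply: le_trans (ltW h1) _.
  by rewrite ler_weXn2l ?leq_addr// ltW// (c_gt1 hs).
apply/andP; split; last first.
  apply: le_trans (ltW h2) _; apply: ler_weXn2l; first exact: ltW.
  by rewrite addnCA leq_addr.
rewrite exprVn -[ltRHS]invrK ltf_pV2 ?posrE ?exprn_gt0 ?invr_gt0//.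
apply: lt_le_trans h3 _; apply: ler_weXn2l; first exact: ltW.
by rewrite addnA leq_addl.
Qed.

Lemma trunc_lp (D : set (borel X)) : measurable D ->
  lp q (fun y => g y * \1_D y) /\ lp q (fun y => g y - g y * \1_D y).
Proof.
move=> mD; have [mg ig] := lg.
have h : lp q (fun y => g y * \1_D y).
  apply: (proj1 (lp_le (ltW q0) _ _ lg)).
    by apply: measurable_funM => //; exact: meas_indic.
  by move=> y; rewrite normrM ler_piMr//; exact: (@norm_indic X R).
by split => //; apply: lpB => //; exact: ltW.
Qed.

Lemma trunc_cvg : Ip q (fun y => g y - g y * \1_(trunc_set N) y) @[N --> \oo] --> 0.
Proof.
have [mg ig] := lg.
have mt N : measurable_fun [set: borel X] (fun y => `|g y - g y * \1_(trunc_set N) y| `^ q).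
  by have [_ [h _]] := trunc_lp (meas_trunc_set N); exact: meas_norm_powR.
have [|||_ _] := @I_dct _ (borel X) R mu _ (fun=> 0) (fun y => `|g y| `^ q) mt _ _ _ ig.
- exact: measurable_cst.
- apply: aeW => y; apply/cvgrPdist_le => e e0.
  have [gy|gy] := eqVneq (g y) 0.
    apply: nearW => N; rewrite gy mul0r subrr normr0 powR0 ?gt_eqF//.
    by rewrite subrr normr0 ltW.
  have [N hN] := trunc_set_ex gy; exists N => // M /= NM.
  rewrite indicE mem_set; last exact: (trunc_set_mono NM hN).
  by rewrite mulr1 subrr normr0 powR0 ?gt_eqF// subrr normr0 ltW.
- apply: aeW => y N; rewrite ger0_norm ?powR_ge0// ge0_ler_powR ?nnegrE ?(ltW q0)//.
  by have [[_ ->]|[_ ->]] := @indicP _ R (trunc_set N) y; rewrite ?mulr1 ?mulr0 ?subrr ?normr0 ?subr0.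
- by rewrite I0.
Qed.

End truncation.

Section pair.
Variables (S S' : (X -> R) -> X -> R) (p q Ap Aq : R).
Hypothesis p0 : 0 < p.
Hypothesis q0 : 0 < q.
Hypothesis pq : p^-1 + q^-1 = 1.
Hypothesis hS : lpop mu p S Ap.
Hypothesis hS' : lpop mu q S' Aq.

Lemma bil_lp_norm g F G H : lp q g -> lp p F -> 0 < G -> 0 < H ->
  Ip q g <= G `^ q -> Ip p F <= H `^ p ->
  intg (bil S S' g F) /\ I (fun y => `|bil S S' g F y|) <= (Ap + Aq) * G * H.
Proof.
move=> lg lF G0 H0 hG hH.
have A0 := lpop_gt0 hS; have A0' := lpop_gt0 hS'.
have lS := lpop_lp hS lF; have lS' := lpop_lp hS' lg.
have h1 := hoelderR p0 q0 pq lF lS' H0 (mulr_gt0 A0' G0) hH (lpop_bound hS' G0 lg hG).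
have h2 := hoelderR p0 q0 pq lS lg (mulr_gt0 A0 H0) G0 (lpop_bound hS H0 lF hH) hG.
have i1 := lp_mul p0 q0 pq lF lS'; have i2 := lp_mul p0 q0 pq lS lg.
have ib : intg (bil S S' g F).
  by apply: eq_intg (intgB i1 i2) => y; rewrite /bil mulrC (mulrC (S F y)).
split => //.
apply: (@le_trans _ _ (I (fun y => `|F y * S' g y| + `|S F y * g y|))).
  apply: I_le => [||y]; [exact: intg_norm|by apply: intgD; exact: intg_norm|].
  by rewrite /bil (mulrC (F y)) (mulrC (S F y)); exact: ler_normB.
rewrite ID; [|exact: intg_norm|exact: intg_norm].
rewrite (_ : _ * G * H = H * (Aq * G) + Ap * H * G); last by ring.
exact: lerD.
Qed.

(** For fixed [F], the function [g] is a series of differences of truncations along a fast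
    subsequence, the [k]-th of norm at most [2 G / 2^k]. The costs add up to [4 C G], and the series
    of forms converges in [L^1] by Hoelder's inequality. *)
Lemma bil_extend F H C : lp p F -> 0 < H -> Ip p F <= H `^ p -> 0 <= C ->
  (forall g G, lvl q g -> 0 < G -> Ip q g <= G `^ q -> acost mu latom (bil S S' g F) (C * G)) ->
  forall g G, lp q g -> 0 < G -> Ip q g <= G `^ q ->
    acost mu latom (bil S S' g F) (4 * C * G).
Proof.
move=> lF H0 hH C0 hC g G lg G0 hG.
have A0 := lpop_gt0 hS; have A0' := lpop_gt0 hS'.
have G2 k : 0 < 2 * G / 2 ^+ k by rewrite divr_gt0 ?exprn_gt0// mulr_gt0.
have /choice[N hN] : forall k, exists N, forall M, (N <= M)%N ->
    Ip q (fun y => g y - g y * \1_(trunc_set q g M) y) <= (2 * G / 2 ^+ k) `^ q.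
  move=> k; have e0 : 0 < (2 * G / 2 ^+ k) `^ q by rewrite powR_gt0.
  move/cvgrPdist_le : (trunc_cvg q0 lg) => /(_ _ e0) [N _ hN].
  exists N => M NM; have := hN M NM; rewrite sub0r normrN ger0_norm//; exact: Ip_ge0.
(* Partial sums give a nondecreasing sequence that stays above each [N k], so the truncation sets
   are nested. *)
pose M k := (\sum_(i < k.+1) N i)%N.
have NM k : (N k <= M k)%N by rewrite /M big_ord_recr/= leq_addl.
have MM k : (M k <= M k.+1)%N by rewrite /M [in leqRHS]big_ord_recr/= leq_addr.
(* Starting from the empty set makes the first difference a whole truncation; its remainder is [g]
   itself, of norm at most [G]. *)
pose D k : set (borel X) := if k is j.+1 then trunc_set q g (M j.+1) else set0.
have mD k : measurable (D k).
  by case: k => [|k] /=; [exact: measurable0|exact: meas_trunc_set].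
have DD k : D k `<=` D k.+1.
  by case: k => [|k] y //=; exact: trunc_set_mono.
have lD k : lp q (fun y => g y * \1_(D k) y) /\ lp q (fun y => g y - g y * \1_(D k) y).
  exact: trunc_lp.
have bD k : Ip q (fun y => g y - g y * \1_(D k) y) <= (2 * G / 2 ^+ k) `^ q.
  case: k => [|k] /=.
    rewrite expr0 divr1 (_ : (fun y => _) = g); last first.
      by apply/funext => y; rewrite indicE in_set0 mulr0 subr0.
    apply: le_trans hG _; rewrite ge0_ler_powR ?nnegrE ?(ltW q0) ?(ltW G0)//; lra.
  exact: (hN _ _ (NM _)).
pose gk k y := g y * \1_(D k.+1) y - g y * \1_(D k) y.
have gkE k y : gk k y = if (y \in D k.+1) && (y \notin D k) then g y else 0.
  rewrite /gk; have [[h1 ->]|[h1 ->]] := @indicP _ R (D k) y.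
    by rewrite !(mem_set h1)/= andbF; have [[_ ->]|[]] := @indicP _ R (D k.+1) y;
      [ring|move=> /(_ (DD k _ h1))].
  rewrite (memNset h1) andbT; have [[h2 ->]|[h2 ->]] := @indicP _ R (D k.+1) y.
    by rewrite (mem_set h2); ring.
  by rewrite (memNset h2); ring.
have lgk k : lp q (gk k) by apply: lpB (lD k.+1).1 (lD k).1; exact: ltW.
have lvk k : lvl q (gk k).
  exists (2^-1 ^+ M k.+1), (M k.+1 + M k.+1)%N, (c ^+ M k.+1); split.
  - by rewrite exprn_gt0// invr_gt0.
  - split; [by have [] := lgk k|by rewrite exprn_gt0// (c_gt0 hs)|].
    move=> y ny; rewrite gkE; case: ifP => // /andP[/set_mem h _].
    by case: ny; have [] := h.
  move=> y; rewrite gkE; case: ifPn; rewrite ?eqxx// => /andP[/set_mem [_ /andP[h1 h2]] _] _.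
  rewrite h1/=; apply: le_trans h2 _; rewrite exprD mulrA -exprMn mulVf ?expr1n ?mul1r//.
have bgk k : Ip q (gk k) <= (2 * G / 2 ^+ k) `^ q.
  apply: le_trans (bD k); apply: (lp_le (ltW q0) _ _ (lD k).2).2; first by have [] := lgk k.
  move=> y; rewrite gkE; case: ifPn => [/andP[_ h]|_]; last by rewrite normr0.
  by rewrite indicE (negbTE h) mulr0 subr0.
have sgk n y : \sum_(k < n) gk k y = g y * \1_(D n) y.
  elim: n => [|n IH]; first by rewrite big_ord0 indicE in_set0 mulr0.
  by rewrite big_ord_recr/= IH /gk; ring.
have bilA u v : lp q u -> lp q v ->
    {ae mu, forall y, bil S S' (fun z => u z + v z) F y = bil S S' u F y + bil S S' v F y}.
  by move=> lu lv; apply: (ae_imp (lpop_add hS' lu lv)) => y h; rewrite /bil h; ring.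
have [i0 _] := bil_lp_norm lg lF G0 H0 hG hH.
apply: (@acost_series _ (borel X) R mu latom (fun k => bil S S' (gk k) F)
  (fun k => C * (2 * G / 2 ^+ k)) _ _ (latom_family hs) i0).
- by move=> k; apply: hC.
- move=> n; rewrite -mulr_sumr -mulr_sumr (_ : 4 * C * G = C * (2 * G * 2)); last by ring.
  apply: ler_wpM2l => //; apply: ler_wpM2l; first by rewrite mulr_ge0// ltW.
  rewrite (eq_bigr (fun i : 'I_n => 2^-1 ^+ i)) => [|i _]; last by rewrite exprVn.
  exact: geometric_half_le.
have lz : lp q (fun=> 0) by exact: lp0.
have bil0 : {ae mu, forall y, bil S S' (fun=> 0) F y = 0}.
  apply: (ae_imp (lpop_add hS' lz lz)) => y; rewrite (_ : (fun=> 0 + 0 : R) = fun=> 0) => [h|]; last first.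
    by apply/funext => z; rewrite addr0.
  rewrite /bil (_ : S' _ y = 0) ?mul0r ?subr0//.
  by apply: (@addrI _ (S' (fun=> 0) y)); rewrite addr0 -h.
have bilT n : {ae mu, forall y, \sum_(k < n) bil S S' (gk k) F y =
    bil S S' (fun z => g z * \1_(D n) z) F y}.
  elim: n => [|n IH].
    apply: (ae_imp bil0) => y h; rewrite big_ord0 -[LHS]h; congr (bil _ _ _ _ _).
    by apply/funext => z; rewrite indicE in_set0 mulr0.
  apply: (ae_imp2 IH (bilA _ _ (lD n).1 (lgk n))) => y h1 h2.
  rewrite big_ord_recr/= h1 -h2; congr (bil _ _ _ _ _).
  by apply/funext => z; rewrite /gk; ring.
have small_rem n : I (fun y => `|bil S S' g F y - \sum_(k < n) bil S S' (gk k) F y|)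
    <= (Ap + Aq) * (2 * G * 2^-1 ^+ n) * H.
  have [ir hr] := bil_lp_norm (lD n).2 lF (G2 n) H0 (bD n) hH.
  rewrite exprVn; apply: le_trans hr; rewrite le_eqVlt; apply/orP; left; apply/eqP.
  have is_ : intg (fun y => \sum_(k < n) bil S S' (gk k) F y).
    by apply: intg_sum => k _; have [] := bil_lp_norm (lgk k) lF (G2 k) H0 (bgk k) hH.
  apply: (proj2 (I_eq_ae (intg_norm ir) _ _)).
    by apply: intg_meas; apply: intg_norm; exact: (intgB i0 is_).
  have := bilA _ _ (lD n).1 (lD n).2; rewrite (_ : (fun z => _ + _) = g); last first.
    by apply/funext => z; ring.
  by move=> h; apply: (ae_imp2 h (bilT n)) => y -> ->; congr (`|_|); rewrite addrAC subrr add0r.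
pose Q := (Ap + Aq) * (2 * G) * H.
apply: (@squeeze_cvgr _ _ _ _ (fun=> 0) (fun n => Q * 2^-1 ^+ n)).
- apply: nearW => n; rewrite I_ge0//=; apply: le_trans (small_rem n) _.
  by rewrite le_eqVlt; apply/orP; left; apply/eqP; rewrite /Q; ring.
- exact: cvg_cst.
by apply: cvgn0_scale; exact: half_cvg0.
Qed.

End pair.

End extension.

Lemma powR_expR (R : realType) (a x : R) : 0 < a -> a `^ x = expR (x * ln a).
Proof. by move=> a0; rewrite /powR gt_eqF. Qed.

(** The left side is the geometric mean [a^(1-t) b^t], which never exceeds the larger of the two
    numbers. *)
Lemma interpolation_le (R : realType) (a b t : R) : 0 < a -> 0 < b -> 0 <= t <= 1 ->
  a * (b / a) `^ t <= a + b.
Proof.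
move=> a0 b0 /andP[t0 t1]; have r0 : 0 < b / a by rewrite divr_gt0.
have [h|h] := leP 1 (b / a).
  apply: (@le_trans _ _ (a * (b / a))); last by rewrite mulrC divfK ?gt_eqF// lerDr ltW.
  by apply: ler_wpM2l; [exact: ltW|exact: ler1_powR].
apply: (@le_trans _ _ a); last by rewrite lerDl ltW.
rewrite ler_piMr ?(ltW a0)// -[leRHS](powRr0 (b / a)).
by apply: ger_powR => //; rewrite r0 ltW.
Qed.

(** With [p' = 1/p], the left side is the restricted cost for heights [(2 U)^(1/q)], [(2 V)^(1/p)]
    and supports [a / U], [b / V], where [U], [V] are dyadic values of [|g|^q], [|F|^p] and [a], [b]
    the masses of the levels. Only the ratio [U / V] survives. *)
Lemma level_weight (R : realType) (U V a b t p' : R) :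
  0 < U -> 0 < V -> 0 < a -> 0 < b ->
  (2 * U) `^ (1 - p') * (2 * V) `^ p' * (a / U) * ((b / V) / (a / U)) `^ t
  = 2 * (U / V) `^ (t - p') * (a * (b / a) `^ t).
Proof.
move=> U0 V0 a0 b0; have two : 0 < 2 :> R by [].
have E (x : R) : 0 < x -> exists y, x = expR y by move=> x0; exists (ln x); rewrite lnK.
have [u eU] := E _ U0; have [v eV] := E _ V0; have [x ea] := E _ a0; have [y eb] := E _ b0.
have [w e2] := E _ two; rewrite e2; subst U V a b.
rewrite -!expRN -!expRD -expRN -!expRD.
by rewrite !powR_expR ?expR_gt0// !expRK -!expRD; congr expR; ring.
Qed.

(** With truncated subtraction [(n - j) + (j - n)] is [|n - j|]; each side of the diagonal is at
    most one geometric series. *)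
Lemma geometric_row_sum (R : realType) (t : R) N n : 0 <= t -> t < 1 ->
  \sum_(j < N) t ^+ ((n - j) + (j - n)) <= 2 / (1 - t).
Proof.
move=> t0 t1; have h k := @geometric_sum_le R t k t0 t1.
pose f j := t ^+ ((n - j) + (j - n)).
have f0 j : 0 <= f j by rewrite exprn_ge0.
apply: (@le_trans _ _ (\sum_(j < n.+1 + N) f j)).
  rewrite -!(big_mkord xpredT f) [leRHS](big_cat_nat _ _ (n := N))//=; last by rewrite leq_addl.
  by rewrite lerDl sumr_ge0.
rewrite big_split_ord/= (_ : 2 / (1 - t) = (1 - t)^-1 + (1 - t)^-1); last by field; lra.
apply: lerD.
  apply: le_trans (h n.+1); rewrite (reindex_inj rev_ord_inj)/=; apply: ler_sum => i _.
  by rewrite /f/= (_ : (_ + _)%N = i)//; have := ltn_ord i; lia.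
apply: le_trans (h N); apply: ler_sum => i _; rewrite /f.
by apply: ler_wiXn2l; rewrite ?t0 ?ltW//; lia.
Qed.

(** The exponent is moved by [e] to the side of [p'] on which [(U/V)^(t - p')] decays: below for
    [j <= n], above otherwise. The margins [2 e] keep it in [[e, 1 - e]]. *)
Lemma level_choice (R : realType) (s a b e p' : R) (n j : nat) :
  0 < s -> 0 < a -> 0 < b -> 0 < e -> 2 * e <= p' -> 2 * e <= 1 - p' ->
  exists t, [/\ e <= t, t <= 1 - e &
    (2 * (s * 2 ^+ n)) `^ (1 - p') * (2 * (s * 2 ^+ j)) `^ p' * (a / (s * 2 ^+ n)) *
      ((b / (s * 2 ^+ j)) / (a / (s * 2 ^+ n))) `^ t
    <= 2 * (2 `^ (- e)) ^+ ((n - j) + (j - n)) * (a + b)].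
Proof.
move=> s0 a0 b0 e0 ep eq.
have two k : 0 < 2 ^+ k :> R by rewrite exprn_gt0.
have P k : (2 ^+ k) `^ (- e) = (2 `^ (- e)) ^+ k :> R.
  by rewrite -[2 ^+ k]powR_mulrn// -[RHS]powR_mulrn ?powR_ge0// -!powRrM mulrC.
pose t := if (j <= n)%N then p' - e else p' + e.
have r0 : s * 2 ^+ n / (s * 2 ^+ j) = 2 ^+ n / 2 ^+ j.
  by rewrite -mulf_div divff ?gt_eqF// mul1r.
exists t; split; [rewrite /t; case: ifP => _; lra|rewrite /t; case: ifP => _; lra|].
rewrite level_weight ?mulr_gt0// r0 -!mulrA ler_pM2l//.
apply: ler_pM; [exact: powR_ge0|by rewrite mulr_ge0 ?powR_ge0// ltW| |]; last first.
  by apply: interpolation_le => //; rewrite /t; case: ifP => _; apply/andP; split; lra.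
rewrite le_eqVlt; apply/orP; left; apply/eqP; rewrite /t; case: leqP => jn.
  rewrite (_ : j - n = 0)%N ?addn0; last by apply/eqP; rewrite subn_eq0.
  by rewrite -P -expfB_cond ?gt_eqF//; congr (_ `^ _); ring.
rewrite (_ : n - j = 0)%N ?add0n; last by apply/eqP; rewrite subn_eq0 ltnW.
rewrite -P (_ : p' + e - p' = -1 * - e); last by ring.
rewrite powRrM powR_inv1 ?divr_ge0 ?(ltW (two _))// invf_div.
by rewrite -expfB// ltnW.
Qed.

(** * The restricted estimate in power form and the dyadic levels *)

Section levels.
Context (R : realType) (X : ptopologicalType).
Variables (mu : {measure set (borel X) -> \bar R}) (d : X -> X -> R).
Variables (c K eta : R).
Hypothesis hs : growing_space mu d c K eta.
Local Notation mr A := (fine (mu A)).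
Local Notation intg := (intg mu).
Local Notation I := (I mu).
Local Notation bbf := (bbf d).
Local Notation small := (small mu d).
Local Notation latom := (latom mu d).
Local Notation lp := (lp mu).
Local Notation Ip := (Ip mu).
Local Notation lvl := (lvl d).
Implicit Types (f g u v b F w : X -> R) (x y : X).

Lemma small_le u h a h' a' : small u h a -> h <= h' -> a <= a' -> small u h' a'.
Proof.
move=> [bu hu au] hh aa; split => // [y|]; first exact: le_trans (hu y) hh.
exact: le_trans au aa.
Qed.

Section restricted.
Variables (S S' : (X -> R) -> X -> R) (A theta : R) (l0 : nat).
Hypothesis hp : czpair mu d c S S' A theta l0.

(** Take the least [n] with [t <= M^n a]. The loss is [Q^n], and if [n > 0] then [M^(n-1) <= t / a]
    by minimality. *)
Lemma restricted_half (e : R) : 0 < e -> exists2 C : R, 0 < C &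
  forall g F (h k a t : R), 0 < a -> a <= t -> small g h a -> small F k t ->
    acost mu latom (bil S S' g F) (C * (h * k * a * (t / a) `^ e)).
Proof.
move=> e0; have K0 := K_gt0 hs; have K1 := K_gt1 hs.
pose Q := 4 * K ^+ 2.
have Q1 : 1 <= Q by have := exprn_ege1 2 (ltW K1); rewrite /Q; lra.
(* Large enough for [Q <= M^e], so that [Q^(n-1) <= (t / a)^e]. *)
pose L := Num.max K (Q `^ e^-1).
have LK : K <= L by rewrite le_max lexx.
have L0 : 0 < L by exact: lt_le_trans LK.
pose M := 3 * K * L.
have ML : L <= M.
  by rewrite /M ler_peMl ?(ltW L0)//; lra.
have M1 : 1 < M by apply: lt_le_trans ML; exact: lt_le_trans LK.
have MQ : Q <= M `^ e.
  rewrite -[leLHS](powRr1 (le_trans ler01 Q1)) -(mulVf (lt0r_neq0 e0)) powRrM.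
  rewrite ge0_ler_powR ?nnegrE ?powR_ge0 ?(ltW e0)//; first exact: ltW (lt_trans _ M1).
  by apply: le_trans ML; rewrite /L le_max lexx orbT.
have [C C0 hC] := bil_unbalanced hs hp LK.
exists (C * Q); first by rewrite mulr_gt0// (lt_le_trans _ Q1).
move=> g F h k a t a0 at_ sg sF.
have h0 := small_h0 sg; have k0 := small_h0 sF.
have t0 : 0 < t by exact: lt_le_trans at_.
have [N hN] := expr_unbounded (t / a) M1.
have ex : exists n, t <= M ^+ n * a by exists N; rewrite -ler_pdivrMr// ltW.
case: (ex_minnP ex) => n hn nmin.
apply: acost_le (hC n g F h k a t a0 sg sF hn) _.
have r1 : 1 <= t / a by rewrite ler_pdivlMr ?mul1r.
suff H : Q ^+ n <= Q * (t / a) `^ e.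
  rewrite -mulrA (_ : C * Q * _ = C * ((Q * (t / a) `^ e) * (h * k * a))); last by ring.
  rewrite ler_pM2l// ler_wpM2r// !mulr_ge0//; exact: ltW.
case: n hn nmin {ex} => [|n] hn nmin.
  rewrite expr0 -[leLHS]mulr1; apply: ler_pM => //.
  apply: (@le_trans _ _ (1 `^ e)); first by rewrite powR1.
  by rewrite ge0_ler_powR ?nnegrE// ltW// (lt_le_trans ltr01).
rewrite exprS ler_wpM2l ?(le_trans ler01 Q1)//.
have lt : M ^+ n <= t / a.
  rewrite ler_pdivlMr// leNgt; apply/negP => /ltW /nmin; by rewrite ltnn.
apply: (@le_trans _ _ ((M `^ e) ^+ n)).
  by apply: lerXn2r => //; rewrite nnegrE ?powR_ge0// (le_trans ler01 Q1).
rewrite -powR_mulrn ?powR_ge0// -powRrM mulrC powRrM powR_mulrn; last exact: ltW (lt_trans _ M1).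
rewrite ge0_ler_powR ?nnegrE ?(ltW e0)//; first by rewrite exprn_ge0// ltW// (lt_trans _ M1).
exact: le_trans r1.
Qed.
End restricted.

(** For [a <= t] the exponent [e] is raised to [r]. For [t < a] the roles are exchanged, and
    [t (a/t)^e = a (t/a)^(1-e)] only increases when the exponent is lowered to [r]. *)
Lemma restricted_power S S' (A theta : R) l0 (e : R) :
  czpair mu d c S S' A theta l0 -> 0 < e -> exists2 C : R, 0 < C &
  forall g F (h k a t r : R), 0 < a -> 0 < t -> small g h a -> small F k t ->
    e <= r -> r <= 1 - e ->
    acost mu latom (bil S S' g F) (C * (h * k * a * (t / a) `^ r)).
Proof.
move=> hp e0; have [C1 C10 h1] := restricted_half hp e0.
have [C2 C20 h2] := restricted_half (czpair_sym hp) e0.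
exists (C1 + C2); first exact: addr_gt0.
move=> g F h k a t r a0 t0 sg sF er re.
have h0 := small_h0 sg; have k0 := small_h0 sF.
have hk : 0 <= h * k by exact: mulr_ge0.
have [at_|ta] := leP a t.
  apply: acost_le (h1 g F h k a t a0 at_ sg sF) _; apply: ler_pM.
  - exact: ltW.
  - by rewrite mulr_ge0 ?powR_ge0// mulr_ge0// ltW.
  - by rewrite lerDl ltW.
  apply: ler_wpM2l; first by rewrite mulr_ge0// ltW.
  by apply: ler_powR => //; rewrite ler_pdivlMr ?mul1r.
have := acostZ (-1) (latom_family hs) (h2 F g k h t a t0 (ltW ta) sF sg).
rewrite (_ : (fun y => _) = bil S S' g F); last first.
  by apply/funext => y; rewrite bil_sym mulN1r opprK.
move/acost_le; apply; rewrite normrN1 mul1r; apply: ler_pM.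
- exact: ltW.
- by rewrite mulr_ge0 ?powR_ge0// mulr_ge0 ?(ltW t0)// mulr_ge0.
- by rewrite lerDr ltW.
rewrite (mulrC k) -!mulrA; apply: ler_wpM2l => //; apply: ler_wpM2l => //.
have r0 : 0 < t / a by rewrite divr_gt0.
rewrite (_ : t * _ = a * (t / a) `^ (1 - e)); last first.
  rewrite powRB ?(gt_eqF r0) ?implybT// powRr1 ?(ltW r0)// mulrA (mulrCA a) divff ?gt_eqF// mulr1.
  by rewrite -powRN -mulN1r powRrM powR_inv1 ?(ltW r0)// invf_div.
by apply: ler_wpM2l; [exact: ltW|apply: ger_powR => //; rewrite r0 ler_pdivrMr// mul1r ltW].
Qed.

(** Unlike [lvl] this exposes [s] and [N], so that two functions can be cut along the same dyadic
    scale. *)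
Definition lvls (q s : R) (N : nat) g : Prop :=
  [/\ 0 < s, exists r, ball_fun d g point r &
    forall y, g y != 0 -> s < `|g y| `^ q <= s * 2 ^+ N].

Lemma lvls_mono q s s' N N' g : lvls q s N g -> 0 < s' -> s' <= s ->
  s * 2 ^+ N <= s' * 2 ^+ N' -> lvls q s' N' g.
Proof.
move=> [s0 bg hg] s0' ss sN; split => // y /hg /andP[h1 h2].
by rewrite (le_lt_trans ss h1) (le_trans h2 sN).
Qed.

Lemma dyadic_sum (s v : R) k : 0 < s -> s < v ->
  \sum_(n < k) (s * 2 ^+ n < v <= 2 * (s * 2 ^+ n))%R%:R = (v <= s * 2 ^+ k)%R%:R :> R.
Proof.
move=> s0 sv; elim: k => [|k IH].
  by rewrite big_ord0 expr0 mulr1 leNgt sv.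
rewrite big_ord_recr/= IH exprS (mulrCA s).
have P : 0 < s * 2 ^+ k by rewrite mulr_gt0// exprn_gt0.
have [h|h] := leP v (s * 2 ^+ k).
  by rewrite /= addr0 (_ : v <= 2 * _)//; lra.
by rewrite /= add0r.
Qed.

(** The mass [a n] is the integral of [|g|^q] over the [n]-th level; Chebyshev's inequality bounds
    the support of [u n]. *)
Lemma lvls_split (q s : R) N g : 0 < q -> lvls q s N g ->
  exists (u : nat -> X -> R) (a : nat -> R), [/\
    forall n, small (u n) ((2 * (s * 2 ^+ n)) `^ q^-1) (a n / (s * 2 ^+ n)),
    forall n, 0 <= a n, forall y, g y = \sum_(n < N) u n y &
    \sum_(n < N) a n <= Ip q g].
Proof.
move=> q0 [s0 [r0 bg] hg].
have lg : lvl q g by exists s, N, r0.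
have bbg := lvl_bbf q0 lg.
have mg := bbf_meas bbg.
have [_ ig] := bbf_lp hs q0 bbg.
have sn n : 0 < s * 2 ^+ n by rewrite mulr_gt0// exprn_gt0.
pose E n : set (borel X) := [set y | s * 2 ^+ n < `|g y| `^ q <= 2 * (s * 2 ^+ n)].
have mE n : measurable (E n).
  rewrite (_ : E n = [set: borel X] `&`
    ((fun y => `|g y| `^ q) @^-1` `](s * 2 ^+ n), (2 * (s * 2 ^+ n))]%classic)).
    by apply: (meas_norm_powR q mg) => //; exact: measurable_itv.
  by rewrite setTI; apply/seteqP; split => y /=; rewrite in_itv.
have EE y : g y != 0 -> \sum_(n < N) \1_(E n) y = 1 :> R.
  move=> gy; have /andP[h1 h2] := hg y gy.
  have := dyadic_sum N s0 h1; rewrite h2 => e; rewrite -[RHS]/(true%:R) -[RHS]e; apply: eq_bigr => n _.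
  have [[h ->]|[h ->]] := @indicP _ R (E n) y; first by rewrite h.
  by case: (boolP (_ < _ <= _)).
exists (fun n y => g y * \1_(E n) y), (fun n => I (fun y => `|g y| `^ q * \1_(E n) y)).
have iE n : intg (fun y => `|g y| `^ q * \1_(E n) y) by exact: intgM_indic.
have bu n : bbf (fun y => g y * \1_(E n) y) by exact: bbfM_indic.
split.
- move=> n; split => //.
    move=> y; have [[/andP[h1 h2] ->]|[h ->]] := @indicP _ R (E n) y; last first.
      by rewrite mulr0 normr0 powR_ge0.
    have e1 : `|g y| = (`|g y| `^ q) `^ q^-1 by rewrite -powRrM divff ?gt_eqF// powRr1.
    rewrite mulr1 e1; apply: ge0_ler_powR; rewrite ?nnegrE ?powR_ge0 ?invr_ge0 ?(ltW q0)//.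
    by apply: mulr_ge0 => //; exact: ltW.
  have [mS fS] := supp_meas hs (bu n).
  rewrite ler_pdivlMr// mulrC -(I_indic mu mS) -IZ; last exact: intg_indic.
  apply: I_le => //; first by apply: intgZ; exact: intg_indic.
  move=> y; have [[h ->]|[h ->]] := @indicP _ R (nz (fun y => g y * \1_(E n) y)) y; last first.
    by rewrite mulr0 mulr_ge0 ?powR_ge0//; rewrite indicE.
  move: h; rewrite /nz/=; have [[/andP[h1 h2] ->]|[h ->]] := @indicP _ R (E n) y.
    by rewrite !mulr1 ltW.
  by rewrite mulr0 eqxx.
- by move=> n; apply: I_ge0 => y; rewrite mulr_ge0 ?powR_ge0//; rewrite indicE.
- move=> y; rewrite -mulr_sumr; have [->|gy] := eqVneq (g y) 0; first by rewrite mul0r.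
  by rewrite EE// mulr1.
rewrite -I_sum//; apply: I_le => //; first exact: intg_sum.
move=> y; rewrite -mulr_sumr; have [->|gy] := eqVneq (g y) 0.
  by rewrite normr0 powR0 ?gt_eqF// mul0r.
by rewrite EE// mulr1.
Qed.

End levels.

(** * The strong bound for the real form *)

Section lp_estimate.
Context (R : realType) (X : ptopologicalType).
Variables (mu : {measure set (borel X) -> \bar R}) (d : X -> X -> R).
Variables (c K eta : R).
Hypothesis hs : growing_space mu d c K eta.
Local Notation intg := (intg mu).
Local Notation I := (I mu).
Local Notation bbf := (bbf d).
Local Notation small := (small mu d).
Local Notation latom := (latom mu d).
Local Notation lp := (lp mu).
Local Notation Ip := (Ip mu).
Local Notation lvl := (lvl d).
Local Notation lvls := (lvls d).
Implicit Types (f g u v b F w : X -> R) (x y : X).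

Lemma lvl_lvls q g : lvl q g -> exists s N, lvls q s N g.
Proof. by move=> [s [N [r [s0 bg hg]]]]; exists s, N; split => //; exists r. Qed.

Lemma lvls_bbf q s N g : 0 < q -> lvls q s N g -> bbf g.
Proof. by move=> q0 [s0 [r bg] hg]; apply: (lvl_bbf q0); exists s, N, r. Qed.

Lemma lvlZ q k g : 0 < q -> 0 < k -> lvl q g -> lvl q (fun y => k * g y).
Proof.
move=> q0 k0 [s [N [r [s0 [mg r0 g0] hg]]]].
have kq : 0 < k `^ q by exact: powR_gt0.
exists (k `^ q * s), N, r; split; first exact: mulr_gt0.
  split => //; first exact: measurable_funM.
  by move=> y /g0 ->; rewrite mulr0.
move=> y; rewrite mulf_eq0 gt_eqF//= => /hg /andP[h1 h2].
by rewrite normrM gtr0_norm// powRM ?(ltW k0)// -mulrA ltr_pM2l// ler_pM2l// h1.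
Qed.

Section pair.
Variables (S S' : (X -> R) -> X -> R) (A theta : R) (l0 : nat).
Hypothesis hp : czpair mu d c S S' A theta l0.
Variables p q : R.
Hypothesis p0 : 0 < p.
Hypothesis q0 : 0 < q.
Hypothesis pq : p^-1 + q^-1 = 1.

Lemma bil_sumr n g (u : nat -> X -> R) : (forall i, bbf (u i)) -> bbf g ->
  {ae mu, forall y, bil S S' g (fun z => \sum_(i < n) u i z) y = \sum_(i < n) bil S S' g (u i) y}.
Proof.
move=> hu bg; apply: (ae_imp (op_sum hs (pair_half hp) n hu)) => y h.
by rewrite /bil h sumrB !mulr_sumr.
Qed.

(** A pair of levels costs [2^(-e |n - j|)] times the sum of the two masses. Summing the first mass
    along rows and the second along columns leaves geometric series. *)
Lemma lvls_bil : exists2 C : R, 0 < C & forall g F s N, lvls q s N g -> lvls p s N F ->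
  Ip q g <= 1 -> Ip p F <= 1 -> acost mu latom (bil S S' g F) C.
Proof.
have ip0 : 0 < p^-1 by rewrite invr_gt0.
have iq0 : 0 < q^-1 by rewrite invr_gt0.
(* The largest value allowed by [level_choice] at both [1/p] and [1/q]. *)
pose e := Num.min p^-1 q^-1 / 2.
have e0 : 0 < e by rewrite divr_gt0// lt_min ip0.
have ep : 2 * e <= p^-1.
  have : Num.min p^-1 q^-1 <= p^-1 by rewrite ge_min lexx.
  by move=> h; rewrite /e; lra.
have eq : 2 * e <= 1 - p^-1.
  rewrite (_ : 1 - p^-1 = q^-1); last by rewrite -pq addrAC subrr add0r.
  have : Num.min p^-1 q^-1 <= q^-1 by rewrite ge_min lexx orbT.
  by move=> h; rewrite /e; lra.
have [C C0 hC] := restricted_power hs hp e0.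
pose t := 2 `^ (- e).
have t0 : 0 < t by exact: powR_gt0.
have t1 : t < 1.
  by rewrite /t powRN invf_lt1 ?powR_gt0// -[ltLHS](powRr0 2) /powR gt_eqF// ltr_expR mul0r mulr_gt0// ln_gt0// ltr1n.
pose G := 2 / (1 - t).
have G0 : 0 < G by rewrite divr_gt0// subr_gt0.
exists (C * (2 * (G * 4))); first by rewrite mulr_gt0// mulr_gt0// mulr_gt0.
move=> g F s N lg lF Ig IF; have [s0 _ _] := lg.
have [u [a [su a0 gu sa]]] := lvls_split hs q0 lg.
have [v [b [sv b0 Fv sb]]] := lvls_split hs p0 lF.
have bg := lvls_bbf q0 lg; have bF := lvls_bbf p0 lF.
have bu n : bbf (u n) by have [] := su n.
have bv n : bbf (v n) by have [] := sv n.
(* Added to each mass to make it positive; over [N] levels the total grows by at most 1. *)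
pose ee : R := N.+1%:R^-1.
have ee0 : 0 < ee by rewrite invr_gt0.
have sn n : 0 < s * 2 ^+ n by rewrite mulr_gt0// exprn_gt0.
pose a' n := a n + ee; pose b' n := b n + ee.
have a'0 n : 0 < a' n by rewrite ltr_wpDl.
have b'0 n : 0 < b' n by rewrite ltr_wpDl.
have cost n j : acost mu latom (bil S S' (u n) (v j))
    (C * (2 * t ^+ ((n - j) + (j - n)) * (a' n + b' j))).
  have [r [er re hr]] := level_choice n j s0 (a'0 n) (b'0 j) e0 ep eq.
  have su' : small (u n) ((2 * (s * 2 ^+ n)) `^ (1 - p^-1)) (a' n / (s * 2 ^+ n)).
    rewrite (_ : 1 - p^-1 = q^-1); last by rewrite -pq addrAC subrr add0r.
    apply: (small_le (su n)) => //; rewrite ler_pM2r ?invr_gt0// lerDl; exact: ltW.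
  have sv' : small (v j) ((2 * (s * 2 ^+ j)) `^ p^-1) (b' j / (s * 2 ^+ j)).
    apply: (small_le (sv j)) => //; rewrite ler_pM2r ?invr_gt0// lerDl; exact: ltW.
  have A0 : 0 < a' n / (s * 2 ^+ n) by exact: divr_gt0.
  have B0 : 0 < b' j / (s * 2 ^+ j) by exact: divr_gt0.
  apply: acost_le (hC _ _ _ _ _ _ r A0 B0 su' sv' er re) _.
  by rewrite ler_pM2l.
have costF n : acost mu latom (bil S S' (u n) F)
    (\sum_(j < N) C * (2 * t ^+ ((n - j) + (j - n)) * (a' n + b' j))).
  apply: (acost_eq_ae (acost_bigsum (latom_family hs) (fun j _ => cost n j))).
  - exact: intg_meas (intg_bil hs hp (bu n) bF).
  - apply: (ae_imp (bil_sumr N bv (bu n))) => y <-; congr (bil _ _ _ _ _).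
    by apply/funext => z; rewrite Fv.
  - exact: latom_family hs.
have : acost mu latom (bil S S' g F)
    (\sum_(n < N) \sum_(j < N) C * (2 * t ^+ ((n - j) + (j - n)) * (a' n + b' j))).
  apply: (acost_eq_ae (acost_bigsum (latom_family hs) (fun n _ => costF n))).
  - exact: intg_meas (intg_bil hs hp bg bF).
  - apply: (ae_imp (bil_suml hs hp N F bu)) => y <-; congr (bil _ _ _ _ _).
    by apply/funext => z; rewrite gu.
  - exact: latom_family hs.
move/acost_le; apply.
under eq_bigr => n _ do rewrite -mulr_sumr.
rewrite -mulr_sumr ler_pM2l//.
have row (n : nat) : \sum_(j < N) t ^+ ((n - j) + (j - n)) <= G.
  exact: geometric_row_sum (ltW t0) t1.
have Nee : \sum_(n < N) ee <= 1.
  rewrite sumr_const card_ord -mulr_natr /ee mulrC ler_pdivrMr// mul1r ler_nat//.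
have Sa : \sum_(n < N) a' n <= 2 by rewrite big_split; exact: lerD (le_trans sa Ig) Nee.
have Sb : \sum_(n < N) b' n <= 2 by rewrite big_split; exact: lerD (le_trans sb IF) Nee.
have E : \sum_(n < N) \sum_(j < N) 2 * t ^+ ((n - j) + (j - n)) * (a' n + b' j) =
   2 * (\sum_(n < N) a' n * (\sum_(j < N) t ^+ ((n - j) + (j - n))) +
        \sum_(j < N) b' j * (\sum_(n < N) t ^+ ((n - j) + (j - n)))).
  rewrite mulrDr 2!mulr_sumr.
  under [X in _ = _ + X]eq_bigr => j _ do rewrite !mulr_sumr.
  rewrite [X in _ = _ + X]exchange_big -big_split/=; apply: eq_bigr => n _.
  rewrite !mulr_sumr -big_split/=; apply: eq_bigr => j _; ring.
rewrite E ler_pM2l//.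
have -> : G * 4 = 2 * G + 2 * G by ring.
apply: lerD.
  apply: (@le_trans _ _ (\sum_(n < N) a' n * G)).
    by apply: ler_sum => n _; rewrite ler_pM2l.
  by rewrite -mulr_suml ler_pM2r.
apply: (@le_trans _ _ (\sum_(n < N) b' n * G)).
  apply: ler_sum => j _; rewrite ler_pM2l//; apply: le_trans (row j).
  by apply: ler_sum => n _; rewrite addnC.
by rewrite -mulr_suml ler_pM2r.
Qed.

Lemma Ip_normalize r G g : 0 < r -> 0 < G -> lp r g -> Ip r g <= G `^ r ->
  Ip r (fun y => G^-1 * g y) <= 1.
Proof.
move=> r0 G0 lg hG; have [_ ->] := lpZ G^-1 (ltW r0) lg.
rewrite gtr0_norm ?invr_gt0// -powR_inv1 ?(ltW G0)// -powRrM mulN1r powRN.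
by rewrite mulrC ler_pdivrMr ?mul1r// powR_gt0.
Qed.

(** Homogeneity reduces to norms at most 1, and enlarging the two dyadic ranges makes them equal. *)
Lemma lvl_bil : exists2 C : R, 0 < C & forall g F (G H : R), lvl q g -> lvl p F ->
  0 < G -> 0 < H -> Ip q g <= G `^ q -> Ip p F <= H `^ p ->
  acost mu latom (bil S S' g F) (C * G * H).
Proof.
have [C C0 hC] := lvls_bil; exists C => // g F G H lg lF G0 H0 Gg HF.
have iG : 0 < G^-1 by rewrite invr_gt0.
have iH : 0 < H^-1 by rewrite invr_gt0.
have bg := lvl_bbf q0 lg; have bF := lvl_bbf p0 lF.
have [s [N lg']] := lvl_lvls (lvlZ q0 iG lg).
have [s' [N' lF']] := lvl_lvls (lvlZ p0 iH lF).
have [s0 _ _] := lg'; have [s'0 _ _] := lF'.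
pose r := Num.min s s'.
have r0 : 0 < r by rewrite lt_min s0.
have [M hM] : exists M, Num.max (s * 2 ^+ N) (s' * 2 ^+ N') / r < 2 ^+ M.
  by apply: expr_unbounded; rewrite ltr1n.
have {}hM : Num.max (s * 2 ^+ N) (s' * 2 ^+ N') <= r * 2 ^+ M.
  by rewrite [leRHS]mulrC -ler_pdivrMr// ltW.
have := hC (fun y => G^-1 * g y) (fun y => H^-1 * F y) r M.
move=> /(_ (lvls_mono lg' r0 _ _) (lvls_mono lF' r0 _ _)) h.
have {h} := h _ _ _ _ (Ip_normalize q0 G0 (bbf_lp hs q0 bg) Gg) (Ip_normalize p0 H0 (bbf_lp hs p0 bF) HF).
rewrite /r !ge_min !lexx orbT; move: hM; rewrite ge_max => /andP[-> ->] /(_ isT isT isT isT).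
move=> /(acostZ (G * H) (latom_family hs)) h.
rewrite -mulrA mulrC -(gtr0_norm (mulr_gt0 G0 H0)).
apply: (acost_eq_ae h) (latom_family hs).
  exact: intg_meas (intg_bil hs hp bg bF).
apply: (ae_imp2 (op_scale (pair_half' hp) G^-1 bg) (op_scale (pair_half hp) H^-1 bF)) => y e1 e2.
rewrite /bil e1 e2; field; by rewrite !gt_eqF.
Qed.

Variables Ap Aq : R.
Hypothesis hS : lpop mu p S Ap.
Hypothesis hS' : lpop mu q S' Aq.

(** The extension is made in [g] for dyadic [F], then in [F] for arbitrary [g]; the second time [S]
    and [S'] are exchanged, which changes the sign of the form. *)
Theorem lp_bil : exists2 C : R, 0 < C & forall g F (G H : R), lp q g -> lp p F ->
  0 < G -> 0 < H -> Ip q g <= G `^ q -> Ip p F <= H `^ p ->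
  acost mu latom (bil S S' g F) (C * G * H).
Proof.
have [C C0 hC] := lvl_bil; exists (4 * (4 * C)); first by rewrite mulr_gt0// mulr_gt0.
have h1 g F (G H : R) : lp q g -> lvl p F -> 0 < G -> 0 < H -> Ip q g <= G `^ q ->
    Ip p F <= H `^ p -> acost mu latom (bil S S' g F) (4 * C * G * H).
  move=> lg lF G0 H0 Gg HF.
  have := bil_extend hs p0 q0 pq hS hS' (bbf_lp hs p0 (lvl_bbf p0 lF)) H0 HF (C := C * H).
  rewrite (_ : 4 * C * G * H = 4 * (C * H) * G); last by ring.
  apply => //; first by rewrite mulr_ge0// ltW.
  by move=> g' G' lg' G'0 Gg'; rewrite mulrAC; exact: hC.
have flip g F C' : acost mu latom (bil S S' g F) C' -> acost mu latom (bil S' S F g) C'.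
  move=> /(acostZ (-1) (latom_family hs)); rewrite normrN1 mul1r.
  by congr (acost _ _ _ _); apply/funext => y; rewrite /bil; ring.
have flip' g F C' : acost mu latom (bil S' S F g) C' -> acost mu latom (bil S S' g F) C'.
  move=> /(acostZ (-1) (latom_family hs)); rewrite normrN1 mul1r.
  by congr (acost _ _ _ _); apply/funext => y; rewrite /bil; ring.
move=> g F G H lg lF G0 H0 Gg HF; apply: flip'.
have pq' : q^-1 + p^-1 = 1 by rewrite addrC.
have := bil_extend hs q0 p0 pq' hS' hS lg G0 Gg (C := 4 * C * G).
rewrite (_ : 4 * (4 * C) * G * H = 4 * (4 * C * G) * H); last by ring.
apply => //; first by apply: mulr_ge0; [apply: mulr_ge0 => //|]; exact: ltW.
by move=> F' H' lF' H'0 HF'; apply: flip; exact: h1.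
Qed.

End pair.

End lp_estimate.

(** * Duality of Lebesgue spaces *)

Section duality.
Context d (T : measurableType d) (R : realType).
Variable mu : {measure set T -> \bar R}.
Local Notation intg := (intg mu).
Local Notation I := (I mu).
Local Notation lp := (lp mu).
Local Notation Ip := (Ip mu).
Local Notation meas := (measurable_fun [set: T]).
Implicit Types (f g h k : T -> R).

Lemma I_monotone (f_ : nat -> T -> R) f C : (forall n, intg (f_ n)) ->
  (forall n x, 0 <= f_ n x) -> (forall x, {homo f_^~ x : m n / (m <= n)%N >-> m <= n}) ->
  (forall x, f_ n x @[n --> \oo] --> f x) -> (forall n, I (f_ n) <= C) ->
  intg f /\ I f <= C.
Proof.
move=> i_ f0 nd cf hC.
have m_ n : meas (f_ n) by exact: intg_meas (i_ n).
have mf : meas f by apply: (measurable_fun_cvg (h := f_)) => // x _; exact: cf.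
have fge0 x : 0 <= f x.
  by rewrite -(cvg_lim (@Rhausdorff R) (cf x)); apply: limr_ge; [apply/cvg_ex; exists (f x); exact: cf|exact: nearW].
have E : (\int[mu]_x (f x)%:E = limn (fun n => \int[mu]_x (f_ n x)%:E))%E.
  rewrite -monotone_convergence//.
  - apply: eq_integral => x _; apply/esym/cvg_lim => //.
    by apply: cvg_EFin; [exact: nearW|exact: cf].
  - by move=> n; exact/measurable_EFinP.
  - by move=> n x _; rewrite lee_fin.
  - by move=> x _ m n mn; rewrite lee_fin; exact: nd.
have En n : (\int[mu]_x (f_ n x)%:E = (I (f_ n))%:E)%E.
  by rewrite /I /Rintegral fineK//; apply: integrable_fin_num => //; exact: (i_ n).
have le : (\int[mu]_x (f x)%:E <= C%:E)%E.
  rewrite E; apply: lime_le; last by apply: nearW => n; rewrite En lee_fin.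
  apply: ereal_nondecreasing_is_cvgn => m n mn; apply: ge0_le_integral => //.
  - by move=> x _; rewrite lee_fin.
  - exact/measurable_EFinP.
  - exact/measurable_EFinP.
  - by move=> x _; rewrite lee_fin; exact: nd.
have iff : intg f.
  apply/integrableP; split; first exact/measurable_EFinP.
  apply: le_lt_trans (_ : (_ <= C%:E)%E) _; last by rewrite ltry.
  apply: le_trans le; rewrite le_eqVlt; apply/orP; left; apply/eqP.
  by apply: eq_integral => x _ /=; rewrite ger0_norm.
split => //; rewrite -lee_fin /I /Rintegral fineK//; exact: integrable_fin_num.
Qed.

Section conjugate.
Variables p q : R.
Hypothesis p0 : 0 < p.
Hypothesis q0 : 0 < q.
Hypothesis pq : p^-1 + q^-1 = 1.

(* The test function attaining equality in Hoelder's inequality against [k]; for [q < 2] the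
   junk value of the negative power at [0] is harmless. *)
Definition extremal k : T -> R := fun x => `|k x| `^ (q - 2) * k x.

Let q1 : 1 < q.
Proof.
have ip : 0 < p^-1 by rewrite invr_gt0.
by rewrite -invf_lt1// -pq ltrDr.
Qed.

Let pqE : (q - 1) * p = q.
Proof.
have : (p^-1 + q^-1) * (p * q) = p * q by rewrite pq mul1r.
rewrite mulrDl mulrA mulVf ?gt_eqF// mul1r (mulrC p) mulrA mulVf ?gt_eqF// mul1r => h.
by rewrite mulrBl mul1r -h; ring.
Qed.

Lemma extremal_mul k x : extremal k x * k x = `|k x| `^ q.
Proof.
rewrite /extremal; have [->|k0] := eqVneq (k x) 0; first by rewrite mulr0 normr0 powR0// gt_eqF.
rewrite -mulrA -expr2 -[k x ^+ 2]real_normK ?num_real// -powR_mulrn// -powRD ?normr_eq0 ?k0 ?implybT//.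
by rewrite subrK.
Qed.

Lemma norm_extremal k x : `|extremal k x| = `|k x| `^ (q - 1).
Proof.
rewrite /extremal normrM (ger0_norm (powR_ge0 _ _)).
have [->|k0] := eqVneq (k x) 0.
  by rewrite normr0 mulr0 powR0// gt_eqF// subr_gt0.
rewrite -{2}(powRr1 (normr_ge0 (k x))) -powRD ?normr_eq0 ?k0 ?implybT//.
by congr (_ `^ _); ring.
Qed.

Lemma powR_extremal k x : `|extremal k x| `^ p = `|k x| `^ q.
Proof. by rewrite norm_extremal -powRrM pqE. Qed.

Lemma meas_extremal k : meas k -> meas (extremal k).
Proof. by move=> mk; apply: measurable_funM => //; exact: meas_norm_powR. Qed.

Lemma lp_extremal k : lp q k -> lp p (extremal k).
Proof.
move=> [mk ik]; split; first exact: meas_extremal.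
by apply: eq_intg ik => x; rewrite powR_extremal.
Qed.

(** Division by [J^(1/p)], possible because [J] is a finite real number, leaves [J^(1/q) <= A]. *)
Lemma self_bound (J A : R) : 0 <= J -> 0 < A -> (0 < J -> J <= A * J `^ p^-1) -> J <= A `^ q.
Proof.
rewrite le_eqVlt => /orP[/eqP <- _ _|J0 A0 /(_ J0) h]; first exact: powR_ge0.
have e1 : J `^ p^-1 * J `^ q^-1 = J.
  by rewrite -powRD ?pq ?powRr1 ?(ltW J0)// gt_eqF ?implybT.
have : J `^ q^-1 <= A.
  by rewrite -(ler_pM2l (powR_gt0 p^-1 J0)) e1 mulrC.
move=> /(ge0_ler_powR (ltW q0)); rewrite !nnegrE powR_ge0 (ltW A0) => /(_ isT isT).
by rewrite -powRrM mulVf ?gt_eqF// powRr1// ltW.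
Qed.

(** The converse of Hoelder's inequality, tested on [extremal k]. Membership of [k] in [L^q] is
    assumed, which makes [self_bound] applicable. *)
Lemma dual_bound k A : 0 < A -> lp q k ->
  (forall f H, lp p f -> 0 < H -> Ip p f <= H `^ p -> I (fun x => f x * k x) <= A * H) ->
  Ip q k <= A `^ q.
Proof.
move=> A0 lk hA; apply: self_bound => //; first exact: Ip_ge0.
move=> J0; have := hA _ (Ip q k `^ p^-1) (lp_extremal lk) (powR_gt0 _ J0).
rewrite (eq_I mu (extremal_mul k)); apply.
rewrite -powRrM mulVf ?gt_eqF// powRr1 ?(ltW J0)// /Ip.
by rewrite (eq_I mu (powR_extremal k)).
Qed.

Lemma dual_zero k : lp q k -> (forall f, lp p f -> I (fun x => f x * k x) = 0) ->
  {ae mu, forall x, k x = 0}.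
Proof.
move=> lk h0; have := h0 _ (lp_extremal lk); rewrite (eq_I mu (extremal_mul k)) => e.
have [mk ik] := lk.
have : I (fun x => `| `|k x| `^ q|) = 0.
  by rewrite -[RHS]e; apply: eq_I => x; rewrite ger0_norm ?powR_ge0.
move=> /(I_eq0_ae ik) h; apply: (ae_imp h) => x /powR_eq0_eq0/eqP.
by rewrite normr_eq0 => /eqP.
Qed.

Section riesz.
Variables (w : T -> R) (phi : (T -> R) -> R) (A : R).
Hypothesis A0 : 0 < A.
Hypothesis w0 : forall x, 0 < w x.
Hypothesis lw : lp p w.
Hypothesis sf : sigma_finite [set: T] mu.
Hypothesis phi_lin : forall a f g, lp p f -> lp p g ->
  phi (fun x => a * f x + g x) = a * phi f + phi g.
Hypothesis phi_bd : forall f H, lp p f -> 0 < H -> Ip p f <= H `^ p -> `|phi f| <= A * H.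

Lemma phi_cvg (f_ : nat -> T -> R) : (forall n, lp p (f_ n)) ->
  Ip p (f_ n) @[n --> \oo] --> 0 -> phi (f_ n) @[n --> \oo] --> 0.
Proof.
move=> lf cf; apply/cvgrPdist_le => e e0.
have e1 : 0 < (e / A) `^ p by rewrite powR_gt0// divr_gt0.
move/cvgrPdist_le : cf => /(_ _ e1) [N _ hN]; exists N => // n /= /hN.
rewrite !sub0r !normrN ger0_norm ?Ip_ge0// => h.
apply: le_trans (phi_bd (lf n) (divr_gt0 e0 A0) h) _.
by rewrite mulrC divfK// gt_eqF.
Qed.

Let lz : lp p (fun=> 0). Proof. exact: lp0. Qed.

Let phi0 : phi (fun=> 0) = 0.
Proof.
have := phi_lin 1 lz lz; rewrite (_ : (fun x => _) = fun=> 0); first lra.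
by apply/funext => x; rewrite mulr0 addr0.
Qed.

Let phiZ a f : lp p f -> phi (fun x => a * f x) = a * phi f.
Proof.
move=> lf; have := phi_lin a lf lz; rewrite phi0 addr0 => <-; congr phi.
by apply/funext => x; rewrite addr0.
Qed.

Let phiD f g : lp p f -> lp p g -> phi (fun x => f x + g x) = phi f + phi g.
Proof.
move=> lf lg; have := phi_lin 1 lf lg; rewrite mul1r => <-; congr phi.
by apply/funext => x; rewrite mul1r.
Qed.

Let lwM f : meas f -> (forall x, `|f x| <= 1) -> lp p (fun x => w x * f x).
Proof.
move=> mf f1; apply: (proj1 (lp_le (ltW p0) _ _ lw)).
  by apply: measurable_funM => //; case: lw.
by move=> x; rewrite normrM ler_piMr.
Qed.

(** The weight [w] makes every measurable set admissible, also those of infinite measure, so that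
    [nu] is a finite charge. *)
Let nu (D : set T) : \bar R := (phi (fun x => w x * \1_D x))%:E.

Let lw1 D : measurable D -> lp p (fun x => w x * \1_D x).
Proof. by move=> mD; apply: lwM => [|x]; [exact: meas_indic|exact: norm_indic]. Qed.

Let nu0 : nu set0 = 0%E.
Proof.
rewrite /nu (_ : (fun x => _) = fun=> 0) ?phi0//.
by apply/funext => x; rewrite indicE in_set0 mulr0.
Qed.

Let nu_fin D : measurable D -> nu D \is a fin_num.
Proof. by []. Qed.

(** Countable additivity is the continuity of [phi]: the tails, multiplied by [w], tend to 0 in
    [L^p] by dominated convergence. *)
Let nu_sigma : semi_sigma_additive nu.
Proof.
move=> F mF tF mU; pose U := \bigcup_n F n; rewrite -/U in mU *.
pose G n := \bigcup_(i < n) F i.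
have mG n : measurable (G n) by apply: bigcup_measurable => i _; exact: mF.
have sumG n x : \1_(G n) x = \sum_(i < n) \1_(F i) x :> R.
  elim: n => [|n IH].
    by rewrite big_ord0 /G (_ : \bigcup_(i < _) _ = set0) ?indicE ?in_set0// bigcup_mkord big_ord0.
  rewrite big_ord_recr/= -IH; have [[h ->]|[h ->]] := @indicP _ R (G n) x.
    have nF : ~ F n x.
      move=> Fn; have [i /= i_n Fi] := h.
      by move/trivIsetP : tF => /(_ i n Logic.I Logic.I); rewrite ltn_eqF// => /(_ isT)/seteqP[/(_ x (conj Fi Fn))].
    rewrite [\1_(F n) x]indicE memNset// addr0 indicE mem_set//.
    by have [i /= i_n Fi] := h; exists i => //=; exact: ltnW.
  rewrite add0r; have [[Fn ->]|[Fn ->]] := @indicP _ R (F n) x.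
    by rewrite indicE mem_set//; exists n => /=.
  rewrite indicE memNset// => -[i /= i_n Fi].
  move: i_n; rewrite ltnS leq_eqVlt => /orP[/eqP e|i_n]; first by apply: Fn; rewrite -e.
  by apply: h; exists i.
have GU n : G n `<=` U by move=> x [i _ Fi]; exists i.
have nuG n : (\sum_(0 <= i < n) nu (F i) = (phi (fun x => w x * \1_(G n) x))%:E)%E.
  elim: n => [|n IH].
    rewrite big_geq//; congr (_%:E); rewrite -[LHS]phi0; congr phi; apply/funext => x.
    by rewrite sumG big_ord0 mulr0.
  rewrite big_nat_recr//= IH -EFinD -phiD; [|exact: lw1|exact: lw1].
  by congr (phi _)%:E; apply/funext => x; rewrite !sumG big_ord_recr/=; ring.
rewrite (_ : (fun n => _) = EFin \o (fun n => phi (fun x => w x * \1_(G n) x))); last first.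
  by apply/funext => n; rewrite nuG.
apply: cvg_EFin; first exact: nearW.
have lU := lw1 mU.
have ltail n : lp p (fun x => w x * \1_(G n) x + -1 * (w x * \1_U x)).
  by apply: lpD; [exact: ltW|exact: lw1|exact: (lpZ (-1) (ltW p0) lU).1].
have tailE n x : `|w x * \1_(G n) x + -1 * (w x * \1_U x)| <= `|w x|.
  have [[h ->]|[h ->]] := @indicP _ R (G n) x.
    by rewrite indicE (mem_set (GU _ _ h)) !mulr1 mulN1r subrr normr0.
  by have [[_ ->]|[_ ->]] := @indicP _ R U x; rewrite ?mulr1 ?mulr0 ?add0r ?normr0// mulN1r normrN.
have c0 : Ip p (fun x => w x * \1_(G n) x + -1 * (w x * \1_U x)) @[n --> \oo] --> 0.
  have [mw iw] := lw.
  have [|||_ _] := @I_dct _ T R mu _ (fun=> 0) (fun x => `|w x| `^ p)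
    (fun n => meas_norm_powR p (ltail n).1) _ _ _ iw.
  - exact: measurable_cst.
  - apply: aeW => x; apply/cvgrPdist_le => e e0.
    have [Ux|nUx] := pselect (U x).
      have [i _ Fi] := Ux; exists i.+1 => // n /= i_n.
      rewrite !indicE (mem_set Ux) mem_set; last by exists i.
      by rewrite mulr1 mulN1r subrr normr0 powR0 ?gt_eqF// subrr normr0 ltW.
    apply: nearW => n; rewrite !indicE (memNset nUx) memNset; last by move=> h; exact: nUx (GU _ _ h).
    by rewrite mulr0 mulr0 addr0 normr0 powR0 ?gt_eqF// subrr normr0 ltW.
  - apply: aeW => x n; rewrite ger0_norm ?powR_ge0//.
    by apply: ge0_ler_powR; rewrite ?nnegrE ?(ltW p0).
  - by rewrite I0.
have := phi_cvg ltail c0.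
have E n : phi (fun x => w x * \1_(G n) x + -1 * (w x * \1_U x)) =
    phi (fun x => w x * \1_(G n) x) - phi (fun x => w x * \1_U x).
  by rewrite phiD ?phiZ ?mulN1r//; [exact: lw1|exact: (lpZ (-1) (ltW p0) lU).1].
under eq_fun do rewrite E.
by move=> /subr_cvg0.
Qed.

HB.instance Definition _ := isCharge.Build _ T R nu nu0 nu_fin nu_sigma.

Let mu' : set T -> \bar R := mu.
HB.instance Definition _ := Measure.on mu'.
HB.instance Definition _ := Measure_isSigmaFinite.Build _ T R mu' sf.

Lemma riesz_density : exists2 k : T -> R, intg k &
  forall D, measurable D -> phi (fun x => w x * \1_D x) = I (fun x => \1_D x * k x).
Proof.
have dom : nu `<< mu'.
  apply/null_content_dominatesP => D mD D0; rewrite /nu; congr (_%:E).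
  have z : I (fun x => `|w x * \1_D x| `^ p) = 0.
    have [mw iw] := lw; have [_ iD] := lw1 mD.
    rewrite -[RHS](I0 mu); apply: (proj2 (I_eq_ae (intg0 mu) (intg_meas iD) _)).
    exists D; split => // x /=; apply: contra_notP => nD.
    by rewrite indicE memNset// mulr0 normr0 powR0// gt_eqF.
  apply/eqP; rewrite -normr_eq0 eq_le normr_ge0 andbT; apply/ler_addgt0Pr => e e0.
  rewrite add0r; have := phi_bd (lw1 mD) (divr_gt0 e0 A0).
  by rewrite [Ip _ _]z mulrCA divff ?gt_eqF// mulr1; apply; exact: powR_ge0.
pose f := @Radon_Nikodym _ T R nu mu'.
have fi : mu.-integrable [set: T] f by exact: (Radon_Nikodym_integrable dom).
have E x : (fine (f x))%:E = f x by rewrite fineK//; exact: (Radon_Nikodym_fin_num x dom).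
exists (fine \o f); first by apply: eq_integrable fi => // x _; rewrite /= E.
move=> D mD; rewrite (_ : phi _ = fine (nu D))// (Radon_Nikodym_integral dom mD) /I /Rintegral; congr fine.
rewrite [LHS]integral_mkcond; apply: eq_integral => x _; rewrite /patch.
case: ifPn => h; first by rewrite indicE h mul1r/= E.
by rewrite indicE (negbTE h) mul0r.
Qed.

(** The representing function is [h = k / w], with [k] the density of [nu]. The identity passes from
    indicators to functions bounded by a multiple of [w], and from there to [L^p] by truncation at
    multiples of [w]. *)
Lemma lp_riesz : exists2 h, lp q h & forall f, lp p f -> phi f = I (fun x => f x * h x).
Proof.
have [k ik hk] := riesz_density.
have [mw iw] := lw; have mk := intg_meas ik.
(* The defect of the representation, to be shown zero on measurable functions bounded by 1. *)
pose D f := phi (fun x => w x * f x) - I (fun x => f x * k x).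
have Ilk f : meas f -> (forall x, `|f x| <= 1) -> intg (fun x => f x * k x).
  move=> mf f1; apply: eq_intg (intgM_bd ik mf f1) => x; exact: mulrC.
have Dlin a b f g : meas f -> meas g -> (forall x, `|f x| <= 1) -> (forall x, `|g x| <= 1) ->
    D (fun x => a * f x + b * g x) = a * D f + b * D g.
  move=> mf mg f1 g1; have lf := lwM mf f1; have lg := lwM mg g1.
  rewrite /D (_ : (fun x => w x * _) = fun x => a * (w x * f x) + b * (w x * g x)); last first.
    by apply/funext => x; ring.
  rewrite phiD ?phiZ//; [|exact: (lpZ a (ltW p0) lf).1|exact: (lpZ b (ltW p0) lg).1].
  rewrite (eq_I mu (g := fun x => a * (f x * k x) + b * (g x * k x))); last by move=> x; ring.
  by rewrite ID ?IZ//; [ring|exact: Ilk|exact: Ilk|apply: intgZ; exact: Ilk|apply: intgZ; exact: Ilk].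
have D1 E : measurable E -> D (\1_E) = 0 by move=> mE; rewrite /D hk// subrr.
pose CD := A * (1 + Ip p w) `^ p^-1 + I (fun x => `|k x|).
have Dbd f : meas f -> (forall x, 0 <= f x <= 1) -> `|D f| <= CD.
  move=> mf f01; have f1 x : `|f x| <= 1 by have /andP[a b] := f01 x; rewrite ger0_norm.
  apply: le_trans (ler_normB _ _) _; apply: lerD.
    have P0 : 0 < 1 + Ip p w by rewrite ltr_pwDl// Ip_ge0.
    apply: phi_bd; [exact: lwM|exact: powR_gt0|].
    rewrite -powRrM mulVf ?gt_eqF// powRr1 ?(ltW P0)//.
    apply: le_trans (_ : Ip p w <= _); last by rewrite lerDr.
    apply: (lp_le (ltW p0) _ _ lw).2; first exact: measurable_funM.
    by move=> x; rewrite normrM ler_piMr.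
  apply: le_trans (I_abs (Ilk f mf f1)) _; apply: I_le => [||x].
  - by apply: intg_norm; exact: Ilk.
  - exact: intg_norm.
  - by rewrite normrM ler_piMl.
(* [D] vanishes on indicators, and [f = (1_{f >= 1/2} + r) / 2] with [0 <= r <= 1]. *)
have Dhalf n : forall f, meas f -> (forall x, 0 <= f x <= 1) -> `|D f| <= 2^-1 ^+ n * CD.
  elim: n => [|n IH] f mf f01; first by rewrite expr0 mul1r; exact: Dbd.
  pose E := [set x | 2^-1 <= f x].
  have mE : measurable E.
    rewrite (_ : E = [set: T] `&` f @^-1` `[2^-1, +oo[%classic).
      by apply: mf => //; exact: measurable_itv.
    by rewrite setTI; apply/seteqP; split => x /=; rewrite in_itv/= andbT.
  pose r x := 2 * f x - \1_E x.
  have r01 x : 0 <= r x <= 1.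
    have /andP[a b] := f01 x; rewrite /r; have [[h ->]|[h ->]] := @indicP _ R E x.
      by move: h; rewrite /E/= => h; lra.
    by move/negP : h; rewrite -ltNge => h; lra.
  have mr : meas r by apply: measurable_funB; [exact: measurable_funM|exact: meas_indic].
  have -> : D f = 2^-1 * D r.
    have /= := Dlin 2^-1 2^-1 (\1_E) r (@meas_indic _ T R E mE) mr.
    rewrite (_ : (fun x => 2^-1 * \1_E x + 2^-1 * r x) = f); last first.
      by apply/funext => x; rewrite /r; field.
    rewrite (D1 _ mE) mulr0 add0r; apply => x; first exact: norm_indic.
    by have /andP[a b] := r01 x; rewrite ger0_norm.
  by rewrite normrM gtr0_norm// exprS -mulrA ler_pM2l//; exact: IH.
have D0 f : meas f -> (forall x, 0 <= f x <= 1) -> D f = 0.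
  move=> mf f01; apply/eqP; rewrite -normr_eq0 eq_le normr_ge0 andbT.
  have c : (2^-1 ^+ n * CD) @[n --> \oo] --> 0.
    under eq_fun do rewrite mulrC.
    by apply: cvgn0_scale; exact: half_cvg0.
  rewrite -(cvg_lim (@Rhausdorff R) c); apply: limr_ge.
    by apply/cvg_ex; exists 0.
  by apply: nearW => n; exact: Dhalf.
have D2 f : meas f -> (forall x, `|f x| <= 1) -> D f = 0.
  move=> mf f1.
  have half x : 0 <= (f x + 1) / 2 <= 1.
    by have := f1 x; rewrite ler_norml => /andP[a b]; lra.
  have mh : meas (fun x => (f x + 1) / 2).
    by apply: measurable_funM => //; exact: measurable_funD.
  have one (x : T) : (0 <= (1 : R)) && ((1 : R) <= 1) by rewrite ler01 lexx.
  have /= := Dlin 2 (-1) (fun x => (f x + 1) / 2) (fun=> 1) mh (measurable_cst _).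
  rewrite (D0 _ mh half) (D0 (fun=> 1) (measurable_cst _) one).
  rewrite (_ : (fun x => 2 * ((f x + 1) / 2) + -1 * 1) = f); last first.
    by clear one; apply/funext => x; field.
  rewrite !mulr0 addr0; apply => x; last by rewrite normr1.
  by have /andP[a b] := half x; rewrite ger0_norm.
pose h x := k x / w x.
have mwV : meas (fun x => (w x)^-1).
  rewrite (_ : (fun x => _) = fun x => w x `^ (-1)).
    apply: (measurableT_comp (f := fun y : R => y `^ (-1))) => //; exact: measurable_powR.
  by apply/funext => x; rewrite powR_inv1// ltW.
have mh : meas h by exact: measurable_funM.
have phiE f M : 0 < M -> meas f -> (forall x, `|f x| <= M * w x) ->
    [/\ lp p f, intg (fun x => f x * h x) & phi f = I (fun x => f x * h x)].
  move=> M0 mf fM; pose g x := f x / (M * w x).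
  have g1 x : `|g x| <= 1.
    by rewrite /g normrM normfV (gtr0_norm (mulr_gt0 M0 (w0 x))) ler_pdivrMr ?mulr_gt0// mul1r.
  have mg : meas g.
    rewrite (_ : g = fun x => f x * (M^-1 * (w x)^-1)).
      by apply: measurable_funM => //; exact: measurable_funM.
    by apply/funext => x; rewrite /g invfM.
  have fE : f = fun x => M * (w x * g x).
    by apply/funext => x; rewrite /g; field; rewrite !gt_eqF.
  have hE x : M * (g x * k x) = f x * h x by rewrite /h /g; field; rewrite !gt_eqF.
  split.
  - by rewrite fE; exact: (lpZ M (ltW p0) (lwM mg g1)).1.
  - by apply: eq_intg hE _; apply: intgZ; exact: Ilk.
  rewrite -(eq_I mu hE) IZ; last exact: Ilk.
  rewrite {1}fE phiZ; last exact: lwM.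
  by congr (_ * _); apply/eqP; rewrite -subr_eq0; apply/eqP; exact: D2.
pose E (f : T -> R) n := [set x | `|f x| <= n.+1%:R * w x].
have mE f n : meas f -> measurable (E f n).
  move=> mf; rewrite (_ : E f n = [set: T] `&` (fun x => n.+1%:R * w x - `|f x|) @^-1` `[0, +oo[%classic).
    have : meas (fun x => n.+1%:R * w x - `|f x|).
      by apply: measurable_funB; [exact: measurable_funM|exact: measurableT_comp].
    by apply => //; exact: measurable_itv.
  by rewrite setTI; apply/seteqP; split => x /=; rewrite in_itv/= andbT subr_ge0.
have En f x : \forall n \near \oo, E f n x.
  exists (Num.Def.truncn (`|f x| / w x)) => // n /= hn.
  rewrite /E/= -ler_pdivrMr//; apply: ltW; apply: lt_le_trans (truncnS_gt _) _.
  by rewrite ler_nat ltnS.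
have phiE1 f n : meas f -> [/\ lp p (fun x => f x * \1_(E f n) x),
    intg (fun x => f x * \1_(E f n) x * h x) &
    phi (fun x => f x * \1_(E f n) x) = I (fun x => f x * \1_(E f n) x * h x)].
  move=> mf; apply: (phiE _ n.+1%:R) => //.
    by apply: measurable_funM => //; apply: meas_indic; exact: mE.
  move=> x; have [[e ->]|[e ->]] := @indicP _ R (E f n) x; first by rewrite mulr1.
  by rewrite mulr0 normr0 mulr_ge0// ltW.
(* Applying [phi] to truncations of [extremal h] bounds the integrals of [|h|^q] over the sets
   [E f n] uniformly; monotone convergence then removes the truncation. *)
have lh : lp q h.
  split => //; pose f := extremal h; have mf : meas f by exact: meas_extremal.
  have fhE n x : f x * \1_(E f n) x * h x = `|h x| `^ q * \1_(E f n) x.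
    by rewrite mulrAC /f extremal_mul.
  have [] := @I_monotone (fun n x => `|h x| `^ q * \1_(E f n) x) (fun x => `|h x| `^ q) (A `^ q).
  - move=> n; have [_ i1 _] := phiE1 f n mf; exact: eq_intg (fhE n) i1.
  - by move=> n x; rewrite mulr_ge0 ?powR_ge0// indicE.
  - move=> x m n mn; apply: ler_wpM2l; first exact: powR_ge0.
    have [[e ->]|[e ->]] := @indicP _ R (E f m) x; last by rewrite indicE.
    rewrite indicE mem_set//; apply: le_trans e _.
    by rewrite ler_wpM2r ?(ltW (w0 x))// ler_nat.
  - move=> x; apply/cvgrPdist_le => e e0; have [N _ hN] := En f x.
    exists N => // n /= /hN h'; rewrite indicE mem_set// mulr1 subrr normr0; exact: ltW.
  - move=> n; have [l1 i1 e1] := phiE1 f n mf.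
    apply: self_bound => // [|J0]; first by apply: I_ge0 => x; rewrite mulr_ge0 ?powR_ge0// indicE.
    rewrite -{1}(eq_I mu (fhE n)) -e1; apply: le_trans (ler_norm _) _.
    apply: phi_bd => //; first exact: powR_gt0.
    rewrite -powRrM mulVf ?gt_eqF// powRr1 ?(ltW J0)// le_eqVlt; apply/orP; left; apply/eqP.
    apply: eq_I => x; have [[e ->]|[e ->]] := @indicP _ R (E f n) x; last first.
      by rewrite !mulr0 normr0 powR0// gt_eqF.
    by rewrite !mulr1 /f powR_extremal.
  by [].
exists h => // f lf; have [mf iff] := lf.
have ifh := lp_mul p0 q0 pq lf lh.
have c1 : (I (fun x => f x * \1_(E f n) x * h x)) @[n --> \oo] --> I (fun x => f x * h x).
  have [||||_ _] := @I_dct _ T R mu (fun n x => f x * \1_(E f n) x * h x)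
     (fun x => f x * h x) (fun x => `|f x * h x|) _ _ _ _ (intg_norm ifh).
  - by move=> n; have [_ i1 _] := phiE1 f n mf; exact: intg_meas i1.
  - exact: intg_meas ifh.
  - apply: aeW => x; apply/cvgrPdist_le => e e0; have [N _ hN] := En f x.
    exists N => // n /= /hN h'; rewrite indicE mem_set// mulr1 subrr normr0; exact: ltW.
  - apply: aeW => x n; rewrite mulrAC normrM ler_piMr//; exact: (@norm_indic T R).
  by [].
have lr n : lp p (fun x => -1 * f x + f x * \1_(E f n) x).
  have [l1 _ _] := phiE1 f n mf; apply: lpD => //; first exact: ltW.
  exact: (lpZ (-1) (ltW p0) lf).1.
have c2 : phi (fun x => -1 * f x + f x * \1_(E f n) x) @[n --> \oo] --> 0.
  apply: phi_cvg => //.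
  have [|||_ _] := @I_dct _ T R mu _ (fun=> 0) (fun x => `|f x| `^ p)
    (fun n => meas_norm_powR p (lr n).1) _ _ _ iff.
  - exact: measurable_cst.
  - apply: aeW => x; apply/cvgrPdist_le => e e0; have [N _ hN] := En f x.
    exists N => // n /= /hN h'; rewrite indicE mem_set// mulr1 mulN1r addNr normr0.
    by rewrite powR0 ?gt_eqF// subrr normr0 ltW.
  - apply: aeW => x n; rewrite ger0_norm ?powR_ge0//.
    apply: ge0_ler_powR; rewrite ?nnegrE ?(ltW p0)//.
    by have [[e ->]|[e ->]] := @indicP _ R (E f n) x; rewrite ?mulr1 ?mulr0 ?addr0 mulN1r ?addNr ?normr0 ?normrN.
  - by rewrite I0.
have e2 n : phi (fun x => -1 * f x + f x * \1_(E f n) x) = I (fun x => f x * \1_(E f n) x * h x) - phi f.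
  have [l1 _ e1] := phiE1 f n mf; rewrite phi_lin// e1; ring.
have {}c2 : (I (fun x => f x * \1_(E f n) x * h x)) @[n --> \oo] --> phi f.
  by apply/subr_cvg0; under eq_fun do rewrite -e2.
exact: cvg_unique c2 c1.
Qed.

End riesz.

End conjugate.

End duality.

(** * Approximation by Holder functions *)

Lemma clamp_lip (R : realType) (w w' u u' : R) : 0 <= w -> 0 <= w' ->
  `|Num.max (- w) (Num.min w u) - Num.max (- w') (Num.min w' u')| <= `|u - u'| + `|w - w'|.
Proof.
move=> w0 w'0; rewrite ler_norml.
have := ler_norm (u - u'); have := ler_norm (u' - u); rewrite (distrC u' u).
have := ler_norm (w - w'); have := ler_norm (w' - w); rewrite (distrC w' w).
move: `|u - u'| `|w - w'| => P Q h1 h2 h3 h4.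
case: (leP w u) => ? ; case: (leP w' u') => ?;
 case: (leP (- w) _) => ?; case: (leP (- w') _) => ?; apply/andP; split; lra.
Qed.

Section holder_approximation.
Context (R : realType) (X : ptopologicalType).
Variables (mu : {measure set (borel X) -> \bar R}) (d : X -> X -> R).
Variables (c K eta : R).
Hypothesis hs : growing_space mu d c K eta.
Hypothesis hd : quasi_metric d.
Local Notation B := (qball d).
Local Notation mr A := (fine (mu A)).
Local Notation m x r := (mr (B x r)).
Local Notation intg := (intg mu).
Local Notation I := (I mu).
Local Notation sqi := (sqi mu).
Local Notation bbf := (bbf d).
Local Notation lp := (lp mu).
Local Notation Ip := (Ip mu).
Local Notation meas := (measurable_fun [set: borel X]).
Implicit Types (f g u v b F w : X -> R) (x y : X).

Lemma ball_open_criterion (O : set X) :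
  (forall x, O x -> exists2 r : R, 0 < r & B x r `<=` O) -> open O.
Proof.
move=> h; rewrite openE => x /h [r r0 sub]; rewrite /interior.
apply: filterS sub _; apply: open_nbhs_nbhs; split; first exact: (open_ball hs).
exact: (ball_center hs).
Qed.

(** Superlevel sets of the product are open at nonnegative heights; at negative heights the
    complement of [U], where the product is 0, is added. *)
Lemma meas_local_cont (U : set X) f : open U ->
  (forall x, U x -> forall e : R, 0 < e -> exists2 r : R, 0 < r & forall y, B x r y -> `|f x - f y| < e) ->
  meas (fun y => f y * \1_U y).
Proof.
move=> oU hf; have mU : measurable (U : set (borel X)) by exact: meas_open.
have mO a : measurable ([set y | U y /\ a < f y] : set (borel X)).
  apply: meas_open; apply: ball_open_criterion => x [Ux ax].
  have ax' : 0 < f x - a by rewrite subr_gt0.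
  have [r1 r10 h1] := hf x Ux _ ax'.
  have [r2 r20 h2] := ht_nbhs (hs_space hs) (open_nbhs_nbhs (conj oU Ux)).
  exists (Num.min r1 r2); first by rewrite lt_min r10.
  move=> y; rewrite /qball/= lt_min => /andP[/h1 y1 /h2 y2]; split => //.
  by have := ler_norm (f x - f y); lra.
apply: (measurability _ (RGenOInfty.measurableE R)) => //.
move=> _ [_ [a ->] <-]; rewrite setTI; have [a0|a0] := ltP a 0.
  rewrite (_ : _ @^-1` _ = [set y | U y /\ a < f y] `|` ~` U).
    by apply: measurableU => //; exact: measurableC.
  apply/seteqP; split => y /=; rewrite in_itv/= andbT.
    by have [[Uy ->]|[Uy ->]] := @indicP _ R U y; rewrite ?mulr1; [left|right].
  by move=> [[Uy ay]|Uy]; rewrite indicE ?(mem_set Uy) ?(memNset Uy) ?mulr1// mulr0.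
rewrite (_ : _ @^-1` _ = [set y | U y /\ a < f y])//.
apply/seteqP; split => y /=; rewrite in_itv/= andbT.
  have [[Uy ->]|[Uy ->]] := @indicP _ R U y; rewrite ?mulr1//.
  by rewrite mulr0 => /(le_lt_trans a0); rewrite ltxx.
by move=> [Uy ay]; rewrite indicE (mem_set Uy) mulr1.
Qed.

Section holder.
Variable delta : R.
Hypothesis delta0 : 0 < delta.

(** Real counterpart of [Holder], with the support condition expressed by nonvanishing instead of a
    closure. *)
Definition hol f : Prop :=
  (exists A : R, forall x y, `|f x - f y| <= A * d x y `^ delta) /\
  exists x (r : R), 0 < r /\ forall y, f y != 0 -> B x r y.

Lemma hol_small f : hol f -> forall e : R, 0 < e -> exists2 r : R, 0 < r &
  forall x y, d x y < r -> `|f x - f y| < e.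
Proof.
move=> [[A hA] _] e e0; pose A' := `|A| + 1.
have A'0 : 0 < A' by rewrite ltr_wpDl.
exists ((e / A') `^ delta^-1); first by rewrite powR_gt0// divr_gt0.
move=> x y dxy; apply: le_lt_trans (hA x y) _.
have dp : d x y `^ delta < e / A'.
  have -> : e / A' = ((e / A') `^ delta^-1) `^ delta.
    by rewrite -powRrM mulVf ?gt_eqF// powRr1// ltW// divr_gt0.
  by apply: gt0_ltr_powR dxy; rewrite ?nnegrE ?powR_ge0 ?(qm_ge0 hd).
apply: (@le_lt_trans _ _ (A' * d x y `^ delta)).
  by apply: ler_wpM2r; [exact: powR_ge0|rewrite /A'; have := ler_norm A; lra].
by rewrite mulrC -ltr_pdivlMr.
Qed.

Lemma hol_meas f : hol f -> meas f.
Proof.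
move=> hf; have := @meas_local_cont setT f openT.
rewrite (_ : (fun y => _) = f); last by apply/funext => y; rewrite indicT mulr1.
apply => x _ e e0; have [r r0 hr] := hol_small hf e0; exists r => // y; exact: hr.
Qed.

Lemma hol_bbf f : hol f -> bbf f.
Proof.
move=> hf; have mf := hol_meas hf; have [[A hA] [x [r [r0 h]]]] := hf.
exists x, r, (`|f x| + `|A| * r `^ delta); split.
  by split => // y nB; apply/eqP; apply: contra_notT nB; exact: h.
move=> y; have [->|fy] := eqVneq (f y) 0; first by rewrite normr0 addr_ge0// mulr_ge0// powR_ge0.
have dy := h y fy.
have -> : f y = f x - (f x - f y) by ring.
apply: le_trans (ler_normB _ _) _; rewrite lerD2l; apply: le_trans (hA x y) _.
apply: (@le_trans _ _ (`|A| * d x y `^ delta)).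
  by apply: ler_wpM2r; [exact: powR_ge0|exact: ler_norm].
apply: ler_wpM2l => //; apply: ge0_ler_powR; rewrite ?nnegrE ?(ltW delta0) ?(qm_ge0 hd) ?(ltW r0)//.
exact: ltW.
Qed.

Lemma holN f : hol f -> hol (fun y => - f y).
Proof.
move=> [[A hA] [x [r [r0 h]]]]; split.
  by exists A => y z; rewrite -opprD normrN.
by exists x, r; split => // y; rewrite oppr_eq0; exact: h.
Qed.

(* Clamping at a multiple of [F - 1/4] localizes a Holder function to [F > 1/4] without a
   product, and does not increase the distance to functions bounded by [M] living on [F >= 1/2]. *)
Definition holder_clamp M F u y : R :=
  let w := 4 * M * Num.max (F y - 4^-1) 0 in Num.max (- w) (Num.min w (u y)).

Lemma holder_clamp_eq0 M F u y : F y <= 4^-1 -> holder_clamp M F u y = 0.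
Proof.
move=> Fy; rewrite /holder_clamp (_ : Num.max (F y - 4^-1) 0 = 0); last first.
  by apply: max_r; lra.
rewrite mulr0 oppr0; case: (leP 0 (u y)) => hu; first by rewrite maxxx.
by rewrite max_l// ltW.
Qed.

Lemma holder_clamp_hol M F u : 0 <= M -> hol F -> hol u -> hol (holder_clamp M F u).
Proof.
move=> M0 [[A hA] [x [r [r0 h]]]] [[A' hA'] _]; split; last first.
  exists x, r; split => // y; apply: contra_neqP => nB.
  have F0 : F y = 0 by apply/eqP; apply: contra_notT nB; exact: h.
  by apply: holder_clamp_eq0; rewrite F0; lra.
exists (A' + 4 * M * A) => y z; rewrite /holder_clamp.
apply: le_trans (clamp_lip _ _ _ _) _.
- by rewrite !mulr_ge0// le_max lexx orbT.
- by rewrite !mulr_ge0// le_max lexx orbT.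
rewrite [leRHS]mulrDl; apply: lerD => //; rewrite -mulrBr normrM ger0_norm ?mulr_ge0// -[leRHS]mulrA.
apply: ler_wpM2l; first exact: mulr_ge0.
apply: le_trans (hA y z); rewrite ler_norml.
have := ler_norm (F y - F z); have := ler_norm (F z - F y); rewrite (distrC (F z)).
move: `|F y - F z| => P h1 h2.
by case: (leP (F y - 4^-1) 0) => ?; case: (leP (F z - 4^-1) 0) => ?; apply/andP; split; lra.
Qed.

Lemma holder_clamp_close M F u v y : 0 <= M -> `|v y| <= M -> (v y != 0 -> 2^-1 <= F y) ->
  `|holder_clamp M F u y - v y| <= `|u y - v y|.
Proof.
move=> M0 vM hv; pose w := 4 * M * Num.max (F y - 4^-1) 0.
have w0 : 0 <= w by rewrite !mulr_ge0// le_max lexx orbT.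
have vw : `|v y| <= w.
  have [->|/hv h] := eqVneq (v y) 0; first by rewrite normr0.
  apply: le_trans vM _; rewrite /w max_l; last lra.
  by rewrite mulrAC ler_peMl//; lra.
have -> : v y = Num.max (- w) (Num.min w (v y)).
  by move: vw; rewrite ler_norml => /andP[a b]; rewrite min_r// max_r.
apply: le_trans (clamp_lip _ _ w0 w0) _.
by rewrite subrr normr0 addr0; move: vw; rewrite ler_norml => /andP[a b]; rewrite min_r// max_r.
Qed.

Lemma holder_clamp_le M F u y N : 0 <= M -> `|F y| <= N -> `|holder_clamp M F u y| <= 4 * M * N.
Proof.
move=> M0 FN; rewrite /holder_clamp; pose w := 4 * M * Num.max (F y - 4^-1) 0; rewrite -/w.
have w0 : 0 <= w by rewrite !mulr_ge0// le_max lexx orbT.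
have wN : w <= 4 * M * N.
  apply: ler_wpM2l; first exact: mulr_ge0.
  have := ler_norm (F y); have := normr_ge0 (F y); case: (leP (F y - 4^-1) 0) => _; lra.
apply: le_trans wN; move: w0; clearbody w => w0; rewrite ler_norml.
by rewrite le_max lexx/= ge_max ge_min lexx/= andbT; lra.
Qed.

Lemma hol_sep F (t : R) : 0 < t -> hol F ->
  exists2 e : R, 0 < e & forall x y, t <= `|F x - F y| -> e <= d x y.
Proof.
move=> t0 hF; have [r r0 hr] := hol_small hF t0; exists r => // x y h.
by rewrite leNgt; apply/negP => /hr; rewrite ltNge h.
Qed.

(** Splits at height [s]: below it the ball has finite measure, above it [|f|^p <= N^p f^2 / s^2].
    Convergence in [L^2] of bounded functions on one ball thus gives convergence for every
    exponent. *)
Lemma Ip_bounded_le p f x (r N s : R) : 0 < p -> 0 < s -> ball_fun d f x r -> (forall y, `|f y| <= N) ->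
  Ip p f <= s `^ p * m x r + N `^ p / s ^+ 2 * I (fun y => f y ^+ 2).
Proof.
move=> p0 s0 bf hN; have bb : bbf f by exists x, r, N.
have [mf r0 f0] := bf; have [_ i2] := bbf_sqi hs bb; have [_ ip] := bbf_lp hs p0 bb.
have mB := meas_ball hs x r0.
rewrite -(I_indic mu mB) -IZ; last exact: intg_indic (fin_ball hs x r0).
rewrite -IZ// -ID; [|apply: intgZ; exact: intg_indic (fin_ball hs x r0)|exact: intgZ].
apply: I_le => //; first by apply: intgD; [apply: intgZ; exact: intg_indic (fin_ball hs x r0)|exact: intgZ].
move=> y; have N0 : 0 <= N by exact: le_trans (hN y).
have q0 : 0 <= N `^ p / s ^+ 2 * f y ^+ 2.
  by rewrite mulr_ge0 ?sqr_ge0// divr_ge0 ?powR_ge0// exprn_ge0// ltW.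
have [[By ->]|[nB ->]] := @indicP _ R (B x r) y; last first.
  by rewrite (f0 _ nB) normr0 powR0 ?gt_eqF// mulr0 add0r expr0n mulr0.
have [h|h] := leP `|f y| s.
  apply: ler_wpDr => //; rewrite mulr1; apply: ge0_ler_powR; rewrite ?nnegrE ?(ltW p0) ?(ltW s0)//.
apply: ler_wpDl; first by rewrite mulr1 powR_ge0.
apply: (@le_trans _ _ (N `^ p)).
  by apply: ge0_ler_powR; rewrite ?nnegrE ?(ltW p0).
rewrite mulrAC -mulrA ler_peMr ?powR_ge0//.
rewrite mulrC ler_pdivlMl ?exprn_gt0// mulr1 -[leRHS]real_normK ?num_real//.
by apply: lerXn2r; rewrite ?nnegrE ?(ltW s0)// ltW.
Qed.

Lemma Ip_bounded_cvg p (f_ : nat -> X -> R) x (r N : R) : 0 < p ->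
  (forall n, ball_fun d (f_ n) x r) -> (forall n y, `|f_ n y| <= N) ->
  I (fun y => f_ n y ^+ 2) @[n --> \oo] --> 0 -> Ip p (f_ n) @[n --> \oo] --> 0.
Proof.
move=> p0 bf hN c0; apply/cvgrPdist_le => e e0.
have [_ r0 _] := bf 0%N; have m0 := m_gt0 hs x r0.
pose s := (e / (2 * m x r)) `^ p^-1.
have em : 0 < e / (2 * m x r) by rewrite divr_gt0// mulr_gt0.
have s0 : 0 < s by exact: powR_gt0.
have sp : s `^ p * m x r = e / 2.
  by rewrite /s -powRrM mulVf ?gt_eqF// powRr1 ?(ltW em)//; field; rewrite gt_eqF.
have := cvgn0_scale (N `^ p / s ^+ 2) c0; have e2 : 0 < e / 2 by rewrite divr_gt0.
move=> /cvgrPdist_le /(_ _ e2) [n0 _ hn]; exists n0 => // n /= /hn.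
rewrite !sub0r !normrN => h; rewrite ger0_norm ?Ip_ge0//.
apply: le_trans (Ip_bounded_le p0 s0 (bf n) (hN n)) _; rewrite sp.
by have := le_trans (ler_norm _) h; lra.
Qed.

(** [L^2] convergence with a common bound and a common ball, a mode stronger than convergence in
    [L^p] for each finite [p]. It makes functionals that come from different exponents
    comparable. *)
Definition bcont (L : (X -> R) -> R) : Prop := forall (u_ : nat -> X -> R) u x (r N : R),
  (forall n, ball_fun d (u_ n) x r) -> (forall n y, `|u_ n y| <= N) ->
  ball_fun d u x r -> (forall y, `|u y| <= N) ->
  I (fun y => (u_ n y - u y) ^+ 2) @[n --> \oo] --> 0 -> L (u_ n) @[n --> \oo] --> L u.

Lemma bcont_functional p (A : R) (phi : (X -> R) -> R) : 0 < p -> 0 < A ->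
  (forall a f g, lp p f -> lp p g -> phi (fun x => a * f x + g x) = a * phi f + phi g) ->
  (forall f H, lp p f -> 0 < H -> Ip p f <= H `^ p -> `|phi f| <= A * H) -> bcont phi.
Proof.
move=> p0 A0 lin bd u_ u x r N bu hu bu' hu' c0.
have lu n : lp p (u_ n) by apply: (bbf_lp hs p0); exists x, r, N.
have lu' : lp p u by apply: (bbf_lp hs p0); exists x, r, N.
have bd_ n : ball_fun d (fun y => u_ n y - u y) x r.
  have [m1 r0 z1] := bu n; have [m2 _ z2] := bu'; split => //; first exact: measurable_funB.
  by move=> y nB; rewrite z1// z2// subrr.
have hd_ n y : `|u_ n y - u y| <= N + N by apply: le_trans (ler_normB _ _) _; exact: lerD.
have c1 := Ip_bounded_cvg p0 bd_ hd_ c0.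
have := @phi_cvg _ (borel X) R mu p phi A A0 bd _ (fun n => lpB (ltW p0) (lu n) lu') c1.
have E n : phi (fun y => u_ n y - u y) = phi (u_ n) - phi u.
  rewrite (_ : (fun y => _) = fun y => -1 * u y + u_ n y); last by apply/funext => y; ring.
  rewrite lin//; ring.
by under eq_fun do rewrite E; move/subr_cvg0.
Qed.

Hypothesis dense : forall u, sqi u -> forall e : R, 0 < e ->
  exists2 h, hol h & I (fun y => (u y - h y) ^+ 2) <= e.

Lemma harmonic_gt0 n : 0 < n.+1%:R^-1 :> R. Proof. by []. Qed.

Lemma le_harmonic_cvg0 (a : nat -> R) k : (forall n, 0 <= a n <= k * n.+1%:R^-1) -> a n @[n --> \oo] --> 0.
Proof.
move=> h; apply: (@squeeze_cvgr _ _ _ _ (fun=> 0) (fun n => k * n.+1%:R^-1)).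
- exact: nearW.
- exact: cvg_cst.
by apply: cvgn0_scale; exact: cvg_harmonic.
Qed.

(** Arbitrary Holder approximants of [v] in [L^2] are clamped along [F], which confines them to
    [F > 1/4] and keeps the error. *)
Lemma clamp_approx F v : hol F -> bbf v -> (forall y, v y != 0 -> 2^-1 <= F y) ->
  exists (u_ : nat -> X -> R) x (r N : R), [/\ forall n, hol (u_ n) /\ ball_fun d (u_ n) x r,
    forall n y, `|u_ n y| <= N, ball_fun d v x r /\ (forall y, `|v y| <= N),
    forall n y, u_ n y != 0 -> 4^-1 < F y &
    I (fun y => (u_ n y - v y) ^+ 2) @[n --> \oo] --> 0].
Proof.
move=> hF bv hv.
have [x [r [N [[mF r0 F0] FN]]]] := hol_bbf hF.
have [r' [M [bv' M0 vM]]] := bbf_at hs x bv; have [mv r'0 v0] := bv'.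
have sv := bbf_sqi hs bv.
have /choice[g hg] : forall n, exists h, hol h /\ I (fun y => (v y - h y) ^+ 2) <= n.+1%:R^-1.
  by move=> n; have [h h1 h2] := dense sv (harmonic_gt0 n); exists h.
pose u_ n := holder_clamp M F (g n).
have hu n : hol (u_ n) by apply: holder_clamp_hol => //; have [] := hg n.
exists u_, x, r, (M + 4 * M * N).
have N0 : 0 <= N by exact: le_trans (FN point).
have vF y : ~ B x r y -> v y = 0.
  move=> nB; apply/eqP; apply: contraT => /hv; rewrite F0// => h; lra.
split.
- move=> n; split => //; split => //; first exact: hol_meas (hu n).
  by move=> y nB; rewrite /u_ holder_clamp_eq0// F0//; lra.
- by move=> n y; apply: le_trans (holder_clamp_le (g n) M0 (FN y)) _; rewrite lerDr.
- by split => // y; apply: le_trans (vM y) _; rewrite lerDl !mulr_ge0.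
- move=> n y; apply: contra_neqT; rewrite -leNgt; exact: holder_clamp_eq0.
have su n : sqi (u_ n) by apply: (bbf_sqi hs); exact: hol_bbf.
apply: (@le_harmonic_cvg0 _ 1) => n; rewrite mul1r I_ge0/=; last by move=> y; exact: sqr_ge0.
have [h1 h2] := hg n; apply: le_trans h2.
have sg : sqi (g n) by apply: (bbf_sqi hs); exact: hol_bbf.
apply: I_le => [||y].
- by have [] := sqiB (su n) sv.
- by have [] := sqiB sv sg.
rewrite -[leLHS]real_normK ?num_real// -[leRHS]real_normK ?num_real//.
apply: lerXn2r; rewrite ?nnegrE// (distrC (v y)).
by apply: holder_clamp_close => //; exact: hv.
Qed.

Lemma meas_ge F (a : R) : meas F -> measurable ([set y | a <= F y] : set (borel X)).
Proof.
move=> mF; rewrite (_ : [set y | _] = [set: borel X] `&` F @^-1` `[a, +oo[%classic).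
  by apply: mF => //; exact: measurable_itv.
by rewrite setTI; apply/seteqP; split => y /=; rewrite in_itv/= andbT.
Qed.

Definition cut F v y : R := v y * \1_[set z | 2^-1 <= F z] y.

Lemma cut_le F v y : `|cut F v y| <= `|v y|.
Proof. by rewrite /cut normrM ler_piMr//; exact: (@norm_indic X R). Qed.

Lemma cut_bbf F v : hol F -> bbf v -> bbf (cut F v).
Proof. by move=> hF bv; apply: bbfM_indic => //; apply: meas_ge; exact: hol_meas. Qed.

Lemma cut_nz F v y : cut F v y != 0 -> 2^-1 <= F y.
Proof.
by rewrite /cut; have [[h _]//|[_ ->]] := @indicP _ R [set z | 2^-1 <= F z] y; rewrite mulr0 eqxx.
Qed.

Lemma cut_ball F v x r : hol F -> ball_fun d v x r -> ball_fun d (cut F v) x r.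
Proof.
move=> hF [mv r0 v0]; split => //.
  by apply: measurable_funM => //; apply: meas_indic; apply: meas_ge; exact: hol_meas.
by move=> y /v0 e; rewrite /cut e mul0r.
Qed.

(** The [F_ n] approximate [t], the difference of the indicators of the two supports. Where [v] is
    nonzero [t] is 1, so [F < 1/2] there forces [|t - F| > 1/2]: what the cut discards is controlled
    by the [L^2] error. *)
Lemma cut_approx v b : bbf v -> bbf b -> (forall y, v y = 0 \/ b y = 0) ->
  exists F_ : nat -> X -> R, [/\ forall n, hol (F_ n),
    I (fun y => (cut (F_ n) v y - v y) ^+ 2) @[n --> \oo] --> 0 &
    I (fun y => (cut (fun z => - F_ n z) b y - b y) ^+ 2) @[n --> \oo] --> 0].
Proof.
move=> bv bb vb.
have bi u : bbf u -> bbf (\1_[set y | u y != 0]) /\ measurable ([set y | u y != 0] : set (borel X)).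
  move=> bu; have mS : measurable ([set y | u y != 0] : set (borel X)).
    rewrite (_ : [set y | _] = [set: borel X] `&` u @^-1` (~` [set 0])).
      by apply: (bbf_meas bu) => //; exact: measurableC.
    by rewrite setTI; apply/seteqP; split => y /= /eqP.
  split => //; have [x [r [k [[mu_ r0 u0] hk]]]] := bu.
  exists x, r, 1; split; last by move=> y; exact: (@norm_indic X R).
  split => // y /u0 e; rewrite indicE memNset//= e eqxx; exact.
have [b1 _] := bi v bv; have [b2 _] := bi b bb.
pose t y : R := \1_[set z | v z != 0] y - \1_[set z | b z != 0] y.
have st : sqi t by apply: (bbf_sqi hs); exact: (bbfB hs b1 b2).
have /choice[F hF] : forall n, exists h, hol h /\ I (fun y => (t y - h y) ^+ 2) <= n.+1%:R^-1.
  by move=> n; have [h h1 h2] := dense st (harmonic_gt0 n); exists h.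
have key u G M n : bbf u -> hol G -> 0 <= M -> (forall y, `|u y| <= M) ->
    (forall y, u y != 0 -> `|1 - G y| = `|t y - F n y|) ->
    0 <= I (fun y => (cut G u y - u y) ^+ 2) <= (2 * M) ^+ 2 * n.+1%:R^-1.
  move=> bu hG M0 hM E; rewrite I_ge0/=; last by move=> y; exact: sqr_ge0.
  have [h1 h2] := hF n.
  apply: (@le_trans _ _ ((2 * M) ^+ 2 * I (fun y => (t y - F n y) ^+ 2))); last first.
    by apply: ler_wpM2l => //; exact: sqr_ge0.
  have [_ i1] := sqiB st (bbf_sqi hs (hol_bbf h1)).
  rewrite -IZ//; apply: I_le => [||y]; [|exact: intgZ|].
    by have [] := sqiB (bbf_sqi hs (cut_bbf hG bu)) (bbf_sqi hs bu).
  rewrite -exprMn -[leLHS]real_normK ?num_real// -[leRHS]real_normK ?num_real//.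
  apply: lerXn2r; rewrite ?nnegrE//.
  have [u0|u0] := eqVneq (u y) 0; first by rewrite /cut u0 mul0r subrr normr0.
  have P2 : 0 <= 2 * M by exact: mulr_ge0.
  rewrite normrM (ger0_norm P2) -E//.
  rewrite /cut; have [[h ->]|[h ->]] := @indicP _ R [set z | 2^-1 <= G z] y.
    by rewrite mulr1 subrr normr0 !mulr_ge0.
  rewrite mulr0 sub0r normrN; move: h => /negP; rewrite -ltNge => h.
  have h' : 2^-1 <= `|1 - G y| by apply: le_trans (ler_norm _); lra.
  apply: le_trans (hM y) _; rewrite -mulrA mulrCA ler_peMr//; lra.
exists F; have hFn n : hol (F n) by have [] := hF n.
have [_ [_ [Mv [_ hv]]]] := bv; have [_ [_ [Mb [_ hb]]]] := bb.
have Mv0 : 0 <= Mv by exact: le_trans (hv point).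
have Mb0 : 0 <= Mb by exact: le_trans (hb point).
split => //; apply: le_harmonic_cvg0 => n.
  apply: key Mv0 hv _ => // y vy; congr (`|_ - _|).
  have [e|e] := vb y; first by rewrite e eqxx in vy.
  by rewrite /t !indicE mem_set// memNset/= ?subr0// e eqxx.
apply: key Mb0 hb _ => //; first exact: holN.
move=> y by_; have [e|e] := vb y; last by rewrite e eqxx in by_.
rewrite /t !indicE (_ : (y \in [set z | b z != 0]) = true); last exact: mem_set.
rewrite memNset/=; last by rewrite e eqxx.
by rewrite -normrN; congr (`|_|); ring.
Qed.

(** First for functions living on a set [F >= 1/2], where clamped approximants are available, then
    for all test functions by cutting. *)
Lemma hol_determines L : bcont L -> (forall h, hol h -> L h = 0) -> forall u, bbf u -> L u = 0.
Proof.
move=> cL h0 u bu.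
have step F v : hol F -> bbf v -> (forall y, v y != 0 -> 2^-1 <= F y) -> L v = 0.
  move=> hF bv hv; have [u_ [x [r [N [hu uN [bv' vN] _ c0]]]]] := clamp_approx hF bv hv.
  have := cL u_ v x r N (fun n => (hu n).2) uN bv' vN c0.
  under eq_fun => n do rewrite (h0 _ (hu n).1).
  by move=> h; apply/esym; apply: (cvg_unique _ (cvg_cst _) h); exact: Rhausdorff.
have [F [hF c1 _]] := cut_approx bu (bbf0 d) (fun y => or_intror erefl).
have [x [r [N [bu' uN]]]] := bu.
have := cL (fun n => cut (F n) u) u x r N (fun n => cut_ball (hF n) bu')
  (fun n y => le_trans (cut_le _ _ _) (uN y)) bu' uN c1.
under eq_fun => n do rewrite (step _ _ (hF n) (cut_bbf (hF n) bu) (@cut_nz (F n) u)).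
by move=> h; apply/esym; apply: (cvg_unique _ (cvg_cst _) h); exact: Rhausdorff.
Qed.

End holder.

(** The sign of [k], cut by growing balls, is an admissible test function. *)
Lemma ae_zero_bbf (k : X -> R) : meas k -> (forall v, bbf v -> intg (fun y => k y * v y)) ->
  (forall v, bbf v -> I (fun y => k y * v y) = 0) -> {ae mu, forall y, k y = 0}.
Proof.
move=> mk ik h0; have mk' : meas (fun y => - k y) by exact: measurableT_comp.
have mP u : meas u -> measurable ([set y | 0 < u y] : set (borel X)).
  move=> mu_; rewrite (_ : [set y | _] = [set: borel X] `&` u @^-1` `]0, +oo[%classic).
    by apply: mu_ => //; exact: measurable_itv.
  by rewrite setTI; apply/seteqP; split => y /=; rewrite in_itv/= andbT.
pose s y : R := \1_[set z | 0 < k z] y - \1_[set z | 0 < - k z] y.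
have ks y : k y * s y = `|k y|.
  rewrite /s; have [[/= h ->]|[/= h ->]] := @indicP _ R [set z | 0 < k z] y;
  have [[/= h' ->]|[/= h' ->]] := @indicP _ R [set z | 0 < - k z] y.
  - by lra.
  - by rewrite subr0 mulr1 gtr0_norm.
  - by rewrite sub0r mulrN1 ltr0_norm//; lra.
  have h1 : k y <= 0 by rewrite leNgt; apply/negP.
  have h2 : - k y <= 0 by rewrite leNgt; apply/negP.
  by rewrite (_ : k y = 0) ?mul0r ?normr0//; lra.
have ms : meas s by apply: measurable_funB; apply: meas_indic; exact: mP.
have cc n : 0 < c ^+ n by rewrite exprn_gt0// (c_gt0 hs).
pose v n y : R := \1_(B point (c ^+ n)) y * s y.
have bv n : bbf (v n).
  apply: (bbfM_bd (k := 1 + 1)) => //; first exact: (bbf_ball hs).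
  by move=> y; apply: le_trans (ler_normB _ _) _; apply: lerD; exact: (@norm_indic X R).
have kv n y : k y * v n y = `|k y| * \1_(B point (c ^+ n)) y by rewrite /v mulrCA ks mulrC.
have [i1 i2] : intg (fun y => `|k y|) /\ I (fun y => `|k y|) <= 0.
  apply: (@I_monotone _ (borel X) R mu (fun n y => `|k y| * \1_(B point (c ^+ n)) y)).
  - by move=> n; exact: (@eq_intg _ (borel X) R mu _ _ (kv n) (ik _ (bv n))).
  - by move=> n y; rewrite mulr_ge0// indicE.
  - move=> y i j ij; apply: ler_wpM2l => //.
    have [[h ->]|[h ->]] := @indicP _ R (B point (c ^+ i)) y; last by rewrite indicE.
    by rewrite indicE mem_set//; apply: ball_mono h; rewrite ler_weXn2l// ltW// (c_gt1 hs).
  - move=> y; have [r r0 hr] := ball_in hs y point (ltr01 : 0 < 1 :> R).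
    have [N hN] := expr_unbounded r (c_gt1 hs).
    apply/cvgrPdist_le => e e0; exists N => // n /= Nn.
    rewrite indicE mem_set ?mulr1 ?subrr ?normr0; first exact: ltW.
    apply: ball_mono (hr y (ball_center hs y ltr01)); apply: le_trans (ltW hN) _.
    by rewrite ler_weXn2l// ltW// (c_gt1 hs).
  by move=> n; rewrite -(eq_I mu (kv n)) h0.
have iknorm : intg k by apply: (intg_le mk _ i1) => y.
apply: (I_eq0_ae iknorm); apply/eqP; rewrite eq_le i2; exact: I_ge0.
Qed.

End holder_approximation.

(** * Kernels *)

Section kernel.
Context (R : realType) (X : ptopologicalType).
Variables (mu : {measure set (borel X) -> \bar R}) (d : X -> X -> R).
Variables (c K eta : R).
Hypothesis hs : growing_space mu d c K eta.
Hypothesis hd : quasi_metric d.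
Local Notation B := (qball d).
Local Notation mr A := (fine (mu A)).
Local Notation m x r := (mr (B x r)).
Local Notation intg := (intg mu).
Local Notation I := (I mu).
Local Notation sqi := (sqi mu).
Local Notation bbf := (bbf d).
Local Notation meas := (measurable_fun [set: borel X]).
Local Notation cut := (@cut R X).
Implicit Types (f g u v b F w : X -> R) (x y : X) (e r C G : R).

Lemma dist_gt0 x y : x <> y -> 0 < d x y.
Proof.
move=> xy; rewrite lt_neqAle (qm_ge0 hd) andbT eq_sym; apply/eqP => /(qm_eq0 hd); exact: xy.
Qed.

Section L2_operator.
Variables (S : (X -> R) -> X -> R) (A : R).
Hypothesis A0 : 0 < A.
Hypothesis S_lin : forall a u v, bbf u -> bbf v ->
    {ae mu, forall y, S (fun z => a * u z + v z) y = a * S u y + S v y}.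
Hypothesis S_sqi : forall u, bbf u -> sqi (S u).
Hypothesis S_l2 : forall u, bbf u -> I (fun y => S u y ^+ 2) <= A ^+ 2 * I (fun y => u y ^+ 2).

Local Notation N2 u := (Num.sqrt (I (fun y => u y ^+ 2))).

Lemma op_pair_le u v : bbf u -> bbf v -> `|I (fun y => S u y * v y)| <= A * N2 u * N2 v.
Proof.
move=> bu bv; have sv := bbf_sqi hs bv.
apply: le_trans (I_abs (sqi_mul (S_sqi bu) sv)) _.
apply: le_trans (I_CS (S_sqi bu) sv) _; apply: ler_wpM2r; first exact: sqrtr_ge0.
apply: (@le_trans _ _ (Num.sqrt (A ^+ 2 * I (fun y => u y ^+ 2)))).
  by rewrite ler_wsqrtr// S_l2.
by rewrite sqrtrM ?sqr_ge0// sqrtr_sqr gtr0_norm.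
Qed.

(** The difference expands into three terms, each with a factor [v_ n - v] or [b_ n - b], and each
    is bounded by Cauchy-Schwarz. *)
Lemma op_joint (v_ b_ : nat -> X -> R) v b : (forall n, bbf (v_ n)) -> (forall n, bbf (b_ n)) ->
  bbf v -> bbf b ->
  I (fun y => (v_ n y - v y) ^+ 2) @[n --> \oo] --> 0 ->
  I (fun y => (b_ n y - b y) ^+ 2) @[n --> \oo] --> 0 ->
  I (fun y => S (v_ n) y * b_ n y) @[n --> \oo] --> I (fun y => S v y * b y).
Proof.
move=> bv_ bb_ bv bb cv cb; apply/subr_cvg0.
pose dv n y := v_ n y - v y; pose db n y := b_ n y - b y.
have bdv n : bbf (dv n) by exact: (bbfB hs).
have bdb n : bbf (db n) by exact: (bbfB hs).
have E n : I (fun y => S (v_ n) y * b_ n y) - I (fun y => S v y * b y) =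
    I (fun y => S (dv n) y * db n y) + I (fun y => S (dv n) y * b y) + I (fun y => S v y * db n y).
  have i1 := sqi_bbf hs (S_sqi (bdv n)) (bdb n); have i2 := sqi_bbf hs (S_sqi (bdv n)) bb.
  have i3 := sqi_bbf hs (S_sqi bv) (bdb n); have i4 := sqi_bbf hs (S_sqi bv) bb.
  have i5 := sqi_bbf hs (S_sqi (bv_ n)) (bb_ n).
  rewrite -IB// -ID// -ID//; last exact: intgD.
  apply: (proj2 (I_eq_ae (intgD (intgD i1 i2) i3) _ _)); first by apply: intg_meas; exact: (intgB i5 i4).
  have := S_lin 1 (bdv n) bv; rewrite (_ : (fun z => _) = v_ n); last by apply/funext => z; rewrite /dv; ring.
  by move=> h; apply: (ae_imp h) => y ->; rewrite /db; ring.
have cv0 : N2 (dv n) @[n --> \oo] --> 0 by exact: cvgn0_sqrt.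
have cb0 : N2 (db n) @[n --> \oo] --> 0 by exact: cvgn0_sqrt.
have lim : (A * N2 (dv n) * N2 (db n) + A * N2 (dv n) * N2 b + A * N2 v * N2 (db n)) @[n --> \oo] --> 0.
  rewrite [X in _ --> X](_ : 0 = A * 0 * 0 + A * 0 * N2 b + A * N2 v * 0); last by ring.
  apply: cvgD; last by apply: cvgMl_tmp.
  apply: cvgD; first by apply: cvgM => //; exact: cvgMl_tmp.
  by apply: cvgMr_tmp; exact: cvgMl_tmp.
apply/cvgrPdist_le => t t0; move/cvgrPdist_le : lim => /(_ _ t0) [n0 _ h]; exists n0 => // n /= /h.
rewrite !sub0r !normrN E => h1; apply: le_trans h1; apply: le_trans (ler_norm _).
apply: le_trans (ler_normD _ _) _; apply: lerD; last exact: op_pair_le.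
by apply: le_trans (ler_normD _ _) _; apply: lerD; exact: op_pair_le.
Qed.

Variables (kap : X -> X -> R) (eps C0 : R).
Hypothesis eps0 : 0 < eps.
Hypothesis C00 : 0 < C0.
Hypothesis kap_size : forall x y, x <> y -> `|kap x y| <= C0 / m x (d x y).
Hypothesis kap_smooth : forall x x' y, x <> y -> c * d x x' <= d x y ->
  `|kap x y - kap x' y| + `|kap y x - kap y x'| <= (d x x' / d x y) `^ eps * (C0 / m x (d x y)).

Definition kint v x : R := I (fun y => kap x y * v y).

Lemma far_neq e x y : 0 < e -> e <= d x y -> x <> y.
Proof. by move=> e0 h xy; move: h; rewrite xy (proj2 (qm_eq0 hd y y) erefl) leNgt e0. Qed.

Lemma m_far e x y : 0 < e -> e <= d x y -> m x e <= m x (d x y).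
Proof.
move=> e0 h; apply: (mr_sub hs) => //; first exact: (meas_ball hs).
  exact: lt_le_trans h.
exact: ball_mono.
Qed.

Lemma kap_far e x y : 0 < e -> e <= d x y -> `|kap x y| <= C0 / m x e.
Proof.
move=> e0 h; apply: le_trans (kap_size (far_neq e0 h)) _.
rewrite ler_pM2l// lef_pV2 ?posrE ?(m_gt0 hs)//; first exact: m_far.
exact: lt_le_trans h.
Qed.

(** A fixed number of dilations makes the ball of radius [e] engulf [B z r]; doubling bounds the
    loss. *)
Lemma m_lower z r e : 0 < r -> 0 < e -> exists2 t, 0 < t & forall x, B z r x -> t <= m x e.
Proof.
move=> r0 e0; have [n hn] := expr_unbounded (r / e) (c_gt1 hs).
have cn : 0 < c ^+ n by rewrite exprn_gt0// (c_gt0 hs).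
have Kn : 0 < K ^+ n.+1 by rewrite exprn_gt0// (K_gt0 hs).
exists (m z r / K ^+ n.+1); first by rewrite divr_gt0// (m_gt0 hs).
move=> x Bx; rewrite ler_pdivrMr// mulrC; apply: le_trans (m_dbl hs n.+1 x e0).
have cne : 0 < c ^+ n * e by exact: mulr_gt0.
apply: (mr_sub hs); [exact: (meas_ball hs)|by rewrite mulr_gt0// exprn_gt0// (c_gt0 hs)|].
rewrite exprS -mulrA; apply: (engulf hs r0 _ (ball_center hs x cne) Bx).
by rewrite -ler_pdivrMr// ltW.
Qed.

Lemma kap_bounded z r e : 0 < r -> 0 < e ->
  exists2 G, 0 < G & forall x y, B z r x -> e <= d x y -> `|kap x y| <= G.
Proof.
move=> r0 e0; have [t t0 ht] := m_lower z r0 e0; exists (C0 / t); first exact: divr_gt0.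
move=> x y Bx h; apply: le_trans (kap_far e0 h) _; rewrite ler_pM2l// lef_pV2 ?posrE//.
  exact: ht.
exact: (m_gt0 hs).
Qed.

(** The smoothness condition gives continuity in one variable off the diagonal; the diagonal point
    is cut out since the kernel is unconstrained there. *)
Lemma kap_meas x : meas (fun y => kap x y * \1_[set z | z <> x] y).
Proof.
apply: (meas_local_cont hs).
  apply: (ball_open_criterion hs) => y yx; exists (d y x); first exact: dist_gt0.
  by move=> z /= h zx; move: h; rewrite /qball/= zx ltxx.
move=> y yx t t0; have dp := dist_gt0 yx; have mp := m_gt0 hs y dp.
pose s := (t / (C0 / m y (d y x))) `^ eps^-1.
have P : 0 < t / (C0 / m y (d y x)) by rewrite divr_gt0// divr_gt0.
have s0 : 0 < s by exact: powR_gt0.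
exists (Num.min (d y x / c) (d y x * s)).
  by rewrite lt_min divr_gt0 ?(c_gt0 hs)// mulr_gt0.
move=> z; rewrite /qball/= lt_min => /andP[h1 h2].
have h1' : c * d y z <= d y x by rewrite mulrC -ler_pdivlMr ?(c_gt0 hs)// ltW.
apply: (@le_lt_trans _ _ ((d y z / d y x) `^ eps * (C0 / m y (d y x)))).
  apply: le_trans (kap_smooth yx h1'); by rewrite lerDr.
rewrite -ltr_pdivlMr ?divr_gt0//.
have -> : t / (C0 / m y (d y x)) = s `^ eps by rewrite /s -powRrM mulVf ?gt_eqF// powRr1// ltW.
apply: gt0_ltr_powR => //; rewrite ?nnegrE ?(ltW s0) ?divr_ge0 ?(qm_ge0 hd)//.
by rewrite ltr_pdivrMr// mulrC.
Qed.

Lemma kap_intg v x e G : 0 < e -> bbf v -> (forall y, v y != 0 -> e <= d x y) ->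
  (forall y, v y != 0 -> `|kap x y| <= G) ->
  intg (fun y => kap x y * v y) /\ `|kint v x| <= G * I (fun y => `|v y|).
Proof.
move=> e0 bv hv hG; have iv := intg_norm (bbf_intg hs bv).
have i : intg (fun y => kap x y * v y).
  apply: (intg_le _ _ (intgZ G iv)).
    rewrite (_ : (fun y => _) = fun y => kap x y * \1_[set z | z <> x] y * v y).
      by apply: measurable_funM; [exact: kap_meas|exact: (bbf_meas bv)].
    apply/funext => y; have [->|vy] := eqVneq (v y) 0; first by rewrite !mulr0.
    by rewrite indicE mem_set ?mulr1// => /= yx; exact: (far_neq e0 (hv y vy)).
  move=> y; have [->|vy] := eqVneq (v y) 0; first by rewrite mulr0 !normr0 mulr0.
  by rewrite normrM ler_wpM2r// hG.
split => //; apply: le_trans (I_abs i) _.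
rewrite -IZ//; apply: I_le => [||y]; [exact: intg_norm|exact: intgZ|].
have [->|vy] := eqVneq (v y) 0; first by rewrite mulr0 !normr0 mulr0.
by rewrite normrM ler_wpM2r// hG.
Qed.

Lemma kint_diff v x x' e G : 0 < e -> bbf v -> (forall y, v y != 0 -> e <= d x y) ->
  (forall y, v y != 0 -> e <= d x' y) ->
  (forall y, v y != 0 -> `|kap x y - kap x' y| <= G) ->
  `|kint v x - kint v x'| <= G * I (fun y => `|v y|).
Proof.
move=> e0 bv hx hx' hG; have iv := intg_norm (bbf_intg hs bv).
have [i1 _] := kap_intg e0 bv hx (fun y vy => kap_far e0 (hx y vy)).
have [i2 _] := kap_intg e0 bv hx' (fun y vy => kap_far e0 (hx' y vy)).
rewrite /kint -IB//; apply: le_trans (I_abs (intgB i1 i2)) _.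
rewrite -IZ//; apply: I_le => [||y]; [by apply: intg_norm; exact: intgB|exact: intgZ|].
have [->|vy] := eqVneq (v y) 0; first by rewrite !mulr0 subrr !normr0 mulr0.
by rewrite -mulrBl normrM ler_wpM2r// hG.
Qed.

Lemma kint_lin v w x e : 0 < e -> bbf v -> bbf w -> (forall y, v y != 0 -> e <= d x y) ->
  (forall y, w y != 0 -> e <= d x y) ->
  kint (fun y => v y - w y) x = kint v x - kint w x.
Proof.
move=> e0 bv bw hv hw.
have [i1 _] := kap_intg e0 bv hv (fun y vy => kap_far e0 (hv y vy)).
have [i2 _] := kap_intg e0 bw hw (fun y vy => kap_far e0 (hw y vy)).
by rewrite /kint -IB//; apply: eq_I => y; ring.
Qed.

Variable delta : R.
Hypothesis delta0 : 0 < delta.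
Hypothesis dense : forall u, sqi u -> forall e : R, 0 < e ->
  exists2 h, hol d delta h & I (fun y => (u y - h y) ^+ 2) <= e.
Hypothesis S_form : forall f g, hol d delta f -> hol d delta g ->
  (exists2 e, 0 < e & forall x y, f x != 0 -> g y != 0 -> e <= d x y) ->
  I (fun y => S f y * g y) = I (fun x => g x * kint f x).

Section separated.
Variables (F : X -> R).
Hypothesis hF : hol d delta F.

Lemma below_open : open [set x | F x < 0].
Proof.
apply: (ball_open_criterion hs) => x /= Fx; have F0 : 0 < - F x by rewrite oppr_gt0.
have [r r0 h] := hol_small hd delta0 hF F0; exists r => // y /h.
rewrite /=; have := ler_norm (F y - F x); rewrite distrC; lra.
Qed.

Lemma above_sep : exists2 e, 0 < e & forall x y, 4^-1 <= F y -> F x < 0 -> e <= d x y.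
Proof.
have q0 : 0 < 4^-1 :> R by rewrite invr_gt0.
have [e e0 h] := hol_sep hd delta0 q0 hF; exists e => // x y Fy Fx.
by apply: h; have := ler_norm (F y - F x); rewrite distrC; lra.
Qed.

(* The kernel is continuous in each variable off the diagonal, so no joint measurability is needed. *)
Lemma kint_meas v : bbf v -> (forall y, v y != 0 -> 4^-1 <= F y) ->
  meas (fun x => kint v x * \1_[set z | F z < 0] x).
Proof.
move=> bv hv; apply: (meas_local_cont hs); first exact: below_open.
have [e e0 he] := above_sep.
move=> x Fx t t0; have me := m_gt0 hs x e0.
set W := I (fun y => `|v y|); have W0 : 0 <= W by apply: I_ge0.
pose D := C0 / m x e * (1 + W).
have D0 : 0 < D by rewrite mulr_gt0 ?divr_gt0// ltr_wpDr.
pose s := (t / D) `^ eps^-1.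
have s0 : 0 < s by rewrite powR_gt0// divr_gt0.
have [r1 r10 h1] : exists2 r1 : R, 0 < r1 & forall y, B x r1 y -> F y < 0.
  have [r1 r10 h1] := ht_nbhs (hs_space hs) (open_nbhs_nbhs (conj below_open Fx)).
  by exists r1 => // y /h1.
exists (Num.min r1 (Num.min (e / c) (e * s))).
  by rewrite !lt_min r10 divr_gt0 ?(c_gt0 hs)// mulr_gt0.
move=> x'; rewrite /qball/= !lt_min => /and3P[/h1 Fx' h2 h3].
have h2' : c * d x x' <= e by rewrite mulrC -ler_pdivlMr ?(c_gt0 hs)// ltW.
apply: le_lt_trans (kint_diff (G := (d x x' / e) `^ eps * (C0 / m x e)) e0 bv _ _ _) _.
- by move=> y /hv Fy; exact: he.
- by move=> y /hv Fy; exact: he.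
- move=> y /hv Fy; have exy := he _ _ Fy Fx.
  apply: (@le_trans _ _ ((d x x' / d x y) `^ eps * (C0 / m x (d x y)))).
    by apply: le_trans (kap_smooth (far_neq e0 exy) (le_trans h2' exy)); rewrite lerDl.
  have dxy : 0 < d x y by exact: lt_le_trans exy.
  apply: ler_pM; [exact: powR_ge0|by rewrite divr_ge0 ?(ltW C00)// mr_ge0| |].
    apply: ge0_ler_powR; rewrite ?nnegrE ?(ltW eps0) ?divr_ge0 ?(qm_ge0 hd) ?(ltW e0)//.
    by rewrite ler_wpM2l ?(qm_ge0 hd)// lef_pV2.
  by rewrite ler_pM2l// lef_pV2 ?posrE ?(m_gt0 hs)//; exact: m_far.
rewrite -/W; apply: (@le_lt_trans _ _ ((d x x' / e) `^ eps * D)).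
  rewrite -[leLHS]mulrA; apply: ler_wpM2l; first exact: powR_ge0.
  by apply: ler_wpM2l; [exact: divr_ge0 (ltW C00) (mr_ge0 _ _)|rewrite lerDr].
rewrite -ltr_pdivlMr//.
have -> : t / D = s `^ eps by rewrite /s -powRrM mulVf ?gt_eqF// powRr1// ltW// divr_gt0.
apply: gt0_ltr_powR => //; rewrite ?nnegrE ?(ltW s0) ?divr_ge0 ?(qm_ge0 hd) ?(ltW e0)//.
by rewrite ltr_pdivrMr// mulrC.
Qed.

(** The constant depends on [F] and on the ball [B z r] but not on [v] or [b], so it is uniform
    along approximating sequences. *)
Lemma kint_pair z r : 0 < r -> exists2 G, 0 < G & forall v b, bbf v -> ball_fun d b z r -> bbf b ->
  (forall y, v y != 0 -> 4^-1 <= F y) -> (forall x, b x != 0 -> F x < 0) ->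
  [/\ intg (fun x => b x * kint v x),
      forall x, b x != 0 -> `|kint v x| <= G * I (fun y => `|v y|) &
    `|I (fun x => b x * kint v x)| <= G * I (fun y => `|v y|) * I (fun y => `|b y|)].
Proof.
move=> r0; have [e e0 he] := above_sep; have [G G0 hG] := kap_bounded z r0 e0.
exists G => // v b bv bb' bb hv hb; have ib := intg_norm (bbf_intg hs bb).
have bound x : b x != 0 -> `|kint v x| <= G * I (fun y => `|v y|).
  move=> bx; have Fx := hb x bx; have [_ _ b0] := bb'.
  have Bx : B z r x by apply: contrapT => /b0 e1; rewrite e1 eqxx in bx.
  apply: (kap_intg e0 bv _ _).2 => y /hv Fy; first exact: he.
  by apply: hG => //; exact: he.
have E x : b x * kint v x = b x * (kint v x * \1_[set z | F z < 0] x).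
  have [->|bx] := eqVneq (b x) 0; first by rewrite !mul0r.
  by rewrite indicE mem_set ?mulr1//; exact: hb.
have bd x : `|b x * kint v x| <= G * I (fun y => `|v y|) * `|b x|.
  have [->|bx] := eqVneq (b x) 0; first by rewrite mul0r normr0 mulr0.
  by rewrite normrM mulrC ler_wpM2r// bound.
have i : intg (fun x => b x * kint v x).
  apply: (@intg_le _ (borel X) R mu _ _ _ bd (intgZ _ ib)); rewrite (funext E).
  by apply: measurable_funM; [exact: (bbf_meas bb)|exact: kint_meas].
split => //; apply: le_trans (I_abs i) _; rewrite -IZ//.
by apply: I_le => //; [exact: intg_norm|exact: intgZ].
Qed.

Lemma L1_cvg (u_ : nat -> X -> R) u x r N : (forall n, ball_fun d (u_ n) x r) ->
  (forall n y, `|u_ n y| <= N) -> ball_fun d u x r -> (forall y, `|u y| <= N) ->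
  I (fun y => (u_ n y - u y) ^+ 2) @[n --> \oo] --> 0 ->
  I (fun y => `|u_ n y - u y|) @[n --> \oo] --> 0.
Proof.
move=> bu hu bu' hu' c0.
have bd_ n : ball_fun d (fun y => u_ n y - u y) x r.
  have [m1 r0 z1] := bu n; have [m2 _ z2] := bu'; split => //; first exact: measurable_funB.
  by move=> y nB; rewrite z1// z2// subrr.
have hd_ n y : `|u_ n y - u y| <= N + N by apply: le_trans (ler_normB _ _) _; exact: lerD.
have := Ip_bounded_cvg hs ltr01 bd_ hd_ c0.
by under eq_fun do rewrite /Ip (eq_I mu (fun y => powRr1 (normr_ge0 _))).
Qed.

(** Clamped approximants of [v] and [b] live on [F > 1/4] and [F < -1/4], hence are Holder functions
    at positive distance, for which the kernel formula is given. Both sides pass to the limit, the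
    left by [op_joint], the right by [L^1] convergence. *)
Lemma separated_kernel v b : bbf v -> bbf b -> (forall y, v y != 0 -> 2^-1 <= F y) ->
  (forall y, b y != 0 -> 2^-1 <= - F y) ->
  I (fun y => S v y * b y) = I (fun x => b x * kint v x).
Proof.
move=> bv bb hv hb.
have [v_ [x [r [N [hv_ vN [bvx vN'] nv cv]]]]] := clamp_approx hs hd delta0 dense hF bv hv.
have [b_ [x' [r' [N' [hb_ bN [bbx bN'] nb cb]]]]] :=
  clamp_approx hs hd delta0 dense (holN hF) bb hb.
have [_ r'0 _] := bbx.
have bv_ n : bbf (v_ n) by exact: (hol_bbf hs hd delta0 (hv_ n).1).
have bb_ n : bbf (b_ n) by exact: (hol_bbf hs hd delta0 (hb_ n).1).
have c1 := op_joint bv_ bb_ bv bb cv cb.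
have [G G0 hG] := kint_pair x' r'0.
have [e e0 he] := above_sep.
have nv4 y : v y != 0 -> 4^-1 <= F y by move=> /hv; lra.
have nb0 y : b y != 0 -> F y < 0 by move=> /hb; lra.
have nv4n n y : v_ n y != 0 -> 4^-1 <= F y by move=> /nv /ltW.
have nb0n n y : b_ n y != 0 -> F y < 0 by move=> /nb; lra.
have E n : I (fun y => S (v_ n) y * b_ n y) = I (fun x => b_ n x * kint (v_ n) x).
  apply: S_form; [exact: (hv_ n).1|exact: (hb_ n).1|exists e => // y z /nv4n h1 /nb0n h2].
  by rewrite (qm_sym hd); exact: he.
rewrite (funext E) in c1.
suff c2 : I (fun x => b_ n x * kint (v_ n) x) @[n --> \oo] --> I (fun x => b x * kint v x).
  by apply: (cvg_unique _ c1 c2); exact: Rhausdorff.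
have cv1 := L1_cvg (fun n => (hv_ n).2) vN bvx vN' cv.
have cb1 := L1_cvg (fun n => (hb_ n).2) bN bbx bN' cb.
set W := I (fun y => `|v y|).
have W0 : 0 <= W by apply: I_ge0.
set T := I (fun y => `|b y|).
pose bound n := G * I (fun y => `|v_ n y - v y|) * (I (fun y => `|b_ n y - b y|) + T) +
  G * W * I (fun y => `|b_ n y - b y|).
have cbound : bound n @[n --> \oo] --> 0.
  rewrite [X in _ --> X](_ : 0 = G * 0 * (0 + T) + G * W * 0); last by ring.
  apply: cvgD; last exact: cvgMl_tmp.
  by apply: cvgM; [exact: cvgMl_tmp|apply: cvgD => //; exact: cvg_cst].
apply/cvgrPdist_le => t t0; move/cvgrPdist_le : cbound => /(_ _ t0) [n0 _ h]; exists n0 => // n /= /h.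
rewrite sub0r normrN distrC => h1; apply: le_trans h1; apply: le_trans (ler_norm _).
have bdv : bbf (fun y => v_ n y - v y) by exact: (bbfB hs).
have bdb : bbf (fun y => b_ n y - b y) by exact: (bbfB hs).
have bdb' : ball_fun d (fun y => b_ n y - b y) x' r'.
  have [m1 _ z1] := (hb_ n).2; have [m2 _ z2] := bbx; split => //; first exact: measurable_funB.
  by move=> y nB; rewrite z1// z2// subrr.
have ndv y : v_ n y - v y != 0 -> 4^-1 <= F y.
  have [->|/nv4n//] := eqVneq (v_ n y) 0; by rewrite sub0r oppr_eq0 => /nv4.
have ndb y : b_ n y - b y != 0 -> F y < 0.
  have [->|/nb0n//] := eqVneq (b_ n y) 0; by rewrite sub0r oppr_eq0 => /nb0.
have [i1 _ p1] := hG _ _ bdv (hb_ n).2 (bb_ n) ndv (nb0n n).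
have [i2 _ p2] := hG _ _ bv bdb' bdb nv4 ndb.
have [i3 _ _] := hG _ _ bv bbx bb nv4 nb0.
have [i4 _ _] := hG _ _ (bv_ n) (hb_ n).2 (bb_ n) (nv4n n) (nb0n n).
rewrite -IB// (eq_I mu (g := fun y => b_ n y * kint (fun z => v_ n z - v z) y + (b_ n y - b y) * kint v y)).
  rewrite ID//; apply: le_trans (ler_normD _ _) _; apply: lerD => //.
  apply: le_trans p1 _; apply: ler_wpM2l; first by rewrite mulr_ge0 ?(ltW G0)//; exact: I_ge0.
  rewrite -ID; [|exact: intg_norm (bbf_intg hs bdb)|exact: intg_norm (bbf_intg hs bb)].
  apply: I_le => [||y]; [exact: intg_norm (bbf_intg hs (bb_ n))| |].
    by apply: intgD; [exact: intg_norm (bbf_intg hs bdb)|exact: intg_norm (bbf_intg hs bb)].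
  by apply: le_trans (ler_normD _ _); rewrite subrK.
move=> y; have [->|by_] := eqVneq (b_ n y) 0.
  by rewrite !mul0r; ring.
have Fy := nb0n n y by_.
rewrite (kint_lin e0 (bv_ n) bv); first ring.
- by move=> z /nv4n h2; exact: he.
- by move=> z /nv4 h2; exact: he.
Qed.

End separated.

End L2_operator.

End kernel.

Lemma cvg_le_add (R : realType) (u a : nat -> R) (l L : R) :
  u n @[n --> \oo] --> l -> (forall n, u n <= L + a n) -> a n @[n --> \oo] --> 0 -> l <= L.
Proof.
move=> cu h ca; have cL : (L + a n) @[n --> \oo] --> L.
  by rewrite -[X in _ --> X]addr0; apply: cvgD => //; exact: cvg_cst.
exact: ler_cvg_to cu cL (nearW _ h).
Qed.

(** * Off-diagonal decay from the smoothness of the kernel *)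

Section cz_from_kernel.
Context (R : realType) (X : ptopologicalType).
Variables (mu : {measure set (borel X) -> \bar R}) (d : X -> X -> R).
Variables (c K eta : R).
Hypothesis hs : growing_space mu d c K eta.
Hypothesis hd : quasi_metric d.
Local Notation B := (qball d).
Local Notation mr A := (fine (mu A)).
Local Notation m x r := (mr (B x r)).
Local Notation intg := (intg mu).
Local Notation I := (I mu).
Local Notation sqi := (sqi mu).
Local Notation bbf := (bbf d).
Local Notation meas := (measurable_fun [set: borel X]).
Local Notation cut := (@cut R X).
Implicit Types (f g u v b F w : X -> R) (x y : X) (e r C G : R).

Variables (S : (X -> R) -> X -> R) (A : R).
Hypothesis A0 : 0 < A.
Hypothesis S_lin : forall a u v, bbf u -> bbf v ->
    {ae mu, forall y, S (fun z => a * u z + v z) y = a * S u y + S v y}.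
Hypothesis S_sqi : forall u, bbf u -> sqi (S u).
Hypothesis S_l2 : forall u, bbf u -> I (fun y => S u y ^+ 2) <= A ^+ 2 * I (fun y => u y ^+ 2).
Variables (kap : X -> X -> R) (eps C0 : R).
Hypothesis eps0 : 0 < eps.
Hypothesis C00 : 0 < C0.
Hypothesis kap_size : forall x y, x <> y -> `|kap x y| <= C0 / m x (d x y).
Hypothesis kap_smooth : forall x x' y, x <> y -> c * d x x' <= d x y ->
  `|kap x y - kap x' y| + `|kap y x - kap y x'| <= (d x x' / d x y) `^ eps * (C0 / m x (d x y)).
Variable delta : R.
Hypothesis delta0 : 0 < delta.
Hypothesis dense : forall u, sqi u -> forall e : R, 0 < e ->
  exists2 h, hol d delta h & I (fun y => (u y - h y) ^+ 2) <= e.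
Hypothesis S_form : forall f g, hol d delta f -> hol d delta g ->
  (exists2 e, 0 < e & forall x y, f x != 0 -> g y != 0 -> e <= d x y) ->
  I (fun y => S f y * g y) = I (fun x => g x * kint mu kap f x).
Local Notation kint := (kint mu kap).

Let theta := c `^ (- eps).

Lemma theta01 : 0 <= theta < 1.
Proof.
rewrite powR_ge0/=; have c1 := c_gt1 hs; have c0 := c_gt0 hs.
by rewrite /theta powRN invf_lt1 ?powR_gt0// /powR gt_eqF// -expR0 ltr_expR mulr_gt0// ln_gt0.
Qed.

(** The displacement is below [r] and the distance at least [c^l r], so the ratio raised to [eps] is
    at most [theta^l]. The condition [0 < l] provides the factor [c] that smoothness requires. *)
Lemma far_kap x0 r l x y : 0 < r -> (0 < l)%N -> B x0 r x -> ~ B x0 (c ^+ l * r) y ->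
  `|kap x0 y - kap x y| + `|kap y x0 - kap y x| <= C0 * theta ^+ l / m x0 (c ^+ l * r).
Proof.
move=> r0 l0 Bx /negP; rewrite -leNgt => By.
have cl : 0 < c ^+ l by rewrite exprn_gt0// (c_gt0 hs).
have rr0 : 0 < c ^+ l * r by exact: mulr_gt0.
have dxy : 0 < d x0 y by exact: lt_le_trans By.
have cc : c * d x0 x <= d x0 y.
  apply: le_trans By; apply: (@le_trans _ _ (c * r)); first by rewrite ler_wpM2l ?(ltW (c_gt0 hs))// ltW.
  by rewrite ler_wpM2r ?(ltW r0)// -[leLHS]expr1 ler_weXn2l// ltW// (c_gt1 hs).
apply: le_trans (kap_smooth (far_neq hd rr0 By) cc) _.
rewrite (_ : C0 * _ / _ = theta ^+ l * (C0 / m x0 (c ^+ l * r))); last by ring.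
apply: ler_pM.
- exact: powR_ge0.
- exact: divr_ge0 (ltW C00) (mr_ge0 _ _).
- have -> : theta ^+ l = (c ^+ l)^-1 `^ eps.
    rewrite /theta -powR_mulrn ?powR_ge0// -powRrM -powR_inv1 ?(ltW cl)//.
    rewrite -powR_mulrn ?(ltW (c_gt0 hs))// -!powRrM; congr (_ `^ _); ring.
  apply: ge0_ler_powR; rewrite ?nnegrE ?(ltW eps0) ?divr_ge0 ?(qm_ge0 hd) ?invr_ge0 ?(ltW cl)//.
  rewrite ler_pdivrMr// mulrC ler_pdivlMr// mulrC; apply: le_trans By.
  by rewrite ler_wpM2l ?(ltW cl)// ltW.
by rewrite ler_pM2l// lef_pV2 ?posrE ?(m_gt0 hs)//; exact: (m_far hs).
Qed.

Section estimates.
Variables (x0 : X) (r : R) (l : nat) (b v : X -> R).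
Hypothesis l0 : (0 < l)%N.
Hypothesis bb' : ball_fun d b x0 r.
Hypothesis bb : bbf b.
Hypothesis Ib : I b = 0.
Hypothesis bv : bbf v.
Hypothesis v0 : forall y, B x0 (c ^+ l * r) y -> v y = 0.
Let rr := c ^+ l * r.
Let Q := C0 * theta ^+ l / m x0 rr.

Let r0 : 0 < r. Proof. by case: bb'. Qed.
Let rr0 : 0 < rr. Proof. by rewrite mulr_gt0// exprn_gt0// (c_gt0 hs). Qed.
Let Q0 : 0 <= Q.
Proof. by rewrite divr_ge0 ?mr_ge0// mulr_ge0 ?(ltW C00)// exprn_ge0// powR_ge0. Qed.
Let nzb x : b x != 0 -> B x0 r x.
Proof. by have [_ _ z] := bb'; move=> bx; apply: contrapT => /z e; rewrite e eqxx in bx. Qed.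
Let nzv y : v y != 0 -> ~ B x0 rr y.
Proof. by move=> vy By; rewrite v0 ?eqxx in vy. Qed.
Let dfar y : v y != 0 -> rr <= d x0 y.
Proof. by move=> /nzv/negP; rewrite -leNgt. Qed.
Let disj y : v y = 0 \/ b y = 0.
Proof.
have [->|/nzb h] := eqVneq (b y) 0; [by right|left; apply: v0; apply: ball_mono h].
by rewrite ler_peMl ?(ltW r0)// exprn_ege1// ltW// (c_gt1 hs).
Qed.

Let cutnz F u y : cut F u y != 0 -> u y != 0.
Proof. by apply: contra_neq => e; rewrite /cut e mul0r. Qed.

Let approx : exists F_ : nat -> X -> R, [/\ forall n, hol d delta (F_ n),
  I (fun y => S (cut (F_ n) v) y * cut (fun z => - F_ n z) b y) @[n --> \oo] --> I (fun y => S v y * b y),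
  I (fun y => S (cut (fun z => - F_ n z) b) y * cut (F_ n) v y) @[n --> \oo] --> I (fun y => S b y * v y) &
  `|I (cut (fun z => - F_ n z) b)| @[n --> \oo] --> 0].
Proof.
have [F [hF c1 c2]] := cut_approx hs hd delta0 dense bv bb disj.
have bv_ n : bbf (cut (F n) v) by exact: (cut_bbf hs hd delta0 (hF n) bv).
have bb_ n : bbf (cut (fun z => - F n z) b) by exact: (cut_bbf hs hd delta0 (holN (hF n)) bb).
exists F; split => //.
- exact: (op_joint hs A0 S_lin S_sqi S_l2 bv_ bb_ bv bb c1 c2).
- exact: (op_joint hs A0 S_lin S_sqi S_l2 bb_ bv_ bb bv c2 c1).
have [x [r' [N [bbx bN]]]] := bb.
have := L1_cvg hs (fun n => cut_ball hs hd delta0 (holN (hF n)) bbx)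
  (fun n y => le_trans (cut_le _ _ _) (bN y)) bbx bN c2.
apply: (@squeeze_cvgr _ _ _ _ (fun=> 0)); last exact: cvg_cst.
apply: nearW => n; rewrite normr_ge0/= -[I (cut _ _)]subr0 -Ib -IB; [|exact: (bbf_intg hs (bb_ n))|exact: (bbf_intg hs bb)].
by apply: I_abs; apply: intgB; [exact: (bbf_intg hs (bb_ n))|exact: (bbf_intg hs bb)].
Qed.

Section fixed.
Variable F : X -> R.
Hypothesis hF : hol d delta F.
Let v' := cut F v.
Let b' := cut (fun z => - F z) b.

Let bv' : bbf v'. Proof. exact: (cut_bbf hs hd delta0 hF bv). Qed.
Let bb1 : bbf b'. Proof. exact: (cut_bbf hs hd delta0 (holN hF) bb). Qed.
Let Fv y : v' y != 0 -> 2^-1 <= F y. Proof. exact: cut_nz. Qed.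
Let Fb y : b' y != 0 -> 2^-1 <= - F y. Proof. by move/cut_nz. Qed.
Let Iv : I (fun y => `|v' y|) <= I (fun y => `|v y|).
Proof.
apply: I_le => [||y]; [exact: intg_norm (bbf_intg hs bv')|exact: intg_norm (bbf_intg hs bv)|].
exact: cut_le.
Qed.
Let Ib1 : I (fun y => `|b' y|) <= I (fun y => `|b y|).
Proof.
apply: I_le => [||y]; [exact: intg_norm (bbf_intg hs bb1)|exact: intg_norm (bbf_intg hs bb)|].
exact: cut_le.
Qed.
Let bb1' : ball_fun d b' x0 r. Proof. exact: (cut_ball hs hd delta0 (holN hF) bb'). Qed.

(** Subtracting [kint v' x0] uses the mean zero of [b]. The cut [b'] has lost it, and its integral
    enters as an error that tends to 0 along the approximation. *)
Lemma far_fixed : I (fun y => S v' y * b' y) <=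
  Q * I (fun y => `|v y|) * I (fun y => `|b y|) + C0 / m x0 rr * I (fun y => `|v y|) * `|I b'|.
Proof.
rewrite (separated_kernel hs hd A0 S_lin S_sqi S_l2 eps0 C00 kap_size kap_smooth delta0 dense S_form hF bv' bb1 Fv Fb).
have [e e0 he] := above_sep hd delta0 hF.
have nv4 y : v' y != 0 -> 4^-1 <= F y by move=> /Fv; lra.
have nb0 y : b' y != 0 -> F y < 0 by move=> /Fb; lra.
have [G G0 /(_ _ _ bv' bb1' bb1 nv4 nb0) [i1 _ _]] :=
  kint_pair hs hd eps0 C00 kap_size kap_smooth delta0 hF x0 r0.
have iv := intg_norm (bbf_intg hs bv'); have ib := bbf_intg hs bb1.
pose e' := Num.min e rr.
have e'0 : 0 < e' by rewrite lt_min e0.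
have [_ J0] := kap_intg hs hd eps0 C00 kap_smooth rr0 bv' (fun y vy => dfar (cutnz vy))
  (fun y vy => kap_far hs hd C00 kap_size rr0 (dfar (cutnz vy))).
have D x : b' x * (kint v' x - kint v' x0) <= Q * I (fun y => `|v' y|) * `|b' x|.
  apply: le_trans (ler_norm _) _.
  have [->|bx] := eqVneq (b' x) 0; first by rewrite mul0r normr0 mulr0.
  rewrite normrM mulrC; apply: ler_wpM2r => //.
  apply: (kint_diff hs hd eps0 C00 kap_size kap_smooth e'0 bv') => y vy.
  - by rewrite ge_min he//; [exact: nv4|exact: nb0].
  - by rewrite ge_min (dfar (cutnz vy)) orbT.
  rewrite distrC; apply: le_trans (far_kap r0 l0 (nzb (cutnz bx)) (nzv (cutnz vy))).
  by rewrite lerDl.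
have i2 : intg (fun x => b' x * (kint v' x - kint v' x0)).
  apply: eq_intg (intgB i1 (intgZ (kint v' x0) ib)) => x; ring.
rewrite (eq_I mu (g := fun x => b' x * (kint v' x - kint v' x0) + kint v' x0 * b' x)); last by move=> x; ring.
rewrite ID ?IZ//; last exact: intgZ.
apply: lerD.
  apply: (@le_trans _ _ (Q * I (fun y => `|v' y|) * I (fun x => `|b' x|))).
    by rewrite -IZ; [apply: I_le => //; apply: intgZ; exact: intg_norm|exact: intg_norm].
  apply: ler_pM => //; [by rewrite mulr_ge0//; exact: I_ge0|exact: I_ge0|exact: ler_wpM2l].
apply: le_trans (ler_norm _) _; rewrite normrM; apply: ler_wpM2r => //.
apply: le_trans J0 _; apply: ler_wpM2l => //; exact: divr_ge0 (ltW C00) (mr_ge0 _ _).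
Qed.

(** Here the kernel at [x0] is subtracted inside the inner integral. The bound [G] may depend on
    [v], since it only multiplies the vanishing error. *)
Lemma far_fixed' G : 0 < G -> (forall x, v x != 0 -> `|kap x x0| <= G) ->
  I (fun y => S b' y * v' y) <=
  Q * I (fun y => `|v y|) * I (fun y => `|b y|) + G * I (fun y => `|v y|) * `|I b'|.
Proof.
move=> G0 hG.
have Fv2 y : v' y != 0 -> 2^-1 <= - - F y by rewrite opprK; exact: Fv.
rewrite (separated_kernel hs hd A0 S_lin S_sqi S_l2 eps0 C00 kap_size kap_smooth delta0 dense S_form (holN hF) bb1 bv' Fb Fv2).
have [e e0 he] := above_sep hd delta0 (holN hF).
have nv0 y : v' y != 0 -> - F y < 0 by move=> /Fv; lra.
have nb4 y : b' y != 0 -> 4^-1 <= - F y by move=> /Fb; lra.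
have [x [r' [k [bvx _]]]] := bv'; have [_ r'0 _] := bvx.
have [G' G'0 /(_ _ _ bb1 bvx bv' nb4 nv0) [i1 _ _]] :=
  kint_pair hs hd eps0 C00 kap_size kap_smooth delta0 (holN hF) x r'0.
have iv := intg_norm (bbf_intg hs bv'); have ib := bbf_intg hs bb1.
have ibn := intg_norm ib.
pose W := Q * I (fun y => `|b y|) + G * `|I b'|.
have W0 : 0 <= W by rewrite addr_ge0// mulr_ge0 ?(ltW G0)//; exact: I_ge0.
have D y : v' y * kint b' y <= W * `|v' y|.
  apply: le_trans (ler_norm _) _.
  have [->|vy] := eqVneq (v' y) 0; first by rewrite mul0r normr0 mulr0.
  rewrite normrM mulrC; apply: ler_wpM2r => //.
  have hb z : b' z != 0 -> e <= d y z by move=> bz; apply: he; [exact: nb4|exact: nv0].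
  have [i2 _] := kap_intg hs hd eps0 C00 kap_smooth e0 bb1 hb (fun z bz => kap_far hs hd C00 kap_size e0 (hb z bz)).
  have i3 : intg (fun z => kap y z * b' z - kap y x0 * b' z) by apply: intgB => //; exact: intgZ.
  rewrite /kint (eq_I mu (g := fun z => (kap y z * b' z - kap y x0 * b' z) + kap y x0 * b' z)); last by move=> z; ring.
  rewrite ID ?IZ//; last exact: intgZ.
  apply: le_trans (ler_normD _ _) _; apply: lerD; last first.
    by rewrite normrM; apply: ler_wpM2r => //; exact: hG (cutnz vy).
  apply: le_trans (I_abs i3) _.
  apply: (@le_trans _ _ (Q * I (fun z => `|b' z|))); last exact: ler_wpM2l.
  rewrite -IZ//; apply: I_le => [||z]; [exact: intg_norm|exact: intgZ|].
  have [->|bz] := eqVneq (b' z) 0; first by rewrite !mulr0 subrr !normr0 mulr0.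
  rewrite -mulrBl normrM distrC; apply: ler_wpM2r => //.
  apply: le_trans (far_kap r0 l0 (nzb (cutnz bz)) (nzv (cutnz vy))).
  by rewrite lerDr.
apply: (@le_trans _ _ (W * I (fun y => `|v' y|))).
  by rewrite -IZ//; apply: I_le => //; exact: intgZ.
apply: (@le_trans _ _ (W * I (fun y => `|v y|))); first exact: ler_wpM2l.
by rewrite /W mulrDl lerD// le_eqVlt; apply/orP; left; apply/eqP; ring.
Qed.

End fixed.

Lemma far_estimate : I (fun y => S v y * b y) <=
  C0 * theta ^+ l * I (fun y => `|v y|) * I (fun y => `|b y|) / m x0 (c ^+ l * r).
Proof.
have [F [hF c1 _ c3]] := approx.
rewrite (_ : _ / _ = Q * I (fun y => `|v y|) * I (fun y => `|b y|)); last by rewrite /Q /rr; ring.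
apply: (cvg_le_add c1 (fun n => far_fixed (hF n))).
exact: cvgn0_scale.
Qed.

Lemma far_estimate' : I (fun y => S b y * v y) <=
  C0 * theta ^+ l * I (fun y => `|v y|) * I (fun y => `|b y|) / m x0 (c ^+ l * r).
Proof.
have [F [hF _ c2 c3]] := approx.
have [x [r' [k [[_ r'0 vx] _]]]] := bv.
have [G G0 hG] := kap_bounded hs hd C00 kap_size x r'0 rr0.
have hG' y : v y != 0 -> `|kap y x0| <= G.
  move=> vy; apply: hG; last by rewrite (qm_sym hd); exact: dfar.
  by apply: contrapT => /vx e; rewrite e eqxx in vy.
rewrite (_ : _ / _ = Q * I (fun y => `|v y|) * I (fun y => `|b y|)); last by rewrite /Q /rr; ring.
apply: (cvg_le_add c2 (fun n => far_fixed' (hF n) G0 hG')).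
exact: cvgn0_scale.
Qed.

End estimates.

Variable S' : (X -> R) -> X -> R.
Hypothesis S'_lin : forall a u v, bbf u -> bbf v ->
    {ae mu, forall y, S' (fun z => a * u z + v z) y = a * S' u y + S' v y}.
Hypothesis S'_meas : forall v, bbf v -> meas (S' v).
Hypothesis S'_intg : forall u v, bbf u -> bbf v -> intg (fun y => u y * S' v y).
Hypothesis adj : forall u v, bbf u -> bbf v ->
    I (fun y => S u y * v y) = I (fun y => u y * S' v y).

(** Square integrability of [S' v] is not given. Testing on its truncations bounds their square
    integrals [J] by [J <= A sqrt(J) sqrt(V)], hence [J <= A^2 V]; monotone convergence
    concludes. *)
Lemma dual_sqi v : bbf v -> sqi (S' v) /\ I (fun y => S' v y ^+ 2) <= A ^+ 2 * I (fun y => v y ^+ 2).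
Proof.
move=> bv; set k := S' v; have mk : meas k by exact: S'_meas.
have cc n : 0 < c ^+ n by rewrite exprn_gt0// (c_gt0 hs).
pose E n : set (borel X) := [set y | `|k y| <= n%:R].
have mE n : measurable (E n).
  rewrite (_ : E n = [set: borel X] `&` (fun y => `|k y|) @^-1` `]-oo, n%:R]%classic).
    have mnk : meas (fun y => `|k y|) by exact: measurableT_comp.
    by apply: mnk => //; exact: measurable_itv.
  by rewrite setTI; apply/seteqP; split => y /=; rewrite in_itv.
pose D n : set (borel X) := E n `&` B point (c ^+ n).
have mD n : measurable (D n) by apply: (@measurableI _ (borel X)) => //; exact: (meas_ball hs).
pose u n y := k y * \1_(D n) y.
have bu n : bbf (u n).
  exists point, (c ^+ n), n%:R; split.
    split => //; first by apply: measurable_funM => //; exact: meas_indic.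
    by move=> y nB; rewrite /u indicE memNset ?mulr0// => -[].
  move=> y; rewrite /u; have [[[h _] ->]|[_ ->]] := @indicP _ R (D n) y; first by rewrite mulr1.
  by rewrite mulr0 normr0.
have uk n y : u n y * k y = k y ^+ 2 * \1_(D n) y by rewrite /u mulrAC.
have uu n y : u n y ^+ 2 = k y ^+ 2 * \1_(D n) y.
  by rewrite /u exprMn; have [[_ ->]|[_ ->]] := @indicP _ R (D n) y; rewrite ?expr1n ?expr0n.
have ub n : I (fun y => k y ^+ 2 * \1_(D n) y) <= A ^+ 2 * I (fun y => v y ^+ 2).
  set J := I _; have J0 : 0 <= J by apply: I_ge0 => y; rewrite mulr_ge0 ?sqr_ge0// indicE.
  set V := I (fun y => v y ^+ 2); have V0 : 0 <= V by apply: I_ge0 => y; exact: sqr_ge0.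
  have : J <= A * Num.sqrt J * Num.sqrt V.
    rewrite {1}/J -(eq_I mu (uk n)) -(adj (bu n) bv).
    apply: le_trans (ler_norm _) _; apply: le_trans (op_pair_le hs A0 S_sqi S_l2 (bu n) bv) _.
    by rewrite (eq_I mu (uu n)).
  have [a a0 Ja] : exists2 a : R, 0 <= a & J = a ^+ 2 by exists (Num.sqrt J); rewrite ?sqr_sqrtr ?sqrtr_ge0.
  have [t t0 Vt] : exists2 t : R, 0 <= t & V = t ^+ 2 by exists (Num.sqrt V); rewrite ?sqr_sqrtr ?sqrtr_ge0.
  rewrite Ja Vt !sqrtr_sqr (ger0_norm a0) (ger0_norm t0) => h; rewrite -exprMn.
  have : a <= A * t.
    have [a00|a00] := eqVneq a 0; first by rewrite a00 mulr_ge0// ltW.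
    have ap : 0 < a by rewrite lt_neqAle eq_sym a00.
    by rewrite -(ler_pM2l ap) -expr2; apply: le_trans h _; rewrite le_eqVlt; apply/orP; left; apply/eqP; ring.
  by move=> h'; apply: lerXn2r; rewrite ?nnegrE// mulr_ge0// ltW.
have [||||i h] := @I_monotone _ (borel X) R mu (fun n y => k y ^+ 2 * \1_(D n) y) (fun y => k y ^+ 2)
  (A ^+ 2 * I (fun y => v y ^+ 2)) _ _ _ _ ub.
- by move=> n; apply: (@eq_intg _ (borel X) R mu _ _ (uk n)); exact: S'_intg.
- by move=> n y; rewrite mulr_ge0 ?sqr_ge0// indicE.
- move=> y i j ij; apply: ler_wpM2l; first exact: sqr_ge0.
  have [[[h1 h2] ->]|[h ->]] := @indicP _ R (D i) y; last by rewrite indicE.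
  rewrite indicE mem_set//; split; first by apply: le_trans h1 _; rewrite ler_nat.
  by apply: ball_mono h2; rewrite ler_weXn2l// ltW// (c_gt1 hs).
- move=> y; have [r r0 hr] := ball_in hs y point (ltr01 : 0 < 1 :> R).
  have [N hN] := expr_unbounded r (c_gt1 hs).
  apply/cvgrPdist_le => e e0; exists (N + (Num.Def.truncn `|k y|).+1)%N => // n /= Nn.
  rewrite indicE mem_set ?mulr1 ?subrr ?normr0; [exact: ltW|].
    split; rewrite /E/=.
      apply: ltW; apply: lt_le_trans (truncnS_gt _) _; rewrite ler_nat.
      by apply: leq_trans Nn; exact: leq_addl.
    apply: ball_mono (hr y (ball_center hs y ltr01)); apply: le_trans (ltW hN) _.
    rewrite ler_weXn2l//; first exact: ltW (c_gt1 hs).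
    by apply: leq_trans Nn; exact: leq_addr.
by [].
Qed.

(** Decay starts at [l0 = 1], the first dilate at which the smoothness condition applies; the sum
    [A + C0] serves both for the [L^2] size and for the decay. *)
Theorem czpair_of_kernel : czpair mu d c S S' (A + C0) theta 1.
Proof.
have AC : A ^+ 2 <= (A + C0) ^+ 2.
  by apply: lerXn2r; rewrite ?nnegrE ?lerDl ?(ltW C00) ?addr_ge0 ?(ltW A0)// ltW.
have wk u (Z : R) : Z <= A ^+ 2 * I (fun y => u y ^+ 2) -> Z <= (A + C0) ^+ 2 * I (fun y => u y ^+ 2).
  by move/le_trans; apply; apply: ler_wpM2r => //; apply: I_ge0 => y; exact: sqr_ge0.
have wk' x r l u w (Z : R) :
  Z <= C0 * theta ^+ l * I (fun y => `|u y|) * I (fun y => `|w y|) / m x (c ^+ l * r) ->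
  Z <= (A + C0) * theta ^+ l * I (fun y => `|u y|) * I (fun y => `|w y|) / m x (c ^+ l * r).
  move/le_trans; apply; apply: ler_wpM2r; first by rewrite invr_ge0 mr_ge0.
  apply: ler_wpM2r; first exact: I_ge0.
  apply: ler_wpM2r; first exact: I_ge0.
  by apply: ler_wpM2r; [rewrite exprn_ge0// powR_ge0|rewrite lerDr ltW].
split => //; first exact: addr_gt0; first exact: theta01.
  split => // [u bu|x r l b v bb' bb Ib l0 bv v0]; first exact: wk (S_l2 bu).
  by apply: wk'; exact: far_estimate.
split => // [u bu|u bu|x r l b v bb' bb Ib l0 bv v0].
- by have [] := dual_sqi bu.
- by apply: wk; have [] := dual_sqi bu.
rewrite (eq_I mu (g := fun y => b y * S' v y)); last by move=> y; rewrite mulrC.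
by rewrite -adj//; apply: wk'; exact: far_estimate'.
Qed.

End cz_from_kernel.

(** * Real operators *)

Section real_operators.
Context (R : realType) (X : ptopologicalType).
Variables (mu : {measure set (borel X) -> \bar R}) (d : X -> X -> R).
Variables (c K eta : R).
Hypothesis hs : growing_space mu d c K eta.
Hypothesis hd : quasi_metric d.
Local Notation B := (qball d).
Local Notation mr A := (fine (mu A)).
Local Notation m x r := (mr (B x r)).
Local Notation intg := (intg mu).
Local Notation I := (I mu).
Local Notation sqi := (sqi mu).
Local Notation bbf := (bbf d).
Local Notation lp := (lp mu).
Local Notation Ip := (Ip mu).
Local Notation latom := (latom mu d).
Local Notation meas := (measurable_fun [set: borel X]).
Implicit Types (f g u v b F w : X -> R) (x y : X).

Let cn n : 0 < c ^+ n. Proof. by rewrite exprn_gt0// (c_gt0 hs). Qed.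

Lemma ball_exhaust y : exists n, B point (c ^+ n) y.
Proof.
have [r r0 hr] := ball_in hs y point (ltr01 : 0 < 1 :> R).
have [N hN] := expr_unbounded r (c_gt1 hs); exists N.
by apply: (ball_mono (ltW hN)); apply: hr; exact: (ball_center hs).
Qed.

Lemma sigma_finite_balls : sigma_finite [set: borel X] mu.
Proof.
exists (fun n => B point (c ^+ n)).
  apply/seteqP; split => // y _; have [n hn] := ball_exhaust y; by exists n.
by move=> n; split; [exact: (meas_ball hs)|exact: (fin_ball hs)].
Qed.

(** A series of indicators of the balls of radius [c^k] with ratio [1/(2 K)], which beats the
    doubling growth [K^k]. The power [1/p] turns the integrable weight into one in [L^p]. *)
Lemma positive_weight p : 0 < p -> exists2 w, lp p w & forall x, 0 < w x.
Proof.
move=> p0; have K0 := K_gt0 hs; have K1 := K_gt1 hs.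
pose a : R := (2 * K)^-1.
have a0 : 0 < a by rewrite invr_gt0 mulr_gt0.
have aK : a * K = 2^-1 by rewrite /a invfM mulrAC -mulrA mulfV ?mulr1// gt_eqF.
have a1 : a < 1 by rewrite invf_lt1 ?mulr_gt0//; lra.
pose f_ n y := \sum_(k < n) a ^+ k * \1_(B point (c ^+ k)) y.
have t0 k y : 0 <= a ^+ k * \1_(B point (c ^+ k)) y by rewrite mulr_ge0 ?exprn_ge0 ?(ltW a0)// indicE.
have f0 n y : 0 <= f_ n y by apply: sumr_ge0 => k _; exact: t0.
have nd y : {homo f_^~ y : i j / (i <= j)%N >-> i <= j}.
  by apply/nondecreasing_seqP => n; rewrite /f_ big_ord_recr/= lerDl.
have ub n y : f_ n y <= (1 - a)^-1.
  apply: le_trans (geometric_sum_le n (ltW a0) a1); apply: ler_sum => k _.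
  by rewrite ler_piMr ?exprn_ge0 ?(ltW a0).
have cv y : cvgn (f_^~ y).
  by apply: nondecreasing_is_cvgn; [exact: nd|exists (1 - a)^-1 => _ [n _ <-]; exact: ub].
pose w0 y := limn (f_^~ y).
have i1 k : intg (fun y => a ^+ k * \1_(B point (c ^+ k)) y).
  by apply: intgZ; apply: intg_indic; [exact: (meas_ball hs)|exact: (fin_ball hs)].
have if_ n : intg (f_ n) by apply: intg_sum => k _; exact: i1.
have mk k : m point (c ^+ k) <= K ^+ k * m point 1.
  by have := m_dbl hs k point ltr01; rewrite mulr1.
have Ib n : I (f_ n) <= 2 * m point 1.
  rewrite /f_ I_sum//; apply: (@le_trans _ _ (\sum_(k < n) 2^-1 ^+ k * m point 1)).
    apply: ler_sum => k _; rewrite IZ; last by apply: intg_indic; [exact: (meas_ball hs)|exact: (fin_ball hs)].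
    rewrite I_indic; last exact: (meas_ball hs).
    rewrite -aK exprMn -mulrA; apply: ler_wpM2l; first by rewrite exprn_ge0// ltW.
    exact: mk.
  rewrite -mulr_suml; apply: ler_wpM2r; first exact: mr_ge0.
  exact: geometric_half_le.
have [iw _] := @I_monotone _ (borel X) R mu f_ w0 (2 * m point 1) if_ f0 nd cv Ib.
have w0p y : 0 < w0 y.
  have [n hn] := ball_exhaust y; apply: lt_le_trans (nondecreasing_cvgn_le (nd y) (cv y) n.+1).
  rewrite /f_ big_ord_recr/= ltr_wpDl//; first exact: f0.
  by rewrite indicE mem_set// mulr1 exprn_gt0.
exists (fun y => w0 y `^ p^-1); last by move=> x; exact: powR_gt0.
split.
  apply: (measurableT_comp (f := fun z : R => z `^ p^-1)); first exact: measurable_powR.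
  exact: intg_meas iw.
apply: eq_intg iw => y.
by rewrite ger0_norm ?powR_ge0// -powRrM mulVf ?gt_eqF// powRr1// ltW.
Qed.

Definition ae_linear (p : R) (S : (X -> R) -> X -> R) : Prop := forall a f g, lp p f -> lp p g ->
  {ae mu, forall y, S (fun z => a * f z + g z) y = a * S f y + S g y}.

Section conjugate.
Variables p q : R.
Hypothesis p0 : 0 < p.
Hypothesis q0 : 0 < q.
Hypothesis pq : p^-1 + q^-1 = 1.

Definition adjoint_pair (S S' : (X -> R) -> X -> R) : Prop :=
  forall u g, lp p u -> lp q g -> I (fun x => S u x * g x) = I (fun x => u x * S' g x).

Lemma lp_norm_witness r g : 0 < r -> lp r g -> exists2 G : R, 0 < G & Ip r g <= G `^ r.
Proof.
move=> r0 lg; have P : 0 < 1 + Ip r g by rewrite ltr_pwDl// Ip_ge0.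
exists ((1 + Ip r g) `^ r^-1); first exact: powR_gt0.
by rewrite -powRrM mulVf ?gt_eqF// powRr1 ?(ltW P)// lerDr.
Qed.

Lemma lpop_pair_le S A u g H G : lpop mu p S A -> lp p u -> lp q g -> 0 < H -> 0 < G ->
  Ip p u <= H `^ p -> Ip q g <= G `^ q -> `|I (fun x => S u x * g x)| <= A * H * G.
Proof.
move=> hS lu lg H0 G0 hH hG.
have i := lp_mul p0 q0 pq (lpop_lp hS lu) lg.
apply: le_trans (I_abs i) _.
by apply: (hoelderR p0 q0 pq (lpop_lp hS lu) lg (mulr_gt0 (lpop_gt0 hS) H0) G0 _ hG); exact: (lpop_bound hS).
Qed.

Lemma functional_linear S A g : lpop mu p S A -> ae_linear p S -> lp q g -> forall a u v, lp p u -> lp p v ->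
  I (fun x => S (fun z => a * u z + v z) x * g x) = a * I (fun x => S u x * g x) + I (fun x => S v x * g x).
Proof.
move=> hS lS lg a u v lu lv.
have i1 := lp_mul p0 q0 pq (lpop_lp hS lu) lg; have i2 := lp_mul p0 q0 pq (lpop_lp hS lv) lg.
have l3 : lp p (fun z => a * u z + v z).
  by apply: lpD => //; [exact: ltW|exact: (lpZ a (ltW p0) lu).1].
have i3 := lp_mul p0 q0 pq (lpop_lp hS l3) lg.
rewrite -IZ// -ID//; last exact: intgZ.
apply: (proj2 (I_eq_ae (intgD (intgZ a i1) i2) (intg_meas i3) _)).
by apply: (ae_imp (lS a u v lu lv)) => x ->; ring.
Qed.

(** [S' g] is chosen by Riesz representation of the functional sending [u] to the integral of
    [S u . g]. Linearity holds almost everywhere because a function of [L^q] orthogonal to [L^p]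
    vanishes. *)
Lemma real_adjoint S A : lpop mu p S A -> ae_linear p S ->
  exists S', [/\ lpop mu q S' A, ae_linear q S' & adjoint_pair S S'].
Proof.
move=> hS lS; have A0 := lpop_gt0 hS.
have [w lw w0] := positive_weight p0.
have /choice[S' hS'] : forall g, exists h, lp q g -> lp q h /\
    forall u, lp p u -> I (fun x => S u x * g x) = I (fun x => u x * h x).
  move=> g; have [lg|ng] := pselect (lp q g); last by exists (fun=> 0).
  have [G G0 hG] := lp_norm_witness q0 lg.
  have bd u H : lp p u -> 0 < H -> Ip p u <= H `^ p -> `|I (fun x => S u x * g x)| <= A * G * H.
    by move=> lu H0 hu; rewrite mulrAC; exact: lpop_pair_le.
  have [h lh hh] := @lp_riesz _ (borel X) R mu p q p0 q0 pq w (fun u => I (fun x => S u x * g x)) (A * G)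
    (mulr_gt0 A0 G0) w0 lw sigma_finite_balls (functional_linear hS lS lg)
    bd.
  by exists h.
have lS' g : lp q g -> lp q (S' g) by move=> /hS' [].
have adj : adjoint_pair S S' by move=> u g lu /hS' [_ h]; exact: h.
have linS' : ae_linear q S'.
  move=> a f g lf lg.
  have l3 : lp q (fun z => a * f z + g z).
    by apply: lpD => //; [exact: ltW|exact: (lpZ a (ltW q0) lf).1].
  pose k x := S' (fun z => a * f z + g z) x - (a * S' f x + S' g x).
  have laf := (lpZ a (ltW q0) (lS' f lf)).1.
  have lk : lp q k.
    apply: lpB; [exact: ltW|exact: lS'|].
    by apply: lpD; [exact: ltW|exact: laf|exact: lS'].
  have : {ae mu, forall x, k x = 0}.
    apply: (dual_zero p0 q0 pq lk) => u lu.
    have j1 := lp_mul p0 q0 pq lu (lS' f lf); have j2 := lp_mul p0 q0 pq lu (lS' g lg).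
    have j3 := lp_mul p0 q0 pq lu (lS' _ l3).
    have e1 := lp_mul p0 q0 pq (lpop_lp hS lu) lf; have e2 := lp_mul p0 q0 pq (lpop_lp hS lu) lg.
    rewrite (eq_I mu (g := fun x => u x * S' (fun z => a * f z + g z) x - (a * (u x * S' f x) + u x * S' g x))).
      rewrite IB//; last by apply: intgD => //; exact: intgZ.
      rewrite ID//; last exact: intgZ.
      rewrite IZ// -!adj//.
      rewrite (eq_I mu (g := fun x => a * (S u x * f x) + S u x * g x)); last by move=> x; ring.
      by rewrite ID ?IZ ?subrr//; exact: intgZ.
    by move=> x; rewrite /k; ring.
  by move=> h; apply: (ae_imp h) => x /eqP; rewrite subr_eq0 => /eqP.
exists S'; split => //; split => //; last first.
  move=> f g lf lg; apply: (ae_imp (linS' 1 f g lf lg)) => y.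
  rewrite (_ : (fun z => 1 * f z + g z) = fun z => f z + g z) ?mul1r//.
  by apply/funext => z; rewrite mul1r.
move=> g G G0 lg hG; apply: (dual_bound p0 q0 pq (mulr_gt0 A0 G0) (lS' g lg)) => u H lu H0 hu.
rewrite -adj//; apply: le_trans (ler_norm _) _.
by rewrite mulrAC; exact: lpop_pair_le.
Qed.

(** What a Calderon-Zygmund operator provides for each of its real parts: the [L^2] bound on test
    functions, and a real kernel with a Holder class dense in [L^2]. *)
Record kernel_op (S : (X -> R) -> X -> R) : Prop := KernelOp {
  ko_l2 : exists2 A : R, 0 < A & forall u, bbf u -> sqi (S u) /\
    I (fun y => S u y ^+ 2) <= A ^+ 2 * I (fun y => u y ^+ 2) ;
  ko_ker : exists (kap : X -> X -> R) (eps C0 delta : R), [/\ 0 < eps /\ 0 < C0 /\ 0 < delta,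
    forall x y, x <> y -> `|kap x y| <= C0 / m x (d x y),
    forall x x' y, x <> y -> c * d x x' <= d x y ->
      `|kap x y - kap x' y| + `|kap y x - kap y x'| <= (d x x' / d x y) `^ eps * (C0 / m x (d x y)),
    forall u, sqi u -> forall e : R, 0 < e ->
      exists2 h, hol d delta h & I (fun y => (u y - h y) ^+ 2) <= e &
    forall f g, hol d delta f -> hol d delta g ->
      (exists2 e : R, 0 < e & forall x y, f x != 0 -> g y != 0 -> e <= d x y) ->
      I (fun y => S f y * g y) = I (fun x => g x * kint mu kap f x)] }.

Theorem kernel_op_bil S A : lpop mu p S A -> ae_linear p S -> kernel_op S ->
  exists S', [/\ lpop mu q S' A, ae_linear q S', adjoint_pair S S' &
    exists2 C : R, 0 < C & forall g F G H, lp q g -> lp p F -> 0 < G -> 0 < H ->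
      Ip q g <= G `^ q -> Ip p F <= H `^ p -> acost mu latom (bil S S' g F) (C * G * H)].
Proof.
move=> hS lS [[A2 A20 hl2] [kap [eps [C0 [delta [[eps0 [C00 delta0]] hk1 hk2 dense form]]]]]].
have [S' [hS' lS' adj]] := real_adjoint hS lS; exists S'; split => //.
have blp := fun r (r0 : 0 < r) u (bu : bbf u) => bbf_lp hs r0 bu.
have hp := @czpair_of_kernel R X mu d c K eta hs hd S A2 A20
  (fun a u v bu bv => lS a u v (blp p p0 u bu) (blp p p0 v bv))
  (fun u bu => (hl2 u bu).1) (fun u bu => (hl2 u bu).2)
  kap eps C0 eps0 C00 hk1 hk2 delta delta0 dense form S'
  (fun a u v bu bv => lS' a u v (blp q q0 u bu) (blp q q0 v bv))
  (fun v bv => (lpop_lp hS' (blp q q0 v bv)).1)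
  (fun u v bu bv => lp_mul p0 q0 pq (blp p p0 u bu) (lpop_lp hS' (blp q q0 v bv)))
  (fun u v bu bv => adj u v (blp p p0 u bu) (blp q q0 v bv)).
exact: (lp_bil hs hp p0 q0 pq hS hS').
Qed.

(** Extensions to [L^p] and to [L^2] have the same form on Holder functions. Both forms are
    continuous in each variable in the sense of [bcont], so equality extends to test functions in
    the second variable, then in the first. *)
Lemma agree_on_bbf S A S2 A2 delta : 0 < delta ->
  (forall u, sqi u -> forall e : R, 0 < e ->
      exists2 h, hol d delta h & I (fun y => (u y - h y) ^+ 2) <= e) ->
  lpop mu p S A -> ae_linear p S -> lpop mu 2 S2 A2 -> ae_linear 2 S2 ->
  (forall f g, hol d delta f -> hol d delta g ->
     I (fun y => S f y * g y) = I (fun y => S2 f y * g y)) ->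
  forall u, bbf u -> {ae mu, forall y, S u y = S2 u y}.
Proof.
move=> delta0 dense hS lS hS2 lS2 form.
have two : 0 < 2 :> R by [].
have pq2 : 2^-1 + 2^-1 = 1 :> R by lra.
have hb h : hol d delta h -> bbf h by exact: (hol_bbf hs hd delta0).
have c1 f : lp p f -> bcont mu d (fun v => I (fun y => f y * v y)).
  move=> lf; have [H H0 hH] := lp_norm_witness p0 lf.
  apply: (bcont_functional hs q0 H0) => [a u v lu lv|v G lv G0 hG].
    have i1 := lp_mul p0 q0 pq lf lu; have i2 := lp_mul p0 q0 pq lf lv.
    by rewrite -IZ// -ID//; [apply: eq_I => y; ring|exact: intgZ].
  by apply: le_trans (I_abs (lp_mul p0 q0 pq lf lv)) _; exact: (hoelderR p0 q0 pq).
have c2 f : lp 2 f -> bcont mu d (fun v => I (fun y => f y * v y)).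
  move=> lf; have [H H0 hH] := lp_norm_witness two lf.
  apply: (bcont_functional hs two H0) => [a u v lu lv|v G lv G0 hG].
    have i1 := lp_mul two two pq2 lf lu; have i2 := lp_mul two two pq2 lf lv.
    by rewrite -IZ// -ID//; [apply: eq_I => y; ring|exact: intgZ].
  by apply: le_trans (I_abs (lp_mul two two pq2 lf lv)) _; exact: (hoelderR two two pq2).
have bsub (L1 L2 : (X -> R) -> R) : bcont mu d L1 -> bcont mu d L2 -> bcont mu d (fun u => L1 u - L2 u).
  by move=> b1 b2 u_ u x r N h1 h2 h3 h4 h5; apply: cvgB; [exact: (b1 _ _ x r N)|exact: (b2 _ _ x r N)].
have step1 f v : hol d delta f -> bbf v -> I (fun y => S f y * v y) = I (fun y => S2 f y * v y).
  move=> hf bv; have bf := hb f hf; apply/eqP; rewrite -subr_eq0; apply/eqP.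
  have cc := bsub _ _ (c1 _ (lpop_lp hS (bbf_lp hs p0 bf))) (c2 _ (lpop_lp hS2 (bbf_lp hs two bf))).
  apply: (hol_determines hs hd delta0 dense cc _ bv) => h hh.
  by rewrite form// subrr.
have step2 u v : bbf u -> bbf v -> I (fun y => S u y * v y) = I (fun y => S2 u y * v y).
  move=> bu bv; apply/eqP; rewrite -subr_eq0; apply/eqP.
  have lq := bbf_lp hs q0 bv; have l2 := bbf_lp hs two bv.
  have [G G0 hG] := lp_norm_witness q0 lq; have [G2 G20 hG2] := lp_norm_witness two l2.
  have d1 : bcont mu d (fun u => I (fun y => S u y * v y)).
    apply: (bcont_functional hs p0 (mulr_gt0 (lpop_gt0 hS) G0)) => [a f g lf lg|f H lf H0 hH].
      exact: (functional_linear hS lS lq).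
    by rewrite mulrAC; exact: lpop_pair_le.
  have d2 : bcont mu d (fun u => I (fun y => S2 u y * v y)).
    apply: (bcont_functional hs two (mulr_gt0 (lpop_gt0 hS2) G20)) => [a f g lf lg|f H lf H0 hH].
      have i1 := lp_mul two two pq2 (lpop_lp hS2 lf) l2; have i2 := lp_mul two two pq2 (lpop_lp hS2 lg) l2.
      have l3 : lp 2 (fun z => a * f z + g z).
        by apply: lpD => //; exact: (lpZ a (ltW two) lf).1.
      have i3 := lp_mul two two pq2 (lpop_lp hS2 l3) l2.
      rewrite -IZ// -ID//; last exact: intgZ.
      apply: (proj2 (I_eq_ae (intgD (intgZ a i1) i2) (intg_meas i3) _)).
      by apply: (ae_imp (lS2 a f g lf lg)) => x ->; ring.
    apply: le_trans (I_abs (lp_mul two two pq2 (lpop_lp hS2 lf) l2)) _.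
    rewrite mulrAC; apply: (hoelderR two two pq2 (lpop_lp hS2 lf) l2 (mulr_gt0 (lpop_gt0 hS2) H0) G20 _ hG2).
    exact: (lpop_bound hS2).
  apply: (hol_determines hs hd delta0 dense (bsub _ _ d1 d2) _ bu) => h hh.
  by rewrite step1// subrr.
move=> u bu; have lu := lpop_lp hS (bbf_lp hs p0 bu); have lu2 := lpop_lp hS2 (bbf_lp hs two bu).
have i1 v (bv : bbf v) := lp_mul p0 q0 pq lu (bbf_lp hs q0 bv).
have i2 v (bv : bbf v) := lp_mul two two pq2 lu2 (bbf_lp hs two bv).
have [m1 _] := lu; have [m2 _] := lu2.
have E v y : S u y * v y - S2 u y * v y = (S u y - S2 u y) * v y by ring.
have : {ae mu, forall y, S u y - S2 u y = 0}.
  apply: (@ae_zero_bbf R X mu d c K eta hs) => [|v bv|v bv].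
  - exact: measurable_funB.
  - by apply: (@eq_intg _ (borel X) R mu _ _ (E v)); apply: intgB; [exact: i1|exact: i2].
  by rewrite -(eq_I mu (E v)) IB ?step2 ?subrr//; [exact: i1|exact: i2].
by move=> h; apply: (ae_imp h) => y /eqP; rewrite subr_eq0 => /eqP.
Qed.

End conjugate.

End real_operators.

(** * Complex operators *)

Import ComplexField.Normc.
Local Open Scope complex_scope.



Section complex_parts.
Context (R : realType).
Implicit Types (z w : R[i]) (k : R) (b : bool).

Definition part b z : R := if b then complex.Re z else complex.Im z.

Lemma part_lin b k z w : part b (k%:C * z + w) = k * part b z + part b w.
Proof. by case: b; case: z => a1 a2; case: w => b1 b2 /=; ring. Qed.

Lemma partB b z w : part b (z - w) = part b z - part b w.
Proof. by case: b; case: z => a1 a2; case: w => b1 b2. Qed.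

Lemma part_le b z : `|part b z| <= normc z.
Proof.
case: z => a1 a2; rewrite -[leRHS]/(Num.sqrt (a1 ^+ 2 + a2 ^+ 2)).
rewrite -[leRHS](ger0_norm (sqrtr_ge0 _)) -ler_sqr ?nnegrE// !real_normK ?num_real//.
by rewrite sqr_sqrtr ?addr_ge0 ?sqr_ge0//; case: b => /=; rewrite ?lerDl ?lerDr sqr_ge0.
Qed.

Lemma normc_ge0 z : 0 <= normc z.
Proof. by case: z => a1 a2; exact: sqrtr_ge0. Qed.

Lemma normc_le z : normc z <= `|complex.Re z| + `|complex.Im z|.
Proof.
case: z => a1 a2 /=; rewrite -[leRHS]ger0_norm ?addr_ge0// -sqrtr_sqr ler_wsqrtr// sqrrD.
by rewrite !real_normK ?num_real// addrAC lerDl mulrn_wge0// mulr_ge0.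
Qed.

Lemma normc_real k : normc k%:C = `|k|.
Proof. by rewrite /= expr0n addr0 sqrtr_sqr. Qed.

End complex_parts.

Section bridge.
Context (R : realType) (X : ptopologicalType).
Variables (mu : {measure set (borel X) -> \bar R}) (d : X -> X -> R).
Variables (c K eta : R).
Hypothesis hs : growing_space mu d c K eta.
Hypothesis hd : quasi_metric d.
Local Notation B := (qball d).
Local Notation mr A := (fine (mu A)).
Local Notation m x r := (mr (B x r)).
Local Notation intg := (intg mu).
Local Notation I := (I mu).
Local Notation sqi := (sqi mu).
Local Notation bbf := (bbf d).
Local Notation lp := (lp mu).
Local Notation Ip := (Ip mu).
Local Notation meas := (measurable_fun [set: borel X]).
Implicit Types (f g u v : X -> R) (F G : X -> R[i]) (x y : X) (S : (X -> R[i]) -> X -> R[i]) (b : bool).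

Definition cplx u : X -> R[i] := fun x => (u x)%:C.
Definition nrm F : X -> R := fun x => normc (F x).
(** The real operators to which the real theory is applied; by linearity they determine a complex
    linear [S], see [op_parts]. *)
Definition op_part b S : (X -> R) -> X -> R := fun u x => part b (S (cplx u) x).

Lemma part_meas b F : cmeasurable F -> meas (fun x => part b (F x)).
Proof. by move=> [h1 h2]; case: b. Qed.

Lemma nrm_meas F : cmeasurable F -> meas (nrm F).
Proof.
move=> [h1 h2].
rewrite (_ : nrm F = fun x => (complex.Re (F x) ^+ 2 + complex.Im (F x) ^+ 2) `^ 2^-1).
  apply: (measurableT_comp (f := fun y : R => y `^ 2^-1)); first exact: measurable_powR.
  by apply: measurable_funD; exact: measurable_funX.
by apply/funext => x; rewrite powR12_sqrt ?addr_ge0 ?sqr_ge0// /nrm; case: (F x).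
Qed.

Section exponent.
Variable p : R.
Hypothesis p0 : 0 < p.

Lemma cLnorm_lp F : cmeasurable F -> lp p (nrm F) -> cLnorm mu p%:E F = (Ip p (nrm F) `^ p^-1)%:E.
Proof.
move=> mF [_ i]; rewrite /cLnorm unlock -poweR_EFin /Ip; congr (_ `^ _)%E.
rewrite /I /Rintegral fineK; last exact: (integrable_fin_num measurableT i).
by apply: eq_integral => x _; rewrite /= -poweR_EFin.
Qed.

Lemma Lp_nrm F : Lp mu p%:E F <-> cmeasurable F /\ lp p (nrm F).
Proof.
split=> [[mF]|[mF lF]]; last by split => //; rewrite cLnorm_lp// ltry.
move=> h; split => //; split; first exact: nrm_meas.
apply/integrableP; split.
  by apply/measurable_EFinP; apply: meas_norm_powR; exact: nrm_meas.
rewrite ltey; apply/eqP => e; move: h; rewrite /cLnorm unlock.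
rewrite (_ : (\int[mu]_x _)%E = +oo%E) ?poweRyr ?invr_eq0 ?gt_eqF//.
rewrite -[RHS]e; apply: eq_integral => x _.
transitivity ((`|nrm F x| `^ p)%:E); first by rewrite -poweR_EFin.
have e1 : `| `|nrm F x| `^ p | = `|nrm F x| `^ p by rewrite ger0_norm ?powR_ge0.
exact: (congr1 EFin (esym e1)).
Qed.

Lemma Lp_part b F : Lp mu p%:E F -> lp p (fun x => part b (F x)) /\
  Ip p (fun x => part b (F x)) <= Ip p (nrm F).
Proof.
move=> /Lp_nrm[mF lF]; apply: (lp_le (ltW p0) _ _ lF); first exact: part_meas.
by move=> x; rewrite [leRHS]ger0_norm ?normc_ge0//; exact: part_le.
Qed.

Lemma Lp_parts F : lp p (fun x => complex.Re (F x)) -> lp p (fun x => complex.Im (F x)) -> Lp mu p%:E F.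
Proof.
move=> l1 l2; have [m1 _] := l1; have [m2 _] := l2; apply/Lp_nrm; split => //.
have la f : lp p f -> lp p (fun x => `|f x|).
  by move=> [mf i]; apply: (proj1 (lp_le (ltW p0) _ _ (conj mf i))) => [|x]; [exact: measurableT_comp|rewrite normr_id].
apply: (proj1 (lp_le (ltW p0) _ _ (lpD (ltW p0) (la _ l1) (la _ l2)))); first exact: nrm_meas.
move=> x; rewrite (ger0_norm (normc_ge0 _)) ger0_norm ?addr_ge0//; exact: normc_le.
Qed.

Lemma cplx_Lp u : lp p u -> Lp mu p%:E (cplx u) /\ Ip p (nrm (cplx u)) = Ip p u.
Proof.
move=> lu; split; last by apply: eq_I => x; rewrite /nrm /cplx normc_real normr_id.
by apply: Lp_parts => //; exact: lp0.
Qed.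

Lemma Lp_bounded_le S : Lp_bounded mu p%:E S -> exists2 A : R, 0 < A &
  forall F (H : R), 0 < H -> Lp mu p%:E F -> Ip p (nrm F) <= H `^ p ->
    Lp mu p%:E (S F) /\ Ip p (nrm (S F)) <= (A * H) `^ p.
Proof.
move=> [_ [C hC]]; exists (Num.max C 1); first by rewrite lt_max ltr01 orbT.
move=> F H H0 lF hF; have [lSF hb] := hC F lF; split => //.
have /Lp_nrm[mF nF] := lF; have /Lp_nrm[mS nS] := lSF.
move: hb; rewrite !cLnorm_lp// -EFinM lee_fin => hb.
have h : Ip p (nrm (S F)) `^ p^-1 <= Num.max C 1 * H.
  apply: le_trans hb _; apply: (@le_trans _ _ (Num.max C 1 * Ip p (nrm F) `^ p^-1)).
    by apply: ler_wpM2r; [exact: powR_ge0|rewrite le_max lexx].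
  apply: ler_wpM2l; first by rewrite le_max ler01 orbT.
  have -> : H = (H `^ p) `^ p^-1 by rewrite -powRrM divff ?gt_eqF// powRr1// ltW.
  by apply: ge0_ler_powR; rewrite ?nnegrE ?invr_ge0 ?(ltW p0) ?Ip_ge0 ?powR_ge0.
have -> : Ip p (nrm (S F)) = (Ip p (nrm (S F)) `^ p^-1) `^ p.
  by rewrite -powRrM mulVf ?gt_eqF// powRr1// Ip_ge0.
apply: ge0_ler_powR h; rewrite ?nnegrE ?(ltW p0) ?powR_ge0//.
by rewrite mulr_ge0 ?(ltW H0)// le_max ler01 orbT.
Qed.

Lemma op_part_linear b S : Lp_bounded mu p%:E S -> ae_linear mu p (op_part b S).
Proof.
move=> [lin _] a f g lf lg.
have := lin a%:C (cplx f) (cplx g) (cplx_Lp lf).1 (cplx_Lp lg).1.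
rewrite (_ : (fun y => _) = cplx (fun z => a * f z + g z)); last first.
  by apply/funext => z; rewrite /cplx rmorphD rmorphM.
by move=> h; apply: (ae_imp h) => y; rewrite /op_part => ->; rewrite part_lin.
Qed.

Lemma op_part_lpop b S : Lp_bounded mu p%:E S -> exists A : R, lpop mu p (op_part b S) A.
Proof.
move=> bS; have [A A0 hA] := Lp_bounded_le bS; exists A; split => //.
- move=> f lf; have [G G0 hG] := lp_norm_witness p0 lf.
  have [lF eF] := cplx_Lp lf.
  by apply: (Lp_part b _).1; apply: (hA _ G G0 lF _).1; rewrite eF.
- move=> f H H0 lf hf; have [lF eF] := cplx_Lp lf.
  have [lS hS] : Lp mu p%:E (S (cplx f)) /\ Ip p (nrm (S (cplx f))) <= (A * H) `^ p.
    by apply: (hA _ H H0 lF); rewrite eF.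
  by apply: le_trans (Lp_part b lS).2 hS.
move=> f g lf lg; apply: (ae_imp (op_part_linear b bS 1 lf lg)) => y.
rewrite (_ : (fun z => 1 * f z + g z) = fun z => f z + g z) ?mul1r//.
by apply/funext => z; rewrite mul1r.
Qed.

Lemma op_parts S F : Lp_bounded mu p%:E S -> Lp mu p%:E F ->
  {ae mu, forall x,
    complex.Re (S F x) = op_part true S (fun y => complex.Re (F y)) x - op_part false S (fun y => complex.Im (F y)) x /\
    complex.Im (S F x) = op_part true S (fun y => complex.Im (F y)) x + op_part false S (fun y => complex.Re (F y)) x}.
Proof.
move=> [lin _] lF; have l1 := (Lp_part true lF).1; have l2 := (Lp_part false lF).1.
have := lin (0 +i* 1) (cplx (fun y => complex.Im (F y))) (cplx (fun y => complex.Re (F y)))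
  (cplx_Lp l2).1 (cplx_Lp l1).1.
rewrite (_ : (fun y => _) = F); last first.
  by apply/funext => y; rewrite /cplx; case: (F y) => a1 a2; apply/eqP; rewrite eq_complex /=; apply/andP; split; apply/eqP; ring.
move=> h; apply: (ae_imp h) => x ->; rewrite /op_part/=.
by case: (S _ x) => a1 a2; case: (S _ x) => b1 b2 /=; split; ring.
Qed.

End exponent.

Section duality.
Variables p q : R.
Hypothesis p0 : 0 < p.
Hypothesis q0 : 0 < q.
Hypothesis pq : p^-1 + q^-1 = 1.
Variables (S : (X -> R[i]) -> X -> R[i]) (R1 R2 : (X -> R) -> X -> R) (A1 A2 : R).
Hypothesis bS : Lp_bounded mu p%:E S.
Hypothesis h1 : lpop mu q R1 A1.
Hypothesis h2 : lpop mu q R2 A2.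
Hypothesis adj1 : adjoint_pair mu p q (op_part true S) R1.
Hypothesis adj2 : adjoint_pair mu p q (op_part false S) R2.

Let reG G := fun x => complex.Re (G x).
Let imG G := fun x => complex.Im (G x).

Let IDs (f1 f2 f3 f4 : X -> R) (s2 s3 s4 : R) : intg f1 -> intg f2 -> intg f3 -> intg f4 ->
  I (fun x => f1 x + s2 * f2 x + (s3 * f3 x + s4 * f4 x)) = I f1 + s2 * I f2 + (s3 * I f3 + s4 * I f4).
Proof.
move=> i1 i2 i3 i4; rewrite ID ?ID ?IZ//; try (by apply: intgD => //; exact: intgZ); try exact: intgZ.
Qed.

(** On real functions [S] is [S1 + i S2], so its adjoint is [R1 - i R2]; the right-hand side is the
    action of the latter on [G] in real and imaginary parts. *)
Lemma pairing_op F G : Lp mu p%:E F -> Lp mu q%:E G ->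
  pairing mu (S F) G = pairing mu F (fun x =>
    (R1 (reG G) x + R2 (imG G) x) +i* (R1 (imG G) x - R2 (reG G) x)).
Proof.
move=> lF lG.
have lf1 := (Lp_part p0 true lF).1; have lf2 := (Lp_part p0 false lF).1.
have lg1 := (Lp_part q0 true lG).1; have lg2 := (Lp_part q0 false lG).1.
have [B1 o1] := op_part_lpop p0 true bS; have [B2 o2] := op_part_lpop p0 false bS.
have [C0 C00 hC] := Lp_bounded_le p0 bS.
have hae := op_parts p0 bS lF.
have mS : cmeasurable (S F).
  have /(Lp_nrm p0)[_ nF] := lF; have [H H0 hH] := lp_norm_witness p0 nF.
  by have [/(Lp_nrm p0)[]] := hC F H H0 lF hH.
have [mS1 mS2] := mS; have [mg1 _] := lg1; have [mg2 _] := lg2.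
have j := fun u g (lu : lp p u) (lg : lp q g) => lp_mul p0 q0 pq lu lg.
pose f1 := reG F; pose f2 := imG F; pose g1 := reG G; pose g2 := imG G.
have a1 u g : lp p u -> lp q g -> I (fun x => op_part true S u x * g x) = I (fun x => u x * R1 g x).
  by move=> lu lg; exact: adj1.
have a2 u g : lp p u -> lp q g -> I (fun x => op_part false S u x * g x) = I (fun x => u x * R2 g x).
  by move=> lu lg; exact: adj2.
have e1 := fun u g (lu : lp p u) (lg : lp q g) => j _ _ (lpop_lp o1 lu) lg.
have e2 := fun u g (lu : lp p u) (lg : lp q g) => j _ _ (lpop_lp o2 lu) lg.
have k1 := fun u g (lu : lp p u) (lg : lp q g) => j _ _ lu (lpop_lp h1 lg).
have k2 := fun u g (lu : lp p u) (lg : lp q g) => j _ _ lu (lpop_lp h2 lg).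
rewrite /pairing /cintegral; congr (_ +i* _); rewrite -!/(I _).
  rewrite [RHS](eq_I mu (g := fun x => f1 x * R1 g1 x + 1 * (f1 x * R2 g2 x) +
      (1 * (f2 x * R1 g2 x) + -1 * (f2 x * R2 g1 x)))); last first.
    by move=> x; rewrite /f1 /f2 /g1 /g2 /reG /imG; case: (F x) => ? ? /=; ring.
  rewrite IDs; [|exact: k1|exact: k2|exact: k1|exact: k2].
  rewrite -!a1// -!a2//.
  rewrite -(IDs 1 1 (-1) (e1 _ _ lf1 lg1) (e2 _ _ lf1 lg2) (e1 _ _ lf2 lg2) (e2 _ _ lf2 lg1)).
  apply: (proj2 (I_eq_ae _ _ _)).
  - apply: intgD; apply: intgD; try apply: intgZ; [exact: e1|exact: e2|exact: e1|exact: e2].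
  - rewrite (_ : (fun x => _) = fun x => complex.Re (S F x) * g1 x + complex.Im (S F x) * g2 x).
      by apply: measurable_funD; exact: measurable_funM.
    by apply/funext => x; rewrite /g1 /g2 /reG /imG; case: (S F x) => ? ?; case: (G x) => ? ? /=; ring.
  apply: (ae_imp hae) => x [+ +]; rewrite /g1 /g2 /reG /imG.
  by case: (S F x) => ? ?; case: (G x) => ? ? /= -> ->; ring.
rewrite [RHS](eq_I mu (g := fun x => f2 x * R1 g1 x + 1 * (f2 x * R2 g2 x) +
      (-1 * (f1 x * R1 g2 x) + 1 * (f1 x * R2 g1 x)))); last first.
  by move=> x; rewrite /f1 /f2 /g1 /g2 /reG /imG; case: (F x) => ? ? /=; ring.
rewrite IDs; [|exact: k1|exact: k2|exact: k1|exact: k2].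
rewrite -!a1// -!a2//.
rewrite -(IDs 1 (-1) 1 (e1 _ _ lf2 lg1) (e2 _ _ lf2 lg2) (e1 _ _ lf1 lg2) (e2 _ _ lf1 lg1)).
apply: (proj2 (I_eq_ae _ _ _)).
- apply: intgD; apply: intgD; try apply: intgZ; [exact: e1|exact: e2|exact: e1|exact: e2].
- rewrite (_ : (fun x => _) = fun x => complex.Im (S F x) * g1 x - complex.Re (S F x) * g2 x).
    by apply: measurable_funB; exact: measurable_funM.
  by apply/funext => x; rewrite /g1 /g2 /reG /imG; case: (S F x) => ? ?; case: (G x) => ? ? /=; ring.
apply: (ae_imp hae) => x [+ +]; rewrite /g1 /g2 /reG /imG.
by case: (S F x) => ? ?; case: (G x) => ? ? /= -> ->; ring.
Qed.

Lemma adjoint_parts_Lp G : Lp mu q%:E G -> Lp mu q%:E (fun x =>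
    (R1 (reG G) x + R2 (imG G) x) +i* (R1 (imG G) x - R2 (reG G) x)).
Proof.
move=> lG; have lg1 := (Lp_part q0 true lG).1; have lg2 := (Lp_part q0 false lG).1.
by apply: (Lp_parts q0) => /=; [apply: lpD|apply: lpB]; try exact: ltW;
  try (exact: (lpop_lp h1)); exact: (lpop_lp h2).
Qed.

Lemma adjoint_exists : is_adjoint mu p%:E q%:E S (adjoint mu p%:E q%:E S).
Proof.
apply: xgetPex; exists (fun G x => (R1 (reG G) x + R2 (imG G) x) +i* (R1 (imG G) x - R2 (reG G) x)).
move=> G lG; split; first exact: adjoint_parts_Lp.
by move=> F lF; exact: pairing_op.
Qed.

(** The adjoint selected by [xget] need not be the explicit one. Pairing the difference with all
    real functions of [L^p] shows that they agree almost everywhere. *)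
Lemma adjoint_parts G : Lp mu q%:E G -> {ae mu, forall x,
  complex.Re (adjoint mu p%:E q%:E S G x) = R1 (reG G) x + R2 (imG G) x /\
  complex.Im (adjoint mu p%:E q%:E S G x) = R1 (imG G) x - R2 (reG G) x}.
Proof.
move=> lG; have [lA adj] := adjoint_exists lG; set SG := adjoint _ _ _ _ _ in lA adj *.
have lB := adjoint_parts_Lp lG; set SB := fun x => _ in lB.
have z b : {ae mu, forall x, part b (SG x) - part b (SB x) = 0}.
  have l1 := (Lp_part q0 b lA).1; have l2 := (Lp_part q0 b lB).1.
  apply: (dual_zero p0 q0 pq); first by apply: lpB => //; exact: ltW.
  move=> u lu; have [lU _] := cplx_Lp p0 lu.
  have E : pairing mu (cplx u) SG = pairing mu (cplx u) SB by rewrite -adj// pairing_op.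
  rewrite (eq_I mu (g := fun x => u x * part b (SG x) - u x * part b (SB x))); last by move=> x; ring.
  have i1 := lp_mul p0 q0 pq lu l1; have i2 := lp_mul p0 q0 pq lu l2.
  rewrite IB//; apply/eqP; rewrite subr_eq0; apply/eqP.
  move: E; rewrite /pairing /cintegral => -[]; rewrite -!/(I _) => E1 E2.
  case: b l1 l2 i1 i2 => l1 l2 i1 i2 /=.
    transitivity (I (fun x => complex.Re (cplx u x * (SG x)^*))).
      by apply: eq_I => x; rewrite /cplx; case: (SG x) => ? ? /=; ring.
    by rewrite E1; apply: eq_I => x; rewrite /cplx; case: (SB x) => ? ? /=; ring.
  apply: oppr_inj; rewrite -!IN//.
  transitivity (I (fun x => complex.Im (cplx u x * (SG x)^*))).
    by apply: eq_I => x; rewrite /cplx; case: (SG x) => ? ? /=; ring.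
  by rewrite E2; apply: eq_I => x; rewrite /cplx; case: (SB x) => ? ? /=; ring.
apply: (ae_imp2 (z true) (z false)) => x /eqP + /eqP; rewrite !subr_eq0 /= => /eqP -> /eqP ->.
by [].
Qed.

End duality.

Section kernel.
Variable T : cz_operator mu d c.
Local Notation delta := (cz_order T).
Let delta0 := cz_order_gt0 T.

Lemma hol_Holder u : hol d delta u -> Holder d delta (cplx u).
Proof.
move=> [[A hA] [x [r [r0 h]]]]; split.
  by exists A => y z; rewrite /cplx -rmorphB normc_real.
exists x, (c * r); split; first by rewrite mulr_gt0 ?(c_gt0 hs).
move=> y hy; apply: (closure_ball hs r0); apply: closure_subset hy => z /= hz.
by apply: h; apply: contra_neq hz => e; rewrite /cplx e.
Qed.

Lemma Holder_dense u : sqi u -> forall e : R, 0 < e ->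
  exists2 h, hol d delta h & I (fun y => (u y - h y) ^+ 2) <= e.
Proof.
move=> [mu_ iu] e e0; have two : 0 < 2 :> R by [].
have sq (f : X -> R) x : `|f x| `^ 2 = f x ^+ 2.
  by rewrite powR_mulrn// real_normK ?num_real.
have lu : lp 2 u by split => //; apply: eq_intg iu => x; rewrite sq.
have s0 : 0 < Num.sqrt e by rewrite sqrtr_gt0.
have [g [[A hA] [x [r [r0 sg]]]] hg] := cz_dense T (cplx_Lp two lu).1 s0.
pose h y := complex.Re (g y).
have hh : hol d delta h.
  split.
    exists A => y z; apply: le_trans (hA y z); rewrite /h.
    by have := part_le true (g y - g z); rewrite /part; case: (g y); case: (g z).
  exists x, r; split => // y hy; apply: sg; apply: subset_closure.
  by apply: contra_neq hy => e1; rewrite /h e1.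
exists h => //.
have bh := hol_bbf hs hd delta0 hh.
have lh := bbf_lp hs two bh.
have l1 := lpB (ltW two) lu lh.
have Hg : Lp mu 2%:E (fun x => cplx u x - g x).
  split; last by apply: lt_trans hg _; exact: ltry.
  have gm : meas (fun x => complex.Im (g x)).
    apply: (hol_meas hs hd delta0); split.
      exists A => y z; apply: le_trans (hA y z).
      by have := part_le false (g y - g z); rewrite /part; case: (g y); case: (g z).
    exists x, r; split => // y hy; apply: sg; apply: subset_closure.
    by apply: contra_neq hy => e1; rewrite e1.
  split.
    rewrite (_ : (fun x => _) = fun x => u x - h x); first by have [] := l1.
    by apply/funext => y; rewrite /h /cplx; case: (g y).
  rewrite (_ : (fun x => _) = fun x => - complex.Im (g x)); first exact: measurableT_comp.
  by apply/funext => y; rewrite /cplx; case: (g y) => ? ? /=; ring.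
have /(Lp_nrm two)[mG nG] := Hg.
move: hg; rewrite (cLnorm_lp mG nG) lte_fin => hg.
apply: (@le_trans _ _ (Ip 2 (nrm (fun x => cplx u x - g x)))).
  rewrite -(eq_I mu (sq (fun y => u y - h y))).
  apply: le_trans (_ : _ <= Ip 2 (fun x => part true (cplx u x - g x))) _; last exact: (Lp_part two true Hg).2.
  rewrite le_eqVlt; apply/orP; left; apply/eqP; apply: eq_I => y.
  by rewrite /part /h /cplx; case: (g y).
have J0 := Ip_ge0 mu 2 (nrm (fun x => cplx u x - g x)).
have -> : Ip 2 (nrm (fun x => cplx u x - g x)) = (Ip 2 (nrm (fun x => cplx u x - g x)) `^ 2^-1) ^+ 2.
  by rewrite powR12_sqrt// sqr_sqrtr.
rewrite -(sqr_sqrtr (ltW e0)); apply: lerXn2r; rewrite ?nnegrE ?powR_ge0 ?sqrtr_ge0//; exact: ltW.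
Qed.

(** Separation of the nonvanishing sets passes to their closures at distance [e / (4 k^2)]: points
    of the closures are moved by less than this, and the quasi-triangle inequality with [k >= 1] is
    used twice. *)
Lemma cplx_separated u v (e : R) : 0 < e -> (forall x y, u x != 0 -> v y != 0 -> e <= d x y) ->
  positively_separated d (cplx u) (cplx v).
Proof.
move=> e0 h; have [kap hk] := qm_triangle hd.
pose k := Num.max kap 1.
have k1 : 1 <= k by rewrite le_max lexx orbT.
have k0 : 0 < k by exact: lt_le_trans k1.
have tri x y z : d x z <= k * (d x y + d y z).
  apply: le_trans (hk x y z) _; apply: ler_wpM2r; first by rewrite addr_ge0 ?(qm_ge0 hd).
  by rewrite le_max lexx.
pose r := e / (4 * k ^+ 2).
have k20 : 0 < 4 * k ^+ 2 by rewrite mulr_gt0// exprn_gt0.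
have r0 : 0 < r by exact: divr_gt0.
have er : e = 4 * k ^+ 2 * r by rewrite mulrC /r divfK ?gt_eqF.
have near w x : supp (cplx w) x -> exists2 z, w z != 0 & d x z < r.
  move=> /(_ (B x r)) []; first by apply: open_nbhs_nbhs; split; [exact: (open_ball hs)|exact: (ball_center hs)].
  by move=> z [/= wz xz]; exists z => //; apply: contra_neq wz => e1; rewrite /cplx e1.
exists r => // x y /near[a ua xa] /near[b vb yb].
have := h a b ua vb; have t1 := tri a x b; have t2 := tri x y b.
rewrite (qm_sym hd a x) in t1; move=> hab; rewrite leNgt; apply/negP => xy.
have : e < e; last by rewrite ltxx.
apply: le_lt_trans hab _; apply: le_lt_trans t1 _; rewrite [ltRHS]er.
have t3 : d x b < k * (r + r) by apply: le_lt_trans t2 _; rewrite ltr_pM2l//; lra.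
rewrite (_ : 4 * k ^+ 2 * r = k * (4 * k * r)); last by ring.
rewrite ltr_pM2l//; have := ler_peMl (ltW r0) k1; lra.
Qed.

Lemma op_part_kernel_op b p : 0 < p -> (exists2 q : R, 0 < q & p^-1 + q^-1 = 1) ->
  bounded_on 2%:E T -> kernel_op mu d c (op_part b (Lp_op p%:E T)).
Proof.
move=> p0 [q q0 pq] [S2 [bS2 form2]].
have two : 0 < 2 :> R by [].
set S := Lp_op _ _.
have hb h : hol d delta h -> bbf h by exact: (hol_bbf hs hd delta0).
(* Without an extension to [L^p] the operator is the default 0, which has the kernel 0. *)
have [ex|nex] := pselect (exists S, Lp_extends p%:E T S); last first.
  have S0 : S = fun _ _ => 0.
    by rewrite /S /Lp_op; case: xgetP => // S' _ hS'; exfalso; apply: nex; exists S'.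
  have E u : op_part b S u = fun=> 0.
    by apply/funext => x; rewrite /op_part S0; case: b.
  split.
    exists 1 => // u bu; rewrite E (_ : (fun y => 0 ^+ 2) = fun=> 0); last by apply/funext => y; rewrite expr0n.
    split; last by rewrite I0 mulr_ge0// ?I_ge0// => y; exact: sqr_ge0.
    exact: sqi0.
  exists (fun _ _ => 0), 1, 1, delta; split => //.
  - by move=> x y _; rewrite normr0 mulr_ge0// invr_ge0 mr_ge0.
  - move=> x x' y _ _; rewrite !subrr normr0 addr0 mulr_ge0 ?powR_ge0// mulr_ge0// invr_ge0 mr_ge0//.
  - exact: Holder_dense.
  move=> f g _ _ _; rewrite E; rewrite (eq_I mu (g := fun=> 0)) => [|y]; last by rewrite mul0r.
  rewrite I0; apply/esym; rewrite -[RHS](I0 mu); apply: eq_I => x; rewrite /kint (eq_I mu (g := fun=> 0)) ?I0 ?mulr0// => y.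
  by rewrite mul0r.
have [bS form] : Lp_extends p%:E T S by exact: (xgetPex _ ex).
have [A o1] := op_part_lpop p0 b bS; have [A2 o2] := op_part_lpop two b bS2.
have fE S' f g : (forall f g : X -> R[i], Holder d delta f -> Holder d delta g ->
     T f g = cintegral mu [set: X] (fun x => S' f x * g x)) -> hol d delta f -> hol d delta g ->
     I (fun y => op_part b S' f y * g y) = part b (T (cplx f) (cplx g)).
  move=> h hf hg; rewrite h; [|exact: hol_Holder|exact: hol_Holder].
  rewrite /cintegral; case: b {o1 o2}; apply: eq_I => x;
    by rewrite /op_part /cplx; case: (S' _ x) => ? ? /=; ring.
(* The [L^2] bound belongs to the extension [S2]; agreement on test functions transfers it to the
   [L^p] extension. *)
have agree := agree_on_bbf hs hd p0 q0 pq delta0 Holder_dense o1 (op_part_linear p0 b bS)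
  o2 (op_part_linear two b bS2) (fun f g hf hg => etrans (fE S f g form hf hg) (esym (fE S2 f g form2 hf hg))).
have sq (f : X -> R) x : `|f x| `^ 2 = f x ^+ 2.
  by rewrite powR_mulrn// real_normK ?num_real.
split.
  exists A2; first exact: (lpop_gt0 o2).
  move=> u bu; have l2 := bbf_lp hs two bu.
  have [m2 i2] := lpop_lp o2 l2; have [m1 _] := lpop_lp o1 (bbf_lp hs p0 bu).
  have i2' : intg (fun x => op_part b S2 u x ^+ 2) by apply: eq_intg i2 => x; rewrite sq.
  have [i1 e1] := I_eq_ae i2' (measurable_funX 2 m1)
    (ae_imp (agree u bu) (fun x e => congr1 (fun z => z ^+ 2) (esym e))).
  split; first by split.
  rewrite e1; apply/ler_addgt0Pr => e e0.
  have A20 := lpop_gt0 o2.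
  (* [lpop_bound] wants a positive majorant, hence the added [e / A2^2]; it contributes [e], which
     is arbitrary. *)
  pose H := Num.sqrt (I (fun y => u y ^+ 2) + e / A2 ^+ 2).
  have P : 0 < I (fun y => u y ^+ 2) + e / A2 ^+ 2.
    by apply: ltr_wpDl; [apply: I_ge0 => y; exact: sqr_ge0|rewrite divr_gt0// exprn_gt0].
  have H0 : 0 < H by rewrite sqrtr_gt0.
  have H2 : H ^+ 2 = I (fun y => u y ^+ 2) + e / A2 ^+ 2 by rewrite sqr_sqrtr// ltW.
  have := lpop_bound o2 H0 l2; rewrite /Ip (eq_I mu (sq u)) (eq_I mu (sq _)).
  rewrite !powR_mulrn ?(ltW H0) ?mulr_ge0 ?(ltW H0) ?(ltW A20)// H2 lerDl => /(_ (divr_ge0 (ltW e0) (sqr_ge0 _))).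
  by rewrite exprMn H2 mulrDr mulrC [_ * (e / _)]mulrC divfK ?gt_eqF ?exprn_gt0// mulrC.
have [k [[eps [C0 [eps0 C00 k1 k2]]] [_ assoc]]] := cz_kernel T.
have neq (x y : X) : x <> y -> x != y by move/eqP.
exists (fun x y => part b (k x y)), eps, C0, delta.
have K1 x y : x <> y -> `|part b (k x y)| <= C0 / m x (d x y).
  by move=> /neq xy; apply: le_trans (part_le _ _) _; exact: k1.
have K2 x x' y : x <> y -> c * d x x' <= d x y ->
   `|part b (k x y) - part b (k x' y)| + `|part b (k y x) - part b (k y x')| <= (d x x' / d x y) `^ eps * (C0 / m x (d x y)).
  move=> /neq xy h; apply: le_trans (k2 x x' y xy h).
  by rewrite -!partB; apply: lerD; exact: part_le.
split => //; first exact: Holder_dense.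
move=> f g hf hg [e e0 he]; rewrite fE//.
rewrite (assoc _ _ (hol_Holder hf) (hol_Holder hg) (cplx_separated e0 he)).
have E x : part b (cintegral mu [set: X] (fun y => k x y * cplx f y * cplx g x)) =
    g x * kint mu (fun x y => part b (k x y)) f x.
  transitivity (I (fun y => g x * (part b (k x y) * f y))).
    rewrite /cintegral; case: b {o1 o2 fE agree K1 K2} => /=; apply: eq_I => y;
      rewrite /cplx; case: (k x y) => ? ? /=; ring.
  have [gx|gx] := eqVneq (g x) 0.
    by rewrite gx mul0r -[RHS](I0 mu); apply: eq_I => y; rewrite mul0r.
  have [i _] := kap_intg hs hd eps0 C00 K2 e0 (hb f hf) (fun y fy => eq_ind _ (fun t => e <= t) (he y x fy gx) _ (qm_sym hd y x))
    (fun y fy => kap_far hs hd C00 K1 e0 (eq_ind _ (fun t => e <= t) (he y x fy gx) _ (qm_sym hd y x))).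
  by rewrite IZ.
rewrite {1}/cintegral; case: b {o1 o2 fE agree K1 K2} E => /= E; apply: eq_I => x; exact: E.
Qed.

End kernel.

End bridge.

(** * The Hardy space *)

Lemma sum_parity (V : zmodType) (f g : nat -> V) n :
  \sum_(j < n) (if odd j then g j./2 else f j./2) =
  \sum_(i < uphalf n) f i + \sum_(i < n./2) g i.
Proof.
elim: n => [|n IH]; first by rewrite !big_ord0 addr0.
rewrite big_ord_recr/= IH uphalf_half; case: (odd n) => /=.
  by rewrite add1n [\sum_(i < _.+1) g i]big_ord_recr/= addrA.
by rewrite add0n [\sum_(i < _.+1) f i]big_ord_recr/= addrAC.
Qed.

Section hardy_space.
Context (R : realType) (X : ptopologicalType).
Variables (mu : {measure set (borel X) -> \bar R}) (d : X -> X -> R).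
Variables (c K eta : R).
Hypothesis hs : growing_space mu d c K eta.
Hypothesis hd : quasi_metric d.
Local Notation B := (qball d).
Local Notation mr A := (fine (mu A)).
Local Notation m x r := (mr (B x r)).
Local Notation intg := (intg mu).
Local Notation I := (I mu).
Local Notation lp := (lp mu).
Local Notation Ip := (Ip mu).
Local Notation latom := (latom mu d).
Local Notation meas := (measurable_fun [set: borel X]).
Implicit Types (f g u v : X -> R) (F G : X -> R[i]) (x y : X) (b : bool).

Lemma ae_sum (V : zmodType) (J : Type) (s : seq J) (u v : J -> X -> V) :
  (forall j, {ae mu, forall x, u j x = v j x}) ->
  {ae mu, forall x, \sum_(j <- s) u j x = \sum_(j <- s) v j x}.
Proof.
move=> h; elim: s => [|j s IH]; first by apply: aeW => x; rewrite !big_nil.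
by apply: (ae_imp2 (h j) IH) => x h1 h2; rewrite !big_cons h1 h2.
Qed.

Lemma acost_sum (J : Type) (s : seq J) (u : J -> X -> R) (C : J -> R) :
  (forall j, acost mu latom (u j) (C j)) ->
  acost mu latom (fun x => \sum_(j <- s) u j x) (\sum_(j <- s) C j).
Proof.
move=> h; elim: s => [|j s IH].
  rewrite big_nil (_ : (fun x => _) = fun=> 0); first exact: (acost0 (latom_family hs)).
  by apply/funext => x; rewrite big_nil.
rewrite big_cons (_ : (fun x => _) = fun x => u j x + \sum_(j <- s) u j x).
  exact: (acostD (latom_family hs) (h j) IH).
by apply/funext => x; rewrite big_cons.
Qed.

Definition emb b u : X -> R[i] := fun x => if b then u x +i* 0 else 0 +i* u x.

Lemma emb_norm b u x : normc (emb b u x) = `|u x|.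
Proof. by rewrite /emb; case: b => /=; rewrite expr0n ?addr0 ?add0r sqrtr_sqr. Qed.

Lemma int_ball f x r r' : ball_fun d f x r -> r <= r' -> (\int[mu]_(y in B x r') f y)%R = I f.
Proof.
move=> [mf r0 f0] rr; rewrite /I /Rintegral; congr fine; rewrite [LHS]integral_mkcond.
apply: eq_integral => y _; rewrite /patch; case: ifPn => //= /negP h.
by rewrite f0// => By; apply: h; apply/mem_set; exact: ball_mono By.
Qed.

(* [supp] is a closure, contained only in the ball enlarged by [c]; hence the factor [K^-1]. *)
Lemma complex_atom b a : latom a -> atom mu d (emb b (fun x => K^-1 * a x)).
Proof.
move=> [x [r [ba ha Ia]]]; have [ma r0 a0] := ba.
have K0 := K_gt0 hs; have c1 := c_gt1 hs; have m0 := m_gt0 hs x r0.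
have mK : meas (fun x => K^-1 * a x) by exact: measurable_funM.
have bK : ball_fun d (fun x => K^-1 * a x) x r by split => // y /a0 ->; rewrite mulr0.
have hK y : `|K^-1 * a y| <= (K * m x r)^-1.
  by rewrite normrM gtr0_norm ?invr_gt0// invfM; apply: ler_wpM2l => //; rewrite invr_ge0 ltW.
split.
  split; first by split; rewrite /emb; case: b => //=.
  rewrite /cLnorm unlock; case: ifPn => _; last exact: ltry.
  apply: (@le_lt_trans _ _ ((K * m x r)^-1)%:E); last exact: ltry.
  apply/ess_supP; apply: aeW => y /=.
  by rewrite lee_fin emb_norm normr_id.
exists x, (c * r); split.
- by rewrite mulr_gt0 ?(c_gt0 hs).
- move=> y hy; apply: (closure_ball hs r0); apply: closure_subset hy => z /= hz.
  apply: contrapT => /a0 e; move: hz; rewrite /emb e mulr0; by case: b; rewrite eqxx.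
- apply: aeW => y; rewrite emb_norm; apply: le_trans (hK y) _.
  rewrite lef_pV2 ?posrE ?mulr_gt0 ?(m_gt0 hs) ?mulr_gt0 ?(c_gt0 hs)//.
  by have := m_dbl hs 1 x r0; rewrite !expr1.
have rr : r <= c * r by rewrite ler_peMl ?(ltW r0)// ltW.
have z : (\int[mu]_(y in B x (c * r)) (K^-1 * a y))%R = 0.
  by rewrite (int_ball bK rr) IZ ?Ia ?mulr0//; have [] := (let: And3 _ _ h := latom_family hs in h) a (ex_intro _ x (ex_intro _ r (And3 ba ha Ia))).
have z0 : (\int[mu]_(y in B x (c * r)) (0 : R))%R = 0 by rewrite /Rintegral integral0.
by rewrite /cintegral /emb; case: b => /=; rewrite z z0.
Qed.

(** Atoms of the real and of the imaginary part are interleaved by parity; the factor [K] of the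
    coefficients cancels the [K^-1] inside [complex_atom]. *)
Lemma atomic_of_acost u v C C' : acost mu latom u C -> acost mu latom v C' ->
  exists lam a, atomic_decomposition mu d (fun x => u x +i* v x) lam a /\
    (\sum_(0 <= j <oo) (lam j)%:E <= (K * (C + C'))%:E)%E.
Proof.
move=> [iu [l1 [a1 [p1 l10 s1 c1]]]] [iv [l2 [a2 [p2 l20 s2 c2]]]].
have K0 := K_gt0 hs.
pose lam j := if odd j then K * l2 j./2 else K * l1 j./2.
pose a j := if odd j then emb false (fun x => K^-1 * a2 j./2 x) else emb true (fun x => K^-1 * a1 j./2 x).
have lam0 j : 0 <= lam j by rewrite /lam; case: ifP => _; rewrite mulr_ge0 ?(ltW K0).
have slam n : \sum_(j < n) lam j <= K * (C + C').
  rewrite (sum_parity (fun i => K * l1 i) (fun i => K * l2 i)) -!mulr_sumr -mulrDr.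
  by rewrite ler_pM2l// lerD.
have Slam : (\sum_(0 <= j <oo) (lam j)%:E <= (K * (C + C'))%:E)%E.
  apply: lime_le; first by apply: is_cvg_nneseries => n _ _; rewrite lee_fin.
  by apply: nearW => n; rewrite sumEFin lee_fin big_mkord.
pose e1 n x := u x - \sum_(j < n) l1 j * a1 j x.
pose e2 n x := v x - \sum_(j < n) l2 j * a2 j x.
have la i : intg (fun x => l1 i * a1 i x) /\ intg (fun x => l2 i * a2 i x).
  have [_ _ h] := latom_family hs.
  by split; apply: intgZ; [have [] := h _ (p1 i)|have [] := h _ (p2 i)].
have i1 n : intg (e1 n) by apply: intgB => //; apply: intg_sum => i _; exact: (la i).1.
have i2 n : intg (e2 n) by apply: intgB => //; apply: intg_sum => i _; exact: (la i).2.
have E n : (fun x => (u x +i* v x) - \sum_(j < n) (lam j)%:C * a j x) =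
    fun x => e1 (uphalf n) x +i* e2 n./2 x.
  apply/funext => x.
  have -> : \sum_(j < n) (lam j)%:C * a j x =
      \sum_(i < uphalf n) (l1 i * a1 i x)%:C + \sum_(i < n./2) (0 +i* (l2 i * a2 i x)).
    rewrite -(sum_parity (fun i => (l1 i * a1 i x)%:C) (fun i => 0 +i* (l2 i * a2 i x))).
    apply: eq_bigr => j _; rewrite /lam /a; case: ifP => _; rewrite /emb; apply/eqP;
      rewrite eq_complex /=; apply/andP; split; apply/eqP; field; exact: lt0r_neq0.
  have sRe : \sum_(i < uphalf n) (l1 i * a1 i x)%:C = (\sum_(i < uphalf n) l1 i * a1 i x)%:C.
    by rewrite rmorph_sum.
  have sIm k : \sum_(i < k) (0 +i* (l2 i * a2 i x)) = 0 +i* (\sum_(i < k) l2 i * a2 i x) :> R[i].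
    elim: k => [|k IH]; first by rewrite !big_ord0.
    by rewrite !big_ord_recr/= IH; apply/eqP; rewrite eq_complex /= addr0 !eqxx.
  rewrite sRe sIm /e1 /e2; apply/eqP; rewrite eq_complex /=; apply/andP; split; apply/eqP; ring.
have one : 0 < 1 :> R by [].
have lp1 f : intg f -> lp 1 f.
  move=> i; split; first exact: (intg_meas i).
  by apply: eq_intg (intg_norm i) => x; rewrite powRr1.
have LE n : Lp mu 1%:E (fun x => e1 (uphalf n) x +i* e2 n./2 x).
  by apply: (Lp_parts one) => /=; exact: lp1.
have NE n : cLnorm mu 1%:E (fun x => (u x +i* v x) - \sum_(j < n) (lam j)%:C * a j x) =
    (I (nrm (fun x => e1 (uphalf n) x +i* e2 n./2 x)))%:E.
  have /(Lp_nrm mu one _)[mE lE] := LE n.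
  rewrite E (cLnorm_lp mE lE) invr1 powRr1 ?Ip_ge0//; congr (_%:E); apply: eq_I => x.
  by rewrite powRr1// ger0_norm// normc_ge0.
have bound n : I (nrm (fun x => e1 (uphalf n) x +i* e2 n./2 x)) <=
    I (fun x => `|e1 (uphalf n) x|) + I (fun x => `|e2 n./2 x|).
  rewrite -ID; [|exact: intg_norm|exact: intg_norm].
  have /(Lp_nrm mu one _)[mE [mE' lE]] := LE n.
  apply: I_le => [||x]; last by rewrite /nrm; exact: (normc_le (_ +i* _)).
  - apply: eq_intg lE => x; by rewrite powRr1// ger0_norm// normc_ge0.
  - by apply: intgD; exact: intg_norm.
exists lam, a; split => //; split => //.
- by split; [exact: (intg_meas iu)|exact: (intg_meas iv)].
- by move=> j; rewrite /a; case: ifP => _; apply: complex_atom.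
- by apply: le_lt_trans Slam _; exact: ltry.
rewrite (_ : (fun n => _) = EFin \o (fun n => I (nrm (fun x => e1 (uphalf n) x +i* e2 n./2 x)))); last first.
  by apply/funext => n; rewrite NE.
apply: cvg_EFin; first exact: nearW.
apply/cvgrPdist_le => e e0; have e20 : 0 < e / 2 by rewrite divr_gt0.
move/cvgrPdist_le : c1 => /(_ _ e20) [N1 _ h1]; move/cvgrPdist_le : c2 => /(_ _ e20) [N2 _ h2].
exists (N1 + N2)%N.*2 => // n /= hn.
have hn2 : (N1 + N2 <= n./2)%N by rewrite -(doubleK (N1 + N2)%N) half_leq.
have := h2 n./2 (leq_trans (leq_addl _ _) hn2).
have hn1 : (N1 <= uphalf n)%N.
  rewrite uphalf_half; apply: leq_trans (leq_addl _ _); exact: leq_trans (leq_addr _ _) hn2.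
have := h1 (uphalf n) hn1; rewrite !sub0r !normrN => t1 t2.
rewrite ger0_norm; last by apply: I_ge0 => x; exact: normc_ge0.
apply: le_trans (bound n) _.
by have := le_trans (ler_norm _) t1; have := le_trans (ler_norm _) t2; rewrite -/(e1 _) -/(e2 _); lra.
Qed.

End hardy_space.

Section operators.
Context (R : realType) (X : ptopologicalType).
Variables (mu : {measure set (borel X) -> \bar R}) (d : X -> X -> R).
Variables (c K eta : R).
Hypothesis hs : growing_space mu d c K eta.
Hypothesis hd : quasi_metric d.
Local Notation latom := (latom mu d).
Local Notation lp := (lp mu).
Local Notation Ip := (Ip mu).
Implicit Types (f g u v : X -> R) (F G : X -> R[i]).

(* If [T] has no extension then [Lp_op] is the zero operator. *)
Lemma Lp_op_bounded p (T : cz_operator mu d c) : 0 < p -> Lp_bounded mu p%:E (Lp_op p%:E T).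
Proof.
move=> p0; rewrite /Lp_op; case: xgetP => [S _ []//|_]; split.
  by move=> a f g _ _; apply: aeW => x; rewrite mulr0 addr0.
exists 0 => f _; have z : cLnorm mu p%:E (fun=> 0 : R[i]) = 0%E.
  rewrite /cLnorm (_ : (fun x => _) = cst 0%E) ?Lnorm0 ?eqe ?gt_eqF//.
  by apply/funext => x /=; rewrite expr0n addr0 sqrtr0.
by rewrite z mul0e; split => //; split; [split; exact: measurable_cst|rewrite z ltry].
Qed.

Variables p q : R.
Hypothesis p0 : 0 < p.
Hypothesis q0 : 0 < q.
Hypothesis pq : p^-1 + q^-1 = 1.

Lemma cz_real_parts (T : cz_operator mu d c) : bounded_on 2%:E T ->
  exists R1R2 : ((X -> R) -> X -> R) * ((X -> R) -> X -> R),
    exists A C : R, let: (R1, R2) := R1R2 in let S := Lp_op p%:E T in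
    [/\ (exists A1, lpop mu q R1 A1) /\ (exists A2, lpop mu q R2 A2),
     ae_linear mu q R1 /\ ae_linear mu q R2,
     adjoint_pair mu p q (op_part true S) R1 /\ adjoint_pair mu p q (op_part false S) R2, 0 < C &
     forall g f (G H : R), lp q g -> lp p f -> 0 < G -> 0 < H -> Ip q g <= G `^ q -> Ip p f <= H `^ p ->
       acost mu latom (bil (op_part true S) R1 g f) (C * G * H) /\
       acost mu latom (bil (op_part false S) R2 g f) (C * G * H)].
Proof.
move=> hT; have bS := Lp_op_bounded T p0.
have k b := op_part_kernel_op hs hd b p0 (ex_intro2 _ _ q q0 pq) hT.
have [A1 o1] := op_part_lpop p0 true bS; have [A2 o2] := op_part_lpop p0 false bS.
have [R1 [h1 l1 a1 [C1 C10 e1]]] := kernel_op_bil hs hd p0 q0 pq o1 (op_part_linear p0 true bS) (k true).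
have [R2 [h2 l2 a2 [C2 C20 e2]]] := kernel_op_bil hs hd p0 q0 pq o2 (op_part_linear p0 false bS) (k false).
exists (R1, R2), A1, (C1 + C2); split => //; first by split; [exists A1|exists A2].
  exact: addr_gt0.
move=> g f G H lg lf G0 H0 hG hH; split.
  apply: acost_le (e1 g f G H lg lf G0 H0 hG hH) _; rewrite -!mulrA ler_pM2r ?mulr_gt0// lerDl ltW//.
apply: acost_le (e2 g f G H lg lf G0 H0 hG hH) _; rewrite -!mulrA ler_pM2r ?mulr_gt0// lerDr ltW//.
Qed.

End operators.

(** * The complex form and its bound in the Hardy space *)

Section commutator_form.
Context (R : realType) (X : ptopologicalType).
Variables (mu : {measure set (borel X) -> \bar R}) (d : X -> X -> R).
Variables (c K eta : R).
Hypothesis hs : growing_space mu d c K eta.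
Hypothesis hd : quasi_metric d.
Local Notation latom := (latom mu d).
Local Notation lp := (lp mu).
Local Notation Ip := (Ip mu).
Local Notation meas := (measurable_fun [set: borel X]).
Implicit Types (f g u v : X -> R) (F G : X -> R[i]) (x y : X) (b : bool).
Variables p q : R.
Hypothesis p0 : 0 < p.
Hypothesis q0 : 0 < q.
Hypothesis pq : p^-1 + q^-1 = 1.

Lemma ae_linear2 (r : R) S : 0 < r -> ae_linear mu r S -> forall (a b : R) f g h, lp r f -> lp r g -> lp r h ->
  {ae mu, forall y, S (fun z => a * f z + (b * g z + h z)) y = a * S f y + (b * S g y + S h y)}.
Proof.
move=> r0 lS a b f g h lf lg lh.
have l2 : lp r (fun z => b * g z + h z).
  by apply: lpD => //; [exact: ltW|exact: (lpZ b (ltW r0) lg).1].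
by apply: (ae_imp2 (lS a f _ lf l2) (lS b g h lg lh)) => y -> ->.
Qed.

Lemma re_im_eq (z w : R[i]) : complex.Re z = complex.Re w -> complex.Im z = complex.Im w -> z = w.
Proof. by case: z => ? ?; case: w => ? ? /= -> ->. Qed.

Lemma Re_comb (a z w : R[i]) : complex.Re (a * z + w) =
  complex.Re a * complex.Re z + (- complex.Im a * complex.Im z + complex.Re w).
Proof. by case: a; case: z; case: w => ? ? ? ? ? ? /=; ring. Qed.

Lemma Im_comb (a z w : R[i]) : complex.Im (a * z + w) =
  complex.Re a * complex.Im z + (complex.Im a * complex.Re z + complex.Im w).
Proof. by case: a; case: z; case: w => ? ? ? ? ? ? /=; ring. Qed.

Lemma Lp_comb r (a : R[i]) F G : 0 < r -> Lp mu r%:E F -> Lp mu r%:E G -> Lp mu r%:E (fun y => a * F y + G y).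
Proof.
move=> r0 lF lG; have f1 := (Lp_part r0 true lF).1; have f2 := (Lp_part r0 false lF).1.
have g1 := (Lp_part r0 true lG).1; have g2 := (Lp_part r0 false lG).1.
have Z k f : lp r f -> lp r (fun x => k * f x) by move=> lf; exact: (lpZ k (ltW r0) lf).1.
have D f g : lp r f -> lp r g -> lp r (fun x => f x + g x) by apply: lpD; exact: ltW.
apply: (Lp_parts r0).
  rewrite (_ : (fun x => _) = fun x => complex.Re a * part true (F x) + (- complex.Im a * part false (F x) + part true (G x))).
    by apply: (D _ _ (Z _ _ f1) (D _ _ (Z _ _ f2) g1)).
  by apply/funext => x; exact: Re_comb.
rewrite (_ : (fun x => _) = fun x => complex.Re a * part false (F x) + (complex.Im a * part true (F x) + part false (G x))).
  by apply: (D _ _ (Z _ _ f2) (D _ _ (Z _ _ f1) g2)).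
by apply/funext => x; exact: Im_comb.
Qed.

Variables (m : nat) (T1 : 'I_m -> cz_operator mu d c).
Hypothesis hT1 : forall j, bounded_on 2%:E (T1 j).
Variable F_ : 'I_m -> X -> R[i].
Hypothesis lF : forall j, Lp mu p%:E (F_ j).
Let S j := Lp_op p%:E (T1 j).
Hypothesis zero : {ae mu, forall x, \sum_(j < m) S j (F_ j) x = 0}.
Let S' j := adjoint mu p%:E q%:E (S j).
Let form G x := \sum_(j < m) S' j G x * (F_ j x)^*.

Let bS j : Lp_bounded mu p%:E (S j). Proof. exact: Lp_op_bounded. Qed.

(** Complex linearity is read off from the real adjoints [R1], [R2], whose linearity holds almost
    everywhere. *)
Lemma adjoint_linear j (a : R[i]) G H : Lp mu q%:E G -> Lp mu q%:E H ->
  {ae mu, forall x, S' j (fun y => a * G y + H y) x = a * S' j G x + S' j H x}.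
Proof.
move=> lG lH; have lC := Lp_comb a q0 lG lH.
have [[R1 R2] [A [C [[[A1 h1] [A2 h2]] [l1 l2] [a1 a2] _ _]]]] := cz_real_parts hs hd p0 q0 pq (hT1 j).
have P := fun G lG => @adjoint_parts R X mu p q p0 q0 pq (S j) R1 R2 A1 A2 (bS j) h1 h2 a1 a2 G lG.
have g1 := (Lp_part q0 true lG).1; have g2 := (Lp_part q0 false lG).1.
have k1 := (Lp_part q0 true lH).1; have k2 := (Lp_part q0 false lH).1.
pose al := complex.Re a; pose be := complex.Im a.
have eRe : (fun x => complex.Re (a * G x + H x)) =
    fun x => al * complex.Re (G x) + (- be * complex.Im (G x) + complex.Re (H x)).
  by apply/funext => x; exact: Re_comb.
have eIm : (fun x => complex.Im (a * G x + H x)) =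
    fun x => al * complex.Im (G x) + (be * complex.Re (G x) + complex.Im (H x)).
  by apply/funext => x; exact: Im_comb.
have := P _ lC; rewrite /= eRe eIm => Q.
have Q1 := ae_linear2 q0 l1 al (- be) g1 g2 k1; have Q2 := ae_linear2 q0 l2 al (- be) g1 g2 k1.
have Q3 := ae_linear2 q0 l1 al be g2 g1 k2; have Q4 := ae_linear2 q0 l2 al be g2 g1 k2.
have QQ := ae_imp2 (ae_imp2 Q1 Q2 (fun x => @conj _ _)) (ae_imp2 Q3 Q4 (fun x => @conj _ _)) (fun x => @conj _ _).
have PP := ae_imp2 (P _ lG) (P _ lH) (fun x => @conj _ _).
apply: (ae_imp2 Q (ae_imp2 QQ PP (fun x => @conj _ _))) => x [q1 q2] [[[e1 e2] [e3 e4]] [[r1 r2] [r3 r4]]].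
move: r1 r2 r3 r4 q1 q2; rewrite /S' /=.
case: (adjoint _ _ _ _ G x) => u1 u2; case: (adjoint _ _ _ _ H x) => v1 v2.
case: (adjoint _ _ _ _ _ x) => w1 w2 /= -> -> -> -> -> ->.
move: e1 e2 e3 e4; rewrite /= => -> -> -> ->.
by apply: re_im_eq; rewrite ?Re_comb ?Im_comb /= -/al -/be; ring.
Qed.

Lemma form_linear (a : R[i]) G H : Lp mu q%:E G -> Lp mu q%:E H ->
  {ae mu, forall x, form (fun y => a * G y + H y) x = a * form G x + form H x}.
Proof.
move=> lG lH; have h := fun j => adjoint_linear j a lG lH.
have := ae_sum (index_enum 'I_m) (u := fun j x => S' j (fun y => a * G y + H y) x * (F_ j x)^*)
  (v := fun j x => a * (S' j G x * (F_ j x)^*) + S' j H x * (F_ j x)^*)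
  (fun j => ae_imp (h j) (fun x e => etrans (congr1 (fun z => z * (F_ j x)^*) e)
     (etrans (mulrDl _ _ _) (congr1 (fun z => z + _) (esym (mulrA _ _ _)))))).
by move=> hh; apply: (ae_imp hh) => x; rewrite /form => ->; rewrite big_split/= mulr_sumr.
Qed.

(** The real and the imaginary part of [form G] are each a sum of four real forms per index,
    corrected by multiples of the vanishing sum of the [S j (F_ j)]. *)
Lemma form_H1 : exists2 D : R, 0 <= D & forall G (G0 : R), Lp mu q%:E G -> 0 < G0 ->
  Ip q (nrm G) <= G0 `^ q -> H1 mu d (form G) /\ (H1norm mu d (form G) <= (D * G0)%:E)%E.
Proof.
have /choice[W hW] : forall j, exists w : ((X -> R) -> X -> R) * ((X -> R) -> X -> R) * R,
    [/\ (exists A1, lpop mu q w.1.1 A1) /\ (exists A2, lpop mu q w.1.2 A2),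
     adjoint_pair mu p q (op_part true (S j)) w.1.1 /\ adjoint_pair mu p q (op_part false (S j)) w.1.2,
     0 < w.2 &
     forall g f (G H : R), lp q g -> lp p f -> 0 < G -> 0 < H -> Ip q g <= G `^ q -> Ip p f <= H `^ p ->
       acost mu latom (bil (op_part true (S j)) w.1.1 g f) (w.2 * G * H) /\
       acost mu latom (bil (op_part false (S j)) w.1.2 g f) (w.2 * G * H)].
  move=> j; have [[R1 R2] [A [C [h1 h2 h3 h4 h5]]]] := cz_real_parts hs hd p0 q0 pq (hT1 j).
  by exists (R1, R2, C).
have /choice[H_ hH] : forall j, exists H : R, 0 < H /\ Ip p (nrm (F_ j)) <= H `^ p.
  move=> j; have /(Lp_nrm mu p0 _)[_ l] := lF j.
  by have [H H0 hH] := lp_norm_witness p0 l; exists H.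
have K0 := K_gt0 hs.
(* Four forms per index, once for the real and once for the imaginary part; [K] comes from the
   passage to complex atoms. *)
pose D := K * (\sum_j 4 * ((W j).2 * H_ j) + \sum_j 4 * ((W j).2 * H_ j)).
have s0 : 0 <= \sum_j 4 * ((W j).2 * H_ j).
  apply: sumr_ge0 => j _; have [_ _ w0 _] := hW j; have [H0 _] := hH j.
  by rewrite mulr_ge0// mulr_ge0// ltW.
exists D; first by rewrite mulr_ge0 ?(ltW K0)// addr_ge0.
move=> G G0 lG G00 hG.
pose g1 x := complex.Re (G x); pose g2 x := complex.Im (G x).
pose f1 j x := complex.Re (F_ j x); pose f2 j x := complex.Im (F_ j x).
have lg1 : lp q g1 := (Lp_part q0 true lG).1; have lg2 : lp q g2 := (Lp_part q0 false lG).1.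
have ng1 : Ip q g1 <= G0 `^ q := le_trans (Lp_part q0 true lG).2 hG.
have ng2 : Ip q g2 <= G0 `^ q := le_trans (Lp_part q0 false lG).2 hG.
have lf1 j : lp p (f1 j) := (Lp_part p0 true (lF j)).1.
have lf2 j : lp p (f2 j) := (Lp_part p0 false (lF j)).1.
have nf1 j : Ip p (f1 j) <= H_ j `^ p := le_trans (Lp_part p0 true (lF j)).2 (hH j).2.
have nf2 j : Ip p (f2 j) <= H_ j `^ p := le_trans (Lp_part p0 false (lF j)).2 (hH j).2.
pose S1 j := op_part true (S j); pose S2 j := op_part false (S j).
pose R1 j := (W j).1.1; pose R2 j := (W j).1.2.
pose E j := (W j).2 * G0 * H_ j.
have b1 j g f : lp q g -> lp p f -> Ip q g <= G0 `^ q -> Ip p f <= H_ j `^ p ->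
    acost mu latom (bil (S1 j) (R1 j) g f) (E j).
  move=> lg lf hg hf; have [_ _ _ h] := hW j.
  by have [] := h g f G0 (H_ j) lg lf G00 (hH j).1 hg hf.
have b2 j g f : lp q g -> lp p f -> Ip q g <= G0 `^ q -> Ip p f <= H_ j `^ p ->
    acost mu latom (bil (S2 j) (R2 j) g f) (E j).
  move=> lg lf hg hf; have [_ _ _ h] := hW j.
  by have [] := h g f G0 (H_ j) lg lf G00 (hH j).1 hg hf.
have neg f C : acost mu latom f C -> acost mu latom (fun x => - f x) C.
  move=> /(acostZ (-1) (latom_family hs)); rewrite normrN1 mul1r.
  by congr (acost _ _ _ _); apply/funext => x; rewrite mulN1r.
have D4 u1 u2 u3 u4 C : acost mu latom u1 C -> acost mu latom u2 C -> acost mu latom u3 C ->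
    acost mu latom u4 C -> acost mu latom (fun x => u1 x + u2 x + (u3 x + u4 x)) (4 * C).
  move=> h1 h2 h3 h4; rewrite (_ : 4 * C = C + C + (C + C)); last by ring.
  by apply: (acostD (latom_family hs)); apply: (acostD (latom_family hs)).
pose ure j x := bil (S1 j) (R1 j) g1 (f1 j) x + bil (S2 j) (R2 j) g2 (f1 j) x +
  (bil (S1 j) (R1 j) g2 (f2 j) x + - bil (S2 j) (R2 j) g1 (f2 j) x).
pose uim j x := bil (S1 j) (R1 j) g2 (f1 j) x + - bil (S2 j) (R2 j) g1 (f1 j) x +
  (- bil (S1 j) (R1 j) g1 (f2 j) x + - bil (S2 j) (R2 j) g2 (f2 j) x).
have cre := acost_sum hs (index_enum 'I_m) (fun j => D4 _ _ _ _ _ (b1 j _ _ lg1 (lf1 j) ng1 (nf1 j))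
  (b2 j _ _ lg2 (lf1 j) ng2 (nf1 j)) (b1 j _ _ lg2 (lf2 j) ng2 (nf2 j)) (neg _ _ (b2 j _ _ lg1 (lf2 j) ng1 (nf2 j)))).
have cim := acost_sum hs (index_enum 'I_m) (fun j => D4 _ _ _ _ _ (b1 j _ _ lg2 (lf1 j) ng2 (nf1 j))
  (neg _ _ (b2 j _ _ lg1 (lf1 j) ng1 (nf1 j))) (neg _ _ (b1 j _ _ lg1 (lf2 j) ng1 (nf2 j)))
  (neg _ _ (b2 j _ _ lg2 (lf2 j) ng2 (nf2 j)))).
have sumE : \sum_j 4 * E j = G0 * \sum_j 4 * ((W j).2 * H_ j).
  by rewrite mulr_sumr; apply: eq_bigr => j _; rewrite /E; ring.
have AP j : {ae mu, forall x, S' j G x = (R1 j g1 x + R2 j g2 x) +i* (R1 j g2 x - R2 j g1 x)}.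
  have [[[A1 h1] [A2 h2]] [a1 a2] _ _] := hW j.
  apply: (ae_imp (@adjoint_parts R X mu p q p0 q0 pq (S j) (R1 j) (R2 j) A1 A2 (bS j) h1 h2 a1 a2 G lG)).
  by move=> x [e1 e2]; apply: re_im_eq.
have ZP j : {ae mu, forall x, S j (F_ j) x =
    (S1 j (f1 j) x - S2 j (f2 j) x) +i* (S1 j (f2 j) x + S2 j (f1 j) x)}.
  apply: (ae_imp (op_parts p0 (bS j) (lF j))) => x [e1 e2]; exact: re_im_eq.
have ReS (z : 'I_m -> R[i]) : complex.Re (\sum_j z j) = \sum_j complex.Re (z j).
  by apply: (big_morph (fun z : R[i] => complex.Re z)) => // -[? ?] [? ?].
have ImS (z : 'I_m -> R[i]) : complex.Im (\sum_j z j) = \sum_j complex.Im (z j).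
  by apply: (big_morph (fun z : R[i] => complex.Im z)) => // -[? ?] [? ?].
pose v j x : R[i] := ((R1 j g1 x + R2 j g2 x) +i* (R1 j g2 x - R2 j g1 x)) * (F_ j x)^*.
have hv := ae_sum (index_enum 'I_m) (u := fun j x => S' j G x * (F_ j x)^*) (v := v)
   (fun j => ae_imp (AP j) (fun x e => congr1 (fun z => z * (F_ j x)^*) e)).
have hz := ae_imp2 (ae_sum (index_enum 'I_m) ZP) zero (fun x e1 e2 => etrans (esym e1) e2).
(* The terms with [S] in the real forms add up to [Re G] and [Im G] times the real and imaginary
   parts of the sum of the [S j (F_ j)], which is 0; what remains is the product of the adjoint with
   the conjugate. *)
have main : {ae mu, forall x, \sum_j ure j x = complex.Re (form G x) /\ \sum_j uim j x = complex.Im (form G x)}.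
  apply: (ae_imp2 hv hz) => x ev ez; rewrite /form ev ReS ImS.
  have z1 : \sum_j (S1 j (f1 j) x - S2 j (f2 j) x) = 0.
    by have := congr1 (@complex.Re R) ez; rewrite ReS.
  have z2 : \sum_j (S1 j (f2 j) x + S2 j (f1 j) x) = 0.
    by have := congr1 (@complex.Im R) ez; rewrite ImS.
  split.
    transitivity (\sum_j ure j x + g1 x * \sum_j (S1 j (f1 j) x - S2 j (f2 j) x) +
        g2 x * \sum_j (S1 j (f2 j) x + S2 j (f1 j) x)).
      by rewrite z1 z2 !mulr0 !addr0.
    rewrite !mulr_sumr -!big_split/=; apply: eq_bigr => j _.
    by rewrite /ure /v /bil /f1 /f2; case: (F_ j x) => s t /=; ring.
  transitivity (\sum_j uim j x + g2 x * \sum_j (S1 j (f1 j) x - S2 j (f2 j) x) +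
      - g1 x * \sum_j (S1 j (f2 j) x + S2 j (f1 j) x)).
    by rewrite z1 z2 !mulr0 !addr0.
  rewrite !mulr_sumr -!big_split/=; apply: eq_bigr => j _.
  by rewrite /uim /v /bil /f1 /f2; case: (F_ j x) => s t /=; ring.
have mF j : cmeasurable (F_ j) by have /(Lp_nrm mu p0 _)[] := lF j.
have mS' j : cmeasurable (S' j G).
  have [[[A1 h1] [A2 h2]] [a1 a2] _ _] := hW j.
  have [l _] := @adjoint_exists R X mu p q p0 q0 pq (S j) (R1 j) (R2 j) A1 A2 (bS j) h1 h2 a1 a2 G lG.
  by have /(Lp_nrm mu q0 _)[] := l.
have mre : meas (fun x => complex.Re (form G x)).
  rewrite (_ : (fun x => _) = fun x => \sum_j (complex.Re (S' j G x) * complex.Re (F_ j x) + complex.Im (S' j G x) * complex.Im (F_ j x))).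
    by apply: measurable_sum => j; have [? ?] := mF j; have [? ?] := mS' j; apply: measurable_funD; exact: measurable_funM.
  apply/funext => x; rewrite /form ReS; apply: eq_bigr => j _.
  by case: (S' j G x) => ? ?; case: (F_ j x) => ? ? /=; ring.
have mim : meas (fun x => complex.Im (form G x)).
  rewrite (_ : (fun x => _) = fun x => \sum_j (complex.Im (S' j G x) * complex.Re (F_ j x) - complex.Re (S' j G x) * complex.Im (F_ j x))).
    by apply: measurable_sum => j; have [? ?] := mF j; have [? ?] := mS' j; apply: measurable_funB; exact: measurable_funM.
  apply/funext => x; rewrite /form ImS; apply: eq_bigr => j _.
  by case: (S' j G x) => ? ?; case: (F_ j x) => ? ? /=; ring.
rewrite sumE in cre cim.
have c1 := acost_eq_ae cre mre (ae_imp main (fun x h => h.1)) (latom_family hs).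
have c2 := acost_eq_ae cim mim (ae_imp main (fun x h => h.2)) (latom_family hs).
have [lam [a [dec sum]]] := atomic_of_acost hs c1 c2.
rewrite (_ : (fun x => _) = form G) in dec; last by apply/funext => x; case: (form G x).
split; first by exists lam, a.
apply: ge_ereal_inf; exists (\sum_(0 <= j <oo) (lam j)%:E)%E; first by exists lam, a.
apply: le_trans sum _; rewrite lee_fin le_eqVlt; apply/orP; left; apply/eqP; rewrite /D; ring.
Qed.

(** [form_H1] wants a positive majorant of the norm of [G], which may be 0; it is applied to the
    norm plus a small error. *)
Lemma form_bounded : bounded_linear mu (Lp mu q%:E) (cLnorm mu q%:E) (H1 mu d) (H1norm mu d) form.
Proof.
split; first by move=> a G H lG lH; exact: form_linear.
have [D D0 hD] := form_H1; exists D => G lG.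
have /(Lp_nrm mu q0 _)[mG nG] := lG; rewrite (cLnorm_lp mG nG) -EFinM.
set t := Ip q (nrm G) `^ q^-1; have t0 : 0 <= t by exact: powR_ge0.
have tq : t `^ q = Ip q (nrm G) by rewrite -powRrM mulVf ?gt_eqF// powRr1// Ip_ge0.
have step (e : R) : 0 < e -> H1 mu d (form G) /\ (H1norm mu d (form G) <= (D * (t + e))%:E)%E.
  move=> e0; apply: hD => //; first exact: ltr_wpDl.
  rewrite -tq; apply: ge0_ler_powR; rewrite ?nnegrE ?(ltW q0) ?addr_ge0 ?(ltW e0)//.
  by rewrite lerDl ltW.
split; first by have [] := step 1 ltr01.
(* The error [e / (D + 1)] contributes at most [e] after multiplication by [D], and its denominator
   is positive even when [D] is 0. *)
apply/lee_addgt0Pr => e e0; have D1 : 0 < D + 1 by rewrite ltr_wpDl.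
have [_ h] := step (e / (D + 1)) (divr_gt0 e0 D1); apply: le_trans h _.
rewrite -EFinD lee_fin mulrDr lerD2l mulrCA ler_piMr ?(ltW e0)//.
by rewrite ler_pdivrMr// mul1r lerDl.
Qed.

End commutator_form.

Theorem theorem6p7 (R : realType) (X : ptopologicalType)
    (mu : {measure set (borel X) -> \bar R}) (d : X -> X -> R) (c K : R)
    (hd : quasi_metric d)
    (hX : homogeneous_type mu (qball d) c K)
    (hgrowth : exists2 eps0 : R, 0 < eps0 & exists C0 : R,
       forall (t : R) (x : X) (j : nat), 0 < t ->
         ((c `^ (j%:R * eps0))%:E * mu (qball d x t)
            <= mu (qball d x (c ^+ j * t)))%E /\
         (mu (qball d x (c ^+ j * t))
            <= (C0 ^+ j)%:E * mu (qball d x t))%E)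
    (m : nat) (T1 T2 : 'I_m -> cz_operator mu d c)
    (hT1 : forall j, bounded_on 2%:E (T1 j))
    (hT2 : forall j, bounded_on 2%:E (T2 j))
    (p q : R) (hp : 1 < p) (hq : 1 < q) (hpq : p^-1 + q^-1 = 1)
    (f : X -> R[i]) (hf : Lp mu p%:E f)
    (hTf : {ae mu, forall x,
       \sum_(j < m) Lp_op p%:E (T1 j) (Lp_op p%:E (T2 j) f) x = 0}) :
  bounded_linear mu (Lp mu q%:E) (cLnorm mu q%:E) (H1 mu d) (H1norm mu d)
    (fun g x => \sum_(j < m)
       adjoint mu p%:E q%:E (Lp_op p%:E (T1 j)) g x *
         (Lp_op p%:E (T2 j) f x)^*).
Proof.
have p0 : 0 < p by exact: lt_trans hp.
have q0 : 0 < q by exact: lt_trans hq.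
have [eps0 e0 [C0 hg]] := hgrowth.
have c1 := ht_c_gt1 hX.
have c0 : 0 < c by exact: lt_trans c1.
(* The growth exponent becomes a ratio per dilation, greater than 1 because [c > 1] and
   [eps0 > 0]. *)
have hs : growing_space mu d c K (c `^ eps0).
  split => //.
    by rewrite /powR gt_eqF// -expR0 ltr_expR mulr_gt0// ln_gt0.
  move=> t x j t0; have [h _] := hg t x j t0.
  by move: h; rewrite mulrC powRrM powR_mulrn ?powR_ge0.
have lF j : Lp mu p%:E (Lp_op p%:E (T2 j) f).
  have [_ [C hC]] := Lp_op_bounded (T2 j) p0.
  by have [] := hC f hf.
exact: (form_bounded hs hd p0 q0 hpq hT1 lF hTf).
Qed.
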